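(* Under the hypotheses and notation of the proposition describing $\overline\Delta^\mp_{\mathcal J}(\mu)$ (fix $a<b$, $h_0\in[a,b]$, $\delta\in(0,\delta_0)$, $\mu\in(0,\mu_0)$, $h=\mu h_0$, $\bar\theta_0=-\frac{\sqrt2}{3}(1-\delta^3)$), the following hold: - the curves $\overline\Delta^s_{S^-}(\mu)$ and $\overline\Delta^-_{\mathcal J}(\mu)$ intersect transversally in $\overline\Sigma^<$ at a point $\bar p_-=(\bar\theta_-,\overline\Theta^s_{S^-}(\bar\theta_-))=(\bar\theta_-,\overline\Theta^-_{\mathcal J}(\bar\theta_-))$ with $\bar\theta_-=\bar\theta_0+\mathcal O(\delta^4)$; - the curves $\overline\Delta^u_{S^+}(\mu)$ and $\overline\Delta^+_{\mathcal J}(\mu)$ intersect transversally in $\overline\Sigma^>$ at the point $\bar p_+$ obtained from $\bar p_-$ by the symmetry $(\bar\theta,\overline\Theta)\mapsto(-\bar\theta,\overline\Theta)$; - both points lie in $\{\overline{\mathcal H}_\mu(\delta^2,\bar\theta,\overline R,\overline\Theta)=h\}$.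
   Context: RPC3BP with mass ratio $\mu$, rotating Cartesian Hamiltonian $\hat H_\mu=\frac{|\hat p|^2}{2}-(\hat q_1\hat p_2-\hat q_2\hat p_1)-\frac{1-\mu}{|\hat q+(\mu,0)|}-\frac{\mu}{|\hat q-(1-\mu,0)|}$, Sun at $(-\mu,0)$, Jupiter at $(1-\mu,0)$. Sun-centered rotating polar coordinates $(\bar r,\bar\theta,\overline R,\overline\Theta)$: $\hat q=(-\mu,0)+\bar r(\cos\bar\theta,\sin\bar\theta)$, $\hat p=\overline R(\cos\bar\theta,\sin\bar\theta)+\frac{\overline\Theta}{\bar r}(-\sin\bar\theta,\cos\bar\theta)$; $\overline{\mathcal H}_\mu$ is $\hat H_\mu$ in these coordinates. $\overline\Sigma^>=\{\bar r=\delta^2,\overline{\mathcal H}_\mu=h,\overline R>0\}$, $\overline\Sigma^<=\{\bar r=\delta^2,\overline{\mathcal H}_\mu=h,\overline R<0\}$, described by the coordinates $(\bar\theta,\overline\Theta)$. $\overline\Delta^s_{S^-}(\mu)\subset\overline\Sigma^<$ is the curve of points whose forward orbit reaches collision with the Sun ($\bar r\to0$, $\overline R\to-\infty$ in finite time) staying in $\{\bar r<\delta^2\}$, and $\overline\Delta^u_{S^+}(\mu)\subset\overline\Sigma^>$ the curve of points whose backward orbit does so (ejection from the Sun); for $h=\mu h_0$ and small $\delta,\mu$ these are graphs $\overline\Theta=\overline\Theta^s_{S^-}(\bar\theta)$, $\overline\Theta=\overline\Theta^u_{S^+}(\bar\theta)$ over $\bar\theta\in\mathbb T$ with $\overline\Theta^u_{S^+}=\mathcal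 O(\mu)$ and $\overline\Theta^s_{S^-}(\bar\theta)=\overline\Theta^u_{S^+}(-\bar\theta)$. $\overline\Delta^-_{\mathcal J}(\mu)\subset\overline\Sigma^<$ is the curve of points on orbits ejected from Jupiter given as the graph $\overline\Theta=\overline\Theta^-_{\mathcal J}(\bar\theta)$ over $\bar\theta\in(\bar\theta_0-\delta^4,\bar\theta_0+\delta^4)$ with $\overline\Theta^-_{\mathcal J}=\frac{\delta}{\sqrt2}(\bar\theta-\bar\theta_0)+\mathcal O(\delta^5)$, $\partial_{\bar\theta}\overline\Theta^-_{\mathcal J}=\frac\delta{\sqrt2}(1+\mathcal O(\delta))$; $\overline\Delta^+_{\mathcal J}(\mu)\subset\overline\Sigma^>$ is the analogous curve of points on orbits colliding with Jupiter, the graph $\overline\Theta^+_{\mathcal J}(\bar\theta)=\overline\Theta^-_{\mathcal J}(-\bar\theta)$. *)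

(* Defs.v *)
From Stdlib Require Import Reals Lra.
From Coquelicot Require Import Coquelicot.
Open Scope R_scope.

Definition dSun (mu q1 q2 : R) : R := sqrt ((q1 + mu)^2 + q2^2).
Definition dJup (mu q1 q2 : R) : R := sqrt ((q1 - (1 - mu))^2 + q2^2).

Definition Hhat (mu q1 q2 p1 p2 : R) : R :=
  (p1^2 + p2^2) / 2 - (q1 * p2 - q2 * p1)
  - (1 - mu) / dSun mu q1 q2 - mu / dJup mu q1 q2.

(* Hamilton's equations of Hhat_mu, written out:
   q1' = dH/dp1, q2' = dH/dp2, p1' = -dH/dq1, p2' = -dH/dq2 *)
Definition is_orbit (mu : R) (q1 q2 p1 p2 : R -> R) (D : R -> Prop) : Prop :=
  forall t, D t ->
    0 < dSun mu (q1 t) (q2 t) /\ 0 < dJup mu (q1 t) (q2 t) /\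
    is_derive q1 t (p1 t + q2 t) /\
    is_derive q2 t (p2 t - q1 t) /\
    is_derive p1 t (p2 t - (1 - mu) * (q1 t + mu) / (dSun mu (q1 t) (q2 t))^3
                         - mu * (q1 t - (1 - mu)) / (dJup mu (q1 t) (q2 t))^3) /\
    is_derive p2 t (- p1 t - (1 - mu) * q2 t / (dSun mu (q1 t) (q2 t))^3
                          - mu * q2 t / (dJup mu (q1 t) (q2 t))^3).

Definition Pq1 (mu r th : R) : R := - mu + r * cos th.
Definition Pq2 (mu r th : R) : R := r * sin th.
Definition Pp1 (r th RR Th : R) : R := RR * cos th - Th / r * sin th.
Definition Pp2 (r th RR Th : R) : R := RR * sin th + Th / r * cos th.

Definition Hbar (mu r th RR Th : R) : R :=
  Hhat mu (Pq1 mu r th) (Pq2 mu r th) (Pp1 r th RR Th) (Pp2 r th RR Th).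

Definition rbar (mu q1 q2 : R) : R := dSun mu q1 q2.
Definition Rbar_of (mu q1 q2 p1 p2 : R) : R :=
  ((q1 + mu) * p1 + q2 * p2) / dSun mu q1 q2.

Definition sun_collision_fwd (mu delta r th RR Th : R) : Prop :=
  exists T q1 q2 p1 p2, 0 < T /\
    is_orbit mu q1 q2 p1 p2 (fun t => 0 <= t < T) /\
    q1 0 = Pq1 mu r th /\ q2 0 = Pq2 mu r th /\
    p1 0 = Pp1 r th RR Th /\ p2 0 = Pp2 r th RR Th /\
    (forall t, 0 < t < T -> rbar mu (q1 t) (q2 t) < delta ^ 2) /\
    filterlim (fun t => rbar mu (q1 t) (q2 t)) (at_left T) (locally 0) /\
    filterlim (fun t => Rbar_of mu (q1 t) (q2 t) (p1 t) (p2 t)) (at_left T)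
              (Rbar_locally m_infty).

Definition sun_ejection_bwd (mu delta r th RR Th : R) : Prop :=
  exists T q1 q2 p1 p2, 0 < T /\
    is_orbit mu q1 q2 p1 p2 (fun t => - T < t <= 0) /\
    q1 0 = Pq1 mu r th /\ q2 0 = Pq2 mu r th /\
    p1 0 = Pp1 r th RR Th /\ p2 0 = Pp2 r th RR Th /\
    (forall t, - T < t < 0 -> rbar mu (q1 t) (q2 t) < delta ^ 2) /\
    filterlim (fun t => rbar mu (q1 t) (q2 t)) (at_right (- T)) (locally 0) /\
    filterlim (fun t => Rbar_of mu (q1 t) (q2 t) (p1 t) (p2 t)) (at_right (- T))
              (Rbar_locally p_infty).

Definition jup_ejection_bwd (mu r th RR Th : R) : Prop :=
  exists T q1 q2 p1 p2, 0 < T /\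
    is_orbit mu q1 q2 p1 p2 (fun t => - T < t <= 0) /\
    q1 0 = Pq1 mu r th /\ q2 0 = Pq2 mu r th /\
    p1 0 = Pp1 r th RR Th /\ p2 0 = Pp2 r th RR Th /\
    filterlim q1 (at_right (- T)) (locally (1 - mu)) /\
    filterlim q2 (at_right (- T)) (locally 0).

(* The curves, as subsets of the sections, described by (th, Th). *)
Definition DeltaS_minus (mu delta h th Th : R) : Prop :=
  exists RR, RR < 0 /\ Hbar mu (delta ^ 2) th RR Th = h /\
             sun_collision_fwd mu delta (delta ^ 2) th RR Th.
Definition DeltaU_plus (mu delta h th Th : R) : Prop :=
  exists RR, 0 < RR /\ Hbar mu (delta ^ 2) th RR Th = h /\
             sun_ejection_bwd mu delta (delta ^ 2) th RR Th.

Definition transversal_at (S : R -> R -> Prop) (f : R -> R) (th0 : R) : Prop :=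
  ex_derive f th0 /\
  exists eps g, 0 < eps /\
    g th0 = f th0 /\
    (forall th, Rabs (th - th0) < eps -> ex_derive g th) /\
    (forall th Th, Rabs (th - th0) < eps -> Rabs (Th - g th0) < eps ->
        (S th Th <-> Th = g th)) /\
    Derive g th0 <> Derive f th0.

(* Main.v *)
Require Import Defs.
From Stdlib Require Import ZArith Reals Lra Lia Psatz Classical ClassicalEpsilon.
From Coquelicot Require Import Coquelicot.
Open Scope R_scope.

(* With r = s^2 and L = s^2 la the equations of motion near the Sun are regular down to collision, and the collision orbits are the
   solutions of a two-point problem on 0 <= s <= delta solved by contraction. Hence Delta^s is the graph of a differentiable function g
   of size O(mu) with derivative O(mu), and Delta^u is its mirror image under time reversal combined with a reflection.

   ThJ has slope about delta / sqrt 2, so ThJ and g cross at most once and then transversally. They do cross, although the error term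
   K delta^5 alone does not force a sign change of ThJ on the window; one uses that every point of the graph of ThJ is ejected from
   Jupiter, i.e. that its reversed orbit collides with Jupiter.
   - If ThJ > g throughout, then ThJ(th0) is at least a multiple of delta^5. The reversed orbit of that point has positive energy
     (which is close to the angular momentum), misses Jupiter by a multiple of delta^4 on its way out and escapes: it never collides.
   - If ThJ < g throughout, then the reversed orbits over [th0 - delta^4 / 2, th0] have negative energy about -delta^5, miss Jupiter
     on their way out, and return after a Kepler excursion whose duration 2 pi a^(3/2) varies along this arc by more than a period.
     Hence the phase at which they cross r = 1 on the way in sweeps a full turn. Between a passage far behind Jupiter, which leaves the
     angular momentum negative, and a passage at distance of order mu / delta^5, whose kick makes it positive, some orbit comes back
     to r = delta^2 exactly on the collision curve of the Sun. It collides with the Sun, hence not with Jupiter.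
   Continuity along the arc is obtained from a globally Lipschitz truncation of the vector field, which is inactive on the orbit found. *)

(** * Real analysis *)

(** The line [Th = delta / sqrt 2 * (th - th0)] consists, to leading order, of the points whose
    reversed orbit, taken as parabolic, is at Jupiter's angle when it reaches r = 1; an offset of
    order delta^5 from it means passing Jupiter at a distance of order delta^4. Missing Jupiter on
    that passage contradicts nothing yet, because [jup_ejection_bwd] bounds neither the time nor the
    number of revolutions since the ejection. Orbits of positive energy do not come back, but
    reversed orbits of negative energy may well hit Jupiter on a later passage. Hence just one orbit
    of the arc is excluded, and it is found by continuity in a flow that ignores collisions. The
    constants are chosen in the order K, delta, mu. Energies lie between multiples of q = delta^5
    and of N q with N = K + 3; N delta is small so that the semi-major axes exceed (100 N)^4, which
    makes the spread of the periods beat all errors in the phase. Finally mu is at most a multiple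
    of delta^43: delta^8 pays for passages at distance of order delta^4, and q^7 for perturbations
    accumulated along an excursion of size 1 / q. *)

Lemma contraction_fixpoint {A : Type} (F : (A -> R) -> A -> R)
  (P : (A -> R) -> Prop) (f0 : A -> R) (B : R) :
  P f0 -> (forall f, P f -> P (F f)) ->
  (forall x, Rabs (F f0 x - f0 x) <= B) ->
  (forall f g c, P f -> P g -> (forall x, Rabs (f x - g x) <= c) ->
     forall x, Rabs (F f x - F g x) <= c / 2) ->
  (forall (u : nat -> A -> R) f, (forall n, P (u n)) ->
     (forall eps, 0 < eps -> exists n, forall x, Rabs (u n x - f x) <= eps) -> P f) ->
  exists f, P f /\ forall x, F f x = f x.
Proof.
intros P0 PF HB HF Hlim.
set (u := fun n => Nat.iter n F f0).
assert (Pu : forall n, P (u n)).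
{ induction n as [|n IH]; [exact P0|]. apply (PF _ IH). }
assert (Hstep : forall n x, Rabs (u (S n) x - u n x) <= B / 2 ^ n).
{ induction n as [|n IH]; intros x.
  - simpl. rewrite Rdiv_1_r. apply HB.
  - replace (B / 2 ^ S n) with (B / 2 ^ n / 2)
      by (simpl; field; apply pow_nonzero; lra).
    apply (HF (u (S n)) (u n)); auto. }
assert (Hdist : forall x n k, Rabs (u (n + k)%nat x - u n x) <= 2 * B / 2 ^ n - 2 * B / 2 ^ (n + k)).
{ intros x n k. induction k as [|k IH].
  - rewrite Nat.add_0_r. replace (u n x - u n x) with 0 by ring. rewrite Rabs_R0. lra.
  - rewrite Nat.add_succ_r.
    assert (H := Hstep (n + k)%nat x).
    assert (E : 2 * B / 2 ^ (S (n + k)) = 2 * B / 2 ^ (n + k) - B / 2 ^ (n + k)).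
    { simpl. field. apply pow_nonzero; lra. }
    rewrite E.
    replace (u (S (n + k)) x - u n x) with
      ((u (S (n + k)) x - u (n + k)%nat x) + (u (n + k)%nat x - u n x)) by ring.
    eapply Rle_trans; [apply Rabs_triang|]. lra. }
(* The index type may be empty, so the sign of [B] is only available at a point. *)
assert (B0 : forall x : A, 0 <= B).
{ intros x. eapply Rle_trans; [apply Rabs_pos|apply (HB x)]. }
assert (Hdist' : forall x n k, Rabs (u (n + k)%nat x - u n x) <= 2 * B / 2 ^ n).
{ intros x n k. eapply Rle_trans; [apply Hdist|].
  assert (0 <= 2 * B / 2 ^ (n + k)); [|lra].
  apply Rmult_le_pos; [pose proof (B0 x); lra|].
  left. apply Rinv_0_lt_compat, pow_lt; lra. }
assert (Hsmall : forall C eps, 0 < eps -> exists N, forall n, (N <= n)%nat -> C / 2 ^ n <= eps).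
{ intros C eps He.
  assert (Hg : is_lim_seq (fun n => C * (/ 2) ^ n) (C * 0)).
  { apply (is_lim_seq_scal_l _ C 0). apply is_lim_seq_geom. rewrite Rabs_pos_eq; lra. }
  rewrite Rmult_0_r in Hg.
  apply is_lim_seq_spec in Hg. destruct (Hg (mkposreal eps He)) as [N HN].
  exists N. intros n Hn. specialize (HN n Hn). simpl in HN.
  rewrite Rminus_0_r in HN. rewrite pow_inv in HN. apply Rabs_def2 in HN. unfold Rdiv. lra. }
assert (Hcv : forall x, exists l : R, is_lim_seq (fun n => u n x) l).
{ intros x. apply ex_lim_seq_cauchy_corr. intros eps.
  destruct (Hsmall (4 * B) (eps / 2)) as [N HN]; [destruct eps; simpl; lra|].
  exists N. intros n m Hn Hm.
  assert (H1 := Hdist' x N (n - N)%nat). assert (H2 := Hdist' x N (m - N)%nat).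
  replace (N + (n - N))%nat with n in H1 by lia.
  replace (N + (m - N))%nat with m in H2 by lia.
  specialize (HN N (le_n _)).
  replace (u n x - u m x) with ((u n x - u N x) - (u m x - u N x)) by ring.
  eapply Rle_lt_trans; [apply Rabs_triang|]. rewrite Rabs_Ropp.
  replace (4 * B / 2 ^ N) with (2 * B / 2 ^ N + 2 * B / 2 ^ N) in HN by (field; apply pow_nonzero; lra).
  destruct eps as [e He]; simpl in *. lra. }
pose (f := fun x => proj1_sig (constructive_indefinite_description _ (Hcv x))).
assert (Hf : forall x, is_lim_seq (fun n => u n x) (f x)).
{ intros x. unfold f. apply proj2_sig. }
assert (Hfu : forall n x, Rabs (u n x - f x) <= 2 * B / 2 ^ n).
{ intros n x.
  assert (H : is_lim_seq (fun k => Rabs (u (k + n)%nat x - u n x)) (Rabs (f x - u n x))).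
  { apply (is_lim_seq_abs _ (f x - u n x)). apply is_lim_seq_minus'.
    - apply -> (is_lim_seq_incr_n (fun k => u k x)). apply Hf.
    - apply is_lim_seq_const. }
  rewrite Rabs_minus_sym.
  apply (is_lim_seq_le _ _ (Rabs (f x - u n x)) (2 * B / 2 ^ n)
     (fun k => eq_ind_r (fun m => Rabs (u m x - u n x) <= 2 * B / 2 ^ n) (Hdist' x n k) (Nat.add_comm k n)) H).
  apply is_lim_seq_const. }
assert (Pf : P f).
{ apply (Hlim u); auto. intros eps He. destruct (Hsmall (2 * B) eps He) as [N HN].
  exists N. intros x. eapply Rle_trans; [apply Hfu|]. apply HN; lia. }
exists f. split; auto. intros x. apply Rminus_diag_uniq.
destruct (Req_dec (F f x - f x) 0) as [E|E]; auto. exfalso.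
assert (He : 0 < Rabs (F f x - f x) / 2) by (pose proof (Rabs_pos_lt _ E); lra).
destruct (Hsmall (2 * B) _ He) as [N HN].
assert (H1 := HF f (u N) (2 * B / 2 ^ N) Pf (Pu N)
   (fun y => eq_ind_r (fun z => z <= _) (Hfu N y) (Rabs_minus_sym (f y) (u N y))) x).
assert (H2 := Hfu (S N) x). assert (H3 := HN (S N) ltac:(lia)). specialize (HN N (le_n _)).
change (F (u N) x) with (u (S N) x) in H1.
assert (H4 : 2 * B / 2 ^ S N = 2 * B / 2 ^ N / 2) by (simpl; field; apply pow_nonzero; lra).
rewrite H4 in H2.
assert (H5 : Rabs (F f x - f x) <= Rabs (F f x - u (S N) x) + Rabs (u (S N) x - f x)).
{ replace (F f x - f x) with ((F f x - u (S N) x) + (u (S N) x - f x)) by ring. apply Rabs_triang. }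
 rewrite H4 in H3.
 lra.
Qed.

Lemma real_induction (P : R -> Prop) (a b : R) :
  (forall t, a <= t < b -> (forall s, a <= s < t -> P s) -> P t) ->
  (forall t, a <= t < b -> (forall s, a <= s <= t -> P s) ->
     exists e, 0 < e /\ forall s, t < s < t + e -> s < b -> P s) ->
  forall t, a <= t < b -> P t.
Proof.
intros H1 H2 t Ht. apply NNPP. intros Hn.
set (E := fun x => a <= x <= t /\ forall s, a <= s < x -> P s).
assert (Ea : E a) by (split; [lra|intros; lra]).
destruct (completeness E) as [m [Hub Hlub]].
{ exists t. intros x [Hx _]. lra. }
{ exists a. exact Ea. }
assert (ma : a <= m) by (apply Hub; exact Ea).
assert (mt : m <= t) by (apply Hlub; intros x [Hx _]; lra).
assert (Pm : forall s, a <= s < m -> P s).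
{ intros s Hs. apply NNPP. intros Hns.
  assert (m <= s); [|lra]. apply Hlub. intros x [Hx HPx].
  destruct (Rle_lt_dec x s); auto. exfalso. apply Hns, HPx. lra. }
assert (Pm' : forall s, a <= s <= m -> P s).
{ intros s Hs. destruct (Req_dec s m) as [->|]; [apply H1; [lra|auto]|apply Pm; lra]. }
destruct (H2 m ltac:(lra) Pm') as [e [He HPe]].
destruct (Req_dec m t) as [->|Hmt]; [apply Hn, Pm'; lra|].
assert (Em : E (Rmin t (m + e / 2))).
{ split.
  - split; [apply Rmin_glb; lra|apply Rmin_l].
  - intros s Hs. destruct (Rle_lt_dec s m); [apply Pm'; lra|].
    assert (H := Rmin_r t (m + e / 2)). assert (H' := Rmin_l t (m + e / 2)). apply HPe; lra. }
apply Hub in Em. revert Em. unfold Rmin. destruct Rle_dec; lra.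
Qed.

Lemma derive_le_incr (f g f' g' : R -> R) (a b : R) :
  a <= b ->
  (forall t, a <= t <= b -> is_derive f t (f' t)) ->
  (forall t, a <= t <= b -> is_derive g t (g' t)) ->
  (forall t, a <= t <= b -> f' t <= g' t) ->
  f b - f a <= g b - g a.
Proof.
intros Hab Hf Hg Hle.
destruct (MVT_gen (fun t => g t - f t) a b (fun t => g' t - f' t)) as [c [Hc E]].
- intros x Hx. rewrite Rmin_left, Rmax_right in Hx by lra.
  apply (is_derive_minus (V := R_NormedModule)); [apply Hg|apply Hf]; lra.
- intros x Hx. rewrite Rmin_left, Rmax_right in Hx by lra.
  apply continuity_pt_filterlim.
  apply (ex_derive_continuous (fun t => g t - f t)).
  exists (g' x - f' x). apply (is_derive_minus (V := R_NormedModule)); [apply Hg|apply Hf]; lra.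
- rewrite Rmin_left, Rmax_right in Hc by lra.
  specialize (Hle c ltac:(lra)). nra.
Qed.

Lemma derive_abs_le (f g f' g' : R -> R) (a b : R) :
  a <= b ->
  (forall t, a <= t <= b -> is_derive f t (f' t)) ->
  (forall t, a <= t <= b -> is_derive g t (g' t)) ->
  (forall t, a <= t <= b -> Rabs (f' t) <= g' t) ->
  Rabs (f b - f a) <= g b - g a.
Proof.
intros Hab Hf Hg Hle. apply Rabs_le. split.
- assert (H := derive_le_incr (fun t => - g t) f (fun t => - g' t) f' a b Hab).
  cut (- g b - - g a <= f b - f a); [lra|]. apply H; auto.
  + intros t Ht. apply (is_derive_opp (V := R_NormedModule)); auto.
  + intros t Ht. specialize (Hle t Ht). apply Rabs_le_between in Hle. lra.
- apply (derive_le_incr f g f' g'); auto.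
  intros t Ht. specialize (Hle t Ht). apply Rabs_le_between in Hle. lra.
Qed.

Lemma derive_bound (f f' : R -> R) (c a b : R) :
  a <= b ->
  (forall t, a <= t <= b -> is_derive f t (f' t)) ->
  (forall t, a <= t <= b -> Rabs (f' t) <= c) ->
  Rabs (f b - f a) <= c * (b - a).
Proof.
intros Hab Hf Hle.
replace (c * (b - a)) with ((fun t => c * t) b - (fun t => c * t) a) by ring.
apply (derive_abs_le f (fun t => c * t) f' (fun _ => c)); auto.
intros t Ht. auto_derive; auto. ring.
Qed.

Lemma gronwall (N N' : R -> R) (C a b : R) :
  a <= b ->
  (forall t, a <= t <= b -> is_derive N t (N' t)) ->
  (forall t, a <= t <= b -> N' t <= C * N t) ->
  N b <= N a * exp (C * (b - a)).
Proof.
intros Hab HN Hle.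
assert (H := derive_le_incr (fun t => N t * exp (- C * t)) (fun _ => 0)
  (fun t => (N' t - C * N t) * exp (- C * t)) (fun _ => 0) a b Hab).
assert (N b * exp (- C * b) - N a * exp (- C * a) <= 0 - 0).
{ apply H.
  - intros t Ht. specialize (HN t Ht).
    assert (HD : Derive (fun x => N x) t = N' t) by (apply is_derive_unique; auto).
    auto_derive; [exists (N' t); auto|].
    rewrite HD. ring.
  - intros t Ht. auto_derive; auto.
  - intros t Ht. specialize (Hle t Ht). assert (E := exp_pos (- C * t)). nra. }
replace (C * (b - a)) with (C * b + - C * a) by ring. rewrite exp_plus.
assert (E : exp (C * b) * exp (- C * b) = 1).
{ rewrite <- exp_plus. replace (C * b + - C * b) with 0 by ring. apply exp_0. }
assert (P := exp_pos (C * b)).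
replace (N b) with ((N b * exp (- C * b)) * exp (C * b)).
2:{ rewrite Rmult_assoc, (Rmult_comm (exp (- C * b))), E. ring. }
nra.
Qed.

(** Composing with [clamp] extends a function continuously from an interval to the whole line, so
    that integrands and paths are continuous everywhere and side conditions on domains disappear. *)
Definition clamp (lo hi x : R) : R := Rmax lo (Rmin x hi).

Lemma clamp_bounds lo hi x : lo <= hi -> lo <= clamp lo hi x <= hi.
Proof.
intros H. unfold clamp. split; [apply Rmax_l|].
apply Rmax_lub; auto. apply Rmin_r.
Qed.

Lemma clamp_id lo hi x : lo <= x <= hi -> clamp lo hi x = x.
Proof. intros H. unfold clamp. rewrite Rmin_left, Rmax_right; lra. Qed.

Lemma clamp_lip lo hi x y : lo <= hi -> Rabs (clamp lo hi x - clamp lo hi y) <= Rabs (x - y).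
Proof.
intros H. unfold clamp, Rmax, Rmin.
repeat destruct Rle_dec; unfold Rabs; repeat destruct Rcase_abs; lra.
Qed.

Lemma continuous_of_lip (f : R -> R) (k : R) :
  (forall x y, Rabs (f x - f y) <= k * Rabs (x - y)) -> forall x, continuous f x.
Proof.
intros H x. apply filterlim_locally. intros eps.
assert (Hk : 0 < eps / (Rabs k + 1)).
{ apply Rdiv_lt_0_compat; [apply cond_pos|]. pose proof (Rabs_pos k); lra. }
exists (mkposreal _ Hk). intros y Hy.
change (Rabs (f y - f x) < eps). change (Rabs (y - x) < eps / (Rabs k + 1)) in Hy.
eapply Rle_lt_trans; [apply H|].
assert (k <= Rabs k) by apply Rle_abs. pose proof (Rabs_pos k). pose proof (Rabs_pos (y - x)).
apply Rle_lt_trans with ((Rabs k + 1) * Rabs (y - x)); [nra|].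
apply Rmult_lt_reg_r with (/ (Rabs k + 1)); [apply Rinv_0_lt_compat; lra|].
replace ((Rabs k + 1) * Rabs (y - x) * / (Rabs k + 1)) with (Rabs (y - x)) by (field; lra). exact Hy.
Qed.

Lemma continuous_clamp lo hi x : lo <= hi -> continuous (clamp lo hi) x.
Proof.
intros H. apply (continuous_of_lip _ 1). intros. rewrite Rmult_1_l. apply clamp_lip; auto.
Qed.

Lemma ivt_between (f : R -> R) (a b y : R) :
  a <= b -> (forall x, a <= x <= b -> continuous f x) ->
  f a <= y <= f b \/ f b <= y <= f a -> exists x, a <= x <= b /\ f x = y.
Proof.
intros Hab Hc Hy.
destruct (IVT_gen (fun x => f (clamp a b x)) a b y) as [x [Hx E]].
- intros x. apply continuity_pt_filterlim.
  apply (continuous_comp (clamp a b) f); [apply continuous_clamp; auto|].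
  apply Hc, clamp_bounds; auto.
- rewrite !clamp_id by lra. unfold Rmin, Rmax. destruct Rle_dec; lra.
- rewrite Rmin_left, Rmax_right in Hx by lra. rewrite clamp_id in E by lra.
  exists x; auto.
Qed.

Lemma continuous_eps (f : R -> R) (x : R) :
  continuous f x <-> forall eps, 0 < eps -> exists d, 0 < d /\ forall y, Rabs (y - x) < d -> Rabs (f y - f x) < eps.
Proof.
split.
- intros H eps He.
  destruct (proj1 (filterlim_locally f (f x)) H (mkposreal eps He)) as [d Hd]. exists d. split; [apply cond_pos|].
  intros y Hy. apply Hd. exact Hy.
- intros H. apply filterlim_locally. intros [eps He]. destruct (H eps He) as [d [Hd H']].
  exists (mkposreal d Hd). intros y Hy. apply H'. exact Hy.
Qed.

Lemma first_hit (f : R -> R) (a b y : R) :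
  a <= b -> (forall x, a <= x <= b -> continuous f x) -> f a <= y <= f b ->
  exists x, a <= x <= b /\ f x = y /\ forall z, a <= z < x -> f z < y.
Proof.
intros Hab Hc Hy.
destruct (Req_dec (f a) y) as [Ea|Ea].
{ exists a. repeat split; try lra. intros; lra. }
apply NNPP. intros Hn.
assert (H : forall t, a <= t < b + 1 -> t <= b -> f t < y).
{ apply (real_induction (fun t => t <= b -> f t < y)).
  - intros t Ht IH Htb. destruct (Rtotal_order (f t) y) as [H|[H|H]]; auto; exfalso.
    + apply Hn. exists t. repeat split; try lra. intros z Hz. apply IH; lra.
    + destruct (ivt_between f a t y) as [x [Hx E]]; try lra.
      { intros x Hx. apply Hc; lra. }
      destruct (Req_dec x t) as [->|]; [lra|].
      assert (f x < y) by (apply IH; lra). lra.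
  - intros t Ht IH. destruct (Rle_lt_dec t b) as [Htb|Htb].
    2:{ exists 1. split; [lra|]. intros; lra. }
    assert (Hft : f t < y) by (apply IH; lra).
    destruct (proj1 (continuous_eps f t) (Hc t ltac:(lra)) (y - f t) ltac:(lra)) as [d [Hd H]].
    exists d. split; auto. intros s Hs _ Hsb. specialize (H s).
    rewrite Rabs_pos_eq in H by lra. specialize (H ltac:(lra)). apply Rabs_def2 in H. lra. }
assert (H' := H b). lra.
Qed.

(** Take for v the first point where f reaches y2, and for u the last point before v where f equals
    y1. The control on all of [u, v] is what matters later: it keeps a phase inside the window in
    which the scattering estimates hold. *)
Lemma ivt_window (f : R -> R) (a b y1 y2 : R) :
  a <= b -> (forall x, a <= x <= b -> continuous f x) -> f a <= y1 -> y1 <= y2 -> y2 <= f b ->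
  exists u v, a <= u /\ u <= v /\ v <= b /\ f u = y1 /\ f v = y2 /\ forall x, u <= x <= v -> y1 <= f x <= y2.
Proof.
intros Hab Hc H1 H12 H2.
destruct (first_hit f a b y2 Hab Hc ltac:(lra)) as [v [Hv [Ev Hv']]].
destruct (first_hit (fun x => - f (v + a - x)) a v (- y1)) as [u [Hu [Eu Hu']]]; try lra.
{ intros x Hx. apply (continuous_opp (V := R_NormedModule)).
  apply (continuous_comp (fun x => v + a - x) f).
  - apply (continuous_minus (V := R_NormedModule)); [apply continuous_const|apply continuous_id].
  - apply Hc; lra. }
{ replace (v + a - v) with a by ring. replace (v + a - a) with v by ring. lra. }
exists (v + a - u), v. repeat split; try lra.
- destruct (Req_dec x (v + a - u)) as [->|]; [lra|].
  specialize (Hu' (v + a - x) ltac:(lra)). replace (v + a - (v + a - x)) with x in Hu' by ring. lra.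
- destruct (Req_dec x v) as [->|]; [lra|].
  left. apply Hv'. lra.
Qed.

(** * The collision curve of the Sun as a singular two-point problem *)

Lemma mvt_abs (f f' : R -> R) (x y k : R) :
  (forall t, Rmin x y <= t <= Rmax x y -> is_derive f t (f' t)) ->
  (forall t, Rmin x y <= t <= Rmax x y -> Rabs (f' t) <= k) ->
  Rabs (f y - f x) <= k * Rabs (y - x).
Proof.
intros H1 H2. destruct (Rle_dec x y) as [H|H].
- rewrite Rmin_left, Rmax_right in * by lra.
  rewrite (Rabs_pos_eq (y - x)) by lra. apply (derive_bound f f'); auto.
- rewrite Rmin_right, Rmax_left in * by lra.
  rewrite Rabs_minus_sym, (Rabs_left (y - x)) by lra.
  replace (- (y - x)) with (x - y) by ring. apply (derive_bound f f'); auto; lra.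
Qed.

Lemma cos_lip x y : Rabs (cos y - cos x) <= Rabs (y - x).
Proof.
rewrite <- (Rmult_1_l (Rabs (y - x))). apply (mvt_abs cos (fun t => - sin t)).
- intros t _. auto_derive; auto. ring.
- intros t _. rewrite Rabs_Ropp. apply Rabs_le, SIN_bound.
Qed.

Lemma sin_lip x y : Rabs (sin y - sin x) <= Rabs (y - x).
Proof.
rewrite <- (Rmult_1_l (Rabs (y - x))). apply (mvt_abs sin cos).
- intros t _. auto_derive; auto. ring.
- intros t _. apply Rabs_le, COS_bound.
Qed.

Lemma between_abs x y t : Rmin x y <= t <= Rmax x y -> Rabs (t - x) <= Rabs (y - x).
Proof.
unfold Rmin, Rmax. destruct Rle_dec; intros H; unfold Rabs; repeat destruct Rcase_abs; lra.
Qed.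

Lemma cos_rem x y : Rabs (cos y - cos x - - sin x * (y - x)) <= (y - x) ^ 2.
Proof.
replace (cos y - cos x - - sin x * (y - x)) with
  ((fun t => cos t + sin x * t) y - (fun t => cos t + sin x * t) x) by ring.
replace ((y - x) ^ 2) with (Rabs (y - x) * Rabs (y - x)) by (rewrite <- (pow2_abs (y - x)); ring).
apply (mvt_abs (fun t => cos t + sin x * t) (fun t => sin x - sin t)).
- intros t _. auto_derive; auto. ring.
- intros t Ht. rewrite Rabs_minus_sym. eapply Rle_trans; [apply sin_lip|]. apply between_abs; auto.
Qed.

Lemma sin_rem x y : Rabs (sin y - sin x - cos x * (y - x)) <= (y - x) ^ 2.
Proof.
replace (sin y - sin x - cos x * (y - x)) with
  ((fun t => sin t - cos x * t) y - (fun t => sin t - cos x * t) x) by ring.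
replace ((y - x) ^ 2) with (Rabs (y - x) * Rabs (y - x)) by (rewrite <- (pow2_abs (y - x)); ring).
apply (mvt_abs (fun t => sin t - cos x * t) (fun t => cos t - cos x)).
- intros t _. auto_derive; auto. ring.
- intros t Ht. eapply Rle_trans; [apply cos_lip|]. apply between_abs; auto.
Qed.

Definition dom (s la : R) : Prop := 0 <= s <= 1 / 2 /\ -1 <= la <= 1.

(* Uniform C^{1,1} bounds in the last two variables on [dom], together with joint continuity. *)
Definition tame (M : R) (f : R -> R -> R -> R) : Prop :=
  (forall s th la, dom s la -> Rabs (f s th la) <= M) /\
  (forall s th la th' la', dom s la -> dom s la' ->
     Rabs (f s th' la' - f s th la) <= M * (Rabs (th' - th) + Rabs (la' - la))) /\
  (exists ft fl : R -> R -> R -> R, forall s th la, dom s la ->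
     Rabs (ft s th la) <= M /\ Rabs (fl s th la) <= M /\
     forall th' la', dom s la' ->
       Rabs (f s th' la' - f s th la - (ft s th la * (th' - th) + fl s th la * (la' - la)))
         <= M * (Rabs (th' - th) + Rabs (la' - la)) ^ 2) /\
  (forall (s th la : R -> R) x, continuous s x -> continuous th x -> continuous la x ->
     (forall y, dom (s y) (la y)) -> continuous (fun y => f (s y) (th y) (la y)) x).

(** The parameters are [p = (mu, eta)], with [eta] the value of the Jacobi integral. One constant
    for all of them is required because delta is chosen before mu and the energy level. *)
Definition valid (p : R * R) : Prop := 0 <= fst p <= 1 / 8 /\ -1 / 8 <= snd p <= 1 / 8.

Definition utame (f : R * R -> R -> R -> R -> R) : Prop :=
  exists M, 0 <= M /\ forall p, valid p -> tame M (f p).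

Lemma utame_cst (c : R * R -> R) M : (forall p, valid p -> Rabs (c p) <= M) -> utame (fun p _ _ _ => c p).
Proof.
intros H. exists (Rmax M 0). split; [apply Rmax_r|]. intros p Hp. specialize (H p Hp).
assert (HM := Rmax_l M 0). assert (HM0 := Rmax_r M 0).
repeat split.
- intros; lra.
- intros. rewrite Rminus_diag, Rabs_R0.
  apply Rmult_le_pos; auto. apply Rplus_le_le_0_compat; apply Rabs_pos.
- exists (fun _ _ _ => 0), (fun _ _ _ => 0). intros. rewrite Rabs_R0. repeat split; auto.
  intros. replace (c p - c p - _) with 0 by ring. rewrite Rabs_R0.
  apply Rmult_le_pos; auto. apply pow2_ge_0.
- intros. apply continuous_const.
Qed.

Lemma utame_s : utame (fun _ s _ _ => s).
Proof.
exists 1. split; [lra|]. intros p _. repeat split.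
- intros s th la [H _]. rewrite Rabs_pos_eq; lra.
- intros. rewrite Rminus_diag, Rabs_R0.
  pose proof (Rabs_pos (th' - th)); pose proof (Rabs_pos (la' - la)); lra.
- exists (fun _ _ _ => 0), (fun _ _ _ => 0). intros. rewrite Rabs_R0. repeat split; try lra.
  intros. replace (s - s - _) with 0 by ring. rewrite Rabs_R0.
  apply Rmult_le_pos; [lra|]. apply pow2_ge_0.
- intros; auto.
Qed.

Lemma utame_la : utame (fun _ _ _ la => la).
Proof.
exists 1. split; [lra|]. intros p _. repeat split.
- intros s th la [_ H]. apply Rabs_le; lra.
- intros. pose proof (Rabs_pos (th' - th)); pose proof (Rabs_pos (la' - la)); lra.
- exists (fun _ _ _ => 0), (fun _ _ _ => 1). intros. rewrite Rabs_R0, Rabs_R1. repeat split; try lra.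
  intros. replace (la' - la - _) with 0 by ring. rewrite Rabs_R0.
  apply Rmult_le_pos; [lra|]. apply pow2_ge_0.
- intros; auto.
Qed.

Lemma sq_le_sum x y : x ^ 2 <= (Rabs x + Rabs y) ^ 2.
Proof. rewrite <- (pow2_abs x). pose proof (Rabs_pos x); pose proof (Rabs_pos y). nra. Qed.

Lemma utame_trig (f f' : R -> R) :
  (forall x, Rabs (f x) <= 1) -> (forall x, Rabs (f' x) <= 1) ->
  (forall x y, Rabs (f y - f x) <= Rabs (y - x)) ->
  (forall x y, Rabs (f y - f x - f' x * (y - x)) <= (y - x) ^ 2) ->
  utame (fun _ _ th _ => f th).
Proof.
intros H0 H1 H2 H3. exists 1. split; [lra|]. intros p _. repeat split.
- intros; auto.
- intros. specialize (H2 th th'). pose proof (Rabs_pos (la' - la)); lra.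
- exists (fun _ th _ => f' th), (fun _ _ _ => 0). intros. rewrite Rabs_R0. repeat split; auto; try lra.
  intros. rewrite Rmult_0_l, Rplus_0_r, Rmult_1_l.
  eapply Rle_trans; [apply H3|apply sq_le_sum].
- intros. apply (continuous_comp th f); auto. apply (continuous_of_lip f 1).
  intros x' y. rewrite Rmult_1_l. rewrite Rabs_minus_sym, (Rabs_minus_sym x'). auto.
Qed.

Lemma utame_cos : utame (fun _ _ th _ => cos th).
Proof.
apply (utame_trig cos (fun x => - sin x)).
- intros; apply Rabs_le, COS_bound.
- intros; rewrite Rabs_Ropp; apply Rabs_le, SIN_bound.
- apply cos_lip.
- apply cos_rem.
Qed.

Lemma utame_sin : utame (fun _ _ th _ => sin th).
Proof.
apply (utame_trig sin cos).
- intros; apply Rabs_le, SIN_bound.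
- intros; apply Rabs_le, COS_bound.
- apply sin_lip.
- apply sin_rem.
Qed.

Lemma utame_plus f g : utame f -> utame g -> utame (fun p s th la => f p s th la + g p s th la).
Proof.
intros [M [HM Hf]] [M' [HM' Hg]]. exists (M + M'). split; [lra|].
intros p Hp. destruct (Hf p Hp) as [f0 [f1 [[ft [fl f2]] f3]]].
destruct (Hg p Hp) as [g0 [g1 [[gt [gl g2]] g3]]]. repeat split.
- intros. eapply Rle_trans; [apply Rabs_triang|]. apply Rplus_le_compat; auto.
- intros. specialize (f1 s th la th' la' H H0). specialize (g1 s th la th' la' H H0).
  replace (_ + _ - (_ + _)) with ((f p s th' la' - f p s th la) + (g p s th' la' - g p s th la)) by ring.
  eapply Rle_trans; [apply Rabs_triang|]. lra.
- exists (fun s th la => ft s th la + gt s th la), (fun s th la => fl s th la + gl s th la).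
  intros. destruct (f2 s th la H) as [A1 [A2 A3]]. destruct (g2 s th la H) as [B1 [B2 B3]].
  repeat split.
  + eapply Rle_trans; [apply Rabs_triang|]. lra.
  + eapply Rle_trans; [apply Rabs_triang|]. lra.
  + intros. specialize (A3 th' la' H0). specialize (B3 th' la' H0).
    match goal with |- Rabs ?x <= _ => replace x with
     ((f p s th' la' - f p s th la - (ft s th la * (th' - th) + fl s th la * (la' - la))) +
      (g p s th' la' - g p s th la - (gt s th la * (th' - th) + gl s th la * (la' - la)))) by ring end.
    eapply Rle_trans; [apply Rabs_triang|]. lra.
- intros. apply (continuous_plus (V := R_NormedModule)); auto.
Qed.

Lemma utame_mult f g : utame f -> utame g -> utame (fun p s th la => f p s th la * g p s th la).
Proof.
intros [M [HM Hf]] [M' [HM' Hg]]. exists (3 * (M * M')). split; [nra|].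
intros p Hp. destruct (Hf p Hp) as [f0 [f1 [[ft [fl f2]] f3]]].
destruct (Hg p Hp) as [g0 [g1 [[gt [gl g2]] g3]]].
assert (HMM : 0 <= M * M') by nra.
assert (prod : forall x y a b, Rabs x <= a -> Rabs y <= b -> Rabs (x * y) <= a * b).
{ intros. rewrite Rabs_mult. apply Rmult_le_compat; auto; apply Rabs_pos. }
repeat split.
- intros. eapply Rle_trans; [apply prod; [apply f0|apply g0]; auto|]. lra.
- intros. specialize (f1 s th la th' la' H H0). specialize (g1 s th la th' la' H H0).
  set (N := Rabs (th' - th) + Rabs (la' - la)) in *.
  assert (0 <= N) by (apply Rplus_le_le_0_compat; apply Rabs_pos).
  replace (_ * _ - _ * _) with ((f p s th' la' - f p s th la) * g p s th' la' + f p s th la * (g p s th' la' - g p s th la)) by ring.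
  eapply Rle_trans; [apply Rabs_triang|].
  eapply Rle_trans; [apply Rplus_le_compat; [apply prod; [apply f1|apply g0; auto]|apply prod; [apply f0; auto|apply g1]]|].
  nra.
- exists (fun s th la => ft s th la * g p s th la + f p s th la * gt s th la),
         (fun s th la => fl s th la * g p s th la + f p s th la * gl s th la).
  intros. destruct (f2 s th la H) as [A1 [A2 A3]]. destruct (g2 s th la H) as [B1 [B2 B3]].
  specialize (f0 s th la H). specialize (g0 s th la H).
  repeat split.
  + eapply Rle_trans; [apply Rabs_triang|]. pose proof (prod _ _ _ _ A1 g0). pose proof (prod _ _ _ _ f0 B1). lra.
  + eapply Rle_trans; [apply Rabs_triang|]. pose proof (prod _ _ _ _ A2 g0). pose proof (prod _ _ _ _ f0 B2). lra.
  + intros. specialize (A3 th' la' H0). specialize (B3 th' la' H0).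
    specialize (f1 s th la th' la' H H0). specialize (g1 s th la th' la' H H0).
    set (N := Rabs (th' - th) + Rabs (la' - la)) in *.
    match goal with |- Rabs ?x <= _ => replace x with
     ((f p s th' la' - f p s th la) * (g p s th' la' - g p s th la) +
      ((f p s th' la' - f p s th la - (ft s th la * (th' - th) + fl s th la * (la' - la))) * g p s th la +
       f p s th la * (g p s th' la' - g p s th la - (gt s th la * (th' - th) + gl s th la * (la' - la))))) by ring end.
    eapply Rle_trans; [apply Rabs_triang|].
    eapply Rle_trans; [apply Rplus_le_compat; [apply prod; [apply f1|apply g1]|apply Rabs_triang]|].
    pose proof (prod _ _ _ _ A3 g0). pose proof (prod _ _ _ _ f0 B3).
    replace (3 * (M * M') * N ^ 2) with (M * N * (M' * N) + (M * N ^ 2 * M' + M * (M' * N ^ 2))) by ring. lra.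
- intros. apply (continuous_mult (K := R_AbsRing)); auto.
Qed.

Lemma utame_ext f g : (forall p s th la, f p s th la = g p s th la) -> utame f -> utame g.
Proof.
intros E [M [HM H]]. exists M. split; auto. intros p Hp.
destruct (H p Hp) as [f0 [f1 [[ft [fl f2]] f3]]]. repeat split.
- intros. rewrite <- E. auto.
- intros. rewrite <- !E. auto.
- exists ft, fl. intros. destruct (f2 s th la H0) as [A [B C]]. repeat split; auto. intros. rewrite <- !E. auto.
- intros. apply (continuous_ext (fun y => f p (s y) (th y) (la y))); auto.
Qed.

Lemma utame_opp f : utame f -> utame (fun p s th la => - f p s th la).
Proof.
intros H. apply (utame_ext (fun p s th la => (-1) * f p s th la)); [intros; ring|].
apply (utame_mult (fun _ _ _ _ => -1)); auto. apply (utame_cst (fun _ => -1) 1).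
intros. rewrite Rabs_left; lra.
Qed.

Lemma utame_minus f g : utame f -> utame g -> utame (fun p s th la => f p s th la - g p s th la).
Proof. intros. apply utame_plus; auto. apply utame_opp; auto. Qed.

Lemma utame_pow f n : utame f -> utame (fun p s th la => f p s th la ^ n).
Proof.
intros H. induction n as [|n IH]; simpl.
- apply (utame_cst (fun _ => 1) 1). intros; rewrite Rabs_R1; lra.
- apply utame_mult; auto.
Qed.

Lemma rsqrt_bounds x : 1 / 4 <= x <= 4 -> 1 / 2 <= sqrt x <= 2.
Proof.
intros H. split.
- replace (1 / 2) with (sqrt (1 / 4)); [apply sqrt_le_1; lra|].
  replace (1 / 4) with ((1 / 2) * (1 / 2)) by lra. apply sqrt_square; lra.
- replace 2 with (sqrt 4); [apply sqrt_le_1; lra|].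
  replace 4 with (2 * 2) by lra. apply sqrt_square; lra.
Qed.

Lemma rsqrt_rem x y : 1 / 4 <= x <= 4 -> 1 / 4 <= y <= 4 ->
  Rabs (/ sqrt y - / sqrt x - - (/ (2 * sqrt x ^ 3)) * (y - x)) <= 48 * (y - x) ^ 2.
Proof.
intros Hx Hy. assert (A := rsqrt_bounds x Hx). assert (B := rsqrt_bounds y Hy).
assert (Ex : x = sqrt x * sqrt x) by (rewrite sqrt_sqrt; lra).
assert (Ey : y = sqrt y * sqrt y) by (rewrite sqrt_sqrt; lra).
set (a := sqrt x) in *. set (b := sqrt y) in *. clearbody a b. subst x y. clear Hx Hy.
replace (/ b - / a - - / (2 * a ^ 3) * (b * b - a * a)) with ((b - a) ^ 2 * ((b + 2 * a) / (2 * a ^ 3 * b)))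
  by (field; lra).
assert (H : 0 <= (b + 2 * a) / (2 * a ^ 3 * b) <= 48).
{ assert (0 < a ^ 3) by (apply pow_lt; lra). assert (0 < 2 * a ^ 3 * b) by nra. split.
  - apply Rmult_le_pos; [lra|]. left; apply Rinv_0_lt_compat; auto.
  - apply Rle_div_l; auto. assert (1 / 8 <= a ^ 3).
    { replace (1 / 8) with ((1 / 2) ^ 3) by lra. apply pow_incr; lra. } nra. }
rewrite Rabs_pos_eq by (apply Rmult_le_pos; [apply pow2_ge_0|lra]).
replace ((b * b - a * a) ^ 2) with ((b - a) ^ 2 * (a + b) ^ 2) by ring.
assert (0 <= (b - a) ^ 2) by apply pow2_ge_0. assert (1 <= (a + b) ^ 2) by nra.
nra.
Qed.

Lemma rsqrt_lip x y : 1 / 4 <= x <= 4 -> 1 / 4 <= y <= 4 ->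
  Rabs (/ sqrt y - / sqrt x) <= 4 * Rabs (y - x).
Proof.
intros Hx Hy. assert (A := rsqrt_bounds x Hx). assert (B := rsqrt_bounds y Hy).
assert (Ex : x = sqrt x * sqrt x) by (rewrite sqrt_sqrt; lra).
assert (Ey : y = sqrt y * sqrt y) by (rewrite sqrt_sqrt; lra).
set (a := sqrt x) in *. set (b := sqrt y) in *. clearbody a b. subst x y. clear Hx Hy.
replace (/ b - / a) with ((a - b) * / (a * b)) by (field; lra).
replace (b * b - a * a) with ((a - b) * - (a + b)) by ring.
rewrite !Rabs_mult, Rabs_Ropp, (Rabs_pos_eq (a + b)), (Rabs_pos_eq (/ (a * b))); try lra.
2:{ left; apply Rinv_0_lt_compat; nra. }
assert (/ (a * b) <= 4). { replace 4 with (/ (1 / 4)) by field. apply Rinv_le_contravar; nra. }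
pose proof (Rabs_pos (a - b)). nra.
Qed.

Lemma utame_rsqrt f : utame f ->
  (forall p s th la, valid p -> dom s la -> 1 / 4 <= f p s th la <= 4) ->
  utame (fun p s th la => / sqrt (f p s th la)).
Proof.
intros [M [HM Hf]] Hr. exists (48 * M ^ 2 + 4 * M + 2). split; [nra|].
intros p Hp. destruct (Hf p Hp) as [f0 [f1 [[ft [fl f2]] f3]]]. specialize (Hr p).
assert (HM2 : 0 <= M ^ 2) by nra.
repeat split.
- intros s th la H. specialize (Hr s th la Hp H). assert (B := rsqrt_bounds _ Hr).
  rewrite Rabs_pos_eq by (left; apply Rinv_0_lt_compat; lra).
  assert (/ sqrt (f p s th la) <= / (1 / 2)) by (apply Rinv_le_contravar; lra). lra.
- intros.
  specialize (f1 s th la th' la' H H0).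
  set (N := Rabs (th' - th) + Rabs (la' - la)) in *.
  assert (0 <= N) by (apply Rplus_le_le_0_compat; apply Rabs_pos).
  eapply Rle_trans; [apply rsqrt_lip; auto|]. nra.
- exists (fun s th la => - / (2 * sqrt (f p s th la) ^ 3) * ft s th la),
         (fun s th la => - / (2 * sqrt (f p s th la) ^ 3) * fl s th la).
  intros. destruct (f2 s th la H) as [A1 [A2 A3]]. assert (H1 := Hr s th la Hp H). assert (B := rsqrt_bounds _ H1).
  assert (C : Rabs (- / (2 * sqrt (f p s th la) ^ 3)) <= 4).
  { rewrite Rabs_Ropp. set (a := sqrt (f p s th la)) in *.
    assert (1 / 8 <= a ^ 3) by (replace (1 / 8) with ((1 / 2) ^ 3) by lra; apply pow_incr; lra).
    rewrite Rabs_pos_eq by (left; apply Rinv_0_lt_compat; lra).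
    replace 4 with (/ (1 / 4)) by field. apply Rinv_le_contravar; lra. }
  repeat split.
  + rewrite Rabs_mult. pose proof (Rabs_pos (ft s th la)).
     nra.
  + rewrite Rabs_mult. pose proof (Rabs_pos (fl s th la)).
     nra.
  + intros. assert (H2 := Hr s th' la' Hp H0). specialize (A3 th' la' H0). specialize (f1 s th la th' la' H H0).
    set (N := Rabs (th' - th) + Rabs (la' - la)) in *.

    assert (D := rsqrt_rem _ _ H1 H2).
    set (c := - / (2 * sqrt (f p s th la) ^ 3)) in *.
    match goal with |- Rabs ?x <= _ => replace x with
      ((/ sqrt (f p s th' la') - / sqrt (f p s th la) - c * (f p s th' la' - f p s th la)) +
       c * (f p s th' la' - f p s th la - (ft s th la * (th' - th) + fl s th la * (la' - la)))) by ring end.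
    eapply Rle_trans; [apply Rabs_triang|]. rewrite (Rabs_mult c).
    assert (E : (f p s th' la' - f p s th la) ^ 2 <= M ^ 2 * N ^ 2).
    { rewrite <- (pow2_abs (_ - _)), <- Rpow_mult_distr. apply pow_incr. split; [apply Rabs_pos|auto]. }

    pose proof (Rabs_pos (f p s th' la' - f p s th la - (ft s th la * (th' - th) + fl s th la * (la' - la)))).


    nra.
- intros s th la x Hs Hth Hla Hd. assert (Hx := Hr _ (th x) _ Hp (Hd x)). assert (B := rsqrt_bounds _ Hx).
  apply (continuous_comp (fun y => f p (s y) (th y) (la y)) (fun z => / sqrt z)); auto.
  apply (ex_derive_continuous (fun z => / sqrt z)). auto_derive. repeat split; lra.
Qed.

(** An a priori bound c that can always be improved to e + c / 2 decreases to the fixed point 2 e.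
    This plays the role of Gronwall's lemma for the two-point problem, where values are prescribed
    at both ends; the index set allows several components to be estimated at once. *)
Lemma halving_bound {X : Type} (d : X -> R) (e c0 : R) :
  0 <= e -> 0 <= c0 -> (forall x, d x <= c0) ->
  (forall c, 0 <= c -> (forall x, d x <= c) -> forall x, d x <= e + c / 2) ->
  forall x, d x <= 2 * e.
Proof.
intros He Hc0 H0 H.
assert (Hn : forall n x, d x <= 2 * e + c0 * (/ 2) ^ n).
{ induction n as [|n IH]; intros x; simpl.
  - specialize (H0 x). lra.
  - assert (Hp : 0 <= (/ 2) ^ n) by (apply pow_le; lra).
    assert (H1 := H (2 * e + c0 * (/ 2) ^ n) ltac:(nra) IH x). lra. }
intros x.
assert (Hg : is_lim_seq (fun n => 2 * e + c0 * (/ 2) ^ n) (2 * e + c0 * 0)).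
{ apply is_lim_seq_plus'; [apply is_lim_seq_const|].
  apply (is_lim_seq_scal_l _ c0 0). apply is_lim_seq_geom. rewrite Rabs_pos_eq; lra. }
replace (2 * e) with (2 * e + c0 * 0) by ring.
apply (is_lim_seq_le (fun _ => d x) (fun n => 2 * e + c0 * (/ 2) ^ n) (d x) (2 * e + c0 * 0));
  auto. apply is_lim_seq_const.
Qed.

Lemma ex_RInt_cont (h : R -> R) a b : (forall x, continuous h x) -> ex_RInt h a b.
Proof. intros H. apply (ex_RInt_continuous (V := R_CompleteNormedModule)). auto. Qed.

Lemma RInt_bound (h : R -> R) a b k :
  a <= b -> (forall x, continuous h x) -> (forall x, a <= x <= b -> Rabs (h x) <= k) ->
  Rabs (RInt h a b) <= k * (b - a).
Proof.
intros Hab Hc Hk. rewrite Rmult_comm.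
apply abs_RInt_le_const; auto. apply ex_RInt_cont; auto.
Qed.

Lemma RInt_lip (h : R -> R) x0 k :
  (forall x, continuous h x) -> (forall x, Rabs (h x) <= k) ->
  forall x y, Rabs (RInt h x0 x - RInt h x0 y) <= k * Rabs (x - y).
Proof.
intros Hc Hk.
assert (G : forall x y, y <= x -> Rabs (RInt h x0 x - RInt h x0 y) <= k * Rabs (x - y)).
{ intros x y Hxy.
  assert (E : RInt h x0 x - RInt h x0 y = RInt h y x).
  { rewrite <- (RInt_Chasles h x0 y x) by (apply ex_RInt_cont; auto).
    change (RInt h x0 y + RInt h y x - RInt h x0 y = RInt h y x). ring. }
  rewrite E, (Rabs_pos_eq (x - y)) by lra. apply RInt_bound; auto. }
intros x y. destruct (Rle_dec y x); [auto|].
rewrite Rabs_minus_sym, (Rabs_minus_sym x). apply G; lra.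
Qed.

Lemma RInt_sq_bound (h : R -> R) x d k : 0 < x <= d ->
  (forall s, continuous h s) -> (forall s, 0 <= s <= x -> Rabs (h s) <= k) ->
  Rabs (RInt (fun s => (clamp 0 d s) ^ 2 * h s) 0 x) <= x ^ 2 * (k * d).
Proof.
intros Hx Hc Hk.
assert (Hk0 : 0 <= k) by (eapply Rle_trans; [apply Rabs_pos|apply (Hk 0); lra]).
eapply Rle_trans; [apply (RInt_bound _ 0 x (x ^ 2 * k)); try lra|].
- intros s. apply (continuous_mult (K := R_AbsRing)); auto.
  apply (continuous_comp (clamp 0 d) (fun u => u ^ 2)); [apply continuous_clamp; lra|].
  apply (ex_derive_continuous (fun u : R => u ^ 2)). auto_derive; auto.
- intros s Hs. rewrite clamp_id by lra. rewrite Rabs_mult, Rabs_pos_eq by apply pow2_ge_0.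
  apply Rmult_le_compat; auto; [apply pow2_ge_0|apply Rabs_pos|]. apply pow_incr; lra.
- assert (0 <= x ^ 2 * k) by (apply Rmult_le_pos; auto; apply pow2_ge_0). nra.
Qed.

(* Two-point problem: th is prescribed at s = d, while la has to vanish at the singular point s = 0. *)
Definition bvp_sol (A B : R -> R -> R -> R) (d a : R) (th la : R -> R) : Prop :=
  (forall x, continuous th x) /\ (forall x, continuous la x) /\ (forall x, -1 <= la x <= 1) /\
  (forall x, 0 <= x <= d -> th x = a + RInt (fun s => A (clamp 0 d s) (th s) (la s)) x d) /\
  la 0 = 0 /\
  (forall x, 0 < x <= d -> x ^ 2 * la x = RInt (fun s => (clamp 0 d s) ^ 2 * B (clamp 0 d s) (th s) (la s)) 0 x).

Section Bvp.
Variables (A B : R -> R -> R -> R) (M d : R).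
Hypotheses (HA : tame M A) (HB : tame M B) (Hd : 0 < d <= 1 / 2) (HM : 0 <= M) (HMd : 16 * M * d <= 1).

Lemma tame_bound f : tame M f -> forall s th la, dom s la -> Rabs (f s th la) <= M.
Proof. intros [H _]; auto. Qed.

Lemma dom_clamp s la : -1 <= la <= 1 -> dom (clamp 0 d s) la.
Proof. intros H. split; auto. pose proof (clamp_bounds 0 d s). lra. Qed.

Lemma tame_cont f th la : tame M f -> (forall x, continuous th x) -> (forall x, continuous la x) ->
  (forall x, -1 <= la x <= 1) -> forall x : R, continuous (fun s : R => f (clamp 0 d s) (th s) (la s)) x.
Proof.
intros [_ [_ [_ H]]] Hth Hla Hb x. apply H; auto.
- apply continuous_clamp; lra.
- intros; apply dom_clamp; auto.
Qed.

Lemma continuous_sqclamp h x : (forall s : R, continuous h s) -> continuous (fun s : R => (clamp 0 d s) ^ 2 * h s) x.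
Proof.
intros Hc. apply (continuous_mult (K := R_AbsRing)); auto.
apply (continuous_comp (clamp 0 d) (fun u => u ^ 2)); [apply continuous_clamp; lra|].
apply (ex_derive_continuous (fun u : R => u ^ 2)). auto_derive; auto.
Qed.

(** The pair (th, la) is a single function on [bool * R], with [true] for th, so that the scalar
    fixed point lemma applies. The equation for s^2 la is integrated from the singular end s = 0 and
    divided by x^2; the value 0 chosen at x = 0 is the continuous extension. *)
Definition bvp_map (a : R) (z : bool * R -> R) (i : bool * R) : R :=
  let (b, x) := i in
  if b then a + RInt (fun s => A (clamp 0 d s) (z (true, s)) (z (false, s))) (clamp 0 d x) d
  else if Rlt_dec 0 (clamp 0 d x) then
    / (clamp 0 d x) ^ 2 * RInt (fun s => (clamp 0 d s) ^ 2 * B (clamp 0 d s) (z (true, s)) (z (false, s))) 0 (clamp 0 d x)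
  else 0.

Definition bvp_adm (z : bool * R -> R) : Prop :=
  (forall x : R, continuous (fun s : R => z (true, s)) x) /\
  (forall x : R, continuous (fun s : R => z (false, s)) x) /\ (forall x, -1 <= z (false, x) <= 1).

Lemma avg_bound h x k : 0 < x <= d -> (forall s, continuous h s) -> (forall s, 0 <= s <= x -> Rabs (h s) <= k) ->
  Rabs (/ x ^ 2 * RInt (fun s => (clamp 0 d s) ^ 2 * h s) 0 x) <= k * d.
Proof.
intros Hx Hc Hk. assert (H := RInt_sq_bound h x d k Hx Hc Hk).
assert (0 < x ^ 2) by (apply pow_lt; lra).
rewrite Rabs_mult, Rabs_pos_eq by (left; apply Rinv_0_lt_compat; auto).
apply Rmult_le_reg_l with (x ^ 2); auto.
rewrite <- Rmult_assoc, Rinv_r, Rmult_1_l by lra. lra.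
Qed.

Lemma bvp_map_adm a z : bvp_adm z -> bvp_adm (bvp_map a z).
Proof.
intros [H1 [H2 H3]].
assert (CA := tame_cont A _ _ HA H1 H2 H3). assert (CB := tame_cont B _ _ HB H1 H2 H3). cbv beta in CA, CB.
assert (BA : forall x, Rabs (A (clamp 0 d x) (z (true, x)) (z (false, x))) <= M)
  by (intros; apply (tame_bound A HA), dom_clamp; auto).
assert (BB : forall x, Rabs (B (clamp 0 d x) (z (true, x)) (z (false, x))) <= M)
  by (intros; apply (tame_bound B HB), dom_clamp; auto).
assert (CC : forall x, continuous (clamp 0 d) x) by (intros; apply continuous_clamp; lra).
assert (CQ := fun x => continuous_sqclamp _ x CB). cbv beta in CQ.
assert (BQ : forall x, Rabs ((clamp 0 d x) ^ 2 * B (clamp 0 d x) (z (true, x)) (z (false, x))) <= M).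
{ intros x. specialize (BB x). pose proof (clamp_bounds 0 d x). rewrite Rabs_mult, Rabs_pos_eq by apply pow2_ge_0.
  assert ((clamp 0 d x) ^ 2 <= 1) by nra.
   nra. }
(* Since s^2 / x^2 is at most 1 on [0, x], the averaged integral is at most M x. This gives both the
   bound by 1 and the continuity at the singular point. *)
assert (G : forall x, Rabs (bvp_map a z (false, x)) <= M * clamp 0 d x).
{ intros x. unfold bvp_map. pose proof (clamp_bounds 0 d x). destruct Rlt_dec as [Hp|Hp].
  - set (c := clamp 0 d x) in *. assert (Hcc : 0 < c ^ 2) by (apply pow_lt; lra).
    rewrite Rabs_mult, Rabs_pos_eq by (left; apply Rinv_0_lt_compat; auto).
    apply Rmult_le_reg_l with (c ^ 2); auto.
    rewrite <- Rmult_assoc, Rinv_r, Rmult_1_l by lra.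
    eapply Rle_trans; [apply (RInt_bound _ 0 c (c ^ 2 * M))|]; try lra; auto.
    intros s Hs. rewrite Rabs_mult, Rabs_pos_eq by apply pow2_ge_0.
    apply Rmult_le_compat; auto; [apply pow2_ge_0|apply Rabs_pos|]. rewrite clamp_id by lra. apply pow_incr; lra.
  - rewrite Rabs_R0. apply Rmult_le_pos; lra. }
split; [|split].
- intros x. apply (continuous_plus (V := R_NormedModule)); [apply continuous_const|].
  apply (continuous_comp (clamp 0 d) (fun u => RInt (fun s => A (clamp 0 d s) (z (true, s)) (z (false, s))) u d)); auto.
  apply (continuous_of_lip _ M). intros u v.
  rewrite <- (opp_RInt_swap _ d u), <- (opp_RInt_swap _ d v) by (apply ex_RInt_cont; auto).
  match goal with |- Rabs (opp ?p - opp ?q) <= _ => replace (opp p - opp q) with (- (p - q)) by (unfold opp; simpl; ring) end.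
  rewrite Rabs_Ropp. apply RInt_lip; auto.
- intros x. destruct (Rlt_dec 0 (clamp 0 d x)) as [Hp|Hp].
  + set (q := fun u => / u ^ 2 * RInt (fun s => (clamp 0 d s) ^ 2 * B (clamp 0 d s) (z (true, s)) (z (false, s))) 0 u).
    apply (continuous_ext_loc _ (fun s => q (clamp 0 d s))).
    * assert (Hc := proj1 (continuous_eps _ _) (CC x) _ Hp). destruct Hc as [e [He Hc]].
      exists (mkposreal e He). intros y Hy. specialize (Hc y Hy). apply Rabs_def2 in Hc.
      simpl. destruct Rlt_dec; [reflexivity|lra].
    * apply (continuous_comp (clamp 0 d) q); auto. unfold q.
      apply (continuous_mult (K := R_AbsRing)).
      -- apply (ex_derive_continuous (fun u : R => / u ^ 2)). auto_derive. nra.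
      -- apply (continuous_of_lip _ M). intros u v. apply RInt_lip; auto.
  + assert (E : clamp 0 d x = 0) by (pose proof (clamp_bounds 0 d x); lra).
    apply continuous_eps. intros eps He.
    assert (Hd' : 0 < eps / (M + 1)) by (apply Rdiv_lt_0_compat; lra).
    exists (eps / (M + 1)). split; auto. intros y Hy.
    assert (E' : bvp_map a z (false, x) = 0) by (simpl; destruct Rlt_dec; [lra|reflexivity]).
    rewrite E', Rminus_0_r. eapply Rle_lt_trans; [apply G|].
    assert (L := clamp_lip 0 d y x). rewrite E, Rminus_0_r in L.
    pose proof (clamp_bounds 0 d y). rewrite Rabs_pos_eq in L by lra. specialize (L ltac:(lra)).
    assert (clamp 0 d y < eps / (M + 1)) by lra.
    apply Rle_lt_trans with ((M + 1) * clamp 0 d y); [nra|].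
    apply Rmult_lt_reg_r with (/ (M + 1)); [apply Rinv_0_lt_compat; lra|].
    replace ((M + 1) * clamp 0 d y * / (M + 1)) with (clamp 0 d y) by (field; lra). auto.
- intros x. specialize (G x). pose proof (clamp_bounds 0 d x). apply Rabs_le_between.
  eapply Rle_trans; [apply G|]. nra.
Qed.

Lemma RInt_minus_cont f g a b : (forall x, continuous f x) -> (forall x, continuous g x) ->
  RInt f a b - RInt g a b = RInt (fun s => f s - g s) a b.
Proof.
intros. symmetry. apply (RInt_minus (V := R_CompleteNormedModule)); apply ex_RInt_cont; auto.
Qed.

Lemma bvp_contract (z z' : bool * R -> R) a c : bvp_adm z -> bvp_adm z' ->
  (forall i, Rabs (z i - z' i) <= c) -> forall i, Rabs (bvp_map a z i - bvp_map a z' i) <= c / 2.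
Proof.
intros [H1 [H2 H3]] [H1' [H2' H3']] Hc.
assert (CA := tame_cont A _ _ HA H1 H2 H3). assert (CB := tame_cont B _ _ HB H1 H2 H3).
assert (CA' := tame_cont A _ _ HA H1' H2' H3'). assert (CB' := tame_cont B _ _ HB H1' H2' H3'). cbv beta in *.
assert (Hc0 : 0 <= c) by (eapply Rle_trans; [apply Rabs_pos|apply (Hc (true, 0))]).
assert (L : forall f, tame M f -> forall s, Rabs (f (clamp 0 d s) (z (true, s)) (z (false, s)) - f (clamp 0 d s) (z' (true, s)) (z' (false, s))) <= M * (2 * c)).
{ intros f [_ [Hf _]] s. eapply Rle_trans; [apply Hf; apply dom_clamp; auto|].
  apply Rmult_le_compat_l; auto. pose proof (Hc (true, s)). pose proof (Hc (false, s)). lra. }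
intros [b x]. pose proof (clamp_bounds 0 d x). destruct b.
- simpl. match goal with |- Rabs (a + ?p - (a + ?q)) <= _ => replace (a + p - (a + q)) with (p - q) by ring end.
  rewrite RInt_minus_cont by auto.
  eapply Rle_trans; [apply (RInt_bound _ _ _ (M * (2 * c)))|]; try lra.
  + intros y. apply (continuous_minus (V := R_NormedModule)); auto.
  + intros; apply (L A); auto.
  + assert (0 <= M * (2 * c)) by nra. nra.
- simpl. destruct Rlt_dec as [Hp|Hp]; [|rewrite Rminus_diag, Rabs_R0; lra].
  rewrite <- Rmult_minus_distr_l, RInt_minus_cont by (intros; apply continuous_sqclamp; auto).
  rewrite (RInt_ext _ (fun s => (clamp 0 d s) ^ 2 * (B (clamp 0 d s) (z (true, s)) (z (false, s)) - B (clamp 0 d s) (z' (true, s)) (z' (false, s))))) by (intros; simpl; ring).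
  eapply Rle_trans; [apply (avg_bound _ _ (M * (2 * c)))|]; try lra.
  + intros y. apply (continuous_minus (V := R_NormedModule)); auto.
  + intros; apply (L B); auto.
  + nra.
Qed.

Lemma bvp_exists a : exists th la, bvp_sol A B d a th la.
Proof.
pose (f0 := fun i : bool * R => if fst i then a else 0).
assert (A0 : bvp_adm f0).
{ split; [|split]; intros; unfold f0; simpl; try apply continuous_const. lra. }
destruct (contraction_fixpoint (bvp_map a) bvp_adm f0 (M * d + 1)) as [z [Hz E]]; auto.
- intros; apply bvp_map_adm; auto.
- destruct A0 as [H1 [H2 H3]].
  assert (CA := tame_cont A _ _ HA H1 H2 H3). cbv beta in CA.
  destruct (bvp_map_adm a f0 (conj H1 (conj H2 H3))) as [_ [_ K3]].
  intros [b x]. pose proof (clamp_bounds 0 d x). destruct b.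
  + change (f0 (true, x)) with a. simpl. match goal with |- Rabs (a + ?p - a) <= _ => replace (a + p - a) with (1 * p) by ring; rewrite Rmult_1_l end.
    eapply Rle_trans; [apply (RInt_bound _ _ _ M)|]; try lra; auto.
    * intros. apply tame_bound; auto. apply dom_clamp; auto.
    * nra.
  + specialize (K3 x). change (f0 (false, x)) with 0. apply Rabs_le. split; nra.
- intros; apply bvp_contract; auto.
- intros u f Hu Hl.
  assert (CB : forall b, (forall n (x : R), continuous (fun s : R => u n (b, s)) x) -> forall x : R, continuous (fun s : R => f (b, s)) x).
  { intros b Hb x. apply continuous_eps. intros eps He.
    destruct (Hl (eps / 4) ltac:(lra)) as [n Hn].
    destruct (proj1 (continuous_eps _ _) (Hb n x) (eps / 4) ltac:(lra)) as [e [He' H]].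
    exists e. split; auto. intros y Hy. specialize (H y Hy).
    assert (N1 := Hn (b, x)). assert (N2 := Hn (b, y)).
    apply Rabs_def2 in H. apply Rabs_le_between in N1. apply Rabs_le_between in N2. cbv beta in *. apply Rabs_def1; lra. }
  split; [|split].
  + apply CB. intros n. apply (proj1 (Hu n)).
  + apply CB. intros n. apply (proj1 (proj2 (Hu n))).
  + intros x. split; apply Rnot_lt_le; intros Hn;
    [destruct (Hl ((-1 - f (false, x)) / 2) ltac:(lra)) as [n Hn']|destruct (Hl ((f (false, x) - 1) / 2) ltac:(lra)) as [n Hn']];
    specialize (Hn' (false, x)); destruct (Hu n) as [_ [_ H]]; specialize (H x); apply Rabs_le_between in Hn'; lra.
- exists (fun s => z (true, s)), (fun s => z (false, s)).
  destruct Hz as [H1 [H2 H3]]. split; [|split; [|split; [|split; [|split]]]]; auto.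
  + intros x Hx. rewrite <- (E (true, x)) at 1. simpl. rewrite clamp_id by lra. reflexivity.
  + rewrite <- (E (false, 0)). simpl. rewrite clamp_id by lra. destruct Rlt_dec; [lra|reflexivity].
  + intros x Hx. rewrite <- (E (false, x)) at 1. unfold bvp_map. rewrite clamp_id by lra.
    destruct Rlt_dec; [|lra]. rewrite <- Rmult_assoc, Rinv_r, Rmult_1_l; auto.
    apply pow_nonzero; lra.
Qed.


(** The integral equations are linear in the integrands, so a combination of solutions is controlled
    by the same combination of right-hand sides. Coefficients (-1, 1, 0) give Lipschitz dependence
    on the end value, and 1/e' - 1/e, 1/e, -1/e' compare two difference quotients. *)
Lemma bvp_combo a0 a1 a2 t0 l0 t1 l1 t2 l2 c0 c1 c2 k :
  bvp_sol A B d a0 t0 l0 -> bvp_sol A B d a1 t1 l1 -> bvp_sol A B d a2 t2 l2 ->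
  (forall f s, f = A \/ f = B -> 0 <= s <= d ->
     Rabs (c0 * f s (t0 s) (l0 s) + c1 * f s (t1 s) (l1 s) + c2 * f s (t2 s) (l2 s)) <= k) ->
  forall x, 0 <= x <= d ->
    Rabs (c0 * t0 x + c1 * t1 x + c2 * t2 x - (c0 * a0 + c1 * a1 + c2 * a2)) <= k * d /\
    Rabs (c0 * l0 x + c1 * l1 x + c2 * l2 x) <= k * d.
Proof.
intros [C0 [D0 [B0 [E0 [Z0 F0]]]]] [C1 [D1 [B1 [E1 [Z1 F1]]]]] [C2 [D2 [B2 [E2 [Z2 F2]]]]] Hk x Hx.
assert (CA0 := tame_cont A _ _ HA C0 D0 B0). assert (CB0 := tame_cont B _ _ HB C0 D0 B0).
assert (CA1 := tame_cont A _ _ HA C1 D1 B1). assert (CB1 := tame_cont B _ _ HB C1 D1 B1).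
assert (CA2 := tame_cont A _ _ HA C2 D2 B2). assert (CB2 := tame_cont B _ _ HB C2 D2 B2). cbv beta in *.
assert (Hk0 : 0 <= k) by (eapply Rle_trans; [apply Rabs_pos|apply (Hk A 0); auto; lra]).
assert (comb : forall h0 h1 h2 u v, (forall s, continuous h0 s) -> (forall s, continuous h1 s) -> (forall s, continuous h2 s) ->
   (c0 * RInt h0 u v + c1 * RInt h1 u v + c2 * RInt h2 u v = RInt (fun s : R => c0 * h0 s + c1 * h1 s + c2 * h2 s) u v /\
   forall s : R, continuous (fun s : R => c0 * h0 s + c1 * h1 s + c2 * h2 s) s)).
{ intros h0 h1 h2 u v K0 K1 K2. split.
  - symmetry. apply is_RInt_unique.
    apply (is_RInt_plus (V := R_NormedModule)); [apply (is_RInt_plus (V := R_NormedModule))|];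
    apply (is_RInt_scal (V := R_NormedModule)), (RInt_correct (V := R_CompleteNormedModule)), ex_RInt_cont; auto.
  - intros s. apply (continuous_plus (V := R_NormedModule)); [apply (continuous_plus (V := R_NormedModule))|];
    apply (continuous_scal_r (V := R_NormedModule)); auto. }
split.
- rewrite E0, E1, E2 by lra.
  destruct (comb _ _ _ x d CA0 CA1 CA2) as [Ec Cc].
  match type of Ec with ?l = ?r => match goal with |- Rabs ?y <= _ => replace y with l by ring end end.
  rewrite Ec. eapply Rle_trans; [apply (RInt_bound _ _ _ k)|]; try lra; auto.
  + intros s Hs. rewrite clamp_id by lra. apply Hk; auto; lra.
  + nra.
- destruct (Req_dec x 0) as [->|Hn].
  { rewrite Z0, Z1, Z2. replace (c0 * 0 + c1 * 0 + c2 * 0) with 0 by ring. rewrite Rabs_R0. nra. }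
  assert (Hx' : 0 < x <= d) by lra.
  destruct (comb _ _ _ 0 x CB0 CB1 CB2) as [_ Cc].
  destruct (comb _ _ _ 0 x (fun s => continuous_sqclamp _ s CB0) (fun s => continuous_sqclamp _ s CB1) (fun s => continuous_sqclamp _ s CB2)) as [Ec _].
  assert (G := avg_bound _ x k Hx' Cc).
  replace (c0 * l0 x + c1 * l1 x + c2 * l2 x) with (/ x ^ 2 * (c0 * (x ^ 2 * l0 x) + c1 * (x ^ 2 * l1 x) + c2 * (x ^ 2 * l2 x))) by (field; auto).
  rewrite F0, F1, F2, Ec by auto.
  rewrite (RInt_ext _ (fun s => (clamp 0 d s) ^ 2 * (c0 * B (clamp 0 d s) (t0 s) (l0 s) + c1 * B (clamp 0 d s) (t1 s) (l1 s) + c2 * B (clamp 0 d s) (t2 s) (l2 s)))) by (intros; simpl; ring).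
  apply G. intros s Hs. rewrite clamp_id by lra. apply Hk; auto; lra.
Qed.

Lemma tame_lip f s th la th' la' : tame M f -> dom s la -> dom s la' ->
  Rabs (f s th' la' - f s th la) <= M * (Rabs (th' - th) + Rabs (la' - la)).
Proof. intros [_ [H _]]; auto. Qed.

Lemma bvp_lip a t l a' t' l' : bvp_sol A B d a t l -> bvp_sol A B d a' t' l' ->
  forall x, 0 <= x <= d -> Rabs (t' x - t x) <= 2 * Rabs (a' - a) /\ Rabs (l' x - l x) <= 2 * Rabs (a' - a).
Proof.
intros H H'.
assert (G : forall (i : bool * R), (if fst i then Rabs (t' (clamp 0 d (snd i)) - t (clamp 0 d (snd i))) else
   Rabs (l' (clamp 0 d (snd i)) - l (clamp 0 d (snd i)))) <= 2 * Rabs (a' - a)).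
{ assert (step : forall k, (forall f s, f = A \/ f = B -> 0 <= s <= d -> Rabs (f s (t' s) (l' s) - f s (t s) (l s)) <= k) ->
   forall (i : bool * R), (if fst i then Rabs (t' (clamp 0 d (snd i)) - t (clamp 0 d (snd i))) else
   Rabs (l' (clamp 0 d (snd i)) - l (clamp 0 d (snd i)))) <= Rabs (a' - a) + k * d).
  { intros k Hk [b x]. simpl. assert (Hc := clamp_bounds 0 d x ltac:(lra)). set (c := clamp 0 d x) in *.

    destruct (bvp_combo a a' a t l t' l' t l (-1) 1 0 k H H' H) with (x := c) as [G1 G2]; auto.
    { intros f s Hf Hs. specialize (Hk f s Hf Hs).
      match goal with |- Rabs ?y <= _ => replace y with (f s (t' s) (l' s) - f s (t s) (l s)) by ring end. auto. }
    pose proof (Rabs_pos (a' - a)). destruct b.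
    - replace (t' c - t c) with ((a' - a) + (-1 * t c + 1 * t' c + 0 * t c - (-1 * a + 1 * a' + 0 * a))) by ring.
      eapply Rle_trans; [apply Rabs_triang|]. lra.
    - replace (l' c - l c) with (-1 * l c + 1 * l' c + 0 * l c) by ring. nra. }
  assert (bl : forall s, -1 <= l s <= 1) by apply H. assert (bl' : forall s, -1 <= l' s <= 1) by apply H'.
  assert (dm : forall s, 0 <= s <= d -> dom s (l s) /\ dom s (l' s)).
  { intros s Hs. specialize (bl s). specialize (bl' s). unfold dom. split; split; lra. }
  apply (halving_bound _ (Rabs (a' - a)) (Rabs (a' - a) + 2 * M * d)).
  - apply Rabs_pos.
  - pose proof (Rabs_pos (a' - a)). nra.
  - apply step. intros f s Hf Hs. destruct (dm s Hs).
    assert (tame M f) by (destruct Hf; subst; auto).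
    unfold Rminus. eapply Rle_trans; [apply Rabs_triang|]. rewrite Rabs_Ropp.
    assert (P1 := tame_bound f H2 s (t s) (l s) H0). assert (P2 := tame_bound f H2 s (t' s) (l' s) H1). lra.
  - intros c Hc0 Hc i. eapply Rle_trans; [apply (step (M * (2 * c)))|nra].
    intros f s Hf Hs. destruct (dm s Hs).
    assert (tame M f) by (destruct Hf; subst; auto).
    eapply Rle_trans; [apply tame_lip; auto|]. apply Rmult_le_compat_l; auto.
    assert (P1 := Hc (true, s)). assert (P2 := Hc (false, s)). simpl in P1, P2. rewrite clamp_id in P1, P2 by lra. lra. }
intros x Hx. assert (P1 := G (true, x)). assert (P2 := G (false, x)). simpl in P1, P2. rewrite clamp_id in P1, P2 by lra. auto.
Qed.

(** Both difference quotients solve the same linearised integral equations, up to second-order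
    remainders that are of size |e| or |e'| after division. Hence their difference reproduces itself
    with a factor below 1/2, and the quotients form a Cauchy family: differentiability in a is
    obtained without introducing the variational equation. *)
Lemma bvp_diff a t l e t1 l1 e' t2 l2 : e <> 0 -> e' <> 0 ->
  bvp_sol A B d a t l -> bvp_sol A B d (a + e) t1 l1 -> bvp_sol A B d (a + e') t2 l2 ->
  forall x, 0 <= x <= d ->
  Rabs ((l1 x - l x) / e - (l2 x - l x) / e') <= 2 * (Rabs e + Rabs e').
Proof.
intros He He' H H1 H2.
pose (q := fun (f f1 f2 : R -> R) x => (f1 x - f x) / e - (f2 x - f x) / e').
assert (bl : forall s, -1 <= l s <= 1) by apply H. assert (bl1 : forall s, -1 <= l1 s <= 1) by apply H1.
assert (bl2 : forall s, -1 <= l2 s <= 1) by apply H2.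
assert (dm : forall s, 0 <= s <= d -> dom s (l s) /\ dom s (l1 s) /\ dom s (l2 s)).
{ intros s Hs. specialize (bl s). specialize (bl1 s). specialize (bl2 s). unfold dom. repeat split; lra. }
assert (L1 := bvp_lip _ _ _ _ _ _ H H1). assert (L2 := bvp_lip _ _ _ _ _ _ H H2).
replace (a + e - a) with e in L1 by ring. replace (a + e' - a) with e' in L2 by ring.
assert (Pe := Rabs_pos_lt _ He). assert (Pe' := Rabs_pos_lt _ He').
assert (quo : forall x c, c <> 0 -> Rabs x <= 2 * Rabs c -> Rabs (x / c) <= 2).
{ intros x c Hc Hx. unfold Rdiv. rewrite Rabs_mult, Rabs_inv. assert (P := Rabs_pos_lt _ Hc).
  apply Rmult_le_reg_r with (Rabs c); auto. rewrite Rmult_assoc, Rinv_l by lra. lra. }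
assert (G : forall (i : bool * R), (if fst i then Rabs (q t t1 t2 (clamp 0 d (snd i))) else
   Rabs (q l l1 l2 (clamp 0 d (snd i)))) <= 2 * (Rabs e + Rabs e')).
{ apply (halving_bound _ _ 4); try lra.
  - intros [b x]. assert (Hc := clamp_bounds 0 d x ltac:(lra)).
    destruct (L1 _ Hc) as [X1 X2]. destruct (L2 _ Hc) as [Y1 Y2].
    destruct b; simpl; unfold q; unfold Rminus at 1; (eapply Rle_trans; [apply Rabs_triang|]); rewrite Rabs_Ropp;
    [apply quo in X1; auto; apply quo in Y1; auto; lra|apply quo in X2; auto; apply quo in Y2; auto; lra].
  - intros c Hc0 Hc [b x]. assert (Hcl := clamp_bounds 0 d x ltac:(lra)). simpl. set (xx := clamp 0 d x) in *.
    destruct (bvp_combo a (a + e) (a + e') t l t1 l1 t2 l2 (/ e' - / e) (/ e) (- / e') (M * (2 * c + 16 * (Rabs e + Rabs e'))) H H1 H2)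
      with (x := xx) as [G1 G2]; auto.
    + intros f s Hf Hs. destruct (dm s Hs) as [D0 [D1 D2]].
      assert (Hft : tame M f) by (destruct Hf; subst; auto).
      destruct Hft as [_ [_ [[ft [fl Hf2]] _]]]. destruct (Hf2 s (t s) (l s) D0) as [F1 [F2 F3]].
      assert (R1 := F3 (t1 s) (l1 s) D1). assert (R2 := F3 (t2 s) (l2 s) D2).
      destruct (L1 s Hs) as [X1 X2]. destruct (L2 s Hs) as [Y1 Y2].
      assert (P1 := Hc (true, s)). assert (P2 := Hc (false, s)). simpl in P1, P2. rewrite clamp_id in P1, P2 by lra.
      set (r1 := f s (t1 s) (l1 s) - f s (t s) (l s) - (ft s (t s) (l s) * (t1 s - t s) + fl s (t s) (l s) * (l1 s - l s))) in *.
      set (r2 := f s (t2 s) (l2 s) - f s (t s) (l s) - (ft s (t s) (l s) * (t2 s - t s) + fl s (t s) (l s) * (l2 s - l s))) in *.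
      assert (Q : forall r (u v : R) e, e <> 0 -> Rabs r <= M * (Rabs u + Rabs v) ^ 2 -> Rabs u <= 2 * Rabs e -> Rabs v <= 2 * Rabs e ->
        Rabs (r / e) <= M * (16 * Rabs e)).
      { clear -HM. intros r u v e He Hr Hu Hv. assert (P := Rabs_pos_lt _ He). unfold Rdiv. rewrite Rabs_mult, Rabs_inv.
        apply Rmult_le_reg_r with (Rabs e); auto. rewrite Rmult_assoc, Rinv_l, Rmult_1_r by lra.
        eapply Rle_trans; [apply Hr|]. rewrite !Rmult_assoc. apply Rmult_le_compat_l; auto.
        pose proof (Rabs_pos u). pose proof (Rabs_pos v).
        replace (16 * (Rabs e * Rabs e)) with ((4 * Rabs e) ^ 2) by ring. apply pow_incr. lra. }
      apply (Q _ _ _ e He R1 X1) in X2. apply (Q _ _ _ e' He' R2 Y1) in Y2.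
      replace ((/ e' - / e) * f s (t s) (l s) + / e * f s (t1 s) (l1 s) + - / e' * f s (t2 s) (l2 s)) with
       ((ft s (t s) (l s) * q t t1 t2 s + fl s (t s) (l s) * q l l1 l2 s) + (r1 / e + - (r2 / e')))
       by (unfold q, r1, r2; field; auto).
      eapply Rle_trans; [apply Rabs_triang|].
      assert (T1 := Rabs_triang (ft s (t s) (l s) * q t t1 t2 s) (fl s (t s) (l s) * q l l1 l2 s)).
      assert (T2 := Rabs_triang (r1 / e) (- (r2 / e'))). rewrite Rabs_Ropp in T2. rewrite !Rabs_mult in T1.
      assert (Rabs (ft s (t s) (l s)) * Rabs (q t t1 t2 s) <= M * c) by (apply Rmult_le_compat; auto; apply Rabs_pos).
      assert (Rabs (fl s (t s) (l s)) * Rabs (q l l1 l2 s) <= M * c) by (apply Rmult_le_compat; auto; apply Rabs_pos).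
      lra.
    + replace ((/ e' - / e) * a + / e * (a + e) + - / e' * (a + e')) with 0 in G1 by (field; auto).
      rewrite Rminus_0_r in G1.
      (* The remainder terms carry the factor 16 = 4^2, since each of the two increments is at most
         twice the change of the end value. Here the condition 16 M d <= 1 is used at full
         strength. *)
      assert (M * (2 * c + 16 * (Rabs e + Rabs e')) * d <= Rabs e + Rabs e' + c / 2) by nra.
      destruct b; (eapply Rle_trans; [|eassumption]).
      * replace (q t t1 t2 xx) with ((/ e' - / e) * t xx + / e * t1 xx + - / e' * t2 xx) by (unfold q; field; auto). auto.
      * replace (q l l1 l2 xx) with ((/ e' - / e) * l xx + / e * l1 xx + - / e' * l2 xx) by (unfold q; field; auto). auto. }
intros x Hx. assert (P2 := G (false, x)). simpl in P2. rewrite clamp_id in P2 by lra. exact P2.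
Qed.

End Bvp.

(** The squared distance to Jupiter in polar coordinates around the Sun. [Upot] below is the
    disturbing function: the direct attraction of Jupiter together with the indirect term due to the
    acceleration of the Sun; [Ur] and [Uth] are its partial derivatives. *)
Definition Dq (r th : R) : R := 1 - 2 * r * cos th + r ^ 2.
Definition Upot (mu r th : R) : R := mu * (/ sqrt (Dq r th) - r * cos th).
Definition Ur (mu r th : R) : R := mu * ((cos th - r) / sqrt (Dq r th) ^ 3 - cos th).
Definition Uth (mu r th : R) : R := mu * r * sin th * (1 - / sqrt (Dq r th) ^ 3).

(* On a collision orbit r decreases to 0, so s = sqrt r can be the independent variable; with la = L / s^2 the equations of motion
   become dth/ds = -Avel and d(s^2 la)/ds = s^2 Bvel, both regular at s = 0. Here Ssq = s^2 (dr/dt)^2 is read off the Jacobi integral. *)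
Definition Ssq (p : R * R) (s th la : R) : R :=
  2 * (1 - fst p) + 2 * s ^ 2 * (snd p + s ^ 2 * la + Upot (fst p) (s ^ 2) th) - s ^ 2 * la ^ 2.
Definition Avel (p : R * R) (s th la : R) : R := 2 * (la - s ^ 2) / sqrt (Ssq p s th la).
(** The torque term with the factor mu removed. Uniform bounds on [Bred], rather than on [Bvel]
    alone, are what makes the collision curve and its slope O(mu). *)
Definition Bred (p : R * R) (s th la : R) : R :=
  -2 * (s ^ 2 * sin th * (1 - / sqrt (Dq (s ^ 2) th) ^ 3)) / sqrt (Ssq p s th la).
Definition Bvel (p : R * R) (s th la : R) : R := fst p * Bred p s th la.

Lemma Dq_lower r th : 0 <= r -> (1 - r) ^ 2 <= Dq r th.
Proof. intros H. unfold Dq. pose proof (COS_bound th). nra. Qed.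

Lemma Dq_range r th : 0 <= r <= 1 / 4 -> 1 / 4 <= Dq r th <= 4.
Proof. intros H.  unfold Dq in *. pose proof (COS_bound th). split; nra. Qed.

Lemma Upot_small mu r th : 0 <= mu -> 0 <= r <= 1 / 4 -> Rabs (Upot mu r th) <= 3 * mu.
Proof.
intros Hm Hr. assert (B := rsqrt_bounds _ (Dq_range r th Hr)). pose proof (COS_bound th).
assert (/ sqrt (Dq r th) <= / (1 / 2)) by (apply Rinv_le_contravar; lra).
assert (0 < / sqrt (Dq r th)) by (apply Rinv_0_lt_compat; lra).
unfold Upot. rewrite Rabs_mult, (Rabs_pos_eq mu) by auto. rewrite (Rmult_comm 3).
apply Rmult_le_compat_l; auto. apply Rabs_le. nra.
Qed.

Lemma sq_range s : 0 <= s <= 1 / 2 -> 0 <= s ^ 2 <= 1 / 4.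
Proof. intros; nra. Qed.

Lemma Ssq_range p s th la : valid p -> dom s la -> 1 <= Ssq p s th la <= 3.
Proof.
intros [H1 H2] [H3 H4]. assert (H5 := sq_range s H3).
assert (H6 := Upot_small (fst p) (s ^ 2) th ltac:(lra) H5). apply Rabs_le_between in H6.
unfold Ssq. set (u := Upot _ _ _) in *. set (q := s ^ 2) in *.
assert (0 <= q * la ^ 2 <= 1 / 4) by nra.

assert (-1/4 * (3/4) <= q * (snd p + q * la + u) <= 1/4 * (3/4)).
{  split; nra. }
lra.
Qed.

Lemma utame_Dq : utame (fun _ s th _ => Dq (s ^ 2) th).
Proof.
apply (utame_ext (fun _ s th _ => (1 - (2 * s ^ 2) * cos th) + (s ^ 2) ^ 2)); [intros; unfold Dq; ring|].
assert (Hc : forall c, utame (fun _ _ _ _ => c)) by (intros c; apply (utame_cst (fun _ => c) (Rabs c)); intros; lra).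
apply utame_plus; [|repeat apply utame_pow; apply utame_s].
apply utame_minus; [apply Hc|]. apply utame_mult; [|apply utame_cos].
apply utame_mult; [apply Hc|apply utame_pow, utame_s].
Qed.

Lemma utame_rD : utame (fun _ s th _ => / sqrt (Dq (s ^ 2) th)).
Proof.
apply (utame_rsqrt (fun _ s th _ => Dq (s ^ 2) th)); [apply utame_Dq|].
intros p s th la _ [H _]. apply Dq_range, sq_range; auto.
Qed.

Lemma utame_rS : utame (fun p s th la => / sqrt (Ssq p s th la)).
Proof.
assert (Hc : forall c, utame (fun _ _ _ _ => c)) by (intros c; apply (utame_cst (fun _ => c) (Rabs c)); intros; lra).
assert (Hm : utame (fun p _ _ _ => fst p)) by (apply (utame_cst (fun p => fst p) 1); intros p [H _]; rewrite Rabs_pos_eq; lra).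
assert (He : utame (fun p _ _ _ => snd p)) by (apply (utame_cst (fun p => snd p) 1); intros p [_ H]; apply Rabs_le; lra).
assert (Hs := utame_pow _ 2 utame_s). assert (Hl := utame_la). assert (Hl2 := utame_pow _ 2 utame_la). cbv beta in *.
apply (utame_rsqrt Ssq).
- unfold Ssq, Upot. apply utame_minus; [|apply utame_mult; auto].
  apply utame_plus; [apply utame_mult; [apply Hc|apply utame_minus; auto]|].
  apply utame_mult; [apply utame_mult; auto|].
  apply utame_plus; [apply utame_plus; auto; apply utame_mult; auto|].
  apply utame_mult; auto. apply utame_minus; [apply utame_rD|]. apply utame_mult; auto. apply utame_cos.
- intros p s th la Hp Hd. pose proof (Ssq_range p s th la Hp Hd). lra.
Qed.

Lemma utame_Avel : utame Avel.
Proof.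
unfold Avel. apply utame_mult; [|apply utame_rS].
apply utame_mult; [apply (utame_cst (fun _ => 2) 2); intros; rewrite Rabs_pos_eq; lra|].
apply utame_minus; [apply utame_la|apply utame_pow, utame_s].
Qed.

Lemma utame_Bred : utame Bred.
Proof.
unfold Bred. apply utame_mult; [|apply utame_rS].
apply utame_mult; [apply (utame_cst (fun _ => -2) 2); intros; rewrite Rabs_left; lra|].
apply utame_mult; [apply utame_mult; [apply utame_pow, utame_s|apply utame_sin]|].
apply utame_minus; [apply (utame_cst (fun _ => 1) 1); intros; rewrite Rabs_pos_eq; lra|].
apply (utame_ext (fun _ s th _ => (/ sqrt (Dq (s ^ 2) th)) ^ 3)); [intros; rewrite pow_inv; auto|].
apply utame_pow, utame_rD.
Qed.

Lemma tame_mono M M' f : M <= M' -> tame M f -> tame M' f.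
Proof.
intros HM [f0 [f1 [[ft [fl f2]] f3]]].
assert (Hn : forall x y z w, 0 <= Rabs (x - y) + Rabs (z - w)) by (intros; apply Rplus_le_le_0_compat; apply Rabs_pos).
repeat split; auto.
- intros. eapply Rle_trans; [apply f0|]; auto.
- intros. eapply Rle_trans; [apply f1|]; auto. apply Rmult_le_compat_r; auto.
- exists ft, fl. intros. destruct (f2 s th la H) as [A [B C]]. repeat split; try lra.
  intros. eapply Rle_trans; [apply C|]; auto. apply Rmult_le_compat_r; auto. apply pow2_ge_0.
Qed.

Lemma uniform_tame : exists M, 1 <= M /\ forall p, valid p ->
  tame M (Avel p) /\ tame M (Bred p) /\ tame M (Bvel p).
Proof.
destruct utame_Avel as [M1 [H1 T1]]. destruct utame_Bred as [M2 [H2 T2]].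
assert (HB : utame Bvel).
{ unfold Bvel. apply utame_mult; [|exact utame_Bred].
  apply (utame_cst (fun p => fst p) 1). intros p [H _]. rewrite Rabs_pos_eq; lra. }
destruct HB as [M3 [H3 T3]].
exists (1 + M1 + M2 + M3). split; [lra|]. intros p Hp.
split; [|split]; [apply (tame_mono M1)|apply (tame_mono M2)|apply (tame_mono M3)]; auto; lra.
Qed.

(** The quotients are Cauchy as the increment tends to 0. The limit is taken along the increments 1
    / (n + 1) and then compared with all others. *)
Lemma ex_derive_of_quotients (f : R -> R) (a C : R) :
  (forall e e', e <> 0 -> e' <> 0 ->
     Rabs ((f (a + e) - f a) / e - (f (a + e') - f a) / e') <= C * (Rabs e + Rabs e')) ->
  ex_derive f a.
Proof.
intros H.
pose (u := fun n : nat => (f (a + / (INR n + 1)) - f a) / / (INR n + 1)).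
assert (Hpos : forall n, 0 < / (INR n + 1)) by (intros n; apply Rinv_0_lt_compat; pose proof (pos_INR n); lra).
assert (HC : 0 <= C).
{ specialize (H 1 1 ltac:(lra) ltac:(lra)). rewrite Rminus_diag, Rabs_R0, Rabs_R1 in H. lra. }
assert (Hz : forall eps, 0 < eps -> exists N, forall n, (N <= n)%nat -> / (INR n + 1) < eps).
{ intros eps He. assert (L : is_lim_seq (fun n => / (INR n + 1)) 0).
  { apply (is_lim_seq_ext (fun n => / INR (S n))); [intros; rewrite S_INR; auto|].
    apply -> (is_lim_seq_incr_1 (fun n => / INR n)).
    apply (is_lim_seq_inv _ p_infty); [apply is_lim_seq_INR|discriminate]. }
  apply is_lim_seq_spec in L. destruct (L (mkposreal eps He)) as [N HN]. exists N. intros n Hn.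
  specialize (HN n Hn). simpl in HN. rewrite Rminus_0_r, Rabs_pos_eq in HN; auto. left; auto. }
assert (Hcv : ex_finite_lim_seq u).
{ apply ex_lim_seq_cauchy_corr. intros eps.
  destruct (Hz (eps / (2 * (C + 1)))) as [N HN]; [apply Rdiv_lt_0_compat; [apply cond_pos|lra]|].
  exists N. intros n m Hn Hm. unfold u.
  assert (Pn := Hpos n). assert (Pm := Hpos m). assert (Ln := HN n Hn). assert (Lm := HN m Hm).
  assert (HH := H (/ (INR n + 1)) (/ (INR m + 1)) ltac:(lra) ltac:(lra)).
  rewrite (Rabs_pos_eq (/ (INR n + 1))), (Rabs_pos_eq (/ (INR m + 1))) in HH by lra.
  eapply Rle_lt_trans; [apply HH|].
   set (ee := eps / (2 * (C + 1))) in *.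
  replace (pos eps) with ((C + 1) * (ee + ee)) by (unfold ee; field; lra). nra. }
destruct Hcv as [l Hl]. exists l.
assert (Hq : forall e, e <> 0 -> Rabs ((f (a + e) - f a) / e - l) <= C * Rabs e).
{ intros e He.
  assert (L1 : is_lim_seq (fun n => Rabs ((f (a + e) - f a) / e - u n)) (Rabs ((f (a + e) - f a) / e - l))).
  { apply (is_lim_seq_abs _ (Finite _)). apply is_lim_seq_minus'; auto. apply is_lim_seq_const. }
  assert (L2 : is_lim_seq (fun n => C * (Rabs e + / (INR n + 1))) (C * (Rabs e + 0))).
  { apply (is_lim_seq_scal_l _ C (Finite _)). apply is_lim_seq_plus'; [apply is_lim_seq_const|].
    apply is_lim_seq_spec. intros eps. destruct (Hz eps (cond_pos eps)) as [N HN]. exists N.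
    intros n Hn. rewrite Rminus_0_r, Rabs_pos_eq; auto. left; auto. }
  rewrite Rplus_0_r in L2.
  refine (is_lim_seq_le _ _ _ _ _ L1 L2). intros n. unfold u.
  assert (Pn := Hpos n). assert (HH := H e (/ (INR n + 1)) He ltac:(lra)).
  rewrite (Rabs_pos_eq (/ _)) in HH by lra. exact HH. }
apply is_derive_Reals. intros eps He.
assert (Hd : 0 < eps / (C + 1)) by (apply Rdiv_lt_0_compat; lra).
exists (mkposreal _ Hd). intros e He0 Hlt. simpl in Hlt.
eapply Rle_lt_trans; [apply Hq; auto|].
pose proof (Rabs_pos_lt _ He0).
apply Rle_lt_trans with ((C + 1) * Rabs e); [nra|].
apply Rmult_lt_reg_r with (/ (C + 1)); [apply Rinv_0_lt_compat; lra|].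
replace ((C + 1) * Rabs e * / (C + 1)) with (Rabs e) by (field; lra). exact Hlt.
Qed.

Lemma derive_le_of_lip (f : R -> R) (a k : R) :
  ex_derive f a -> (forall x, Rabs (f x - f a) <= k * Rabs (x - a)) -> Rabs (Derive f a) <= k.
Proof.
intros [l Hl] H. rewrite (is_derive_unique _ _ _ Hl).
apply le_epsilon. intros eps He.
apply is_derive_Reals in Hl. destruct (Hl eps He) as [d Hd].
assert (Hp := cond_pos d). specialize (Hd (d / 2) ltac:(lra)).
rewrite Rabs_pos_eq in Hd by lra. specialize (Hd ltac:(lra)).
specialize (H (a + d / 2)). replace (a + d / 2 - a) with (d / 2) in H by ring.
rewrite (Rabs_pos_eq (d / 2)) in H by lra.
assert (Rabs ((f (a + d / 2) - f a) / (d / 2)) <= k).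
{ unfold Rdiv at 1. rewrite Rabs_mult, (Rabs_pos_eq (/ _)) by (left; apply Rinv_0_lt_compat; lra).
  apply Rmult_le_reg_r with (d / 2); [lra|]. rewrite Rmult_assoc, Rinv_l, Rmult_1_r by lra. exact H. }
replace l with ((f (a + d / 2) - f a) / (d / 2) - ((f (a + d / 2) - f a) / (d / 2) - l)) by ring.
unfold Rminus at 1. eapply Rle_trans; [apply Rabs_triang|]. rewrite Rabs_Ropp. lra.
Qed.

(** [TH a] and [LA a] solve the two-point problem with angle a at s = d, so d^2 times [LA a d] is
    the angular momentum, at r = d^2, of the collision orbit through the angle a. *)
Definition collision_family (M mu eta d : R) (TH LA : R -> R -> R) : Prop :=
  (forall a, bvp_sol (Avel (mu, eta)) (Bvel (mu, eta)) d a (TH a) (LA a)) /\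
  (forall a, Rabs (LA a d) <= mu * M) /\
  (forall a, ex_derive (fun x => LA x d) a) /\
  (forall a, Rabs (Derive (fun x => LA x d) a) <= 4 * mu * M).

Lemma collision_family_exists M mu eta d :
  (forall p, valid p -> tame M (Avel p) /\ tame M (Bred p) /\ tame M (Bvel p)) -> 1 <= M ->
  0 < mu <= 1 / 8 -> - 1 / 8 <= eta <= 1 / 8 -> 0 < d <= 1 / 2 -> 16 * M * d <= 1 ->
  exists TH LA, collision_family M mu eta d TH LA.
Proof.
intros HT HM Hmu He Hd HMd.
assert (Hv : valid (mu, eta)) by (unfold valid; simpl; lra).
destruct (HT _ Hv) as [TA [TB TB']].
assert (Hex : forall a, exists z : (R -> R) * (R -> R), bvp_sol (Avel (mu, eta)) (Bvel (mu, eta)) d a (fst z) (snd z)).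
{ intros a. destruct (bvp_exists _ _ M d TA TB' Hd ltac:(lra) HMd a) as [t [l H]]. exists (t, l). exact H. }
pose (Z := fun a => proj1_sig (constructive_indefinite_description _ (Hex a))).
assert (HZ : forall a, bvp_sol (Avel (mu, eta)) (Bvel (mu, eta)) d a (fst (Z a)) (snd (Z a))).
{ intros a. unfold Z. apply proj2_sig. }
exists (fun a => fst (Z a)), (fun a => snd (Z a)).
assert (dm : forall a s, 0 <= s <= d -> dom s (snd (Z a) s)).
{ intros a s Hs. destruct (HZ a) as [_ [_ [H _]]]. split; [lra|]. apply H. }
(* The factor mu comes out of [Bvel], and the Lipschitz constant of [Bred] is combined with the
   Lipschitz dependence of the whole solution on a. *)
assert (Lp : forall a a', Rabs (snd (Z a') d - snd (Z a) d) <= 4 * mu * M * Rabs (a' - a)).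
{ intros a a'. destruct (HZ a) as [C0 [D0 [B0 [E0 [Z0 F0]]]]]. destruct (HZ a') as [C1 [D1 [B1 [E1 [Z1 F1]]]]].
  assert (CB0 := tame_cont M d ltac:(lra) _ _ _ TB' C0 D0 B0). assert (CB1 := tame_cont M d ltac:(lra) _ _ _ TB' C1 D1 B1).
  cbv beta in *.
  assert (E : snd (Z a') d - snd (Z a) d = / d ^ 2 * (RInt (fun s : R => clamp 0 d s ^ 2 * (Bvel (mu, eta) (clamp 0 d s) (fst (Z a') s) (snd (Z a') s) - Bvel (mu, eta) (clamp 0 d s) (fst (Z a) s) (snd (Z a) s))) 0 d)).
  { assert (Hd2 : d ^ 2 <> 0) by (apply pow_nonzero; lra).
    apply Rmult_eq_reg_l with (d ^ 2); auto. rewrite <- Rmult_assoc, Rinv_r, Rmult_1_l by auto.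
    rewrite Rmult_minus_distr_l, F0, F1 by lra.
    rewrite RInt_minus_cont by (intros; apply (continuous_sqclamp d); auto).
    apply RInt_ext. intros. simpl. ring. }
  rewrite E. eapply Rle_trans.
  - apply (avg_bound d _ d (mu * (M * (4 * Rabs (a' - a))))); try lra.
    + intros s. apply (continuous_minus (V := R_NormedModule)); auto.
    + intros s Hs. rewrite clamp_id by lra. unfold Bvel. simpl fst.
      rewrite <- Rmult_minus_distr_l, Rabs_mult, Rabs_pos_eq by lra. apply Rmult_le_compat_l; [lra|].
      eapply Rle_trans; [apply (tame_lip _ _ _ _ _ _ _ TB); auto|]. apply Rmult_le_compat_l; [lra|].
      destruct (bvp_lip _ _ M d TA TB' Hd ltac:(lra) HMd _ _ _ _ _ _ (HZ a) (HZ a') s Hs). lra.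
  - assert (Q1 : 0 <= mu * (M * (4 * Rabs (a' - a)))) by (repeat apply Rmult_le_pos; try lra; apply Rabs_pos).
    nra. }
assert (Ed : forall a, ex_derive (fun x => snd (Z x) d) a).
{ intros a. apply (ex_derive_of_quotients _ _ 2). intros e e' He0 He0'.
  apply (bvp_diff _ _ M d TA TB' Hd ltac:(lra) HMd a _ _ e _ _ e' _ _ He0 He0' (HZ a) (HZ (a + e)) (HZ (a + e'))). lra. }
split; [exact HZ|]. split; [|split; [exact Ed|]].
- intros a. destruct (HZ a) as [C0 [D0 [B0 [E0 [Z0 F0]]]]].
  assert (CB0 := tame_cont M d ltac:(lra) _ _ _ TB' C0 D0 B0). cbv beta in *.
  assert (E : snd (Z a) d = / d ^ 2 * (RInt (fun s : R => clamp 0 d s ^ 2 * (Bvel (mu, eta) (clamp 0 d s) (fst (Z a) s) (snd (Z a) s))) 0 d)).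
  { assert (Hd2 : d ^ 2 <> 0) by (apply pow_nonzero; lra).
    apply Rmult_eq_reg_l with (d ^ 2); auto. rewrite <- Rmult_assoc, Rinv_r, Rmult_1_l by auto. apply F0; lra. }
  rewrite E. eapply Rle_trans.
  + apply (avg_bound d _ d (mu * M)); try lra; auto.
    intros s Hs. rewrite clamp_id by lra. unfold Bvel. simpl fst. rewrite Rabs_mult, Rabs_pos_eq by lra.
    apply Rmult_le_compat_l; [lra|]. apply (tame_bound M _ TB). auto.
  +  nra.
- intros a. apply (derive_le_of_lip (fun x => snd (Z x) d)); auto.
Qed.

(** * Heliocentric polar coordinates *)

(* w and L are the radial velocity and the angular momentum of the motion relative to the Sun; since the Sun itself moves, they differ
   from the canonical momenta: Rbar = w - mu sin th and Theta = L - mu r cos th. *)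
Definition polar_at (mu : R) (r th w L : R -> R) (t : R) : Prop :=
  0 < r t /\ 0 < Dq (r t) (th t) /\
  is_derive r t (w t) /\ is_derive th t (L t / (r t) ^ 2 - 1) /\
  is_derive w t ((L t) ^ 2 / (r t) ^ 3 - (1 - mu) / (r t) ^ 2 + Ur mu (r t) (th t)) /\
  is_derive L t (Uth mu (r t) (th t)).

(** The Jacobi integral in terms of velocities relative to the Sun. It exceeds [Hbar] by the
    constant mu^2 / 2 coming from the motion of the Sun; this is the origin of
    [eta = h + mu ^ 2 / 2] throughout. *)
Definition Jac (mu r th w L : R) : R :=
  w ^ 2 / 2 + L ^ 2 / (2 * r ^ 2) - (1 - mu) / r - L - Upot mu r th.

Definition cQ1 (mu r th : R) : R := - mu + r * cos th.
Definition cQ2 (r th : R) : R := r * sin th.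
Definition cP1 (r th w L : R) : R := w * cos th - L / r * sin th.
Definition cP2 (mu r th w L : R) : R := w * sin th + L / r * cos th - mu.

Lemma sc1 x : sin x * sin x + cos x * cos x = 1.
Proof. pose proof (sin2_cos2 x). unfold Rsqr in *. auto. Qed.

Lemma dSun_polar mu r th : 0 <= r -> dSun mu (cQ1 mu r th) (cQ2 r th) = r.
Proof.
intros Hr. unfold dSun, cQ1, cQ2. rewrite <- (sqrt_square r) at 3 by auto. f_equal.
pose proof (sc1 th). nra.
Qed.

Lemma dJup_polar mu r th : dJup mu (cQ1 mu r th) (cQ2 r th) = sqrt (Dq r th).
Proof.
unfold dJup, cQ1, cQ2, Dq. f_equal. pose proof (sc1 th). nra.
Qed.

Lemma polar_to_cart mu r th w L (D : R -> Prop) :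
  (forall t, D t -> polar_at mu r th w L t) ->
  is_orbit mu (fun t => cQ1 mu (r t) (th t)) (fun t => cQ2 (r t) (th t))
    (fun t => cP1 (r t) (th t) (w t) (L t)) (fun t => cP2 mu (r t) (th t) (w t) (L t)) D.
Proof.
intros H t Ht. destruct (H t Ht) as [Hr [HD [H1 [H2 [H3 H4]]]]].
rewrite dSun_polar, dJup_polar by lra.
assert (HsD := sqrt_lt_R0 _ HD).
assert (E1 : Derive (fun x => r x) t = w t) by (apply is_derive_unique; auto).
assert (E2 : Derive (fun x => th x) t = L t / (r t) ^ 2 - 1) by (apply is_derive_unique; auto).
assert (E3 := is_derive_unique _ _ _ H3). assert (E4 := is_derive_unique _ _ _ H4).
change (Derive (fun x => w x) t = (L t) ^ 2 / (r t) ^ 3 - (1 - mu) / (r t) ^ 2 + Ur mu (r t) (th t)) in E3.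
change (Derive (fun x => L x) t = Uth mu (r t) (th t)) in E4.
assert (X1 : ex_derive r t) by (eexists; eauto). assert (X2 : ex_derive th t) by (eexists; eauto).
assert (X3 : ex_derive w t) by (eexists; eauto). assert (X4 : ex_derive L t) by (eexists; eauto).
assert (SC := sc1 (th t)).
split; [auto|]. split; [auto|].
split; [|split; [|split]]; unfold cQ1, cQ2, cP1, cP2.
- auto_derive; [auto|]. rewrite E1, E2. field. lra.
- auto_derive; [auto|]. rewrite E1, E2. field. lra.
- auto_derive; [repeat split; auto; lra|]. rewrite E1, E2, E3, E4. unfold Ur, Uth.
  set (c := cos (th t)) in *. set (s := sin (th t)) in *. set (D3 := sqrt (Dq (r t) (th t))) in *.
  transitivity (w t * s + L t / r t * c - mu - (1 - mu) * (- mu + r t * c + mu) / r t ^ 3 -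
    mu * (- mu + r t * c - (1 - mu)) / D3 ^ 3 + mu * (/ D3 ^ 3 - 1) * (s * s + c * c - 1)).
  + field. lra.
  + rewrite SC. ring.
- auto_derive; [repeat split; auto; lra|]. rewrite E1, E2, E3, E4. unfold Ur, Uth.
  set (c := cos (th t)) in *. set (s := sin (th t)) in *. set (D3 := sqrt (Dq (r t) (th t))) in *.
  field. lra.
Qed.

Lemma is_derive_eq (f : R -> R) (x l l' : R) : l = l' -> is_derive f x l -> is_derive f x l'.
Proof. intros ->; auto. Qed.

Lemma const_of_derive0 (f : R -> R) a b : a <= b ->
  (forall t, a <= t <= b -> is_derive f t 0) -> f b = f a.
Proof.
intros Hab H. assert (G := derive_bound f (fun _ => 0) 0 a b Hab H).
assert (Rabs (f b - f a) <= 0 * (b - a)). { apply G. intros. rewrite Rabs_R0; lra. }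
apply Rminus_diag_uniq. destruct (Req_dec (f b - f a) 0); auto.
pose proof (Rabs_pos_lt _ H1). lra.
Qed.

(* The polar angle is recovered as the integral of the angular velocity of the heliocentric position. *)
Lemma cart_to_polar mu T q1 q2 p1 p2 r0 th0 :
  0 < T -> is_orbit mu q1 q2 p1 p2 (fun t => 0 <= t < T) -> 0 < r0 ->
  q1 0 = cQ1 mu r0 th0 -> q2 0 = cQ2 r0 th0 ->
  exists r th w L, r 0 = r0 /\ th 0 = th0 /\
    forall t, 0 <= t < T -> polar_at mu r th w L t /\
      q1 t = cQ1 mu (r t) (th t) /\ q2 t = cQ2 (r t) (th t) /\
      p1 t = cP1 (r t) (th t) (w t) (L t) /\ p2 t = cP2 mu (r t) (th t) (w t) (L t).
Proof.
intros HT H Hr0 Hq1 Hq2.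
pose (r := fun t => dSun mu (q1 t) (q2 t)).
pose (om := fun t => ((q1 t + mu) * (p2 t - q1 t) - q2 t * (p1 t + q2 t)) / (r t) ^ 2).
pose (cl := fun t => Rmax 0 t).
pose (th := fun t => th0 + RInt (fun s => om (cl s)) 0 t).
assert (Hr0' : r 0 = r0). { unfold r. rewrite Hq1, Hq2. apply dSun_polar. lra. }
assert (sq : forall t, r t * r t = (q1 t + mu) ^ 2 + (q2 t) ^ 2).
{ intros t. unfold r, dSun. apply sqrt_sqrt. apply Rplus_le_le_0_compat; apply pow2_ge_0. }
assert (Dr : forall t, 0 <= t < T -> is_derive r t (((q1 t + mu) * (p1 t + q2 t) + q2 t * (p2 t - q1 t)) / r t)).
{ intros t Ht. destruct (H t Ht) as [A [_ [B [C _]]]].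
  assert (E1 : Derive (fun x => q1 x) t = p1 t + q2 t) by (apply is_derive_unique; auto).
  assert (E2 : Derive (fun x => q2 x) t = p2 t - q1 t) by (apply is_derive_unique; auto).
  assert (P : 0 < (q1 t + mu) ^ 2 + q2 t ^ 2).
  { rewrite <- sq. unfold r. nra. }
  unfold r, dSun. auto_derive.
  - repeat split; try (eexists; eauto); auto.
  - rewrite E1, E2. rewrite ?Rmult_1_r. replace ((q1 t + mu) * (q1 t + mu) + q2 t * q2 t) with ((q1 t + mu) ^ 2 + q2 t ^ 2) by ring. field.
    apply Rgt_not_eq. apply sqrt_lt_R0; auto. }
assert (rp : forall t, 0 <= t < T -> 0 < r t) by (intros t Ht; apply (H t Ht)).
assert (Com : forall t, 0 <= t < T -> continuous om t).
{ intros t Ht. destruct (H t Ht) as [A [_ [B [C [D E]]]]]. specialize (Dr t Ht). specialize (rp t Ht).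
  apply (ex_derive_continuous om). unfold om. auto_derive. repeat split; try (eexists; eauto); auto.
  simpl. nra. }
assert (clb : forall t, t < T -> 0 <= cl t < T) by (intros t Ht; unfold cl, Rmax; destruct Rle_dec; lra).
assert (Com' : forall t, t < T -> continuous (fun s => om (cl s)) t).
{ intros t Ht. apply (continuous_comp cl om); [|apply Com, clb; auto].
  apply (continuous_of_lip cl 1). intros x y. unfold cl, Rmax. repeat destruct Rle_dec; unfold Rabs; repeat destruct Rcase_abs; lra. }
assert (Dth : forall t, 0 <= t < T -> is_derive th t (om t)).
{ intros t Ht. unfold th.
  replace (om t) with (plus 0 (om (cl t))).
  2:{ unfold cl. rewrite Rmax_right by lra. unfold plus; simpl. ring. }
  apply (is_derive_plus (V := R_NormedModule)); [apply @is_derive_const|].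
  apply (is_derive_RInt (V := R_CompleteNormedModule) (fun s => om (cl s)) _ 0 t).
  - exists (mkposreal (T - t) ltac:(lra)). intros y Hy.
    apply (RInt_correct (V := R_CompleteNormedModule)). apply (ex_RInt_continuous (V := R_CompleteNormedModule)).
    intros z Hz. apply Com'. change (Rabs (y - t) < T - t) in Hy. apply Rabs_def2 in Hy.
    unfold Rmax in Hz. destruct Rle_dec in Hz; lra.
  - apply Com'. lra. }
assert (th00 : th 0 = th0). { unfold th. rewrite RInt_point. unfold zero; simpl. ring. }
(* Seen in the frame turned by [th], the unit vector from the Sun to the body has zero derivative,
   because [th] was given its angular velocity. It therefore stays equal to its initial value (1,
   0). *)
assert (Ang : forall t, 0 <= t < T -> q1 t = cQ1 mu (r t) (th t) /\ q2 t = cQ2 (r t) (th t)).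
{ assert (Z : forall t, 0 <= t < T ->
     is_derive (fun u => ((q1 u + mu) * cos (th u) + q2 u * sin (th u)) / r u) t 0 /\
     is_derive (fun u => (q2 u * cos (th u) - (q1 u + mu) * sin (th u)) / r u) t 0).
  { intros t Ht. destruct (H t Ht) as [A [_ [B [C _]]]].  assert (Dr' := Dr t Ht). assert (rp' := rp t Ht).
    assert (E1 : Derive (fun x => q1 x) t = p1 t + q2 t) by (apply is_derive_unique; auto).
    assert (E2 : Derive (fun x => q2 x) t = p2 t - q1 t) by (apply is_derive_unique; auto).
    assert (E3 : Derive (fun x => th x) t = om t) by (apply is_derive_unique; auto).
    assert (E4 := is_derive_unique _ _ _ Dr'). change (Derive (fun x => r x) t = ((q1 t + mu) * (p1 t + q2 t) + q2 t * (p2 t - q1 t)) / r t) in E4.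
    assert (S2 := sq t).
    split; auto_derive; try (repeat split; try (eexists; eauto); auto; lra).
    - rewrite E1, E2, E3, E4. unfold om. set (c := cos (th t)). set (s := sin (th t)).
      set (x := q1 t + mu) in *. set (y := q2 t) in *.
      transitivity (((p1 t + y) * c + (p2 t - q1 t) * s) / (r t) ^ 3 * (r t * r t - (x ^ 2 + y ^ 2))).
      + field_simplify_eq; [|lra]. ring_simplify.
        replace (r t ^ 2) with (x ^ 2 + y ^ 2) by (rewrite <- S2; ring). ring.
      + rewrite S2. ring.
    - rewrite E1, E2, E3, E4. unfold om. set (c := cos (th t)). set (s := sin (th t)).
      set (x := q1 t + mu) in *. set (y := q2 t) in *.
      transitivity (((p2 t - q1 t) * c - (p1 t + y) * s) / (r t) ^ 3 * (r t * r t - (x ^ 2 + y ^ 2))).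
      + field_simplify_eq; [|lra]. ring_simplify.
        replace (r t ^ 2) with (x ^ 2 + y ^ 2) by (rewrite <- S2; ring). ring.
      + rewrite S2. ring. }
  intros t Ht. specialize (rp t Ht).
  assert (Z1 := const_of_derive0 (fun u => ((q1 u + mu) * cos (th u) + q2 u * sin (th u)) / r u) 0 t ltac:(lra) (fun u Hu => proj1 (Z u ltac:(lra)))).
  assert (Z2 := const_of_derive0 (fun u => (q2 u * cos (th u) - (q1 u + mu) * sin (th u)) / r u) 0 t ltac:(lra) (fun u Hu => proj2 (Z u ltac:(lra)))).
  cbv beta in Z1, Z2. rewrite Hq1, Hq2, Hr0', th00 in Z1, Z2. unfold cQ1, cQ2 in Z1, Z2.
  assert (SC := sc1 th0). assert (SC' := sc1 (th t)).
  replace (((- mu + r0 * cos th0 + mu) * cos th0 + r0 * sin th0 * sin th0) / r0) with (sin th0 * sin th0 + cos th0 * cos th0) in Z1 by (field; lra).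
  replace ((r0 * sin th0 * cos th0 - (- mu + r0 * cos th0 + mu) * sin th0) / r0) with 0 in Z2 by (field; lra).
  rewrite SC in Z1.
  apply (Rmult_eq_compat_l (r t)) in Z1. apply (Rmult_eq_compat_l (r t)) in Z2.
  replace (r t * (((q1 t + mu) * cos (th t) + q2 t * sin (th t)) / r t)) with ((q1 t + mu) * cos (th t) + q2 t * sin (th t)) in Z1 by (field; lra).
  replace (r t * ((q2 t * cos (th t) - (q1 t + mu) * sin (th t)) / r t)) with (q2 t * cos (th t) - (q1 t + mu) * sin (th t)) in Z2 by (field; lra).
  rewrite Rmult_1_r in Z1. rewrite Rmult_0_r in Z2. unfold cQ1, cQ2. rewrite <- Z1.
  set (c := cos (th t)) in *. set (s := sin (th t)) in *. split.
  - replace (q1 t) with ((q1 t + mu) * (s * s + c * c) - mu) at 1 by (rewrite SC'; ring).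
    replace ((q1 t + mu) * (s * s + c * c)) with (((q1 t + mu) * c + q2 t * s) * c - s * (q2 t * c - (q1 t + mu) * s)) by ring.
    rewrite Z2. ring.
  - replace (q2 t) with (q2 t * (s * s + c * c)) at 1 by (rewrite SC'; ring).
    replace (q2 t * (s * s + c * c)) with (((q1 t + mu) * c + q2 t * s) * s + c * (q2 t * c - (q1 t + mu) * s)) by ring.
    rewrite Z2. ring. }
pose (w := fun t => p1 t * cos (th t) + (p2 t + mu) * sin (th t)).
pose (L := fun t => (q1 t + mu) * (p2 t + mu) - q2 t * p1 t).
exists r, th, w, L. split; auto. split; auto.
intros t Ht. destruct (Ang t Ht) as [A1 A2]. assert (rp' := rp t Ht).
destruct (H t Ht) as [HS [HJ [B [C [D E]]]]].
assert (SC := sc1 (th t)).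
assert (EL : L t = r t * ((p2 t + mu) * cos (th t) - p1 t * sin (th t))).
{ unfold L. rewrite A1, A2. unfold cQ1, cQ2. ring. }
assert (HDq : sqrt (Dq (r t) (th t)) = dJup mu (q1 t) (q2 t)) by (rewrite A1, A2, dJup_polar; auto).
assert (HDqp : 0 < Dq (r t) (th t)).
{ apply Rnot_le_lt. intros Hn. rewrite (sqrt_neg_0 _ Hn) in HDq. lra. }
assert (Eom : om t = L t / r t ^ 2 - 1).
{ unfold om. assert (S2 := sq t). assert (L t = (q1 t + mu) * (p2 t - q1 t) - q2 t * (p1 t + q2 t) + r t * r t) by (rewrite S2; unfold L; ring).
  rewrite H0. field. lra. }
assert (SJ : dSun mu (q1 t) (q2 t) = r t) by reflexivity.
rewrite SJ, <- HDq in D, E. rewrite <- HDq in HJ.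
set (D3 := sqrt (Dq (r t) (th t))) in *.
split.
2:{ repeat split; auto.
  - unfold cP1. rewrite EL. unfold w. set (c := cos (th t)) in *. set (s := sin (th t)) in *.
    transitivity (p1 t * (s * s + c * c)); [rewrite SC; ring|field; lra].
  - unfold cP2. rewrite EL. unfold w. set (c := cos (th t)) in *. set (s := sin (th t)) in *.
    transitivity ((p2 t + mu) * (s * s + c * c) - mu); [rewrite SC; ring|field; lra]. }
split; [auto|]. split; [auto|]. split; [|split; [|split]].
- eapply is_derive_eq; [|apply Dr; auto]. unfold w. rewrite A1, A2. unfold cQ1, cQ2. field. lra.
- rewrite <- Eom. auto.
- assert (Dt := Dth t Ht). rewrite Eom in Dt.
  assert (E3 : Derive (fun x => p1 x) t = _) by (apply is_derive_unique; exact D).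
  assert (E4 : Derive (fun x => p2 x) t = _) by (apply is_derive_unique; exact E).
  assert (E5 : Derive (fun x => th x) t = _) by (apply is_derive_unique; exact Dt).
  unfold w. auto_derive; [repeat split; eexists; eauto|].
  rewrite E3, E4, E5. rewrite EL. rewrite A1, A2. unfold cQ1, cQ2, Ur. fold D3.
  set (c := cos (th t)) in *. set (s := sin (th t)) in *.
  transitivity ((r t * ((p2 t + mu) * c - p1 t * s)) ^ 2 / r t ^ 3 - (1 - mu) / r t ^ 2 + mu * ((c - r t) / D3 ^ 3 - c)
    - ((1 - mu) / r t ^ 2 + mu * r t / D3 ^ 3) * (s * s + c * c - 1)).
  + field. lra.
  + rewrite SC. ring.
- assert (E1 : Derive (fun x => q1 x) t = _) by (apply is_derive_unique; exact B).
  assert (E2 : Derive (fun x => q2 x) t = _) by (apply is_derive_unique; exact C).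
  assert (E3 : Derive (fun x => p1 x) t = _) by (apply is_derive_unique; exact D).
  assert (E4 : Derive (fun x => p2 x) t = _) by (apply is_derive_unique; exact E).
  unfold L. auto_derive; [repeat split; eexists; eauto|].
  rewrite E1, E2, E3, E4. rewrite A1, A2. unfold cQ1, cQ2, Uth. fold D3. field. lra.
Qed.

Lemma Jac_const mu r th w L a b : a <= b -> (forall t, a <= t <= b -> polar_at mu r th w L t) ->
  Jac mu (r b) (th b) (w b) (L b) = Jac mu (r a) (th a) (w a) (L a).
Proof.
intros Hab H. apply (const_of_derive0 (fun t => Jac mu (r t) (th t) (w t) (L t)) a b Hab).
intros t Ht. destruct (H t Ht) as [Hr [HD [H1 [H2 [H3 H4]]]]].
assert (E1 : Derive (fun x => r x) t = w t) by (apply is_derive_unique; auto).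
assert (E2 : Derive (fun x => th x) t = L t / (r t) ^ 2 - 1) by (apply is_derive_unique; auto).
assert (E3 : Derive (fun x => w x) t = _) by (apply is_derive_unique; exact H3).
assert (E4 : Derive (fun x => L x) t = _) by (apply is_derive_unique; exact H4).
assert (HsD := sqrt_lt_R0 _ HD).
unfold Jac, Upot, Dq. unfold Dq in HD, HsD. auto_derive.
- repeat split; try (eexists; eauto); try lra; try nra. apply Rgt_not_eq, sqrt_lt_R0. simpl in *. lra.
- rewrite E1, E2, E3, E4. unfold Ur, Uth, Dq.
  match goal with |- context [sqrt ?x] => set (D3 := sqrt x) in * end.
  match goal with |- context [sqrt ?x] => set (D4 := sqrt x) in *; replace D4 with D3 by (unfold D3, D4; f_equal; ring) end.
  field. lra.
Qed.

Lemma Hbar_Jac mu r th RR Th : 0 < r ->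
  Hbar mu r th RR Th = Jac mu r th (RR + mu * sin th) (Th + mu * r * cos th) - mu ^ 2 / 2.
Proof.
intros Hr. unfold Hbar, Hhat. change (Pq1 mu r th) with (cQ1 mu r th). change (Pq2 mu r th) with (cQ2 r th).
rewrite dSun_polar, dJup_polar by lra. unfold cQ1, cQ2, Pp1, Pp2, Jac, Upot, Rdiv.
set (D := / sqrt (Dq r th)). assert (SC := sc1 th). set (c := cos th) in *. set (s := sin th) in *.
transitivity ((RR ^ 2 + Th ^ 2 / r ^ 2) / 2 * (s * s + c * c) - Th * (s * s + c * c) + mu * (RR * s + Th / r * c) - (1 - mu) * / r - mu * D).
- field. lra.
- rewrite SC. transitivity ((RR ^ 2 + Th ^ 2 / r ^ 2) / 2 - Th + mu * (RR * s + Th / r * c) - (1 - mu) * / r - mu * D + mu ^ 2 / 2 * (s * s + c * c - 1)).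
  + rewrite SC. field. lra.
  + field. lra.
Qed.

(** * Collision orbits and the regularised problem *)

Lemma derive_inverse_eps (q l eps : R) : 0 < eps -> l <> 0 ->
  Rabs (q - l) < Rmin (Rabs l / 2) (eps * Rabs l ^ 2 / 2) -> q <> 0 /\ Rabs (/ q - / l) < eps.
Proof.
intros He Hl H. assert (Pl := Rabs_pos_lt _ Hl).
assert (H1 : Rabs (q - l) < Rabs l / 2) by (eapply Rlt_le_trans; [apply H|apply Rmin_l]).
assert (H2 : Rabs (q - l) < eps * Rabs l ^ 2 / 2) by (eapply Rlt_le_trans; [apply H|apply Rmin_r]).
assert (Hq : Rabs l / 2 < Rabs q).
{ replace l with (q - (q - l)) at 1 by ring.
  assert (Rabs l <= Rabs q + Rabs (q - l)).
  { replace l with (q + - (q - l)) at 1 by ring. eapply Rle_trans; [apply Rabs_triang|]. rewrite Rabs_Ropp. lra. }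
  replace (q - (q - l)) with l by ring. lra. }
assert (Hq0 : q <> 0) by (intros ->; rewrite Rabs_R0 in Hq; lra).
split; auto.
replace (/ q - / l) with (- (q - l) * (/ q * / l)) by (field; auto).
rewrite Rabs_mult, Rabs_Ropp, Rabs_mult, !Rabs_inv.
assert (Hi : / Rabs q < / (Rabs l / 2)) by (apply Rinv_lt_contravar; nra).
assert (0 < / Rabs l) by (apply Rinv_0_lt_compat; auto).

apply Rle_lt_trans with (Rabs (q - l) * (/ (Rabs l / 2) * / Rabs l)).
- apply Rmult_le_compat_l; [apply Rabs_pos|]. apply Rmult_le_compat_r; lra.
- apply Rlt_le_trans with (eps * Rabs l ^ 2 / 2 * (/ (Rabs l / 2) * / Rabs l)).
  + apply Rmult_lt_compat_r; auto. apply Rmult_lt_0_compat; auto. apply Rinv_0_lt_compat. lra.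
  + right. field. lra.
Qed.

(** The derivative is allowed to vanish at the endpoints: time as a function of s along a collision
    orbit has derivative -2 s^2 / sqrt(Ssq), which is zero at the collision. *)
Lemma decreasing_inverse (f f' : R -> R) (a b : R) : a < b ->
  (forall x, a <= x <= b -> is_derive f x (f' x)) ->
  (forall x, a < x < b -> f' x < 0) ->
  (forall x y, a <= x -> x < y -> y <= b -> f y < f x) /\
  exists g, forall t, f b < t < f a -> a < g t < b /\ f (g t) = t /\ is_derive g t (/ f' (g t)).
Proof.
intros Hab Hd Hneg.
assert (Hdec : forall x y, a <= x -> x < y -> y <= b -> f y < f x).
{ intros x y Hx Hxy Hy. destruct (MVT_cor2 f f' x y Hxy) as [c [E Hc]].
  - intros c Hc. apply is_derive_Reals, Hd. lra.
  - assert (f' c < 0) by (apply Hneg; lra). nra. }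
split; auto.
assert (Hcont : forall x, a <= x <= b -> continuous f x).
{ intros x Hx. apply (ex_derive_continuous f). eexists; apply Hd; auto. }
assert (Hex : forall t, exists x, f b < t < f a -> a < x < b /\ f x = t).
{ intros t. destruct (classic (f b < t < f a)) as [Ht|Ht]; [|exists 0; tauto].
  destruct (ivt_between f a b t) as [x [Hx E]]; auto; try lra.
  exists x. intros _. split; auto. destruct (Req_dec x a); [subst; lra|]. destruct (Req_dec x b); [subst; lra|]. lra. }
pose (g := fun t => proj1_sig (constructive_indefinite_description _ (Hex t))).
assert (Hg : forall t, f b < t < f a -> a < g t < b /\ f (g t) = t).
{ intros t. unfold g. apply proj2_sig. }
assert (Hlt : forall x y, a <= x <= b -> a <= y <= b -> f x < f y -> y < x).
{ intros x y Hx Hy H. destruct (Rtotal_order x y) as [L|[L|L]]; auto; exfalso.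
  - assert (f y < f x) by (apply Hdec; lra). lra.
  - subst; lra. }
exists g. intros t Ht. destruct (Hg t Ht) as [Hgt E]. split; auto. split; auto.
set (x0 := g t) in *.
apply is_derive_Reals. intros eps He.
assert (Hl : f' x0 <> 0) by (specialize (Hneg x0 Hgt); lra).
assert (Hm : 0 < Rmin (Rabs (f' x0) / 2) (eps * Rabs (f' x0) ^ 2 / 2)).
{ assert (P := Rabs_pos_lt _ Hl). apply Rmin_pos; [lra|]. assert (0 < Rabs (f' x0) ^ 2) by (apply pow_lt; auto). nra. }
assert (D0 := Hd x0 ltac:(lra)). apply is_derive_Reals in D0.
destruct (D0 _ Hm) as [dl Hdl]. assert (Hdlp := cond_pos dl).
set (y1 := Rmax ((a + x0) / 2) (x0 - dl / 2)). set (y2 := Rmin ((b + x0) / 2) (x0 + dl / 2)).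
assert (Hy1 : a < y1 < x0 /\ x0 - dl < y1) by (unfold y1, Rmax; destruct Rle_dec; lra).
assert (Hy2 : x0 < y2 < b /\ y2 < x0 + dl) by (unfold y2, Rmin; destruct Rle_dec; lra).
assert (F1 : t < f y1) by (rewrite <- E; apply Hdec; lra).
assert (F2 : f y2 < t) by (rewrite <- E; apply Hdec; lra).
assert (F1' : f y1 < f a) by (apply Hdec; lra). assert (F2' : f b < f y2) by (apply Hdec; lra).
assert (Hmin : 0 < Rmin (f y1 - t) (t - f y2)) by (apply Rmin_pos; lra).
exists (mkposreal _ Hmin). intros h Hh0 Hh. simpl in Hh.
assert (Hh1 := Rlt_le_trans _ _ _ Hh (Rmin_l _ _)). assert (Hh2 := Rlt_le_trans _ _ _ Hh (Rmin_r _ _)).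
apply Rabs_def2 in Hh1. apply Rabs_def2 in Hh2.
destruct (Hg (t + h) ltac:(lra)) as [Hgh Eh]. fold x0.
set (y := g (t + h)) in *.
assert (B1 : y1 < y) by (apply Hlt; lra). assert (B2 : y < y2) by (apply Hlt; lra).
assert (Hne : y - x0 <> 0). { intros Z. apply Hh0. replace y with x0 in Eh by lra. lra. }
specialize (Hdl (y - x0) Hne ltac:(apply Rabs_def1; lra)).
replace (x0 + (y - x0)) with y in Hdl by ring. rewrite Eh, E in Hdl.
replace (t + h - t) with h in Hdl by ring.
destruct (derive_inverse_eps _ _ _ He Hl Hdl) as [_ H].
replace ((y - x0) / h) with (/ (h / (y - x0))) by (field; split; auto). exact H.
Qed.

(** A solution of the integral equations is replaced by primitives on the whole line, which are
    differentiable also at s = d. They coincide with th and s^2 la between the collision and s =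
    d. *)
Lemma bvp_extend A B M d a th la : tame M A -> tame M B -> 0 < d <= 1 / 2 -> bvp_sol A B d a th la ->
  exists ae Le : R -> R, (forall x : R, is_derive ae x (- A (clamp 0 d x) (th x) (la x))) /\
    (forall x : R, is_derive Le x ((clamp 0 d x) ^ 2 * B (clamp 0 d x) (th x) (la x))) /\
    (forall x, 0 <= x <= d -> ae x = th x) /\ (forall x, 0 < x <= d -> Le x = x ^ 2 * la x) /\ ae d = a.
Proof.
intros TA TB Hd [Cth [Cla [Bla [Eth [Z0 Ela]]]]].
assert (CA := tame_cont M d Hd _ _ _ TA Cth Cla Bla).
assert (CB := tame_cont M d Hd _ _ _ TB Cth Cla Bla).
assert (CBq := fun x => continuous_sqclamp d Hd _ x CB). cbv beta in *.
exists (fun rho => a + RInt (fun s : R => A (clamp 0 d s) (th s) (la s)) rho d),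
  (fun rho => RInt (fun s : R => (clamp 0 d s) ^ 2 * B (clamp 0 d s) (th s) (la s)) 0 rho).
split; [|split; [|split; [|split]]].
- intros x. eapply is_derive_eq; [|apply (is_derive_plus (V := R_NormedModule)); [apply @is_derive_const|
    apply (is_derive_RInt' (V := R_CompleteNormedModule) (fun s : R => A (clamp 0 d s) (th s) (la s)) _ x d)]].
  + unfold plus, zero, opp; simpl. ring.
  + exists (mkposreal 1 Rlt_0_1). intros y _. apply (RInt_correct (V := R_CompleteNormedModule)), ex_RInt_cont; auto.
  + auto.
- intros x. apply (is_derive_RInt (V := R_CompleteNormedModule) (fun s : R => (clamp 0 d s) ^ 2 * B (clamp 0 d s) (th s) (la s)) _ 0 x).
  + exists (mkposreal 1 Rlt_0_1). intros y _. apply (RInt_correct (V := R_CompleteNormedModule)), ex_RInt_cont; auto.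
  + apply CBq.
- intros x Hx. rewrite Eth by auto. reflexivity.
- intros x Hx. rewrite Ela by auto. reflexivity.
- rewrite RInt_point. unfold zero; simpl. ring.
Qed.

(** Time is recovered by integrating dt = -2 s^2 ds / sqrt(Ssq), which converges at s = 0, and s is
    the inverse function. The radial velocity is minus the root of the expression given by the
    Jacobi integral, and the radial equation of motion follows by differentiating this
    expression. *)
Lemma collision_orbit mu eta d a th la : 0 < mu <= 1 / 8 -> - 1 / 8 <= eta <= 1 / 8 -> 0 < d <= 1 / 2 ->
  (exists M, tame M (Avel (mu, eta)) /\ tame M (Bvel (mu, eta))) ->
  bvp_sol (Avel (mu, eta)) (Bvel (mu, eta)) d a th la ->
  exists T r ph w L, 0 < T /\ (forall t, 0 <= t < T -> polar_at mu r ph w L t) /\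
    r 0 = d ^ 2 /\ ph 0 = a /\ L 0 = d ^ 2 * la d /\ w 0 < 0 /\ Jac mu (r 0) (ph 0) (w 0) (L 0) = eta /\
    (forall t, 0 < t < T -> r t < d ^ 2) /\
    filterlim r (at_left T) (locally 0) /\ filterlim w (at_left T) (Rbar_locally m_infty).
Proof.
intros Hmu He Hd [M [TA TB]] Hsol.
assert (Hv : valid (mu, eta)) by (unfold valid; simpl; lra).
destruct (bvp_extend _ _ M d a th la TA TB Hd Hsol) as [ae [Le [Dae [DLe [aeq [Leq aed]]]]]].
destruct Hsol as [Cth [Cla [Bla _]]].
set (c := clamp 0 d) in *.
pose (S := fun s => sqrt (Ssq (mu, eta) (c s) (th s) (la s))).
assert (dm : forall s, dom (c s) (la s)) by (intros s; apply dom_clamp; auto).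
assert (Sr : forall s, 1 <= Ssq (mu, eta) (c s) (th s) (la s) <= 3) by (intros; apply Ssq_range; auto).
assert (Sp : forall s, 1 <= S s <= 2).
{ intros s. specialize (Sr s). unfold S. split.
  - rewrite <- sqrt_1. apply sqrt_le_1; lra.
  - replace 2 with (sqrt (2 * 2)) by (apply sqrt_square; lra). apply sqrt_le_1; lra. }
assert (Ctau : forall s : R, continuous (fun s : R => 2 * (c s) ^ 2 / S s) s).
{ intros s. destruct utame_rS as [Ms [HMs Ts]]. specialize (Ts _ Hv).
  assert (CS := tame_cont Ms d ltac:(lra) _ _ _ Ts Cth Cla Bla s). cbv beta in CS.
  apply (continuous_mult (K := R_AbsRing)); [|exact CS].
  apply (continuous_mult (K := R_AbsRing)); [apply continuous_const|].
  apply (continuous_comp (clamp 0 d) (fun u => u ^ 2)); [apply continuous_clamp; lra|].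
  apply (ex_derive_continuous (fun u : R => u ^ 2)). auto_derive; auto. }
pose (te := fun rho => RInt (fun s : R => 2 * (c s) ^ 2 / S s) rho d).
assert (Dint : forall h (x : R), (forall s : R, continuous h s) -> is_derive (fun u => RInt h u d) x (- h x)).
{ intros h x Hc. apply (is_derive_RInt' (V := R_CompleteNormedModule) h _ x d).
  - exists (mkposreal 1 Rlt_0_1). intros y _. apply (RInt_correct (V := R_CompleteNormedModule)), ex_RInt_cont; auto.
  - auto. }
assert (Dte : forall x, is_derive te x (- (2 * (c x) ^ 2 / S x))) by (intros; apply (Dint (fun s : R => 2 * (c s) ^ 2 / S s)); auto).
(* Going up to 2 d makes s = d an interior point, so that the inverse has a two-sided derivative at
   time 0. *)
destruct (decreasing_inverse te (fun x => - (2 * (c x) ^ 2 / S x)) 0 (2 * d)) as [Hdec [g Hg]]; try lra.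
{ intros; apply Dte. }
{ intros x Hx. assert (0 < c x).
  { unfold c, clamp, Rmax, Rmin. repeat destruct Rle_dec; lra. }
  specialize (Sp x). assert (0 < 2 * (c x) ^ 2 / S x); [|lra].
  apply Rdiv_lt_0_compat; [|lra]. assert (0 < (c x) ^ 2) by (apply pow_lt; auto). lra. }
assert (ted : te d = 0) by (unfold te; rewrite RInt_point; reflexivity).
assert (te0 : 0 < te 0) by (rewrite <- ted; apply Hdec; lra).
assert (te2 : te (2 * d) < 0) by (rewrite <- ted; apply Hdec; lra).
set (T := te 0) in *.
assert (Hlt : forall x y, 0 <= x <= 2 * d -> 0 <= y <= 2 * d -> te x < te y -> y < x).
{ intros x y Hx Hy H. destruct (Rtotal_order x y) as [Q|[Q|Q]]; auto; exfalso.
  - assert (te y < te x) by (apply Hdec; lra). lra.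
  - subst; lra. }
assert (g0 : g 0 = d).
{ destruct (Hg 0 ltac:(lra)) as [G1 [G2 _]].
  destruct (Rtotal_order (g 0) d) as [Q|[Q|Q]]; auto; exfalso;
  [assert (te d < te (g 0)) by (apply Hdec; lra)|assert (te (g 0) < te d) by (apply Hdec; lra)]; lra. }
assert (gr : forall t, 0 < t < T -> 0 < g t < d).
{ intros t Ht. destruct (Hg t ltac:(lra)) as [G1 [G2 _]]. split; [lra|].
  apply Hlt; try lra. }
assert (gr' : forall t, 0 <= t < T -> 0 < g t <= d).
{ intros t Ht. destruct (Req_dec t 0) as [->|]; [lra|]. specialize (gr t ltac:(lra)). lra. }
(* The square of the radial velocity, written with the extended functions because [th] and [la]
   themselves are only known to be continuous. *)
pose (W := fun t => 2 * (1 - mu) / (g t) ^ 2 + 2 * (eta + Le (g t) + Upot mu ((g t) ^ 2) (ae (g t))) - (Le (g t)) ^ 2 / (g t) ^ 4).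
assert (cg : forall t, 0 <= t < T -> c (g t) = g t) by (intros t Ht; unfold c; apply clamp_id; specialize (gr' t Ht); lra).
assert (WS : forall t, 0 <= t < T -> W t = (S (g t) / g t) ^ 2).
{ intros t Ht. specialize (gr' t Ht). specialize (cg t Ht).
  unfold W. rewrite Leq, aeq by lra.
  replace ((S (g t) / g t) ^ 2) with (S (g t) * S (g t) / (g t) ^ 2) by (field; lra).
  unfold S. rewrite sqrt_sqrt by (specialize (Sr (g t)); lra). rewrite cg. unfold Ssq; simpl fst; simpl snd. field. lra. }
assert (sW : forall t, 0 <= t < T -> sqrt (W t) = S (g t) / g t).
{ intros t Ht. rewrite WS by auto. specialize (gr' t Ht). specialize (Sp (g t)).
  replace ((S (g t) / g t) ^ 2) with ((S (g t) / g t) * (S (g t) / g t)) by ring. apply sqrt_square.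
  apply Rlt_le, Rdiv_lt_0_compat; lra. }
exists T, (fun t => (g t) ^ 2), (fun t => ae (g t)), (fun t => - sqrt (W t)), (fun t => Le (g t)).
assert (Dg : forall t, 0 <= t < T -> is_derive g t (- S (g t) / (2 * (g t) ^ 2))).
{ intros t Ht. destruct (Hg t ltac:(lra)) as [_ [_ D]]. eapply is_derive_eq; [|exact D].
  rewrite cg by auto. specialize (gr' t Ht). specialize (Sp (g t)). field. lra. }
assert (Wpos : forall t, 0 <= t < T -> 0 < W t).
{ intros t Ht. rewrite WS by auto. specialize (gr' t Ht). specialize (Sp (g t)).
  apply pow_lt. apply Rdiv_lt_0_compat; lra. }
split; [auto|]. split.
{ intros t Ht. assert (G := gr' t Ht). assert (C := cg t Ht). assert (Sg := Sp (g t)).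
  assert (HDq : 1 / 4 <= Dq ((g t) ^ 2) (ae (g t)) <= 4) by (apply Dq_range; split; nra).
  assert (EL := Leq (g t) G). assert (Ea := aeq (g t) ltac:(lra)).
  assert (D1 : is_derive (fun t => ae (g t)) t (Le (g t) / ((g t) ^ 2) ^ 2 - 1)).
  { eapply is_derive_eq; [|apply (is_derive_comp ae g t _ _ (Dae (g t)) (Dg t Ht))].
    rewrite C. unfold Avel, scal; simpl; unfold mult; simpl.
    replace (sqrt (Ssq (mu, eta) (g t) (th (g t)) (la (g t)))) with (S (g t)) by (unfold S; rewrite C; reflexivity).
    rewrite EL. field. lra. }
  assert (D2 : is_derive (fun t => Le (g t)) t (Uth mu ((g t) ^ 2) (ae (g t)))).
  { eapply is_derive_eq; [|apply (is_derive_comp Le g t _ _ (DLe (g t)) (Dg t Ht))].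
    rewrite C. unfold Bvel, Bred, scal; simpl fst; simpl; unfold mult; simpl.
    replace (sqrt (Ssq (mu, eta) (g t) (th (g t)) (la (g t)))) with (S (g t)) by (unfold S; rewrite C; reflexivity).
    rewrite <- Ea. unfold Uth.
    replace (g t ^ 2) with (g t * (g t * 1)) by ring. rewrite !Rmult_1_r.
    assert (0 < sqrt (Dq (g t * g t) (ae (g t)))).
    { apply sqrt_lt_R0. replace (g t * g t) with (g t ^ 2) by ring. lra. }
    field. lra. }
  assert (D3 : is_derive (fun t => (g t) ^ 2) t (- sqrt (W t))).
  { assert (E1 : Derive (fun x => g x) t = _) by (apply is_derive_unique; exact (Dg t Ht)).
    auto_derive; [eexists; apply Dg; auto|]. rewrite E1, sW by auto. field. lra. }
  assert (P1 : 0 < (g t) ^ 2) by (apply pow_lt; lra).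
  unfold polar_at. split; [auto|]. split; [lra|]. split; [auto|]. split; [auto|]. split; [|auto].
  pose (rr := fun t => (g t) ^ 2). pose (aa := fun t => ae (g t)). pose (ll := fun t => Le (g t)).
  assert (EW : forall t, 0 < g t -> W t = 2 * (1 - mu) / rr t + 2 * (eta + ll t + mu * (/ sqrt (1 - 2 * rr t * cos (aa t) + (rr t) ^ 2) - rr t * cos (aa t))) - (ll t) ^ 2 / (rr t) ^ 2).
  { intros u Hu. unfold W, rr, aa, ll, Upot, Dq. f_equal. f_equal. ring. }
  set (W' := fun t => 2 * (1 - mu) / rr t + 2 * (eta + ll t + mu * (/ sqrt (1 - 2 * rr t * cos (aa t) + (rr t) ^ 2) - rr t * cos (aa t))) - (ll t) ^ 2 / (rr t) ^ 2) in *.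
  change (is_derive rr t (- sqrt (W t))) in D3. change (is_derive aa t (ll t / (rr t) ^ 2 - 1)) in D1.
  change (is_derive ll t (Uth mu (rr t) (aa t))) in D2.
  change (1 / 4 <= Dq (rr t) (aa t) <= 4) in HDq. change (0 < rr t) in P1.
  assert (HD1 : 0 < Dq (rr t) (aa t)) by lra. assert (HD2 := sqrt_lt_R0 _ HD1). unfold Dq in HD1, HD2.
  set (wt := sqrt (W t)) in *. assert (Hw : 0 < wt) by (apply sqrt_lt_R0; auto).
  assert (DW : is_derive W' t (2 * - wt * ((ll t) ^ 2 / (rr t) ^ 3 - (1 - mu) / (rr t) ^ 2 + Ur mu (rr t) (aa t)))).
  { assert (E1 : Derive (fun x => rr x) t = _) by (apply is_derive_unique; exact D3).
    assert (E2 : Derive (fun x => aa x) t = _) by (apply is_derive_unique; exact D1).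
    assert (E3 : Derive (fun x => ll x) t = _) by (apply is_derive_unique; exact D2).
    unfold W'. auto_derive.
    - repeat split; try (eexists; eauto); try lra; try nra. apply Rgt_not_eq, sqrt_lt_R0. simpl in *. lra.
    - rewrite E1, E2, E3. unfold Ur, Uth, Dq.
      match goal with |- context [sqrt ?x] => set (D4 := sqrt x) in * end.
      match goal with |- context [sqrt ?x] => set (D5 := sqrt x) in *; replace D5 with D4 by (unfold D4, D5; f_equal; ring) end.
      assert (D4 > 0). { unfold D4. match goal with |- sqrt ?x > 0 => replace x with (1 - 2 * rr t * cos (aa t) + rr t ^ 2) by ring end. auto. }
      field. lra. }
  assert (DW2 : is_derive W t (2 * - wt * ((ll t) ^ 2 / (rr t) ^ 3 - (1 - mu) / (rr t) ^ 2 + Ur mu (rr t) (aa t)))).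
  { apply (is_derive_ext_loc W'); auto.
    assert (Cg : continuous g t) by (apply (ex_derive_continuous g); eexists; apply Dg; auto).
    destruct (proj1 (continuous_eps g t) Cg (g t) ltac:(lra)) as [e [He' H]].
    exists (mkposreal e He'). intros y Hy. specialize (H y Hy). apply Rabs_def2 in H. symmetry. apply EW. lra. }
  assert (E0 : Derive (fun x => W x) t = _) by (apply is_derive_unique; exact DW2).
  auto_derive.
  - split; [eexists; eauto|]. split; auto.
  - rewrite E0. fold wt. unfold rr, aa, ll. field. repeat split; apply Rgt_not_eq; auto; lra. }
split; [rewrite g0; auto|]. split; [rewrite g0; exact aed|].
split; [rewrite g0; apply Leq; lra|].
split. { assert (0 < sqrt (W 0)) by (apply sqrt_lt_R0, Wpos; lra). lra. }
split.
{ unfold Jac. replace ((- sqrt (W 0)) ^ 2) with (W 0).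
  - unfold W. rewrite g0. field. lra.
  - replace ((- sqrt (W 0)) ^ 2) with (sqrt (W 0) * sqrt (W 0)) by ring. rewrite sqrt_sqrt; auto. left; apply Wpos; lra. }
split. { intros t Ht. specialize (gr t Ht). nra. }
assert (Near : forall x, 0 < x <= d -> at_left T (fun t => 0 <= t < T /\ 0 < g t < x)).
{ intros x Hx. assert (Hx' : te x < T) by (apply Hdec; lra).
  exists (mkposreal (Rmin (T - te x) T) ltac:(apply Rmin_pos; lra)). intros t Ht HtT.
  change (Rabs (t - T) < Rmin (T - te x) T) in Ht.
  assert (H1 := Rlt_le_trans _ _ _ Ht (Rmin_l _ _)). assert (H2 := Rlt_le_trans _ _ _ Ht (Rmin_r _ _)).
  apply Rabs_def2 in H1. apply Rabs_def2 in H2. split; [lra|].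
  destruct (Hg t ltac:(lra)) as [G1 [G2 _]]. split; [lra|]. apply Hlt; lra. }
split.
- apply filterlim_locally. intros eps.
  assert (Hx : 0 < Rmin eps d <= d) by (split; [apply Rmin_pos; [apply cond_pos|lra]|apply Rmin_r]).
  apply (filter_imp (fun t => 0 <= t < T /\ 0 < g t < Rmin eps d)); [|apply Near; auto].
  intros t [Ht G]. change (Rabs (g t ^ 2 - 0) < eps). rewrite Rminus_0_r, Rabs_pos_eq by apply pow2_ge_0.
  assert (H1 := Rlt_le_trans _ _ _ (proj2 G) (Rmin_l _ _)).  nra.
- intros P [N HN].
  assert (Hx : 0 < Rmin d (/ (Rabs N + 1)) <= d).
  { split; [apply Rmin_pos; [lra|apply Rinv_0_lt_compat; pose proof (Rabs_pos N); lra]|apply Rmin_l]. }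
  unfold filtermap. apply (filter_imp (fun t => 0 <= t < T /\ 0 < g t < Rmin d (/ (Rabs N + 1)))); [|apply (Near _ Hx)].
  intros t [Ht G]. apply HN. rewrite sW by auto. specialize (Sp (g t)).
  assert (H2 := Rlt_le_trans _ _ _ (proj2 G) (Rmin_r _ _)).
  assert (HN1 : 0 < Rabs N + 1) by (pose proof (Rabs_pos N); lra).
  assert (Rabs N + 1 < / g t).
  { apply (Rmult_lt_reg_r (g t)); [lra|]. rewrite (Rinv_l (g t)) by lra.
    apply (Rmult_lt_compat_l (Rabs N + 1)) in H2; [|lra]. rewrite Rinv_r in H2 by lra. exact H2. }
  assert (/ g t <= S (g t) / g t). { unfold Rdiv.  nra. }
  pose proof (Rabs_maj2 N). lra.
Qed.

Lemma rsqrt_Dq_bounds r th : 0 <= r <= 1 / 4 -> 0 < / sqrt (Dq r th) <= 2 /\ 0 < / sqrt (Dq r th) ^ 3 <= 8.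
Proof.
intros Hr. assert (B := rsqrt_bounds _ (Dq_range r th Hr)). set (D := sqrt (Dq r th)) in *.
assert (0 < / D <= 2). { split; [apply Rinv_0_lt_compat; lra|]. replace 2 with (/ (1 / 2)) by field. apply Rinv_le_contravar; lra. }
split; auto. rewrite <- pow_inv. split; [apply pow_lt; lra|]. replace 8 with (2 ^ 3) by ring. apply pow_incr; lra.
Qed.

Lemma Ur_small mu r th : 0 <= mu -> 0 <= r <= 1 / 4 -> Rabs (Ur mu r th) <= 11 * mu.
Proof.
intros Hm Hr. destruct (rsqrt_Dq_bounds r th Hr) as [_ H]. pose proof (COS_bound th).
unfold Ur, Rdiv. rewrite Rabs_mult, (Rabs_pos_eq mu) by auto. rewrite (Rmult_comm 11).
apply Rmult_le_compat_l; auto. set (D := / sqrt (Dq r th) ^ 3) in *. apply Rabs_le. split; nra.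
Qed.

Lemma Uth_small mu r th : 0 <= mu -> 0 <= r <= 1 / 4 -> Rabs (Uth mu r th) <= 9 * mu * r.
Proof.
intros Hm Hr. destruct (rsqrt_Dq_bounds r th Hr) as [_ H]. pose proof (SIN_bound th).
unfold Uth. rewrite !Rabs_mult, (Rabs_pos_eq mu), (Rabs_pos_eq r) by lra.
assert (Rabs (sin th) <= 1) by (apply Rabs_le; lra).
assert (Rabs (1 - / sqrt (Dq r th) ^ 3) <= 9) by (apply Rabs_le; lra).
pose proof (Rabs_pos (sin th)). pose proof (Rabs_pos (1 - / sqrt (Dq r th) ^ 3)).
assert (0 <= mu * r) by nra.
replace (9 * mu * r) with (mu * r * (1 * 9)) by ring. rewrite Rmult_assoc.
apply Rmult_le_compat_l; auto. apply Rmult_le_compat; auto.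
Qed.

(** Half the derivative of r^2 is y = r w. The equations of motion and the Jacobi integral give y'
    >= 1 / (10 r), so y increases; as y^2 <= 3 r, it tends to 0 at the collision and is negative
    before, hence so is w. The torque after time t is at most 90 mu r(t)^2 y', so y also measures
    the change of L, and L tends to 0 because L^2 <= 3 r. The resulting |L| <= r says that every
    orbit falling into the Sun lies in the domain of the regular problem. *)
Lemma collision_apriori mu eta d T r ph w L : 0 < mu <= 1 / 100 -> - 1 / 8 <= eta <= 1 / 8 -> 0 < d <= 1 / 2 -> 0 < T ->
  (forall t, 0 <= t < T -> polar_at mu r ph w L t) ->
  r 0 = d ^ 2 -> Jac mu (r 0) (ph 0) (w 0) (L 0) = eta ->
  (forall t, 0 < t < T -> r t < d ^ 2) -> filterlim r (at_left T) (locally 0) ->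
  forall t, 0 <= t < T -> w t < 0 /\ Rabs (L t) <= r t /\
    r t * (w t) ^ 2 = 2 * (1 - mu) + 2 * r t * (eta + L t + Upot mu (r t) (ph t)) - (L t) ^ 2 / r t /\ r t <= d ^ 2.
Proof.
intros Hmu He Hd HT Hp Hr0 HJ0 Hr Hlim.
assert (rp : forall t, 0 <= t < T -> 0 < r t) by (intros t Ht; apply (Hp t Ht)).
assert (rd : forall t, 0 <= t < T -> r t <= d ^ 2).
{ intros t Ht. destruct (Req_dec t 0) as [->|]; [lra|]. left; apply Hr; lra. }
assert (d2 : d ^ 2 <= 1 / 4) by nra.
assert (HJ : forall t, 0 <= t < T -> (w t) ^ 2 + (L t) ^ 2 / (r t) ^ 2 = 2 * (1 - mu) / r t + 2 * (eta + L t + Upot mu (r t) (ph t))).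
{ intros t Ht. assert (E := Jac_const mu r ph w L 0 t ltac:(lra) (fun u Hu => Hp u ltac:(lra))).
  rewrite HJ0 in E. unfold Jac in E. specialize (rp t Ht). rewrite <- E. field. lra. }
assert (Ub : forall t, 0 <= t < T -> Rabs (Upot mu (r t) (ph t)) <= 3 / 100).
{ intros t Ht. specialize (rp t Ht). specialize (rd t Ht). eapply Rle_trans; [apply Upot_small; lra|lra]. }
assert (Lb : forall t, 0 <= t < T -> (L t) ^ 2 <= 3 * r t /\ (r t * w t) ^ 2 <= 3 * r t).
{ intros t Ht. specialize (rp t Ht). specialize (rd t Ht). specialize (Ub t Ht). apply Rabs_le_between in Ub.
  specialize (HJ t Ht). set (x := r t) in *. set (U := Upot mu x (ph t)) in *.
  assert (E : (x * w t) ^ 2 + (L t) ^ 2 = 2 * (1 - mu) * x + 2 * x ^ 2 * (eta + L t + U)).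
  { transitivity (x ^ 2 * ((w t) ^ 2 + (L t) ^ 2 / x ^ 2)); [field; lra|]. rewrite HJ. field. lra. }

  assert (A3 : x ^ 2 <= x / 4) by nra.
  assert (A4 : 2 * x ^ 2 * (eta + L t + U) <= x ^ 2 * (1 / 2) + x ^ 2 * (1 + (L t) ^ 2)).
  {  assert (2 * (eta + L t + U) <= 1 / 2 + (1 + (L t) ^ 2)) by nra. nra. }

  split; nra. }
assert (Ls : forall t, 0 <= t < T -> -1 <= L t <= 1).
{ intros t Ht. destruct (Lb t Ht) as [H _]. specialize (rd t Ht). split; nra. }
pose (y := fun t => r t * w t).
pose (y' := fun t => (1 - mu) / r t + 2 * (eta + L t + Upot mu (r t) (ph t)) + r t * Ur mu (r t) (ph t)).
assert (Dy : forall t, 0 <= t < T -> is_derive y t (y' t)).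
{ intros t Ht. destruct (Hp t Ht) as [H0 [HD [H1 [H2 [H3 H4]]]]].
  eapply is_derive_eq; [|apply (is_derive_mult r w t _ _ H1 H3); intros; apply Rmult_comm].
  unfold plus, mult; simpl. unfold y'. specialize (HJ t Ht).
  replace (w t * w t) with ((w t) ^ 2 + (L t) ^ 2 / (r t) ^ 2 - (L t) ^ 2 / (r t) ^ 2) by ring. rewrite HJ. field. lra. }
assert (y'p : forall t, 0 <= t < T -> / 10 * / r t <= y' t).
{ intros t Ht. specialize (rp t Ht). specialize (rd t Ht). specialize (Ub t Ht). specialize (Ls t Ht).
  assert (HU := Ur_small mu (r t) (ph t) ltac:(lra) ltac:(lra)).
  apply Rabs_le_between in Ub. apply Rabs_le_between in HU. unfold y', Rdiv.
  assert (4 <= / r t). { replace 4 with (/ (1 / 4)) by field. apply Rinv_le_contravar; lra. }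
  nra. }
assert (ymon : forall s t, 0 <= s <= t -> t < T -> y s <= y t).
{ intros s t Hst Ht. assert (0 - 0 <= y t - y s); [|lra].
  apply (derive_le_incr (fun _ => 0) y (fun _ => 0) y'); try lra.
  - intros; apply @is_derive_const.
  - intros; apply Dy; lra.
  - intros u Hu. specialize (y'p u ltac:(lra)). specialize (rp u ltac:(lra)).
    assert (0 < / r u) by (apply Rinv_0_lt_compat; auto). lra. }
assert (small : forall eps t0, 0 < eps -> 0 <= t0 < T -> exists s, t0 < s < T /\ r s < eps).
{ intros eps t0 Heps Ht0.
  assert (L1 : at_left T (fun s => r s < eps)).
  { assert (Q := proj1 (filterlim_locally r 0) Hlim (mkposreal eps Heps)).
    apply (filter_imp (fun s => ball 0 eps (r s))); auto. intros s Hs. change (Rabs (r s - 0) < eps) in Hs. apply Rabs_def2 in Hs. lra. }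
  destruct L1 as [e H]. exists (T - Rmin e (T - t0) / 2).
  assert (0 < Rmin e (T - t0)) by (apply Rmin_pos; [apply cond_pos|lra]).
  assert (Rmin e (T - t0) <= T - t0) by apply Rmin_r. assert (Rmin e (T - t0) <= e) by apply Rmin_l.
  split; [lra|]. apply H; [|lra]. change (Rabs (T - Rmin e (T - t0) / 2 - T) < e). rewrite Rabs_left; lra. }
assert (yneg : forall t, 0 <= t < T -> y t < 0).
{ intros t Ht. apply Rnot_le_lt. intros Hn.
  set (t1 := (t + T) / 2). assert (Ht1 : t < t1 < T) by (unfold t1; lra).
  assert (Hy1 : 0 < y t1).
  { destruct (MVT_cor2 y y' t t1) as [c [E Hc]]; [lra|intros; apply is_derive_Reals, Dy; lra|].
    specialize (y'p c ltac:(lra)). specialize (rp c ltac:(lra)).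
    assert (0 < / r c) by (apply Rinv_0_lt_compat; auto). assert (0 < y' c * (t1 - t)) by (apply Rmult_lt_0_compat; lra). lra. }
  destruct (small (y t1 ^ 2 / 3) t1) as [s [Hs Hrs]]; [assert (0 < y t1 ^ 2) by (apply pow_lt; auto); lra|lra|].
  assert (y t1 <= y s) by (apply ymon; lra). destruct (Lb s ltac:(lra)) as [_ HH]. change (y s ^ 2 <= 3 * r s) in HH. nra. }
assert (wneg : forall t, 0 <= t < T -> w t < 0).
{ intros t Ht. specialize (yneg t Ht). specialize (rp t Ht). unfold y in yneg. nra. }
assert (rdec : forall s t, 0 <= s <= t -> t < T -> r t <= r s).
{ intros s t Hst Ht. assert (r t - r s <= 0 - 0); [|lra].
  apply (derive_le_incr r (fun _ => 0) w (fun _ => 0)); try lra.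
  - intros u Hu. apply (Hp u ltac:(lra)).
  - intros; apply @is_derive_const.
  - intros u Hu. left; apply wneg; lra. }
intros t Ht. split; [auto|]. split; [|split; [|auto]].
2:{ specialize (rp t Ht). specialize (HJ t Ht).
  replace (r t * (w t) ^ 2) with (r t * ((w t) ^ 2 + (L t) ^ 2 / (r t) ^ 2) - (L t) ^ 2 / r t) by (field; lra).
  rewrite HJ. field. lra. }
assert (Hrt := rp t Ht). assert (Hrd := rd t Ht).
assert (B0 : forall s, t <= s < T -> Rabs (L s - L t) <= 90 * mu * (r t) ^ 2 * (y s - y t)).
{ intros s Hs.
  replace (90 * mu * (r t) ^ 2 * (y s - y t)) with ((fun u => 90 * mu * (r t) ^ 2 * y u) s - (fun u => 90 * mu * (r t) ^ 2 * y u) t) by ring.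
  apply (derive_abs_le L (fun u => 90 * mu * (r t) ^ 2 * y u) (fun u => Uth mu (r u) (ph u)) (fun u => 90 * mu * (r t) ^ 2 * y' u)); try lra.
  - intros u Hu. apply (Hp u ltac:(lra)).
  - intros u Hu. apply (is_derive_scal y u). apply Dy; lra.
  - intros u Hu. specialize (y'p u ltac:(lra)). assert (R1 := rp u ltac:(lra)). assert (R2 := rdec t u ltac:(lra) ltac:(lra)).
    eapply Rle_trans; [apply Uth_small; lra|].
    apply Rle_trans with (90 * mu * (r t) ^ 2 * (/ 10 * / r u)).
    + assert (r u <= (r t) ^ 2 * / r u).
      { apply Rmult_le_reg_r with (r u); auto. rewrite Rmult_assoc, Rinv_l by lra. nra. }
      nra.
    + apply Rmult_le_compat_l; auto.  nra. }
apply Rnot_lt_le. intros Hn.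
assert (Hb : forall s, t <= s < T -> Rabs (L s - L t) <= r t / 2).
{ intros s Hs. eapply Rle_trans; [apply B0; auto|].
  assert (Y1 := yneg s ltac:(lra)). destruct (Lb t Ht) as [_ H]. change (y t ^ 2 <= 3 * r t) in H.
  assert (-1 <= y t) by nra.

   assert (0 <= y s - y t) by (assert (y t <= y s) by (apply ymon; lra); lra).
  assert (90 * mu * r t ^ 2 <= r t / 2) by nra. nra. }
destruct (small ((r t) ^ 2 / 16) t) as [s [Hs Hrs]]; [assert (0 < (r t) ^ 2) by (apply pow_lt; auto); lra|auto|].
specialize (Hb s ltac:(lra)). destruct (Lb s ltac:(lra)) as [H _].
assert (Rabs (L s) < r t / 2). { apply Rabs_def1; nra. }
assert (Rabs (L t) <= Rabs (L s) + Rabs (L s - L t)).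
{ replace (L t) with (L s + - (L s - L t)) at 1 by ring. eapply Rle_trans; [apply Rabs_triang|]. rewrite Rabs_Ropp. lra. }
lra.
Qed.

(** With rho = sqrt r as independent variable an arbitrary collision orbit satisfies the equations
    of the two-point problem. It is compared with the given solution by the same halving argument:
    the angles agree at rho = d, and the angular momenta both vanish at the collision. *)
Lemma collision_unique mu eta d T r ph w L a th la M : 0 < mu <= 1 / 100 -> - 1 / 8 <= eta <= 1 / 8 -> 0 < d <= 1 / 2 -> 0 < T ->
  tame M (Avel (mu, eta)) -> tame M (Bvel (mu, eta)) -> 1 <= M -> 16 * M * d <= 1 ->
  bvp_sol (Avel (mu, eta)) (Bvel (mu, eta)) d a th la ->
  (forall t, 0 <= t < T -> polar_at mu r ph w L t) ->
  r 0 = d ^ 2 -> ph 0 = a -> Jac mu (r 0) (ph 0) (w 0) (L 0) = eta ->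
  (forall t, 0 < t < T -> r t < d ^ 2) -> filterlim r (at_left T) (locally 0) ->
  L 0 = d ^ 2 * la d.
Proof.
intros Hmu He Hd HT TA TB HM HMd Hsol Hp Hr0 Hph0 HJ0 Hr Hlim.
assert (Ap := collision_apriori mu eta d T r ph w L Hmu He Hd HT Hp Hr0 HJ0 Hr Hlim).
destruct (bvp_extend _ _ M d a th la TA TB Hd Hsol) as [ae [Le [Dae [DLe [aeq [Leq aed]]]]]].
destruct Hsol as [Cth [Cla [Bla [Eth [Z0 Ela]]]]].

pose (rho := fun t => sqrt (r t)). pose (lh := fun t => L t / r t).
assert (rp : forall t, 0 <= t < T -> 0 < r t) by (intros t Ht; apply (Hp t Ht)).
assert (rhop : forall t, 0 <= t < T -> 0 < rho t <= d /\ (rho t) ^ 2 = r t).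
{ intros t Ht. specialize (rp t Ht). destruct (Ap t Ht) as [_ [_ [_ Hle]]]. unfold rho. split.
  - split; [apply sqrt_lt_R0; auto|]. rewrite <- (sqrt_pow2 d) by lra. apply sqrt_le_1; try lra.
  - replace (sqrt (r t) ^ 2) with (sqrt (r t) * sqrt (r t)) by ring. apply sqrt_sqrt; lra. }
assert (lhb : forall t, 0 <= t < T -> -1 <= lh t <= 1).
{ intros t Ht. specialize (rp t Ht). destruct (Ap t Ht) as [_ [Hl _]]. apply Rabs_le_between in Hl. unfold lh.
  split; [apply Rle_div_r; lra|apply Rle_div_l; lra]. }
assert (HS : forall t, 0 <= t < T -> sqrt (Ssq (mu, eta) (rho t) (ph t) (lh t)) = - rho t * w t).
{ intros t Ht. specialize (rp t Ht). destruct (rhop t Ht) as [P1 P2]. destruct (Ap t Ht) as [Hw [_ [Hen _]]].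
  replace (Ssq (mu, eta) (rho t) (ph t) (lh t)) with ((- rho t * w t) * (- rho t * w t)).
  - apply sqrt_square. nra.
  - replace (- rho t * w t * (- rho t * w t)) with ((rho t) ^ 2 * (w t) ^ 2) by ring.
    unfold Ssq, lh; simpl fst; simpl snd. rewrite P2, Hen. field. lra. }
assert (Drho : forall t, 0 <= t < T -> is_derive rho t (w t / (2 * rho t))).
{ intros t Ht. specialize (rp t Ht). destruct (Hp t Ht) as [_ [_ [D _]]].
  assert (E1 : Derive (fun x => r x) t = w t) by (apply is_derive_unique; auto).
  unfold rho. auto_derive; [split; [eexists; eauto|auto]|]. rewrite E1. field. apply Rgt_not_eq, sqrt_lt_R0; auto. }
assert (cl : forall t, 0 <= t < T -> clamp 0 d (rho t) = rho t) by (intros t Ht; apply clamp_id; destruct (rhop t Ht); lra).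
pose (d1 := fun t => ph t - ae (rho t)). pose (d2 := fun t => L t - Le (rho t)).
assert (D1 : forall t, 0 <= t < T -> is_derive d1 t (- (w t / (2 * rho t)) *
    (Avel (mu, eta) (rho t) (ph t) (lh t) - Avel (mu, eta) (rho t) (th (rho t)) (la (rho t))))).
{ intros t Ht. destruct (Hp t Ht) as [R0 [_ [_ [Dph _]]]].
  eapply is_derive_eq; [|apply (is_derive_minus (V := R_NormedModule) ph); [exact Dph|apply (is_derive_comp ae rho t _ _ (Dae (rho t)) (Drho t Ht))]].
  rewrite cl by auto. unfold minus, plus, opp, scal; simpl; unfold mult; simpl.
  assert (K : L t / (r t * (r t * 1)) - 1 = - (w t / (2 * rho t)) * Avel (mu, eta) (rho t) (ph t) (lh t)); [|rewrite K; ring].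
  unfold Avel. rewrite HS by auto. destruct (rhop t Ht) as [P1 P2]. destruct (Ap t Ht) as [Hw _].
  unfold lh. rewrite <- P2. field. lra. }
assert (D2 : forall t, 0 <= t < T -> is_derive d2 t ((w t / (2 * rho t)) * ((rho t) ^ 2 *
    (Bvel (mu, eta) (rho t) (ph t) (lh t) - Bvel (mu, eta) (rho t) (th (rho t)) (la (rho t)))))).
{ intros t Ht. destruct (Hp t Ht) as [R0 [HD0 [_ [_ [_ DL]]]]].
  eapply is_derive_eq; [|apply (is_derive_minus (V := R_NormedModule) L); [exact DL|apply (is_derive_comp Le rho t _ _ (DLe (rho t)) (Drho t Ht))]].
  rewrite cl by auto. unfold minus, plus, opp, scal; simpl; unfold mult; simpl.
  assert (K : Uth mu (r t) (ph t) = w t / (2 * rho t) * ((rho t) ^ 2 * Bvel (mu, eta) (rho t) (ph t) (lh t))); [|rewrite K; ring].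
  unfold Bvel, Bred; simpl fst. rewrite HS by auto. destruct (rhop t Ht) as [P1 P2]. destruct (Ap t Ht) as [Hw _].
  rewrite P2. unfold Uth. assert (HsD := sqrt_lt_R0 _ HD0).
  replace (r t) with (rho t ^ 2) in HsD |- * by auto.
  field. repeat split; lra. }
assert (dmh : forall t, 0 <= t < T -> dom (rho t) (lh t)) by (intros t Ht; split; [destruct (rhop t Ht); lra|apply lhb; auto]).
assert (dml : forall t, 0 <= t < T -> dom (rho t) (la (rho t))) by (intros t Ht; split; [destruct (rhop t Ht); lra|apply Bla]).
assert (wneg : forall t, 0 <= t < T -> 0 <= - (w t / (2 * rho t))).
{ intros t Ht. destruct (rhop t Ht). destruct (Ap t Ht) as [Hw _].
  replace (- (w t / (2 * rho t))) with ((- w t) / (2 * rho t)) by (field; lra). apply Rdiv_le_0_compat; lra. }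
assert (d10 : d1 0 = 0).
{ unfold d1, rho. rewrite Hr0, Hph0, sqrt_pow2 by lra. rewrite aed. ring. }
assert (bd1 : forall k, (forall t, 0 <= t < T -> Rabs (Avel (mu, eta) (rho t) (ph t) (lh t) - Avel (mu, eta) (rho t) (th (rho t)) (la (rho t))) <= k) ->
   forall t, 0 <= t < T -> Rabs (ph t - th (rho t)) <= k * d).
{ intros k Hk t Ht. destruct (rhop t Ht) as [P1 _]. rewrite <- aeq by lra. change (Rabs (d1 t) <= k * d).
  assert (Hk0 : 0 <= k) by (eapply Rle_trans; [apply Rabs_pos|apply (Hk t Ht)]).
  replace (d1 t) with (d1 t - d1 0) by (rewrite d10; ring).
  apply Rle_trans with ((fun u => - (k * rho u)) t - (fun u => - (k * rho u)) 0).
  - apply (derive_abs_le d1 (fun u => - (k * rho u)) _ (fun u => - (k * (w u / (2 * rho u)))) 0 t ltac:(lra) (fun u Hu => D1 u ltac:(lra))).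
    + intros u Hu. apply (is_derive_opp (V := R_NormedModule)). apply (is_derive_scal rho u). apply Drho; lra.
    + intros u Hu. rewrite Rabs_mult, Rabs_pos_eq by (apply wneg; lra). specialize (wneg u ltac:(lra)). specialize (Hk u ltac:(lra)). nra.
  - destruct (rhop 0 ltac:(lra)). cbv beta. nra. }
assert (bd2 : forall k, (forall t, 0 <= t < T -> Rabs (Bvel (mu, eta) (rho t) (ph t) (lh t) - Bvel (mu, eta) (rho t) (th (rho t)) (la (rho t))) <= k) ->
   forall t, 0 <= t < T -> Rabs (lh t - la (rho t)) <= k * d).
{ intros k Hk t Ht. destruct (rhop t Ht) as [P1 P2].
  assert (Hk0 : 0 <= k) by (eapply Rle_trans; [apply Rabs_pos|apply (Hk t Ht)]).
  (* There is no initial value at the collision. Instead both angular momenta are bounded by r at a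
     later time s, and s is taken so close to T that their difference is negligible. *)
  assert (G : Rabs (d2 t) <= k * (rho t) ^ 3).
  { apply le_epsilon. intros eps Heps.
    assert (Q : at_left T (fun s => r s < eps / 2)).
    { assert (Q := proj1 (filterlim_locally r 0) Hlim (mkposreal (eps / 2) ltac:(lra))).
      apply (filter_imp (fun s => ball 0 (eps / 2) (r s))); auto. intros s Hs. change (Rabs (r s - 0) < eps / 2) in Hs. apply Rabs_def2 in Hs. lra. }
    destruct Q as [e Q]. set (s := T - Rmin e (T - t) / 2).
    assert (Hm : 0 < Rmin e (T - t)) by (apply Rmin_pos; [apply cond_pos|lra]).
    assert (Rmin e (T - t) <= T - t) by apply Rmin_r. assert (Rmin e (T - t) <= e) by apply Rmin_l.
    assert (Hs : t < s < T) by (unfold s; lra).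
    assert (Hrs : r s < eps / 2). { apply Q; [|lra]. change (Rabs (s - T) < e). unfold s. rewrite Rabs_left; lra. }
    assert (A1 : Rabs (d2 s) <= eps).
    { destruct (Ap s ltac:(lra)) as [_ [Hl _]]. destruct (rhop s ltac:(lra)) as [P3 P4].
      unfold d2. rewrite Leq, P4 by lra. unfold Rminus. eapply Rle_trans; [apply Rabs_triang|].
      rewrite Rabs_Ropp, Rabs_mult, (Rabs_pos_eq (r s)) by (left; apply rp; lra).
      assert (Rabs (la (rho s)) <= 1) by (apply Rabs_le, Bla). specialize (rp s ltac:(lra)). nra. }
    assert (A2 : Rabs (d2 s - d2 t) <= (fun u => - (k * (rho u) ^ 3 / 3)) s - (fun u => - (k * (rho u) ^ 3 / 3)) t).
    { apply (derive_abs_le d2 (fun u => - (k * (rho u) ^ 3 / 3)) _ (fun u => - (k * (rho u) ^ 2 * (w u / (2 * rho u)))) t s ltac:(lra) (fun u Hu => D2 u ltac:(lra))).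
      + intros u Hu. assert (E1 : Derive (fun x => rho x) u = _) by (apply is_derive_unique; apply (Drho u); lra).
        auto_derive; [eexists; apply Drho; lra|]. rewrite E1. destruct (rhop u ltac:(lra)). field. lra.
      + intros u Hu. specialize (wneg u ltac:(lra)). specialize (Hk u ltac:(lra)).
        rewrite Rabs_mult, Rabs_mult, (Rabs_pos_eq ((rho u) ^ 2)) by apply pow2_ge_0.
        rewrite <- (Rabs_Ropp (w u / (2 * rho u))), Rabs_pos_eq by auto.
        set (v := - (w u / (2 * rho u))) in *. replace (- (k * rho u ^ 2 * (w u / (2 * rho u)))) with (v * (rho u ^ 2 * k)) by (unfold v; ring).
        apply Rmult_le_compat_l; auto. apply Rmult_le_compat_l; auto. apply pow2_ge_0. }
    cbv beta in A2. destruct (rhop s ltac:(lra)) as [P3 P4].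
    assert (0 <= k * (rho s) ^ 3) by (apply Rmult_le_pos; auto; apply pow_le; lra).
    assert (0 <= k * (rho t) ^ 3) by (apply Rmult_le_pos; auto; apply pow_le; lra).
    replace (d2 t) with (d2 s + - (d2 s - d2 t)) by ring. eapply Rle_trans; [apply Rabs_triang|]. rewrite Rabs_Ropp. lra. }
  assert (R2 : 0 < (rho t) ^ 2) by (rewrite P2; apply rp; auto).
  replace (lh t - la (rho t)) with (/ (rho t) ^ 2 * d2 t) by (unfold d2, lh; rewrite Leq, <- P2 by lra; field; lra).
  rewrite Rabs_mult, Rabs_pos_eq by (left; apply Rinv_0_lt_compat; auto).
  apply Rmult_le_reg_l with ((rho t) ^ 2); auto. rewrite <- Rmult_assoc, Rinv_r, Rmult_1_l by lra.
  eapply Rle_trans; [apply G|]. replace (k * rho t ^ 3) with (rho t ^ 2 * (k * rho t)) by ring.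
  apply Rmult_le_compat_l; [lra|]. nra. }
pose (X := {t : R | 0 <= t < T}).
assert (F : forall i : bool * X, (if fst i then Rabs (ph (proj1_sig (snd i)) - th (rho (proj1_sig (snd i)))) else
    Rabs (lh (proj1_sig (snd i)) - la (rho (proj1_sig (snd i))))) <= 2 * 0).
{ assert (step : forall k, (forall f t, f = Avel (mu, eta) \/ f = Bvel (mu, eta) -> 0 <= t < T ->
      Rabs (f (rho t) (ph t) (lh t) - f (rho t) (th (rho t)) (la (rho t))) <= k) ->
    forall i : bool * X, (if fst i then Rabs (ph (proj1_sig (snd i)) - th (rho (proj1_sig (snd i)))) else
    Rabs (lh (proj1_sig (snd i)) - la (rho (proj1_sig (snd i))))) <= k * d).
  { intros k Hk [b [t Ht]]. simpl. destruct b; [apply bd1|apply bd2]; auto. }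
  apply (halving_bound _ 0 (2 * M * d)); try lra; try nra.
  - apply step. intros f t Hf Ht. assert (tame M f) by (destruct Hf; subst; auto).
    unfold Rminus. eapply Rle_trans; [apply Rabs_triang|]. rewrite Rabs_Ropp.
    assert (Q1 := tame_bound M f H _ (ph t) _ (dmh t Ht)). assert (Q2 := tame_bound M f H _ (th (rho t)) _ (dml t Ht)). lra.
  - intros c Hc0 Hc i. eapply Rle_trans; [apply (step (M * (2 * c)))|nra].
    intros f t Hf Ht. assert (tame M f) by (destruct Hf; subst; auto).
    eapply Rle_trans; [apply (tame_lip M f); auto|]. apply Rmult_le_compat_l; [lra|].
    assert (Q1 := Hc (true, exist _ t Ht)). assert (Q2 := Hc (false, exist _ t Ht)). simpl in Q1, Q2. lra. }
assert (H0T : 0 <= 0 < T) by lra.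
assert (F0 := F (false, exist _ 0 H0T)). simpl in F0.
destruct (rhop 0 H0T) as [P1 P2].
assert (E0 : rho 0 = d) by (unfold rho; rewrite Hr0; apply sqrt_pow2; lra).
rewrite E0 in F0. pose proof (Rabs_pos (lh 0 - la d)).
assert (lh 0 - la d = 0). { destruct (Req_dec (lh 0 - la d) 0); auto. pose proof (Rabs_pos_lt _ H0). lra. }
unfold lh in H0. rewrite Hr0 in H0.

replace (L 0) with (d ^ 2 * (L 0 / d ^ 2)) by (field; lra). f_equal. lra.
Qed.

(** * Time reversal and the graph of the collision curve *)

Lemma is_derive_reverse (f : R -> R) (t l : R) : is_derive f (- t) l -> is_derive (fun s => f (- s)) t (- l).
Proof.
intros H. eapply is_derive_eq; [|apply (is_derive_comp f Ropp t l (-1)); auto].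
- unfold scal; simpl; unfold mult; simpl. ring.
- auto_derive; auto.
Qed.

(* Time reversal combined with the reflection in the Sun-Jupiter axis. *)
Lemma orbit_reverse mu q1 q2 p1 p2 (D : R -> Prop) : is_orbit mu q1 q2 p1 p2 D ->
  is_orbit mu (fun t => q1 (- t)) (fun t => - q2 (- t)) (fun t => - p1 (- t)) (fun t => p2 (- t)) (fun t => D (- t)).
Proof.
intros H t Ht. destruct (H (- t) Ht) as [A [B [C1 [C2 [C3 C4]]]]].
assert (ES : dSun mu (q1 (- t)) (- q2 (- t)) = dSun mu (q1 (- t)) (q2 (- t))) by (unfold dSun; f_equal; ring).
assert (EJ : dJup mu (q1 (- t)) (- q2 (- t)) = dJup mu (q1 (- t)) (q2 (- t))) by (unfold dJup; f_equal; ring).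
rewrite ES, EJ. split; auto. split; auto.
apply is_derive_reverse in C1. apply is_derive_reverse in C2. apply is_derive_reverse in C3. apply is_derive_reverse in C4.
split; [|split; [|split]].
- eapply is_derive_eq; [|exact C1]. ring.
- eapply is_derive_eq; [|apply (is_derive_opp (V := R_NormedModule)), C2]. unfold opp; simpl. ring.
- eapply is_derive_eq; [|apply (is_derive_opp (V := R_NormedModule)), C3]. unfold opp; simpl. unfold Rdiv; ring.
- eapply is_derive_eq; [|exact C4]. unfold Rdiv; ring.
Qed.

Lemma is_orbit_ext_dom mu q1 q2 p1 p2 (D D' : R -> Prop) : (forall t, D' t -> D t) ->
  is_orbit mu q1 q2 p1 p2 D -> is_orbit mu q1 q2 p1 p2 D'.
Proof. intros H H' t Ht. apply H', H, Ht. Qed.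

Lemma filterlim_opp_at_left T : filterlim Ropp (at_left T) (at_right (- T)).
Proof.
intros P [e H]. exists e. intros y Hy HyT. apply H; [|lra].
change (Rabs (y - T) < e) in Hy. change (Rabs (- y - - T) < e).
replace (- y - - T) with (- (y - T)) by ring. rewrite Rabs_Ropp. auto.
Qed.

Lemma filterlim_opp_at_right T : filterlim Ropp (at_right (- T)) (at_left T).
Proof.
intros P [e H]. exists e. intros y Hy HyT. apply H; [|lra].
change (Rabs (y - - T) < e) in Hy. change (Rabs (- y - T) < e).
replace (- y - T) with (- (y - - T)) by ring. rewrite Rabs_Ropp. auto.
Qed.

Lemma dSun_even mu q1 q2 : dSun mu q1 (- q2) = dSun mu q1 q2.
Proof. unfold dSun; f_equal; ring. Qed.

Lemma Rbar_of_reverse mu q1 q2 p1 p2 : Rbar_of mu q1 (- q2) (- p1) p2 = - Rbar_of mu q1 q2 p1 p2.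
Proof. unfold Rbar_of. rewrite dSun_even. unfold Rdiv. ring. Qed.

Lemma filterlim_opp_m_p : filterlim Ropp (Rbar_locally m_infty) (Rbar_locally p_infty).
Proof. intros P [M H]. exists (- M). intros x Hx. apply H. lra. Qed.

Lemma filterlim_opp_p_m : filterlim Ropp (Rbar_locally p_infty) (Rbar_locally m_infty).
Proof. intros P [M H]. exists (- M). intros x Hx. apply H. lra. Qed.

Lemma Pp_reverse r th RR Th : Pp1 r (- th) (- RR) Th = - Pp1 r th RR Th /\ Pp2 r (- th) (- RR) Th = Pp2 r th RR Th.
Proof. unfold Pp1, Pp2. rewrite cos_neg, sin_neg. split; ring. Qed.

Lemma ejection_collision mu delta r th RR Th :
  sun_ejection_bwd mu delta r th RR Th <-> sun_collision_fwd mu delta r (- th) (- RR) Th.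
Proof.
destruct (Pp_reverse r th RR Th) as [E1 E2].
split; intros [T [q1 [q2 [p1 [p2 [HT [Ho [I1 [I2 [I3 [I4 [Hr [L1 L2]]]]]]]]]]]]];
exists T, (fun t => q1 (- t)), (fun t => - q2 (- t)), (fun t => - p1 (- t)), (fun t => p2 (- t)).
- split; auto. split.
  { apply (is_orbit_ext_dom _ _ _ _ _ (fun t => - T < - t <= 0)); [intros; lra|].
    apply (orbit_reverse mu q1 q2 p1 p2 (fun t => - T < t <= 0)); auto. }
  rewrite Ropp_0, I1, I2, I3, I4, E1, E2. unfold Pq1, Pq2. rewrite cos_neg, sin_neg.
  split; [auto|]. split; [ring|]. split; [auto|]. split; [auto|]. split; [|split].
  + intros t Ht. unfold rbar. rewrite dSun_even. apply Hr. lra.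
  + apply (filterlim_ext (fun t => rbar mu (q1 (- t)) (q2 (- t)))); [intros; unfold rbar; rewrite dSun_even; auto|].
    apply (filterlim_comp _ _ _ Ropp (fun t => rbar mu (q1 t) (q2 t)) _ (at_right (- T)) _); auto. apply filterlim_opp_at_left.
  + apply (filterlim_ext (fun t => - Rbar_of mu (q1 (- t)) (q2 (- t)) (p1 (- t)) (p2 (- t)))); [intros; rewrite Rbar_of_reverse; auto|].
    apply (filterlim_comp _ _ _ (fun t => Rbar_of mu (q1 (- t)) (q2 (- t)) (p1 (- t)) (p2 (- t))) Ropp _ (Rbar_locally p_infty) _); [|apply filterlim_opp_p_m].
    apply (filterlim_comp _ _ _ Ropp (fun t => Rbar_of mu (q1 t) (q2 t) (p1 t) (p2 t)) _ (at_right (- T)) _); auto. apply filterlim_opp_at_left.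
- split; auto. split.
  { apply (is_orbit_ext_dom _ _ _ _ _ (fun t => 0 <= - t < T)); [intros; lra|].
    apply (orbit_reverse mu q1 q2 p1 p2 (fun t => 0 <= t < T)); auto. }
  rewrite Ropp_0, I1, I2, I3, I4, E1, E2. unfold Pq1, Pq2. rewrite cos_neg, sin_neg.
  split; [auto|]. split; [ring|]. split; [ring|]. split; [auto|]. split; [|split].
  + intros t Ht. unfold rbar. rewrite dSun_even. apply Hr. lra.
  + apply (filterlim_ext (fun t => rbar mu (q1 (- t)) (q2 (- t)))); [intros; unfold rbar; rewrite dSun_even; auto|].
    apply (filterlim_comp _ _ _ Ropp (fun t => rbar mu (q1 t) (q2 t)) _ (at_left T) _); auto. apply filterlim_opp_at_right.
  + apply (filterlim_ext (fun t => - Rbar_of mu (q1 (- t)) (q2 (- t)) (p1 (- t)) (p2 (- t)))); [intros; rewrite Rbar_of_reverse; auto|].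
    apply (filterlim_comp _ _ _ (fun t => Rbar_of mu (q1 (- t)) (q2 (- t)) (p1 (- t)) (p2 (- t))) Ropp _ (Rbar_locally m_infty) _); [|apply filterlim_opp_m_p].
    apply (filterlim_comp _ _ _ Ropp (fun t => Rbar_of mu (q1 t) (q2 t) (p1 t) (p2 t)) _ (at_left T) _); auto. apply filterlim_opp_at_right.
Qed.

Lemma Hbar_reverse mu r th RR Th : 0 < r -> Hbar mu r (- th) (- RR) Th = Hbar mu r th RR Th.
Proof.
intros Hr. rewrite !Hbar_Jac by auto. unfold Jac, Upot, Dq. rewrite cos_neg, sin_neg. unfold Rdiv. ring.
Qed.

Lemma DeltaU_DeltaS mu delta h th Th : 0 < delta -> DeltaU_plus mu delta h th Th <-> DeltaS_minus mu delta h (- th) Th.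
Proof.
intros Hd. assert (Hd2 : 0 < delta ^ 2) by (apply pow_lt; auto). split.
- intros [RR [H1 [H2 H3]]]. exists (- RR). split; [lra|]. split; [rewrite Hbar_reverse; auto|].
  apply ejection_collision; auto.
- intros [RR [H1 [H2 H3]]]. exists (- RR). split; [lra|]. split.
  + rewrite <- (Hbar_reverse mu _ th) by auto. rewrite Ropp_involutive; auto.
  + apply ejection_collision. rewrite Ropp_involutive; auto.
Qed.

Lemma polar_init mu r th w L RR Th : 0 < r ->
  Pp1 r th RR Th = cP1 r th w L -> Pp2 r th RR Th = cP2 mu r th w L ->
  w = RR + mu * sin th /\ L = Th + mu * r * cos th.
Proof.
unfold Pp1, Pp2, cP1, cP2. intros Hr E1 E2. assert (SC := sc1 th). set (c := cos th) in *. set (s := sin th) in *.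
split.
- transitivity (w * (s * s + c * c)); [rewrite SC; ring|].
  transitivity ((w * c - L / r * s) * c + (w * s + L / r * c - mu) * s + mu * s); [field; lra|].
  rewrite <- E1, <- E2. transitivity (RR * (s * s + c * c) + mu * s); [field; lra|rewrite SC; ring].
- transitivity (L * (s * s + c * c)); [rewrite SC; ring|].
  transitivity (r * (- (w * c - L / r * s) * s + (w * s + L / r * c - mu) * c + mu * c)); [field; lra|].
  rewrite <- E1, <- E2. transitivity (Th * (s * s + c * c) + mu * r * c); [field; lra|rewrite SC; ring].
Qed.

Lemma polar_init' mu r th w L : 0 < r ->
  Pp1 r th (w - mu * sin th) (L - mu * r * cos th) = cP1 r th w L /\
  Pp2 r th (w - mu * sin th) (L - mu * r * cos th) = cP2 mu r th w L.
Proof.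
unfold Pp1, Pp2, cP1, cP2. intros Hr. assert (SC := sc1 th). set (c := cos th) in *. set (s := sin th) in *.
split; [field; lra|].
transitivity (w * s + L / r * c - mu * (s * s + c * c)); [field; lra|rewrite SC; ring].
Qed.

Lemma Rbar_of_polar mu r th w L : 0 < r ->
  Rbar_of mu (cQ1 mu r th) (cQ2 r th) (cP1 r th w L) (cP2 mu r th w L) = w - mu * sin th.
Proof.
intros Hr. unfold Rbar_of. rewrite dSun_polar by lra. unfold cQ1, cQ2, cP1, cP2.
assert (SC := sc1 th). set (c := cos th) in *. set (s := sin th) in *.
transitivity (w * (s * s + c * c) - mu * s); [field; lra|rewrite SC; ring].
Qed.

Lemma at_left_between a T : a < T -> at_left T (fun t => a < t < T).
Proof.
intros H. exists (mkposreal (T - a) ltac:(lra)). intros t Ht HtT. change (Rabs (t - T) < T - a) in Ht.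
apply Rabs_def2 in Ht. lra.
Qed.

(** One inclusion is the uniqueness of the collision orbit over a given angle, the other its
    existence. The term mu d^2 cos th passes from the relative angular momentum to the canonical
    momentum. *)
Lemma DeltaS_graph M mu eta d TH LA h th Th :
  (forall p, valid p -> tame M (Avel p) /\ tame M (Bred p) /\ tame M (Bvel p)) -> 1 <= M ->
  0 < mu <= 1 / 100 -> - 1 / 8 <= eta <= 1 / 8 -> 0 < d <= 1 / 2 -> 16 * M * d <= 1 ->
  eta = h + mu ^ 2 / 2 -> collision_family M mu eta d TH LA ->
  (DeltaS_minus mu d h th Th <-> Th = d ^ 2 * LA th d - mu * d ^ 2 * cos th).
Proof.
intros HT HM Hmu He Hd HMd Eh [Hsol _].
assert (Hv : valid (mu, eta)) by (unfold valid; simpl; lra).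
destruct (HT _ Hv) as [TA [_ TB]]. assert (Hd2 : 0 < d ^ 2) by (apply pow_lt; lra).
split.
- intros [RR [HRR [HH [T [q1 [q2 [p1 [p2 [HT0 [Ho [I1 [I2 [I3 [I4 [Hr [L1 L2]]]]]]]]]]]]]]]].
  destruct (cart_to_polar mu T q1 q2 p1 p2 (d ^ 2) th HT0 Ho Hd2 I1 I2) as [r [ph [w [L [R0 [P0 Hp]]]]]].
  destruct (Hp 0 ltac:(lra)) as [_ [_ [_ [J3 J4]]]]. rewrite I3, R0, P0 in J3. rewrite I4, R0, P0 in J4.
  destruct (polar_init _ _ _ _ _ _ _ Hd2 J3 J4) as [Ew EL].
  assert (rr : forall t, 0 <= t < T -> rbar mu (q1 t) (q2 t) = r t).
  { intros t Ht. destruct (Hp t Ht) as [[Hrp _] [Q1 [Q2 _]]]. rewrite Q1, Q2. unfold rbar. apply dSun_polar; lra. }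
  assert (EU : L 0 = d ^ 2 * LA th d).
  { apply (collision_unique mu eta d T r ph w L th (TH th) (LA th) M); auto.
    - intros t Ht. apply Hp; auto.
    - rewrite R0, P0, Ew, EL, Eh, <- HH, Hbar_Jac by auto. ring.
    - intros t Ht. rewrite <- rr by lra. apply Hr; auto.
    - apply (filterlim_ext_loc (fun t => rbar mu (q1 t) (q2 t))); auto.
      apply (filter_imp (fun t => 0 < t < T)); [|apply at_left_between; auto]. intros t Ht. apply rr; lra. }
  lra.
- intros ->.
  destruct (collision_orbit mu eta d th (TH th) (LA th)) as [T [r [ph [w [L [HT0 [Hp [R0 [P0 [L0 [W0 [J0 [Hr [L1 L2]]]]]]]]]]]]]]; auto; try lra.
  { exists M; auto. }
  exists (w 0 - mu * sin th).
  (* A negative w does not suffice, since the canonical radial momentum is w - mu sin th. The Jacobi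
     integral gives (d w)^2 = Ssq >= 1, so w is large. *)
  assert (Hw : w 0 < - mu).
  { rewrite R0, P0 in J0.
    assert (E : (d * w 0) ^ 2 = Ssq (mu, eta) d th (LA th d)).
    { rewrite <- J0. unfold Jac, Ssq; cbn [fst snd]. rewrite L0. field. lra. }
    assert (B : 1 <= Ssq (mu, eta) d th (LA th d) <= 3).
    { apply Ssq_range; auto. split; [lra|]. apply (Hsol th). }
    rewrite <- E in B. assert (d * w 0 < 0) by nra. assert (d * w 0 <= -1) by nra. nra. }
  pose proof (SIN_bound th). split; [nra|]. split.
  { rewrite Hbar_Jac by auto.
    replace (w 0 - mu * sin th + mu * sin th) with (w 0) by ring.
    replace (d ^ 2 * LA th d - mu * d ^ 2 * cos th + mu * d ^ 2 * cos th) with (L 0) by (rewrite L0; ring).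
    rewrite <- R0, <- P0, J0, Eh. ring. }
  exists T, (fun t => cQ1 mu (r t) (ph t)), (fun t => cQ2 (r t) (ph t)),
    (fun t => cP1 (r t) (ph t) (w t) (L t)), (fun t => cP2 mu (r t) (ph t) (w t) (L t)).
  split; auto. split; [apply polar_to_cart; auto|].
  rewrite R0, P0. split; [reflexivity|]. split; [reflexivity|].
  rewrite <- L0. destruct (polar_init' mu (d ^ 2) th (w 0) (L 0) Hd2) as [K1 K2].
  split; [rewrite K1; auto|]. split; [rewrite K2; auto|].
  assert (rp : forall t, 0 <= t < T -> 0 < r t) by (intros t Ht; apply (Hp t Ht)).
  split; [|split].
  + intros t Ht. unfold rbar. rewrite dSun_polar by (left; apply rp; lra). apply Hr; auto.
  + apply (filterlim_ext_loc r); auto.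
    apply (filter_imp (fun t => 0 < t < T)); [|apply at_left_between; auto]. intros t Ht.
    unfold rbar. rewrite dSun_polar by (left; apply rp; lra). auto.
  + intros P [N HN].
    assert (Q : at_left T (fun t => w t < N - mu)) by (apply (L2 (fun x => x < N - mu)); exists (N - mu); auto).
    assert (Q2 := at_left_between 0 T HT0). unfold filtermap.
    apply (filter_imp (fun t => w t < N - mu /\ 0 < t < T)); [|apply filter_and; auto].
    intros t [Ht1 Ht2]. apply HN. rewrite Rbar_of_polar by (apply rp; lra).
    pose proof (SIN_bound (ph t)). nra.
Qed.

(** * Outgoing orbits *)

(** The bound is only asked strictly inside the interval: in a continuation argument the estimates
    are available before the current time but not yet at it. *)
Lemma open_derive_le (f g f' g' : R -> R) (a b : R) :
  a <= b ->
  (forall t, a <= t <= b -> is_derive f t (f' t)) ->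
  (forall t, a <= t <= b -> is_derive g t (g' t)) ->
  (forall t, a < t < b -> f' t <= g' t) ->
  f b - f a <= g b - g a.
Proof.
intros Hab Hf Hg Hle. destruct (Req_dec a b) as [->|Hn]; [lra|].
destruct (MVT_cor2 (fun t => g t - f t) (fun t => g' t - f' t) a b) as [c [E Hc]]; [lra| |].
- intros c Hc. apply is_derive_Reals.
  apply (is_derive_minus (V := R_NormedModule)); [apply Hg|apply Hf]; lra.
- specialize (Hle c Hc). nra.
Qed.

Lemma open_derive_abs (f g f' g' : R -> R) (a b : R) :
  a <= b ->
  (forall t, a <= t <= b -> is_derive f t (f' t)) ->
  (forall t, a <= t <= b -> is_derive g t (g' t)) ->
  (forall t, a < t < b -> Rabs (f' t) <= g' t) ->
  Rabs (f b - f a) <= g b - g a.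
Proof.
intros Hab Hf Hg Hle. apply Rabs_le. split.
- cut (- g b - - g a <= f b - f a); [lra|].
  apply (open_derive_le (fun t => - g t) f (fun t => - g' t) f'); auto.
  + intros t Ht. apply (is_derive_opp (V := R_NormedModule)); auto.
  + intros t Ht. specialize (Hle t Ht). apply Rabs_le_between in Hle. lra.
- apply (open_derive_le f g f' g'); auto.
  intros t Ht. specialize (Hle t Ht). apply Rabs_le_between in Hle. lra.
Qed.

Lemma open_derive_bound (f f' : R -> R) (c a b : R) :
  a <= b ->
  (forall t, a <= t <= b -> is_derive f t (f' t)) ->
  (forall t, a < t < b -> Rabs (f' t) <= c) ->
  Rabs (f b - f a) <= c * (b - a).
Proof.
intros Hab Hf Hle.
replace (c * (b - a)) with ((fun t => c * t) b - (fun t => c * t) a) by ring.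
apply (open_derive_abs f (fun t => c * t) f' (fun _ => c)); auto.
intros t Ht. auto_derive; auto. ring.
Qed.

Lemma bootstrap (P : R -> Prop) (a b : R) :
  (forall t, a <= t <= b -> P t -> locally t P) ->
  (forall t, a <= t <= b -> (forall s, a <= s < t -> P s) -> P t) ->
  forall t, a <= t <= b -> P t.
Proof.
intros Hop Hstep.
assert (H : forall t, a <= t < b + 1 -> t <= b -> P t).
{ apply (real_induction (fun t => t <= b -> P t)).
  - intros t Ht IH Htb. apply Hstep; [lra|]. intros s Hs. apply IH; lra.
  - intros t Ht IH. destruct (Rle_lt_dec t b) as [Htb|Htb].
    + destruct (Hop t ltac:(lra) (IH t ltac:(lra) Htb)) as [e He]. exists e. split; [apply cond_pos|].
      intros s Hs _ _. apply He. change (Rabs (s - t) < e). rewrite Rabs_pos_eq; lra.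
    + exists 1. split; [lra|]. intros; lra. }
intros t Ht. apply H; lra.
Qed.

Lemma locally_lt (f : R -> R) (t c : R) : continuous f t -> f t < c -> locally t (fun s => f s < c).
Proof.
intros Hc H. destruct (proj1 (continuous_eps f t) Hc (c - f t) ltac:(lra)) as [d [Hd H']].
exists (mkposreal d Hd). intros y Hy. specialize (H' y Hy). apply Rabs_def2 in H'. lra.
Qed.

Lemma locally_gt (f : R -> R) (t c : R) : continuous f t -> c < f t -> locally t (fun s => c < f s).
Proof.
intros Hc H. destruct (proj1 (continuous_eps f t) Hc (f t - c) ltac:(lra)) as [d [Hd H']].
exists (mkposreal d Hd). intros y Hy. specialize (H' y Hy). apply Rabs_def2 in H'. lra.
Qed.

Lemma left_limit_ge (f : R -> R) (a t c : R) : a < t -> continuous f t ->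
  (forall s, a <= s < t -> c <= f s) -> c <= f t.
Proof.
intros Hat Hc H. apply Rnot_lt_le. intros Hn. destruct (locally_lt f t c Hc Hn) as [e He].
set (s := Rmax a (t - e / 2)). assert (Hep := cond_pos e).
assert (Hs : a <= s < t /\ t - e < s) by (unfold s, Rmax; destruct Rle_dec; lra).
specialize (H s ltac:(lra)). assert (f s < c); [|lra]. apply He. change (Rabs (s - t) < e). rewrite Rabs_left; lra.
Qed.

Lemma is_derive_continuous (f : R -> R) t l : is_derive f t l -> continuous f t.
Proof. intros H. apply (ex_derive_continuous f). eexists; eauto. Qed.

(* Energy in the non-rotating heliocentric frame: up to O(mu) it equals L on the level of the Jacobi integral considered here. *)
Definition En (r w L : R) : R := w ^ 2 / 2 + L ^ 2 / (2 * r ^ 2) - / r.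

Lemma En_derive (r w L b Q : R -> R) t : r t <> 0 -> is_derive r t (w t) -> is_derive w t (b t) -> is_derive L t (Q t) ->
  is_derive (fun s => En (r s) (w s) (L s)) t
    (w t * (b t - ((L t) ^ 2 / (r t) ^ 3 - / (r t) ^ 2)) + L t * Q t / (r t) ^ 2).
Proof.
intros Hr H1 H2 H3.
assert (E1 : Derive (fun x => r x) t = _) by (apply is_derive_unique; exact H1).
assert (E2 : Derive (fun x => w x) t = _) by (apply is_derive_unique; exact H2).
assert (E3 : Derive (fun x => L x) t = _) by (apply is_derive_unique; exact H3).
unfold En. auto_derive.
- repeat split; try (eexists; eauto); auto.
  repeat apply Rmult_integral_contrapositive_currified; auto; lra.
- rewrite E1, E2, E3. field. auto.
Qed.

Lemma Dq_split r th : Dq r th = (r - cos th) ^ 2 + sin th ^ 2 /\ Dq r th = (1 - r) ^ 2 + 2 * r * (1 - cos th).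
Proof. unfold Dq. pose proof (sc1 th). split; [nra|ring]. Qed.

Lemma sin_le_id y : 0 <= y -> sin y <= y.
Proof.
intros H. assert (G := sin_lip 0 y). rewrite sin_0, !Rminus_0_r, (Rabs_pos_eq y) in G by auto.
pose proof (Rle_abs (sin y)). lra.
Qed.

Lemma cos_ge x : 1 - x ^ 2 / 2 <= cos x.
Proof.
assert (G : forall y, 0 <= y -> 1 - y ^ 2 / 2 <= cos y).
{ intros y Hy. assert (H := open_derive_le (fun t => 1 - t ^ 2 / 2) cos (fun t => - t) (fun t => - sin t) 0 y Hy).
  rewrite cos_0 in H. cut (1 - y ^ 2 / 2 - (1 - 0 ^ 2 / 2) <= cos y - 1); [lra|]. apply H.
  - intros t _. auto_derive; auto. field.
  - intros t _. auto_derive; auto. ring.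
  - intros t Ht. pose proof (sin_le_id t ltac:(lra)). lra. }
destruct (Rle_dec 0 x) as [H|H]; [auto|]. rewrite <- cos_neg. replace (x ^ 2) with ((- x) ^ 2) by ring. apply G. lra.
Qed.

Lemma sin_ge y : 0 <= y -> y - y ^ 3 / 6 <= sin y.
Proof.
intros Hy. assert (H := open_derive_le (fun t => t - t ^ 3 / 6) sin (fun t => 1 - t ^ 2 / 2) cos 0 y Hy).
rewrite sin_0 in H. cut (y - y ^ 3 / 6 - (0 - 0 ^ 3 / 6) <= sin y - 0); [lra|]. apply H.
- intros t _. auto_derive; auto. field.
- intros t _. auto_derive; auto. ring.
- intros t Ht. apply cos_ge.
Qed.

Lemma cos_le x : cos x <= 1 - x ^ 2 / 2 + x ^ 4 / 24.
Proof.
assert (G : forall y, 0 <= y -> cos y <= 1 - y ^ 2 / 2 + y ^ 4 / 24).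
{ intros y Hy. assert (H := open_derive_le cos (fun t => 1 - t ^ 2 / 2 + t ^ 4 / 24) (fun t => - sin t) (fun t => - t + t ^ 3 / 6) 0 y Hy).
  rewrite cos_0 in H. cut (cos y - 1 <= 1 - y ^ 2 / 2 + y ^ 4 / 24 - (1 - 0 ^ 2 / 2 + 0 ^ 4 / 24)); [lra|]. apply H.
  - intros t _. auto_derive; auto. ring.
  - intros t _. auto_derive; auto. field.
  - intros t Ht. pose proof (sin_ge t ltac:(lra)). lra. }
destruct (Rle_dec 0 x) as [H|H]; [auto|]. rewrite <- cos_neg. replace (x ^ 2) with ((- x) ^ 2) by ring.
replace (x ^ 4) with ((- x) ^ 4) by ring. apply G. lra.
Qed.

Lemma sin_lower x : Rabs x <= 1 -> Rabs x <= 2 * Rabs (sin x).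
Proof.
intros H. assert (G : forall y, 0 <= y <= 1 -> y <= 2 * sin y).
{ intros y Hy. pose proof (sin_ge y ltac:(lra)). assert (y ^ 3 <= y) by nra. lra. }
unfold Rabs at 1. destruct (Rcase_abs x) as [Hx|Hx].
- specialize (G (- x)). rewrite sin_neg in G. rewrite Rabs_left in H by lra. specialize (G ltac:(lra)).
  pose proof (Rle_abs (- sin x)). rewrite Rabs_Ropp in H0. lra.
- rewrite Rabs_pos_eq in H by lra. specialize (G x ltac:(lra)). pose proof (Rle_abs (sin x)). lra.
Qed.

Lemma sqrt2_bounds : 1.41 < sqrt 2 < 1.42.
Proof.
split.
- rewrite <- (sqrt_square 1.41) by lra. apply sqrt_lt_1; lra.
- rewrite <- (sqrt_square 1.42) by lra. apply sqrt_lt_1; lra.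
Qed.

Lemma Rabs_div_le x y k c : 0 < c -> c <= y -> Rabs x <= k -> Rabs (x / y) <= k / c.
Proof.
intros Hc Hy Hx. unfold Rdiv. rewrite Rabs_mult, (Rabs_pos_eq (/ y)) by (left; apply Rinv_0_lt_compat; lra).
apply Rmult_le_compat; auto; [apply Rabs_pos|left; apply Rinv_0_lt_compat; lra|].
apply Rinv_le_contravar; auto.
Qed.

Lemma inv_le_of c x : 0 < c -> / c <= x -> / x <= c.
Proof.
intros Hc H. rewrite <- (Rinv_inv c). apply Rinv_le_contravar; auto. apply Rinv_0_lt_compat; auto.
Qed.

(** Nearly radial and nearly parabolic motion has w^2 r close to 2, by the identity w^2 r / 2 - 1 =
    E r - L^2 / (2 r). The last term is harmless down to r = d^2 because m is much smaller than
    d^4. *)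
Lemma energy_speed d m r w L : 0 < d <= 1 / 1000 -> 0 < m <= d ^ 4 / 1000 -> d ^ 2 <= r <= 2 ->
  Rabs L <= 2 * m -> Rabs (En r w L) <= 2 * m ->
  Rabs (w ^ 2 * r / 2 - 1) <= 41 / 10 * m /\ 9 / 10 <= w ^ 2 /\ w ^ 2 * r <= 21 / 10.
Proof.
intros Hd Hm Hr HL HE. set (E := En r w L) in *.
assert (Hd2 : 0 < d ^ 2 <= / 1000000) by (split; [apply pow_lt; lra|nra]).
assert (Hd4 : d ^ 4 = d ^ 2 * d ^ 2) by ring.
assert (Ew : w ^ 2 * r / 2 - 1 = E * r - L ^ 2 / (2 * r)) by (unfold E, En; field; lra).
assert (HL2 : 0 <= L ^ 2 <= 4 * m ^ 2). { split; [apply pow2_ge_0|]. rewrite <- pow2_abs. pose proof (Rabs_pos L). nra. }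
assert (H1 : 0 <= L ^ 2 / (2 * r) <= m / 10).
{ split; [apply Rdiv_le_0_compat; lra|]. apply Rle_div_l; [lra|].
  assert (m ^ 2 <= m * (d ^ 4 / 1000)) by (replace (m ^ 2) with (m * m) by ring; apply Rmult_le_compat_l; lra).
  assert (m * d ^ 4 <= m * (/ 1000000 * d ^ 2)) by (apply Rmult_le_compat_l; [lra|]; rewrite Hd4; apply Rmult_le_compat_r; lra).
  assert (m * d ^ 2 <= m * r) by (apply Rmult_le_compat_l; lra). lra. }
apply Rabs_le_between in HE.
assert (H2 : Rabs (w ^ 2 * r / 2 - 1) <= 41 / 10 * m). { rewrite Ew.  assert (-(4 * m) <= E * r <= 4 * m) by (split; nra). apply Rabs_le. lra. }
assert (Hm1 : m <= / 1000000) by nra.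
assert (H3 := H2). apply Rabs_le_between in H3.
split; [auto|]. split; [|lra].  nra.
Qed.

Lemma abs_le_of_sq x y : 0 <= y -> x ^ 2 <= y ^ 2 -> Rabs x <= y.
Proof. intros Hy H. apply Rabs_le. split; nra. Qed.

Lemma abs_sub_one z : 0 <= z -> Rabs (z - 1) <= Rabs (z ^ 2 - 1).
Proof.
intros Hz. replace (z ^ 2 - 1) with ((z - 1) * (z + 1)) by ring. rewrite Rabs_mult, (Rabs_pos_eq (z + 1)) by lra.
pose proof (Rabs_pos (z - 1)). nra.
Qed.

Section Outgoing.
Variables (d m eps b : R) (r th w L a bb Q : R -> R).
Hypotheses (Hd : 0 < d <= 1 / 1000) (Hm : 0 < m <= d ^ 4 / 1000) (Heps : 0 <= eps <= m * d ^ 4 / 100) (Hb : 0 <= b).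
Hypothesis Hder : forall t, 0 <= t <= b -> is_derive r t (w t) /\ is_derive th t (a t) /\ is_derive w t (bb t) /\ is_derive L t (Q t).
(** Only bounds on the field away from the Sun and Jupiter enter, so that the same estimates apply
    to true orbits and to the truncated flow. *)
Hypothesis Hfld : forall t, 0 <= t <= b -> d ^ 2 <= r t <= 2 -> Rabs (L t) <= 1 -> (d ^ 4 / 10) ^ 2 <= Dq (r t) (th t) ->
  a t = L t / (r t) ^ 2 - 1 /\ Rabs (bb t - ((L t) ^ 2 / (r t) ^ 3 - / (r t) ^ 2)) <= eps /\ Rabs (Q t) <= eps.
Hypotheses (Hr2 : forall t, 0 <= t <= b -> r t <= 2) (Hr0 : r 0 = d ^ 2) (Hw0 : 0 < w 0).
(** The radial parabolic orbit needs the time [tp] from r = d^2 to r = 1, during which the rotating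
    frame turns by the angle [tp]. An angular momentum L adds, to leading order, the angle sqrt 2 L
    / d, the integral of L / r^2. Thus [miss] approximates the angular distance to Jupiter at r =
    1. *)
Let tp := sqrt 2 / 3 * (1 - d ^ 3).
Let miss := th 0 - tp + sqrt 2 * L 0 / d.
Hypotheses (Hth0 : Rabs (th 0 - tp) <= d ^ 4) (HL0 : Rabs (L 0) <= m) (HE0 : Rabs (En (r 0) (w 0) (L 0)) <= m)
  (Hmiss : d ^ 4 / 2 <= Rabs miss).

Let good t := 0 < r t /\ 1 / 2 < w t /\ Rabs (L t) < 2 * m /\ Rabs (En (r t) (w t) (L t)) < 2 * m /\ (d ^ 4 / 10) ^ 2 < Dq (r t) (th t).

(** The closing step of the continuation argument: while L and the energy stay small the radial
    speed is at least 1/2, so the leg lasts at most 4 time units and L and the energy move by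
    O(eps). The angle is then known as a function of r, and an encounter with Jupiter would make
    [miss] too small. *)
Lemma outgoing_est t : 0 <= t <= b -> (forall s, 0 <= s < t -> good s) ->
  d ^ 2 <= r t /\ 1 / 2 < w t /\ (d ^ 4 / 10) ^ 2 < Dq (r t) (th t) /\ t <= 4 /\
  Rabs (L t - L 0) <= 4 * eps /\ Rabs (En (r t) (w t) (L t) - En (r 0) (w 0) (L 0)) <= 6 * eps /\ Rabs (th t) <= 3.
Proof.
intros Ht IH.
assert (Hd2 : 0 < d ^ 2 <= / 1000000) by (split; [apply pow_lt; lra|nra]).
assert (Hd4 : 0 < d ^ 4 <= / 1000000 * d ^ 2) by (replace (d ^ 4) with (d ^ 2 * d ^ 2) by ring; nra).
assert (Hm1 : m <= / 1000000000) by nra.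
assert (He1 : eps <= m / 1000000000) by nra.
assert (Hrge : forall s, 0 <= s <= t -> d ^ 2 <= r s).
{ intros s Hs. rewrite <- Hr0. assert (0 - 0 <= r s - r 0); [|lra].
  apply (open_derive_le (fun _ => 0) r (fun _ => 0) w); try lra.
  - intros; apply @is_derive_const.
  - intros u Hu. apply Hder; lra.
  - intros u Hu. destruct (IH u ltac:(lra)) as [_ [H _]]. lra. }
assert (Hf : forall s, 0 < s < t -> a s = L s / (r s) ^ 2 - 1 /\ Rabs (bb s - ((L s) ^ 2 / (r s) ^ 3 - / (r s) ^ 2)) <= eps /\ Rabs (Q s) <= eps).
{ intros s Hs. destruct (IH s ltac:(lra)) as [G1 [G2 [G3 [G4 G5]]]].
  apply Hfld; try lra. split; [apply Hrge; lra|apply Hr2; lra]. }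
assert (Ht4 : t <= 4).
{ assert (G : (fun s => s / 2) t - (fun s => s / 2) 0 <= r t - r 0).
  { apply (open_derive_le (fun s => s / 2) r (fun _ => 1 / 2) w); try lra.
    - intros; auto_derive; auto; field.
    - intros u Hu. apply Hder; lra.
    - intros u Hu. destruct (IH u ltac:(lra)) as [_ [H _]]. lra. }
  cbv beta in G. specialize (Hr2 t Ht). lra. }
assert (GL : Rabs (L t - L 0) <= 4 * eps).
{ apply Rle_trans with (eps * (t - 0)); [|nra].
  apply (open_derive_bound L Q); try lra.
  - intros u Hu. apply Hder; lra.
  - intros u Hu. apply Hf; lra. }
assert (GE : Rabs (En (r t) (w t) (L t) - En (r 0) (w 0) (L 0)) <= 6 * eps).
{ apply Rle_trans with ((fun s => 3 * eps * r s) t - (fun s => 3 * eps * r s) 0).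
  - apply (open_derive_abs (fun s => En (r s) (w s) (L s)) (fun s => 3 * eps * r s)
      (fun s => w s * (bb s - ((L s) ^ 2 / (r s) ^ 3 - / (r s) ^ 2)) + L s * Q s / (r s) ^ 2) (fun s => 3 * eps * w s)); try lra.
    + intros u Hu. specialize (Hrge u Hu). apply En_derive; try (apply Hder; lra). lra.
    + intros u Hu. apply (is_derive_scal r u). apply Hder; lra.
    + intros u Hu. destruct (IH u ltac:(lra)) as [G1 [G2 [G3 [G4 G5]]]]. destruct (Hf u Hu) as [F1 [F2 F3]].
      specialize (Hrge u ltac:(lra)).
      eapply Rle_trans; [apply Rabs_triang|].
      assert (A1 : Rabs (w u * (bb u - (L u ^ 2 / r u ^ 3 - / r u ^ 2))) <= w u * eps).
      { rewrite Rabs_mult, (Rabs_pos_eq (w u)) by lra. apply Rmult_le_compat_l; lra. }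
      assert (A2 : Rabs (L u * Q u / r u ^ 2) <= 1 * eps).
      { replace (L u * Q u / r u ^ 2) with ((L u / r u ^ 2) * Q u) by (field; lra). rewrite Rabs_mult.
        apply Rmult_le_compat; auto; try apply Rabs_pos.
        apply Rle_trans with (2 * m / (d ^ 2) ^ 2).
        - apply Rabs_div_le; [apply pow_lt; lra|apply pow_incr; lra|lra].
        - apply Rle_div_l; [apply pow_lt; lra|]. replace ((d ^ 2) ^ 2) with (d ^ 4) by ring. lra. }
      nra.
  - cbv beta. specialize (Hr2 t Ht). rewrite Hr0. nra. }
assert (Lt : Rabs (L t) <= 2 * m).
{ replace (L t) with ((L t - L 0) + L 0) by ring. eapply Rle_trans; [apply Rabs_triang|]. lra. }
assert (Et : Rabs (En (r t) (w t) (L t)) <= 2 * m).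
{ replace (En (r t) (w t) (L t)) with ((En (r t) (w t) (L t) - En (r 0) (w 0) (L 0)) + En (r 0) (w 0) (L 0)) by ring.
  eapply Rle_trans; [apply Rabs_triang|]. lra. }
assert (Hrt := Hrge t ltac:(lra)). assert (Hrt2 := Hr2 t Ht).
destruct (energy_speed d m (r t) (w t) (L t) Hd Hm ltac:(lra) Lt Et) as [_ [Hw2 _]].
assert (Hwt : 1 / 2 < w t).
{ assert (0 < w t); [|nra]. destruct (Req_dec t 0) as [->|Hn]; [auto|].
  assert (1 / 2 <= w t); [|lra]. apply (left_limit_ge w 0 t); [lra| |].
  - apply (is_derive_continuous w t (bb t)). apply Hder; lra.
  - intros s Hs. destruct (IH s Hs) as [_ [H _]]. lra. }
pose proof sqrt2_bounds as S2. assert (SS : sqrt 2 * sqrt 2 = 2) by (apply sqrt_sqrt; lra).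
(* The angle minus its value predicted by parabolic motion with r as clock, dr/dt = sqrt(2 / r). It
   is constant up to O(m). *)
set (Psi := fun s => th s - sqrt 2 * L 0 * (/ d - / sqrt (r s)) + sqrt 2 / 3 * (r s * sqrt (r s) - d ^ 3)).
assert (GP : Rabs (Psi t - Psi 0) <= 20 * m).
{ apply Rle_trans with (5 * m * (t - 0)); [|nra].
  apply (open_derive_bound Psi (fun s => a s - sqrt 2 * L 0 * (w s / (2 * r s * sqrt (r s))) + sqrt 2 / 2 * sqrt (r s) * w s)); try lra.
  - intros u Hu. specialize (Hrge u Hu). destruct (Hder u ltac:(lra)) as [D1 [D2 _]].
    assert (E1 : Derive (fun x => r x) u = _) by (apply is_derive_unique; exact D1).
    assert (E2 : Derive (fun x => th x) u = _) by (apply is_derive_unique; exact D2).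
    assert (Hs : 0 < sqrt (r u)) by (apply sqrt_lt_R0; lra).
    assert (Hss : r u = sqrt (r u) * sqrt (r u)) by (rewrite sqrt_sqrt; lra).
    unfold Psi. auto_derive.
    + repeat split; try (eexists; eauto); try lra.
    + rewrite E1, E2. set (x := sqrt (r u)) in *. rewrite Hss. field. lra.
  - intros u Hu. destruct (IH u ltac:(lra)) as [G1 [G2 [G3 [G4 G5]]]]. destruct (Hf u Hu) as [F1 _].
    assert (Hru := Hrge u ltac:(lra)). assert (Hru2 := Hr2 u ltac:(lra)).
    assert (GLu : Rabs (L u - L 0) <= 4 * eps).
    { apply Rle_trans with (eps * (u - 0)); [|nra].
      apply (open_derive_bound L Q); try lra.
      - intros x Hx. apply Hder; lra.
      - intros x Hx. apply Hf; lra. }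
    destruct (energy_speed d m (r u) (w u) (L u) Hd Hm ltac:(lra) ltac:(lra) ltac:(lra)) as [Hk _].
    assert (Hs : 0 < sqrt (r u)) by (apply sqrt_lt_R0; lra).
    assert (Hss : sqrt (r u) * sqrt (r u) = r u) by (rewrite sqrt_sqrt; lra).
    set (x := sqrt (r u)) in *. set (z := sqrt 2 / 2 * x * w u).
    assert (Hz : 0 <= z) by (unfold z; apply Rmult_le_pos; nra).
    assert (Hz2 : z ^ 2 = w u ^ 2 * r u / 2).
    { unfold z. transitivity ((sqrt 2 * sqrt 2) / 4 * (x * x) * w u ^ 2); [field|]. rewrite SS, Hss. field. }
    assert (Hz1 := abs_sub_one z Hz). rewrite Hz2 in Hz1.
    replace (a u - sqrt 2 * L 0 * (w u / (2 * r u * x)) + z) with ((L u - L 0) / r u ^ 2 + - (z - 1) * (L 0 / r u ^ 2 - 1)).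
    2:{ rewrite F1. unfold z. rewrite <- Hss. field. lra. }
    eapply Rle_trans; [apply Rabs_triang|]. rewrite Rabs_mult, Rabs_Ropp.
    assert (A1 : Rabs ((L u - L 0) / r u ^ 2) <= m / 10).
    { apply Rle_trans with (4 * eps / (d ^ 2) ^ 2).
      - apply Rabs_div_le; [apply pow_lt; lra|apply pow_incr; lra|lra].
      - apply Rle_div_l; [apply pow_lt; lra|]. replace ((d ^ 2) ^ 2) with (d ^ 4) by ring. nra. }
    assert (A2 : Rabs (L 0 / r u ^ 2 - 1) <= 101 / 100).
    { unfold Rminus. eapply Rle_trans; [apply Rabs_triang|]. rewrite Rabs_Ropp, Rabs_R1.
      assert (Rabs (L 0 / r u ^ 2) <= / 100); [|lra].
      apply Rle_trans with (m / (d ^ 2) ^ 2).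
      - apply Rabs_div_le; [apply pow_lt; lra|apply pow_incr; lra|lra].
      - apply Rle_div_l; [apply pow_lt; lra|]. replace ((d ^ 2) ^ 2) with (d ^ 4) by ring. lra. }
    pose proof (Rabs_pos (z - 1)). pose proof (Rabs_pos (L 0 / r u ^ 2 - 1)). nra. }
assert (P0 : Psi 0 = th 0).
{ unfold Psi. rewrite Hr0, sqrt_pow2 by lra. replace (d ^ 2 * d) with (d ^ 3) by ring. field. lra. }
rewrite P0 in GP.
set (x := sqrt (r t)) in *.
assert (Hx : 0 < x) by (apply sqrt_lt_R0; lra).
assert (Hxx : x * x = r t) by (unfold x; rewrite sqrt_sqrt; lra).
assert (Hxd : d <= x). { apply Rnot_lt_le. intros Hn. nra. }
assert (HLx : Rabs (sqrt 2 * L 0 * / x) <= 2 / 1000).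
{ rewrite !Rabs_mult, (Rabs_pos_eq (sqrt 2)), Rabs_inv, (Rabs_pos_eq x) by lra.
  assert (/ x <= / d) by (apply Rinv_le_contravar; lra).
  assert (0 < / x) by (apply Rinv_0_lt_compat; lra).
  assert (m * / d <= / 1000). { apply Rle_trans with (d ^ 4 / 1000 * / d); [apply Rmult_le_compat_r; [left; apply Rinv_0_lt_compat|]; lra|].
    replace (d ^ 4 / 1000 * / d) with (d ^ 3 / 1000) by (field; lra). assert (d ^ 3 <= 1) by nra. lra. }
  pose proof (Rabs_pos (L 0)). assert (Rabs (L 0) * / x <= m * / d) by (apply Rmult_le_compat; lra).
   nra. }
assert (Hmd : Rabs (sqrt 2 * L 0 / d) <= 2 / 1000).
{ unfold Rdiv. rewrite !Rabs_mult, (Rabs_pos_eq (sqrt 2)), Rabs_inv, (Rabs_pos_eq d) by lra.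
  assert (0 < / d) by (apply Rinv_0_lt_compat; lra).
  assert (m * / d <= / 1000). { apply Rle_trans with (d ^ 4 / 1000 * / d); [apply Rmult_le_compat_r; [left; apply Rinv_0_lt_compat|]; lra|].
    replace (d ^ 4 / 1000 * / d) with (d ^ 3 / 1000) by (field; lra). assert (d ^ 3 <= 1) by nra. lra. }
   assert (Rabs (L 0) * / d <= m * / d) by (apply Rmult_le_compat_r; lra).
   nra. }
assert (Eth : th t = (Psi t - th 0) + miss - sqrt 2 * L 0 * / x + sqrt 2 / 3 * (1 - r t * x)).
{ unfold Psi, miss, tp. fold x. field. lra. }
assert (Hmiss2 : Rabs miss <= 3 / 1000).
{ unfold miss. eapply Rle_trans; [apply Rabs_triang|]. lra. }
assert (Hx2 : x <= 15 / 10) by (apply Rnot_lt_le; intros Hn; nra).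
split; [auto|]. split; [auto|]. split; [|split; [auto|split; [auto|split; [auto|]]]].
2:{ rewrite Eth. apply Rabs_le_between in HLx. apply Rabs_le_between in Hmiss2. apply Rabs_le_between in GP.
  apply Rabs_le. assert (0 <= r t * x <= 3) by nra. split; nra. }
apply Rnot_le_lt. intros HD. set (d0 := d ^ 4 / 10) in *.
destruct (Dq_split (r t) (th t)) as [Sp1 Sp2].
pose proof (COS_bound (th t)) as CB.
assert (Hd0 : 0 < d0 <= / 1000000) by (unfold d0; lra).
assert (R1 : Rabs (r t - 1) <= d0).
{ apply abs_le_of_sq; [lra|]. assert (0 <= 2 * r t * (1 - cos (th t))) by (apply Rmult_le_pos; lra).
  replace ((r t - 1) ^ 2) with ((1 - r t) ^ 2) by ring. lra. }
apply Rabs_le_between in R1.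
assert (X1 : Rabs (x - 1) <= d0).
{ eapply Rle_trans; [apply abs_sub_one; lra|]. replace (x ^ 2) with (r t) by (rewrite <- Hxx; ring). apply Rabs_le; lra. }
apply Rabs_le_between in X1.
assert (Xx : Rabs (1 - r t * x) <= 21 / 10 * d0).
{ replace (1 - r t * x) with (- (r t - 1) - (x - 1) - (r t - 1) * (x - 1)) by ring.
  assert (Rabs ((r t - 1) * (x - 1)) <= d0 * d0).
  { rewrite Rabs_mult. apply Rmult_le_compat; try apply Rabs_pos; apply Rabs_le; lra. }
  assert (d0 * d0 <= d0 * / 1000) by (apply Rmult_le_compat_l; lra). apply Rabs_le_between in H. apply Rabs_le. lra. }
assert (Sn : Rabs (sin (th t)) <= d0).
{ apply abs_le_of_sq; [lra|]. assert (0 <= (r t - cos (th t)) ^ 2) by apply pow2_ge_0. lra. }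
assert (HX : Rabs (sqrt 2 / 3 * (1 - r t * x)) <= d0).
{ rewrite Rabs_mult, (Rabs_pos_eq (sqrt 2 / 3)) by lra. apply Rle_trans with (0.475 * (21 / 10 * d0)); [|lra].
  apply Rmult_le_compat; try lra. apply Rabs_pos. }
assert (Th1 : Rabs (th t) <= 1).
{ rewrite Eth. apply Rabs_le_between in HLx. apply Rabs_le_between in Hmiss2. apply Rabs_le_between in GP. apply Rabs_le_between in HX.
  apply Rabs_le. split; lra. }
assert (Th2 := sin_lower _ Th1).
assert (HLx' : Rabs (sqrt 2 * L 0 * / x) <= 2 * m).
{ rewrite !Rabs_mult, (Rabs_pos_eq (sqrt 2)), Rabs_inv, (Rabs_pos_eq x) by lra.
  assert (/ x <= 1.001). { apply inv_le_of; [lra|].  lra. }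
  assert (0 < / x) by (apply Rinv_0_lt_compat; lra). pose proof (Rabs_pos (L 0)).
  apply Rle_trans with (1.42 * m * 1.001); [|lra].
  apply Rmult_le_compat; try lra; [apply Rmult_le_pos; lra|]. apply Rmult_le_compat; lra. }
assert (Rabs miss <= Rabs (th t) + Rabs (Psi t - th 0) + Rabs (sqrt 2 * L 0 * / x) + Rabs (sqrt 2 / 3 * (1 - r t * x))).
{ replace miss with (th t - (Psi t - th 0) + sqrt 2 * L 0 * / x - sqrt 2 / 3 * (1 - r t * x)) by (rewrite Eth; ring).
  unfold Rabs. repeat destruct Rcase_abs; lra. }
assert (d0 = d ^ 4 / 10) by reflexivity. lra.
Qed.

Lemma outgoing_leg t : 0 <= t <= b ->
  d ^ 2 <= r t /\ 1 / 2 < w t /\ (d ^ 4 / 10) ^ 2 < Dq (r t) (th t) /\ t <= 4 /\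
  Rabs (L t - L 0) <= 4 * eps /\ Rabs (En (r t) (w t) (L t) - En (r 0) (w 0) (L 0)) <= 6 * eps /\ Rabs (th t) <= 3.
Proof.
assert (Hd2 : 0 < d ^ 2) by (apply pow_lt; lra).
assert (He1 : eps <= m / 100).
{ assert (d ^ 4 <= 1) by (replace 1 with (1 ^ 4) by ring; apply pow_incr; lra).
  assert (m * d ^ 4 <= m * 1) by (apply Rmult_le_compat_l; lra). lra. }
assert (H : forall t, 0 <= t <= b -> good t).
{ apply bootstrap.
  - intros u Hu [G1 [G2 [G3 [G4 G5]]]]. destruct (Hder u Hu) as [D1 [D2 [D3 D4]]].
    unfold good. repeat apply filter_and.
    + apply locally_gt; auto. eapply is_derive_continuous; eauto.
    + apply locally_gt; auto. eapply is_derive_continuous; eauto.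
    + apply (locally_lt (fun s => Rabs (L s))); auto. apply (continuous_comp L Rabs); [eapply is_derive_continuous; eauto|apply continuous_Rabs].
    + apply (locally_lt (fun s => Rabs (En (r s) (w s) (L s)))); auto. apply (continuous_comp (fun s => En (r s) (w s) (L s)) Rabs); [|apply continuous_Rabs].
      eapply is_derive_continuous. apply En_derive; eauto. lra.
    + apply (locally_gt (fun s => Dq (r s) (th s))); auto.
      apply (ex_derive_continuous (fun s => Dq (r s) (th s))). unfold Dq. auto_derive. repeat split; eexists; eauto.
  - intros u Hu IH. destruct (outgoing_est u Hu IH) as [E1 [E2 [E3 [E4 [E5 [E6 E7]]]]]].
    unfold good. split; [lra|]. split; [auto|]. split; [|split; [|auto]].
    + replace (L u) with ((L u - L 0) + L 0) by ring. eapply Rle_lt_trans; [apply Rabs_triang|]. lra.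
    + replace (En (r u) (w u) (L u)) with ((En (r u) (w u) (L u) - En (r 0) (w 0) (L 0)) + En (r 0) (w 0) (L 0)) by ring.
      eapply Rle_lt_trans; [apply Rabs_triang|]. lra. }
intros Ht. apply outgoing_est; auto. intros s Hs. apply H; lra.
Qed.
End Outgoing.

(** * Hyperbolic orbits escape *)

Lemma cauchy_schwarz x1 x2 y1 y2 : x1 * y1 + x2 * y2 <= sqrt (x1 ^ 2 + x2 ^ 2) * sqrt (y1 ^ 2 + y2 ^ 2).
Proof.
assert (0 <= x1 ^ 2) by apply pow2_ge_0. assert (0 <= x2 ^ 2) by apply pow2_ge_0.
assert (0 <= y1 ^ 2) by apply pow2_ge_0. assert (0 <= y2 ^ 2) by apply pow2_ge_0.
rewrite <- sqrt_mult by lra.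
apply Rle_trans with (Rabs (x1 * y1 + x2 * y2)); [apply Rle_abs|].
rewrite <- sqrt_Rsqr_abs. apply sqrt_le_1.
- apply Rle_0_sqr.
- apply Rmult_le_pos; lra.
- unfold Rsqr. assert (0 <= (x1 * y2 - x2 * y1) ^ 2) by apply pow2_ge_0. nra.
Qed.

Lemma attraction_bound q1 q2 x1 x2 rho dd lo : 0 < lo <= dd -> rho = sqrt (q1 ^ 2 + q2 ^ 2) -> dd = sqrt (x1 ^ 2 + x2 ^ 2) ->
  (q1 * x1 + q2 * x2) / dd ^ 3 <= rho / lo ^ 2.
Proof.
intros Hlo Hr Hd. assert (0 <= rho) by (rewrite Hr; apply sqrt_pos).
apply Rle_trans with (rho * dd / dd ^ 3).
- apply Rmult_le_compat_r; [left; apply Rinv_0_lt_compat, pow_lt; lra|]. rewrite Hr, Hd. apply cauchy_schwarz.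
- replace (rho * dd / dd ^ 3) with (rho / dd ^ 2) by (field; lra).
  apply Rmult_le_compat_l; auto. apply Rinv_le_contravar; [apply pow_lt; lra|apply pow_incr; lra].
Qed.

(** The distances to the Sun and to Jupiter are at least rho - mu and rho - 1. Beyond rho = 1.8 the
    quotient (rho / (rho - 1))^2 is below 6, so Jupiter only changes the effective mass by O(mu). *)
Lemma escape_force mu rho : 0 < mu <= 1 / 100 -> 18 / 10 <= rho ->
  (1 - mu) * (rho / (rho - mu) ^ 2) + mu * (rho / (rho - 1) ^ 2) <= (1 + 10 * mu) / rho.
Proof.
intros Hm Hr.
assert (A : rho / (rho - mu) ^ 2 <= (1 + 3 * mu) / rho).
{ apply Rle_div_l; [apply pow_lt; lra|]. replace ((1 + 3 * mu) / rho * (rho - mu) ^ 2) with ((1 + 3 * mu) * (rho - mu) ^ 2 / rho) by (field; lra).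
  apply Rle_div_r; [lra|].
  assert (rho * (1 - mu * 10 / 18) <= rho - mu) by nra.
  assert (0 <= rho * (1 - mu * 10 / 18)) by (apply Rmult_le_pos; lra).
  assert ((rho * (1 - mu * 10 / 18)) ^ 2 <= (rho - mu) ^ 2) by (apply pow_incr; lra).


  apply Rle_trans with ((1 + 3 * mu) * (rho * (1 - mu * 10 / 18)) ^ 2).
  - replace ((1 + 3 * mu) * (rho * (1 - mu * 10 / 18)) ^ 2) with (rho ^ 2 * ((1 + 3 * mu) * (1 - mu * 10 / 18) ^ 2)) by ring. nra.
  - apply Rmult_le_compat_l; lra. }
assert (B : rho / (rho - 1) ^ 2 <= 6 / rho).
{ apply Rle_div_l; [apply pow_lt; lra|]. replace (6 / rho * (rho - 1) ^ 2) with (6 * (rho - 1) ^ 2 / rho) by (field; lra).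
  apply Rle_div_r; [lra|]. nra. }
apply Rle_trans with ((1 - mu) * ((1 + 3 * mu) / rho) + mu * (6 / rho)).
- apply Rplus_le_compat; apply Rmult_le_compat_l; lra.
- replace ((1 - mu) * ((1 + 3 * mu) / rho) + mu * (6 / rho)) with (((1 - mu) * (1 + 3 * mu) + 6 * mu) / rho) by (field; lra).
  apply Rmult_le_compat_r; [left; apply Rinv_0_lt_compat; lra|nra].
Qed.

Lemma sqrt_lower x y : 0 <= y -> y ^ 2 <= x -> y <= sqrt x.
Proof. intros Hy H. rewrite <- (sqrt_pow2 y) by auto. apply sqrt_le_1; auto. apply pow2_ge_0. pose proof (pow2_ge_0 y). lra. Qed.

(** The momenta are velocities in the non-rotating frame, hence the rotation drops out of N' = 2 Y.
    The monitored quantity is the radial energy Y^2 / (2 N) - (1 + 10 mu) / sqrt N: while Y > 0 it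
    does not decrease, because the transverse velocity helps and the attraction is at most that of
    the mass 1 + 10 mu. Being positive, it prevents Y from reaching 0, so the distance keeps
    growing. *)
Lemma escape mu q1 q2 p1 p2 t0 T : 0 < mu <= 1 / 100 ->
  is_orbit mu q1 q2 p1 p2 (fun t => t0 <= t < T) ->
  let N := fun t => (q1 t) ^ 2 + (q2 t) ^ 2 in let Y := fun t => q1 t * p1 t + q2 t * p2 t in
  (18 / 10) ^ 2 <= N t0 -> 0 < Y t0 -> 0 < (Y t0) ^ 2 / (2 * N t0) - (1 + 10 * mu) / sqrt (N t0) ->
  forall t, t0 <= t < T -> (18 / 10) ^ 2 <= N t.
Proof.
intros Hmu Ho N Y HN0 HY0 HH0.
set (H := fun t => (Y t) ^ 2 / (2 * N t) - (1 + 10 * mu) / sqrt (N t)). change (0 < H t0) in HH0.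
set (F1 := fun t => - (1 - mu) * (q1 t + mu) / (dSun mu (q1 t) (q2 t)) ^ 3 - mu * (q1 t - (1 - mu)) / (dJup mu (q1 t) (q2 t)) ^ 3).
set (F2 := fun t => - (1 - mu) * q2 t / (dSun mu (q1 t) (q2 t)) ^ 3 - mu * q2 t / (dJup mu (q1 t) (q2 t)) ^ 3).
assert (DN : forall t, t0 <= t < T -> is_derive N t (2 * Y t)).
{ intros t Ht. destruct (Ho t Ht) as [_ [_ [D1 [D2 _]]]].
  assert (E1 : Derive (fun x => q1 x) t = _) by (apply is_derive_unique; exact D1).
  assert (E2 : Derive (fun x => q2 x) t = _) by (apply is_derive_unique; exact D2).
  unfold N, Y. auto_derive; [repeat split; eexists; eauto|]. rewrite E1, E2. ring. }
assert (DY : forall t, t0 <= t < T -> is_derive Y t ((p1 t) ^ 2 + (p2 t) ^ 2 + (q1 t * F1 t + q2 t * F2 t))).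
{ intros t Ht. destruct (Ho t Ht) as [_ [_ [D1 [D2 [D3 D4]]]]].
  assert (E1 : Derive (fun x => q1 x) t = _) by (apply is_derive_unique; exact D1).
  assert (E2 : Derive (fun x => q2 x) t = _) by (apply is_derive_unique; exact D2).
  assert (E3 : Derive (fun x => p1 x) t = _) by (apply is_derive_unique; exact D3).
  assert (E4 : Derive (fun x => p2 x) t = _) by (apply is_derive_unique; exact D4).
  unfold Y. auto_derive; [repeat split; eexists; eauto|]. rewrite E1, E2, E3, E4. unfold F1, F2, Rdiv. ring. }
assert (DH : forall t, t0 <= t < T -> 0 < N t -> is_derive H t (Y t / N t * ((p1 t) ^ 2 + (p2 t) ^ 2 - (Y t) ^ 2 / N t + (q1 t * F1 t + q2 t * F2 t) + (1 + 10 * mu) / sqrt (N t)))).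
{ intros t Ht HN. assert (Hs := sqrt_lt_R0 _ HN). assert (HNs : N t = sqrt (N t) * sqrt (N t)) by (rewrite sqrt_sqrt; lra).
  assert (E1 : Derive (fun x => N x) t = _) by (apply is_derive_unique; apply DN; auto).
  assert (E2 : Derive (fun x => Y x) t = _) by (apply is_derive_unique; apply DY; auto).
  unfold H. auto_derive.
  - repeat split; try (eexists; eauto); try lra.
  - rewrite E1, E2. set (s := sqrt (N t)) in *. rewrite HNs. field. lra. }
assert (Force : forall t, (18 / 10) ^ 2 <= N t -> 0 <= q1 t * F1 t + q2 t * F2 t + (1 + 10 * mu) / sqrt (N t)).
{ intros t HN. set (rho := sqrt (N t)). assert (Hrho : 18 / 10 <= rho) by (apply sqrt_lower; lra).
  assert (Hrr : rho * rho = N t) by (unfold rho; apply sqrt_sqrt; lra).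
  assert (Hq : - rho <= q1 t <= rho).
  { apply Rabs_le_between. apply abs_le_of_sq; [lra|].  unfold N in Hrr. nra. }
  assert (BS : rho - mu <= dSun mu (q1 t) (q2 t)).
  { apply sqrt_lower; [lra|]. unfold N in Hrr. nra. }
  assert (BJ : rho - 1 <= dJup mu (q1 t) (q2 t)).
  { apply sqrt_lower; [lra|]. unfold N in Hrr. nra. }
  assert (A1 := attraction_bound (q1 t) (q2 t) (q1 t + mu) (q2 t) rho (dSun mu (q1 t) (q2 t)) (rho - mu) ltac:(lra) eq_refl eq_refl).
  assert (A2 := attraction_bound (q1 t) (q2 t) (q1 t - (1 - mu)) (q2 t) rho (dJup mu (q1 t) (q2 t)) (rho - 1) ltac:(lra) eq_refl eq_refl).
  assert (A3 := escape_force mu rho Hmu Hrho).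
  replace (q1 t * F1 t + q2 t * F2 t) with (- ((1 - mu) * ((q1 t * (q1 t + mu) + q2 t * q2 t) / dSun mu (q1 t) (q2 t) ^ 3)
     + mu * ((q1 t * (q1 t - (1 - mu)) + q2 t * q2 t) / dJup mu (q1 t) (q2 t) ^ 3))) by (unfold F1, F2, Rdiv; ring).
  assert ((1 - mu) * ((q1 t * (q1 t + mu) + q2 t * q2 t) / dSun mu (q1 t) (q2 t) ^ 3) <= (1 - mu) * (rho / (rho - mu) ^ 2)) by (apply Rmult_le_compat_l; lra).
  assert (mu * ((q1 t * (q1 t - (1 - mu)) + q2 t * q2 t) / dJup mu (q1 t) (q2 t) ^ 3) <= mu * (rho / (rho - 1) ^ 2)) by (apply Rmult_le_compat_l; lra).
  lra. }
assert (Est : forall t, t0 <= t < T -> (forall s, t0 <= s < t -> 0 < Y s) -> N t0 <= N t /\ H t0 <= H t).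
{ intros t Ht IH.
  assert (GN : forall s, t0 <= s <= t -> N t0 <= N s).
  { intros s Hs. assert (0 - 0 <= N s - N t0); [|lra].
    apply (open_derive_le (fun _ => 0) N (fun _ => 0) (fun u => 2 * Y u)); try lra.
    - intros; apply @is_derive_const.
    - intros; apply DN; lra.
    - intros u Hu. specialize (IH u ltac:(lra)). lra. }
  split; [apply GN; lra|].
  assert (0 - 0 <= H t - H t0); [|lra].
  apply (open_derive_le (fun _ => 0) H (fun _ => 0) (fun t => Y t / N t * ((p1 t) ^ 2 + (p2 t) ^ 2 - (Y t) ^ 2 / N t + (q1 t * F1 t + q2 t * F2 t) + (1 + 10 * mu) / sqrt (N t)))); try lra.
  - intros; apply @is_derive_const.
  - intros u Hu. apply DH; [lra|]. specialize (GN u Hu). lra.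
  - intros u Hu. specialize (GN u ltac:(lra)). specialize (IH u ltac:(lra)). specialize (Force u ltac:(lra)).
    assert (HNu : 0 < N u) by lra.
    assert (CS : (Y u) ^ 2 / N u <= (p1 u) ^ 2 + (p2 u) ^ 2).
    { apply Rle_div_l; auto. unfold Y, N. assert (0 <= (q1 u * p2 u - q2 u * p1 u) ^ 2) by apply pow2_ge_0. nra. }
    apply Rmult_le_pos; [|lra]. left. apply Rdiv_lt_0_compat; auto. }
assert (HY : forall t b, t0 <= t <= b -> b < T -> 0 < Y t).
{ intros t b Htb HbT. apply (bootstrap (fun t => 0 < Y t) t0 b); [| |lra].
  - intros u Hu HYu. apply locally_gt; auto. eapply is_derive_continuous. apply DY; lra.
  - intros u Hu IH. destruct (Req_dec u t0) as [->|Hn]; [auto|].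
    destruct (Est u ltac:(lra) IH) as [G1 G2].
    assert (G3 : 0 <= Y u).
    { apply (left_limit_ge Y t0 u); [lra| |].
      - eapply is_derive_continuous. apply DY; lra.
      - intros s Hs. left; auto. }
    destruct (Req_dec (Y u) 0) as [E|E]; [|lra]. exfalso.
    assert (HNu : 0 < N u) by lra. assert (Hs := sqrt_lt_R0 _ HNu).
    assert (H u < 0); [|lra]. unfold H. rewrite E.
    replace (0 ^ 2 / (2 * N u) - (1 + 10 * mu) / sqrt (N u)) with (- ((1 + 10 * mu) / sqrt (N u))) by (field; lra).
    assert (0 < (1 + 10 * mu) / sqrt (N u)) by (apply Rdiv_lt_0_compat; lra). lra. }
intros t Ht. destruct (Est t Ht) as [G _]; [|lra].
intros s Hs. apply (HY s t); lra.
Qed.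

(** Both numerators are components, in suitable orthonormal frames, of the displacement to Jupiter,
    hence at most sqrt(Dq). Allowing any X above Dq covers the truncated denominator. *)
Lemma jupiter_force r th X : Dq r th <= X -> 0 < X ->
  Rabs ((cos th - r) * / sqrt X ^ 3) <= / X /\ Rabs (r * sin th * / sqrt X ^ 3) <= / X.
Proof.
intros H HX. assert (Hs := sqrt_lt_R0 _ HX). assert (Hss : sqrt X * sqrt X = X) by (apply sqrt_sqrt; lra).
assert (G : forall z, z ^ 2 <= X -> Rabs (z * / sqrt X ^ 3) <= / X).
{ intros z Hz. assert (Hz1 : Rabs z <= sqrt X).
  { apply abs_le_of_sq; [lra|]. replace (sqrt X ^ 2) with (sqrt X * sqrt X) by ring. lra. }
  rewrite Rabs_mult, (Rabs_pos_eq (/ _)) by (left; apply Rinv_0_lt_compat, pow_lt; auto).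
  apply Rle_trans with (sqrt X * / sqrt X ^ 3).
  - apply Rmult_le_compat_r; auto. left; apply Rinv_0_lt_compat, pow_lt; auto.
  - right. rewrite <- Hss at 3. field. lra. }
pose proof (sc1 th) as SC. unfold Dq in H. split; apply G.
- nra.
- assert (0 <= (1 - r * cos th) ^ 2) by apply pow2_ge_0. nra.
Qed.

Lemma potential_bounds mu r th d0 : 0 <= mu -> 0 < d0 -> d0 <= Dq r th -> 0 <= r ->
  Rabs (Ur mu r th) <= mu * (/ d0 + 1) /\ Rabs (Uth mu r th) <= mu * (/ d0 + r).
Proof.
intros Hm Hd HD Hr. destruct (jupiter_force r th (Dq r th) ltac:(lra) ltac:(lra)) as [A B].
assert (Hi : / Dq r th <= / d0) by (apply Rinv_le_contravar; lra).
pose proof (COS_bound th). pose proof (SIN_bound th).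
split.
- unfold Ur, Rdiv. rewrite Rabs_mult, (Rabs_pos_eq mu) by auto. apply Rmult_le_compat_l; auto.
  unfold Rminus at 1. eapply Rle_trans; [apply Rabs_triang|]. rewrite Rabs_Ropp.
  assert (Rabs (cos th) <= 1) by (apply Rabs_le; lra). lra.
- replace (Uth mu r th) with (mu * (r * sin th + - (r * sin th * / sqrt (Dq r th) ^ 3))) by (unfold Uth; ring).
  rewrite Rabs_mult, (Rabs_pos_eq mu) by auto. apply Rmult_le_compat_l; auto.
  eapply Rle_trans; [apply Rabs_triang|]. rewrite Rabs_Ropp.
  assert (Rabs (r * sin th) <= r). { apply Rabs_le. split; nra. } lra.
Qed.

Lemma jup_reverse mu r0 th RR Th : 0 < r0 -> jup_ejection_bwd mu r0 th RR Th ->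
  exists T r ph w L, 0 < T /\ (forall t, 0 <= t < T -> polar_at mu r ph w L t) /\
   r 0 = r0 /\ ph 0 = - th /\ w 0 = - RR - mu * sin th /\ L 0 = Th + mu * r0 * cos th /\
   filterlim (fun t => cQ1 mu (r t) (ph t)) (at_left T) (locally (1 - mu)) /\
   filterlim (fun t => cQ2 (r t) (ph t)) (at_left T) (locally 0).
Proof.
intros Hr0 [T [q1 [q2 [p1 [p2 [HT [Ho [I1 [I2 [I3 [I4 [L1 L2]]]]]]]]]]]].
apply orbit_reverse in Ho.
assert (Ho' : is_orbit mu (fun t => q1 (- t)) (fun t => - q2 (- t)) (fun t => - p1 (- t)) (fun t => p2 (- t)) (fun t => 0 <= t < T)).
{ eapply is_orbit_ext_dom; [|exact Ho]. intros; lra. }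
destruct (cart_to_polar mu T _ _ _ _ r0 (- th) HT Ho' Hr0) as [r [ph [w [L [R0 [P0 Hp]]]]]].
{ rewrite Ropp_0, I1. unfold Pq1, cQ1. rewrite cos_neg; auto. }
{ rewrite Ropp_0, I2. unfold Pq2, cQ2. rewrite sin_neg; ring. }
destruct (Hp 0 ltac:(lra)) as [_ [_ [_ [J3 J4]]]]. rewrite Ropp_0, R0, P0 in *.
destruct (Pp_reverse r0 th RR Th) as [E1 E2].
rewrite I3, <- E1 in J3. rewrite I4, <- E2 in J4.
destruct (polar_init _ _ _ _ _ _ _ Hr0 J3 J4) as [Ew EL]. rewrite sin_neg in Ew. rewrite cos_neg in EL.
exists T, r, ph, w, L. split; auto. split; [intros t Ht; apply Hp; auto|].
split; auto. split; auto. split; [lra|]. split; [auto|].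
split.
- apply (filterlim_ext_loc (fun t => q1 (- t))).
  + apply (filter_imp (fun t => 0 < t < T)); [|apply at_left_between; auto]. intros t Ht. apply (Hp t ltac:(lra)).
  + apply (filterlim_comp _ _ _ Ropp q1 _ (at_right (- T)) _); auto. apply filterlim_opp_at_left.
- apply (filterlim_ext_loc (fun t => - q2 (- t))).
  + apply (filter_imp (fun t => 0 < t < T)); [|apply at_left_between; auto]. intros t Ht. apply (Hp t ltac:(lra)).
  + apply (filterlim_comp _ _ _ (fun t => q2 (- t)) Ropp _ (locally 0) _).
    * apply (filterlim_comp _ _ _ Ropp q2 _ (at_right (- T)) _); auto. apply filterlim_opp_at_left.
    * assert (C := filterlim_opp 0). rewrite <- Ropp_0 at 2. exact C.
Qed.

Lemma near_jupiter mu r ph T eps : 0 < eps ->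
  filterlim (fun t => cQ1 mu (r t) (ph t)) (at_left T) (locally (1 - mu)) ->
  filterlim (fun t => cQ2 (r t) (ph t)) (at_left T) (locally 0) ->
  at_left T (fun t => Rabs (cQ1 mu (r t) (ph t) - (1 - mu)) < eps /\ Rabs (cQ2 (r t) (ph t)) < eps).
Proof.
intros He L1 L2. apply filter_and.
- exact (proj1 (filterlim_locally _ (1 - mu)) L1 (mkposreal eps He)).
- assert (Q := proj1 (filterlim_locally _ 0) L2 (mkposreal eps He)).
  apply (filter_imp (fun t => ball 0 eps (cQ2 (r t) (ph t)))); auto.
  intros t Ht. change (Rabs (cQ2 (r t) (ph t) - 0) < eps) in Ht. rewrite Rminus_0_r in Ht. auto.
Qed.

Lemma at_left_point (P : R -> Prop) T t0 : t0 < T -> at_left T P -> exists t, t0 < t < T /\ P t.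
Proof.
intros H [e He]. exists (T - Rmin e (T - t0) / 2).
assert (0 < Rmin e (T - t0)) by (apply Rmin_pos; [apply cond_pos|lra]).
assert (Rmin e (T - t0) <= T - t0) by apply Rmin_r. assert (Rmin e (T - t0) <= e) by apply Rmin_l.
split; [lra|]. apply He; [|lra]. change (Rabs (T - Rmin e (T - t0) / 2 - T) < e). rewrite Rabs_left; lra.
Qed.

Lemma Dq_cart mu r ph : Dq r ph = (cQ1 mu r ph - (1 - mu)) ^ 2 + (cQ2 r ph) ^ 2.
Proof. unfold Dq, cQ1, cQ2. pose proof (sc1 ph). nra. Qed.

Lemma small_Dq mu r ph eps : 0 < eps -> Rabs (cQ1 mu r ph - (1 - mu)) < eps -> Rabs (cQ2 r ph) < eps -> Dq r ph < 2 * eps ^ 2.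
Proof.
intros He H1 H2. rewrite (Dq_cart mu), <- (pow2_abs (_ - _)), <- (pow2_abs (cQ2 _ _)).
pose proof (Rabs_pos (cQ1 mu r ph - (1 - mu))). pose proof (Rabs_pos (cQ2 r ph)). nra.
Qed.

Lemma escape_start mu r th w L : 0 < mu <= 1 / 100 -> r = 2 -> Rabs L <= 1 / 10 -> 9 / 10 <= w <= 11 / 10 ->
  0 < w ^ 2 / 2 - 1 / 2 - 12 * mu ->
  let N := (cQ1 mu r th) ^ 2 + (cQ2 r th) ^ 2 in
  let Y := cQ1 mu r th * cP1 r th w L + cQ2 r th * cP2 mu r th w L in
  (18 / 10) ^ 2 <= N /\ 0 < Y /\ 0 < Y ^ 2 / (2 * N) - (1 + 10 * mu) / sqrt N.
Proof.
intros Hm -> HL Hw HE N Y. apply Rabs_le_between in HL. pose proof (COS_bound th). pose proof (SIN_bound th). pose proof (sc1 th) as SC.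
assert (EN : N = 4 - 4 * mu * cos th + mu ^ 2). { unfold N, cQ1, cQ2. nra. }
assert (EY : Y = 2 * w - mu * (w * cos th - L / 2 * sin th) - 2 * mu * sin th).
{ unfold Y, cQ1, cQ2, cP1, cP2. set (c := cos th) in *. set (s := sin th) in *.
  transitivity (2 * w * (s * s + c * c) - mu * (w * c - L / 2 * s) - 2 * mu * s); [field|rewrite SC; ring]. }
assert (HN : (2 - mu) ^ 2 <= N <= (2 + mu) ^ 2) by (rewrite EN; split; nra).
assert (HY : 2 * w - 4 * mu <= Y).
{ rewrite EY. assert (w * cos th - L / 2 * sin th <= 12 / 10) by nra. nra. }
clearbody N Y. split; [nra|]. split; [lra|].
assert (HsN : 2 - mu <= sqrt N) by (apply sqrt_lower; lra).
assert (A : w ^ 2 / 2 - 6 * mu <= Y ^ 2 / (2 * N)).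
{ assert (0 < N) by nra. apply Rle_div_r; [lra|].
  assert ((2 * w - 4 * mu) ^ 2 <= Y ^ 2) by (apply pow_incr; lra).

  apply Rle_trans with ((w ^ 2 / 2 - 6 * mu) * (2 * (2 + mu) ^ 2)); [apply Rmult_le_compat_l; lra|].
  assert (w * mu <= 11 / 10 * mu) by (apply Rmult_le_compat_r; lra).
  assert (w ^ 2 <= 121 / 100) by (replace (121 / 100) with ((11 / 10) ^ 2) by field; apply pow_incr; lra).
  assert (w ^ 2 * mu <= 121 / 100 * mu) by (apply Rmult_le_compat_r; lra).
  assert (mu * mu <= mu * / 100) by (apply Rmult_le_compat_l; lra).
  assert (0 <= mu ^ 2 <= mu / 100) by (split; [apply pow2_ge_0|lra]). assert (0 <= mu ^ 3) by (apply pow_le; lra).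
  assert (w ^ 2 * mu ^ 2 <= 121 / 100 * mu ^ 2) by (apply Rmult_le_compat_r; lra). lra. }
assert (B : (1 + 10 * mu) / sqrt N <= 1 / 2 + 6 * mu).
{ apply Rle_div_l; [lra|]. apply Rle_trans with ((1 / 2 + 6 * mu) * (2 - mu)); [nra|]. apply Rmult_le_compat_l; lra. }
lra.
Qed.

Lemma En_of_Jac mu r th w L : r <> 0 -> En r w L = Jac mu r th w L - mu / r + L + Upot mu r th.
Proof. intros Hr. unfold En, Jac. field. auto. Qed.

(** If the orbit stays in r <= 2, the estimates of the outgoing leg keep it away from Jupiter for
    all times. Otherwise it crosses r = 2 outwards with an energy that still exceeds the errors of
    order eps, m^2 and mu, all dominated by e0, and it then remains beyond distance 1.8 from the
    origin. *)
Lemma no_hyperbolic_ejection mu d m eps e0 T r ph w L :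
  0 < d <= 1 / 1000 -> 0 < m <= d ^ 4 / 1000 -> 0 <= eps <= m * d ^ 4 / 100 ->
  0 < mu <= 1 / 100 -> mu * (300 / d ^ 8) <= eps ->
  0 < e0 -> 12 * eps <= e0 -> 4 * m ^ 2 <= e0 -> 100 * mu <= e0 ->
  0 < T -> (forall t, 0 <= t < T -> polar_at mu r ph w L t) ->
  r 0 = d ^ 2 -> 0 < w 0 -> Rabs (ph 0 - sqrt 2 / 3 * (1 - d ^ 3)) <= d ^ 4 -> Rabs (L 0) <= m ->
  Rabs (En (r 0) (w 0) (L 0)) <= m -> d ^ 4 / 2 <= Rabs (ph 0 - sqrt 2 / 3 * (1 - d ^ 3) + sqrt 2 * L 0 / d) ->
  2 * e0 <= En (r 0) (w 0) (L 0) ->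
  filterlim (fun t => cQ1 mu (r t) (ph t)) (at_left T) (locally (1 - mu)) ->
  filterlim (fun t => cQ2 (r t) (ph t)) (at_left T) (locally 0) -> False.
Proof.
intros Hd Hm Heps Hmu Hmue He0 He1 He2 He3 HT Hp Hr0 Hw0 Hph0 HL0 HE0 Hmiss HEe L1 L2.
assert (Hd4 : 0 < d ^ 4 <= 1) by (split; [apply pow_lt; lra|replace 1 with (1 ^ 4) by ring; apply pow_incr; lra]).
assert (Hd8 : d ^ 8 = d ^ 4 * d ^ 4) by ring.
assert (H8 : 1 <= / d ^ 8). { rewrite <- Rinv_1. apply Rinv_le_contravar; nra. }
assert (H48 : / d ^ 4 <= / d ^ 8). { apply Rinv_le_contravar; nra. }
assert (Leg : forall b, 0 <= b < T -> (forall t, 0 <= t <= b -> r t <= 2) ->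
   forall t, 0 <= t <= b -> d ^ 2 <= r t /\ 1 / 2 < w t /\ (d ^ 4 / 10) ^ 2 < Dq (r t) (ph t) /\ t <= 4 /\
  Rabs (L t - L 0) <= 4 * eps /\ Rabs (En (r t) (w t) (L t) - En (r 0) (w 0) (L 0)) <= 6 * eps /\ Rabs (ph t) <= 3).
{ intros b Hb Hr2.
  apply (outgoing_leg d m eps b r ph w L (fun t => L t / r t ^ 2 - 1)
    (fun t => (L t) ^ 2 / (r t) ^ 3 - (1 - mu) / (r t) ^ 2 + Ur mu (r t) (ph t)) (fun t => Uth mu (r t) (ph t))); auto; try lra.
  - intros t Ht. destruct (Hp t ltac:(lra)) as [_ [_ H]]. tauto.
  - intros t Ht Hrt HLt HDt. split; auto.
    assert (Hd2 : 0 < d ^ 2) by (apply pow_lt; lra).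
    destruct (potential_bounds mu (r t) (ph t) ((d ^ 4 / 10) ^ 2) ltac:(lra) ltac:(apply pow_lt; lra) HDt ltac:(lra)) as [B1 B2].
    replace (/ (d ^ 4 / 10) ^ 2) with (100 * / d ^ 8) in B1, B2 by (field; lra).
    unfold Rdiv in Hmue. split.
    + replace (_ - _) with (mu / r t ^ 2 + Ur mu (r t) (ph t)) by (field; lra).
      eapply Rle_trans; [apply Rabs_triang|].
      assert (Rabs (mu / r t ^ 2) <= mu * / d ^ 8).
      { rewrite Rabs_pos_eq. 2:{ apply Rle_div_r; [apply pow_lt; lra|]. rewrite Rmult_0_l; lra. }
        apply Rmult_le_compat_l; [lra|]. apply Rle_trans with (/ d ^ 4); auto. replace (d ^ 4) with ((d ^ 2) ^ 2) by ring.
        apply Rinv_le_contravar; [apply pow_lt; lra|apply pow_incr; lra]. }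
      assert (mu * 1 <= mu * / d ^ 8) by (apply Rmult_le_compat_l; lra). lra.
    + assert (mu * r t <= mu * (2 * / d ^ 8)) by (apply Rmult_le_compat_l; lra). lra. }
destruct (classic (forall t, 0 <= t < T -> r t <= 2)) as [Hle|Hgt].
- set (e := d ^ 4 / 40). assert (He : 0 < e) by (unfold e; lra).
  destruct (at_left_point _ T 0 HT (near_jupiter mu r ph T e He L1 L2)) as [t [Ht [N1 N2]]].
  assert (S := small_Dq mu (r t) (ph t) e He N1 N2).
  destruct (Leg t ltac:(lra) ltac:(intros; apply Hle; lra) t ltac:(lra)) as [_ [_ [H _]]].
  assert (2 * e ^ 2 <= (d ^ 4 / 10) ^ 2) by (unfold e; nra). lra.
- apply not_all_ex_not in Hgt. destruct Hgt as [t1 Ht1]. apply imply_to_and in Ht1. destruct Ht1 as [Ht1 Hrt1].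
  assert (Hd2 : d ^ 2 <= 1) by nra.
  assert (Cr : forall x, 0 <= x <= t1 -> continuous r x).
  { intros x Hx. destruct (Hp x ltac:(lra)) as [_ [_ [D _]]]. exact (is_derive_continuous _ _ _ D). }
  destruct (first_hit r 0 t1 2 ltac:(lra) Cr ltac:(lra)) as [t2 [Ht2 [E2 Hlt2]]].
  assert (Hle2 : forall t, 0 <= t <= t2 -> r t <= 2).
  { intros t Ht. destruct (Req_dec t t2) as [->|]; [lra|]. left. apply Hlt2. lra. }
  destruct (Leg t2 ltac:(lra) Hle2 t2 ltac:(lra)) as [_ [G1 [_ [_ [G2 [G3 _]]]]]].
  rewrite E2 in G3.
  assert (Hm1 : m <= / 1000) by lra.
  assert (Hem : eps <= m / 100). { assert (m * d ^ 4 <= m * 1) by (apply Rmult_le_compat_l; lra). lra. }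
  assert (GL : Rabs (L t2) <= 2 * m).
  { replace (L t2) with ((L t2 - L 0) + L 0) by ring. eapply Rle_trans; [apply Rabs_triang|]. lra. }
  assert (GL2 : (L t2) ^ 2 <= e0).
  { eapply Rle_trans; [|apply He2]. rewrite <- pow2_abs. pose proof (Rabs_pos (L t2)). nra. }
  assert (GL3 : 0 <= (L t2) ^ 2) by apply pow2_ge_0.
  apply Rabs_le_between in G3.
  assert (GE : En 2 (w t2) (L t2) = (w t2) ^ 2 / 2 + (L t2) ^ 2 / 8 - 1 / 2) by (unfold En; field).
  apply Rabs_le_between in HE0.
  destruct (escape_start mu (r t2) (ph t2) (w t2) (L t2) Hmu E2) as [S1 [S2 S3]]; [lra| |nra|].
  { split; nra. }
  assert (Ho := polar_to_cart mu r ph w L (fun t => t2 <= t < T) (fun t Ht => Hp t ltac:(lra))).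
  assert (G := escape mu _ _ _ _ t2 T Hmu Ho S1 S2 S3). cbv beta zeta in G.
  destruct (at_left_point _ T t2 ltac:(lra) (near_jupiter mu r ph T (1 / 10) ltac:(lra) L1 L2)) as [t [Ht [N1 N2]]].
  specialize (G t ltac:(lra)). apply Rabs_def2 in N1. apply Rabs_def2 in N2.
  assert (cQ1 mu (r t) (ph t) ^ 2 <= (11 / 10) ^ 2) by (apply pow_incr; lra).
  assert (cQ2 (r t) (ph t) ^ 2 <= (1 / 10) ^ 2) by (rewrite <- pow2_abs; apply pow_incr; split; [apply Rabs_pos|apply Rabs_le; lra]).
  lra.
Qed.

(** * Globally Lipschitz flows *)

Inductive coord := Cr | Cth | Cw | CL.

Definition lip_field (F : (coord -> R) -> coord -> R) (k : R) : Prop :=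
  forall x y c, (forall i, Rabs (x i - y i) <= c) -> forall i, Rabs (F x i - F y i) <= k * c.

Definition flow_of (F : (coord -> R) -> coord -> R) (y : coord -> R -> R) : Prop :=
  forall i t, 0 <= t -> is_derive (y i) t (F (fun j => y j t) i).

Lemma continuous_field F k (z : coord -> R -> R) t : 0 <= k -> lip_field F k -> (forall i, continuous (z i) t) ->
  forall i, continuous (fun s : R => F (fun j => z j s) i) t.
Proof.
intros Hk HF Hz i. apply continuous_eps. intros eps He.
assert (He' : 0 < eps / (k + 1)) by (apply Rdiv_lt_0_compat; lra).
assert (H : forall j, exists d, 0 < d /\ forall y, Rabs (y - t) < d -> Rabs (z j y - z j t) < eps / (k + 1)).
{ intros j. apply (proj1 (continuous_eps (z j) t)); auto. }
destruct (H Cr) as [d1 [P1 H1]]. destruct (H Cth) as [d2 [P2 H2]].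
destruct (H Cw) as [d3 [P3 H3]]. destruct (H CL) as [d4 [P4 H4]].
exists (Rmin (Rmin d1 d2) (Rmin d3 d4)). split; [repeat apply Rmin_pos; auto|].
intros y Hy.
assert (M1 := Rmin_l (Rmin d1 d2) (Rmin d3 d4)). assert (M2 := Rmin_r (Rmin d1 d2) (Rmin d3 d4)).
assert (M3 := Rmin_l d1 d2). assert (M4 := Rmin_r d1 d2). assert (M5 := Rmin_l d3 d4). assert (M6 := Rmin_r d3 d4).
eapply Rle_lt_trans; [apply (HF _ _ (eps / (k + 1)))|].
- intros j. left. destruct j; [apply H1|apply H2|apply H3|apply H4]; lra.
- apply Rlt_le_trans with ((k + 1) * (eps / (k + 1))); [apply Rmult_lt_compat_r; lra|]. right. field. lra.
Qed.

(** Picard iteration in the norm with weight exp(-2 k t). The map contracts by 1/2 on the whole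
    half-line, so no local solutions have to be glued. *)
Lemma flow_exists F k (y0 : coord -> R) : 1 <= k -> lip_field F k ->
  exists y, (forall i, y i 0 = y0 i) /\ flow_of F y.
Proof.
intros Hk HF. set (lam := 2 * k). set (pl := fun t => Rmax 0 t).
assert (plc : forall t : R, continuous pl t).
{ intros t. apply (continuous_of_lip pl 1). intros u v. unfold pl, Rmax. repeat destruct Rle_dec; unfold Rabs; repeat destruct Rcase_abs; lra. }
assert (pl0 : forall t, 0 <= pl t) by (intros; apply Rmax_l).
assert (plid : forall t, 0 <= t -> pl t = t) by (intros; apply Rmax_right; auto).
(* The unknown z is the weighted solution, and [v z] removes the weight. Negative times are sent to
   0 by [pl]. *)
pose (v := fun (z : coord * R -> R) (s : R) (j : coord) => exp (lam * pl s) * z (j, s)).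
pose (Phi := fun (z : coord * R -> R) (p : coord * R) =>
  exp (- lam * pl (snd p)) * (y0 (fst p) + RInt (fun s => F (v z s) (fst p)) 0 (pl (snd p)))).
pose (P := fun z : coord * R -> R => forall i (t : R), continuous (fun s : R => z (i, s)) t).
assert (expc : forall c (t : R), continuous (fun s => exp (c * pl s)) t).
{ intros c t. apply (continuous_comp pl (fun u => exp (c * u))); auto.
  apply (ex_derive_continuous (fun u => exp (c * u))). auto_derive; auto. }
assert (vc : forall z, P z -> forall i (t : R), continuous (fun s : R => F (v z s) i) t).
{ intros z Hz i t. apply (continuous_field F k (fun j s => v z s j)); auto; [lra|].
  intros j. unfold v. apply (continuous_mult (K := R_AbsRing)); auto. }
assert (Ic : forall h : R -> R, (forall t : R, continuous h t) -> forall t : R, is_derive (fun u => RInt h 0 u) t (h t)).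
{ intros h Hc t. apply (is_derive_RInt (V := R_CompleteNormedModule) h _ 0 t).
  - exists (mkposreal 1 Rlt_0_1). intros y _. apply (RInt_correct (V := R_CompleteNormedModule)), ex_RInt_cont; auto.
  - auto. }
assert (Dexp : forall c (t : R), is_derive (fun u => c * exp (lam * u)) t (c * lam * exp (lam * t))).
{ intros c t. auto_derive; auto. ring. }
assert (expn : forall t, exp (- lam * t) * exp (lam * t) = 1).
{ intros t. rewrite <- exp_plus. replace (- lam * t + lam * t) with 0 by ring. apply exp_0. }
pose (z0 := fun p : coord * R => exp (- lam * pl (snd p)) * y0 (fst p)).
set (B := Rmax (Rmax (Rabs (F y0 Cr)) (Rabs (F y0 Cth))) (Rmax (Rabs (F y0 Cw)) (Rabs (F y0 CL)))).
assert (HB : forall i, Rabs (F y0 i) <= B).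
{ intros i. unfold B. destruct i; [eapply Rle_trans; [|apply Rmax_l]; apply Rmax_l|eapply Rle_trans; [|apply Rmax_l]; apply Rmax_r|
   eapply Rle_trans; [|apply Rmax_r]; apply Rmax_l|eapply Rle_trans; [|apply Rmax_r]; apply Rmax_r]. }
assert (B0 : 0 <= B) by (eapply Rle_trans; [apply Rabs_pos|apply (HB Cr)]).
assert (Gb : forall (h : R -> R) c t, 0 <= t -> (forall u : R, continuous h u) -> (forall u, 0 <= u -> Rabs (h u) <= c * lam * exp (lam * u)) -> 0 <= c ->
   exp (- lam * t) * Rabs (RInt h 0 t) <= c).
{ intros h c t Ht Hc Hh Hc0.
  assert (G : Rabs (RInt h 0 t - RInt h 0 0) <= c * exp (lam * t) - c * exp (lam * 0)).
  { apply (open_derive_abs (fun u => RInt h 0 u) (fun u => c * exp (lam * u)) h (fun u => c * lam * exp (lam * u))); auto.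
    intros u Hu. apply Hh; lra. }
  rewrite RInt_point in G. change (Rabs (RInt h 0 t - 0) <= c * exp (lam * t) - c * exp (lam * 0)) in G. rewrite Rminus_0_r in G.
  assert (E := exp_pos (lam * 0)). assert (En' := exp_pos (- lam * t)).
  apply Rle_trans with (exp (- lam * t) * (c * exp (lam * t))).
  - apply Rmult_le_compat_l; [lra|]. assert (0 <= c * exp (lam * 0)) by (apply Rmult_le_pos; lra). lra.
  - right. transitivity (c * (exp (- lam * t) * exp (lam * t))); [ring|]. rewrite expn. ring. }
destruct (contraction_fixpoint Phi P z0 B) as [z [Pz Ez]].
- intros i t. unfold z0. simpl. apply (continuous_mult (K := R_AbsRing)); auto. apply continuous_const.
- intros z Hz i t. unfold Phi. simpl. apply (continuous_mult (K := R_AbsRing)); auto.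
  apply (continuous_plus (V := R_NormedModule)); [apply continuous_const|].
  apply (continuous_comp pl (fun u => RInt (fun s => F (v z s) i) 0 u)); auto.
  eapply is_derive_continuous. apply Ic. apply vc; auto.
- intros [i t]. unfold Phi; simpl fst; simpl snd. change (z0 (i, t)) with (exp (- lam * pl t) * y0 i).
  assert (Pz0 : P z0). { intros j u. unfold z0. simpl. apply (continuous_mult (K := R_AbsRing)); auto. apply continuous_const. }
  match goal with |- Rabs (?e * (?a + ?I) - ?e * ?a) <= _ => replace (e * (a + I) - e * a) with (e * I) by ring end.
  rewrite Rabs_mult, Rabs_pos_eq by (left; apply exp_pos).
  apply (Gb _ B (pl t)); auto.
  intros u Hu. replace (F (v z0 u) i) with (F y0 i + (F (v z0 u) i - F y0 i)) by ring.
  assert (D : Rabs (F (v z0 u) i - F y0 i) <= k * 0).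
  { apply HF. intros j. unfold v, z0; simpl. rewrite plid by auto.
    replace (exp (lam * u) * (exp (- lam * u) * y0 j) - y0 j) with ((exp (- lam * u) * exp (lam * u) - 1) * y0 j) by ring.
    rewrite expn, Rminus_diag, Rmult_0_l, Rabs_R0. lra. }
  rewrite Rmult_0_r in D. eapply Rle_trans; [apply Rabs_triang|].
  assert (1 <= exp (lam * u)).
  { rewrite <- exp_0. destruct (Req_dec u 0) as [->|]; [rewrite Rmult_0_r; lra|]. left. apply exp_increasing. apply Rmult_lt_0_compat; unfold lam; lra. }
  specialize (HB i). assert (B <= B * lam) by (unfold lam; nra).  nra.
- intros z z' c Hz Hz' Hc [i t]. unfold Phi; simpl fst; simpl snd.
  assert (Hc0 : 0 <= c) by (eapply Rle_trans; [apply Rabs_pos|apply (Hc (Cr, 0))]).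
  match goal with |- Rabs (?e * (?a + ?I) - ?e * (?a + ?J)) <= _ => replace (e * (a + I) - e * (a + J)) with (e * (I - J)) by ring end.
  rewrite Rabs_mult, Rabs_pos_eq by (left; apply exp_pos).
  rewrite RInt_minus_cont by (apply vc; auto).
  apply (Gb _ (c / 2) (pl t)); auto; [|intros u Hu|lra].
  + intros u. apply (continuous_minus (V := R_NormedModule)); apply vc; auto.
  + apply Rle_trans with (k * (exp (lam * u) * c)).
    * apply HF. intros j. unfold v. rewrite plid by auto. rewrite <- Rmult_minus_distr_l, Rabs_mult, Rabs_pos_eq by (left; apply exp_pos).
      apply Rmult_le_compat_l; [left; apply exp_pos|]. apply Hc.
    * right. unfold lam. field.
- intros u f Hu Hl i t. apply continuous_eps. intros eps He.
  destruct (Hl (eps / 4) ltac:(lra)) as [n Hn].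
  destruct (proj1 (continuous_eps _ _) (Hu n i t) (eps / 4) ltac:(lra)) as [e [He' H]].
  exists e. split; auto. intros y Hy. specialize (H y Hy). assert (N1 := Hn (i, t)). assert (N2 := Hn (i, y)). cbv beta in *.
  apply Rabs_def2 in H. apply Rabs_le_between in N1. apply Rabs_le_between in N2. apply Rabs_def1; lra.
(* The solution is taken in integral form rather than as the fixed point itself: this expression has
   a two-sided derivative also at t = 0. *)
- exists (fun i t => y0 i + RInt (fun s => F (v z s) i) 0 t).
  assert (E : forall i t, 0 <= t -> v z t i = y0 i + RInt (fun s => F (v z s) i) 0 t).
  { intros i t Ht. unfold v at 1. rewrite <- Ez. unfold Phi; simpl fst; simpl snd. rewrite plid by auto.
    rewrite <- Rmult_assoc, (Rmult_comm (exp (lam * t))), expn. ring. }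
  split.
  + intros i. rewrite RInt_point. unfold zero; simpl. ring.
  + intros i t Ht. eapply is_derive_eq; [|apply (is_derive_plus (V := R_NormedModule)); [apply @is_derive_const|apply Ic; apply vc; auto]].
    unfold plus, zero; simpl. rewrite Rplus_0_l.
    apply Rminus_diag_uniq. destruct (Req_dec (F (v z t) i - F (fun j => y0 j + RInt (fun s => F (v z s) j) 0 t) i) 0) as [Z|Z]; auto.
    exfalso. apply Rabs_pos_lt in Z. assert (D : Rabs (F (v z t) i - F (fun j => y0 j + RInt (fun s => F (v z s) j) 0 t) i) <= k * 0).
    { apply HF. intros j. rewrite E by auto. rewrite Rminus_diag, Rabs_R0. lra. } lra.
Qed.

Definition dist2 (x y : coord -> R) : R := (x Cr - y Cr) ^ 2 + (x Cth - y Cth) ^ 2 + (x Cw - y Cw) ^ 2 + (x CL - y CL) ^ 2.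

Lemma dist2_ge x y i : (x i - y i) ^ 2 <= dist2 x y.
Proof.
unfold dist2. pose proof (pow2_ge_0 (x Cr - y Cr)). pose proof (pow2_ge_0 (x Cth - y Cth)).
pose proof (pow2_ge_0 (x Cw - y Cw)). pose proof (pow2_ge_0 (x CL - y CL)). destruct i; lra.
Qed.

Lemma flow_gronwall F k (y y' : coord -> R -> R) a b : 0 <= k -> lip_field F k -> a <= b ->
  (forall i t, a <= t <= b -> is_derive (y i) t (F (fun j => y j t) i)) ->
  (forall i t, a <= t <= b -> is_derive (y' i) t (F (fun j => y' j t) i)) ->
  dist2 (fun i => y i b) (fun i => y' i b) <= dist2 (fun i => y i a) (fun i => y' i a) * exp (8 * k * (b - a)).
Proof.
intros Hk HF Hab Hy Hy'.
set (D := fun t i => F (fun j => y j t) i - F (fun j => y' j t) i).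
apply (gronwall (fun t => dist2 (fun i => y i t) (fun i => y' i t))
  (fun t => 2 * (y Cr t - y' Cr t) * D t Cr + 2 * (y Cth t - y' Cth t) * D t Cth + 2 * (y Cw t - y' Cw t) * D t Cw + 2 * (y CL t - y' CL t) * D t CL)); auto.
- intros t Ht.
  assert (E : forall i, Derive (fun x => y i x) t = F (fun j => y j t) i) by (intros; apply is_derive_unique; auto).
  assert (E' : forall i, Derive (fun x => y' i x) t = F (fun j => y' j t) i) by (intros; apply is_derive_unique; auto).
  unfold dist2. auto_derive; [repeat split; eexists; eauto|]. rewrite !E, !E'. unfold D. ring.
- intros t Ht. set (N := dist2 (fun i => y i t) (fun i => y' i t)).
  assert (N0 : 0 <= N). { eapply Rle_trans; [apply pow2_ge_0|apply (dist2_ge (fun i => y i t) (fun i => y' i t) Cr)]. }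
  assert (C : forall i, Rabs (y i t - y' i t) <= sqrt N).
  { intros i. rewrite <- sqrt_Rsqr_abs. apply sqrt_le_1; auto; [apply Rle_0_sqr|].
    replace (Rsqr (y i t - y' i t)) with ((y i t - y' i t) ^ 2) by (unfold Rsqr; ring). apply (dist2_ge (fun i => y i t) (fun i => y' i t) i). }
  assert (G : forall i, 2 * (y i t - y' i t) * D t i <= 2 * k * N).
  { intros i. assert (DD := HF (fun j => y j t) (fun j => y' j t) (sqrt N) C i). fold (D t i) in DD.
    apply Rle_trans with (Rabs (2 * (y i t - y' i t) * D t i)); [apply Rle_abs|].
    rewrite !Rabs_mult, (Rabs_pos_eq 2) by lra.
    apply Rle_trans with (2 * sqrt N * (k * sqrt N)).
    - apply Rmult_le_compat; auto; [|apply Rabs_pos|apply Rmult_le_compat_l; auto; lra]. apply Rmult_le_pos; [lra|apply Rabs_pos].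
    - right. transitivity (2 * k * (sqrt N * sqrt N)); [ring|]. rewrite sqrt_sqrt by auto. ring. }
  assert (G1 := G Cr). assert (G2 := G Cth). assert (G3 := G Cw). assert (G4 := G CL). lra.
Qed.

(** Boundedness is included because it is what makes the Lipschitz functions closed under
    products. *)
Definition blip (f : (coord -> R) -> R) : Prop :=
  exists M, 0 <= M /\ (forall x, Rabs (f x) <= M) /\
    forall x y c, (forall i, Rabs (x i - y i) <= c) -> Rabs (f x - f y) <= M * c.

Lemma sup_nonneg (x y : coord -> R) c : (forall i, Rabs (x i - y i) <= c) -> 0 <= c.
Proof. intros H. eapply Rle_trans; [apply Rabs_pos|apply (H Cr)]. Qed.

Lemma blip_const a : blip (fun _ => a).
Proof.
exists (Rabs a). split; [apply Rabs_pos|]. split; [intros; lra|].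
intros x y c H. rewrite Rminus_diag, Rabs_R0. apply Rmult_le_pos; [apply Rabs_pos|apply (sup_nonneg x y); auto].
Qed.

Lemma blip_plus f g : blip f -> blip g -> blip (fun x => f x + g x).
Proof.
intros [M [HM [F1 F2]]] [N [HN [G1 G2]]]. exists (M + N). split; [lra|]. split.
- intros x. eapply Rle_trans; [apply Rabs_triang|]. specialize (F1 x). specialize (G1 x). lra.
- intros x y c H. replace (f x + g x - (f y + g y)) with ((f x - f y) + (g x - g y)) by ring.
  eapply Rle_trans; [apply Rabs_triang|]. specialize (F2 x y c H). specialize (G2 x y c H). lra.
Qed.

Lemma blip_mult f g : blip f -> blip g -> blip (fun x => f x * g x).
Proof.
intros [M [HM [F1 F2]]] [N [HN [G1 G2]]]. exists (2 * (M * N)). assert (0 <= M * N) by (apply Rmult_le_pos; auto).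
split; [lra|]. split.
- intros x. rewrite Rabs_mult. assert (Rabs (f x) * Rabs (g x) <= M * N) by (apply Rmult_le_compat; auto; apply Rabs_pos). lra.
- intros x y c H0.
  replace (f x * g x - f y * g y) with ((f x - f y) * g x + f y * (g x - g y)) by ring.
  eapply Rle_trans; [apply Rabs_triang|]. rewrite !Rabs_mult.
  assert (Rabs (f x - f y) * Rabs (g x) <= M * c * N) by (apply Rmult_le_compat; auto; apply Rabs_pos).
  assert (Rabs (f y) * Rabs (g x - g y) <= M * (N * c)) by (apply Rmult_le_compat; auto; apply Rabs_pos). lra.
Qed.

Lemma blip_opp f : blip f -> blip (fun x => - f x).
Proof.
intros [M [HM [F1 F2]]]. exists M. split; auto. split.
- intros x. rewrite Rabs_Ropp. auto.
- intros x y c H. replace (- f x - - f y) with (- (f x - f y)) by ring. rewrite Rabs_Ropp. auto.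
Qed.

Lemma blip_minus f g : blip f -> blip g -> blip (fun x => f x - g x).
Proof. intros. apply blip_plus; auto. apply blip_opp; auto. Qed.

Lemma blip_pow f n : blip f -> blip (fun x => f x ^ n).
Proof. intros H. induction n; simpl; [apply blip_const|apply blip_mult; auto]. Qed.

Lemma blip_comp_coord (g : R -> R) i B k : 0 <= B -> 0 <= k -> (forall u, Rabs (g u) <= B) -> (forall u v, Rabs (g u - g v) <= k * Rabs (u - v)) ->
  blip (fun x => g (x i)).
Proof.
intros HB Hk H1 H2. exists (B + k). split; [lra|]. split; [intros; specialize (H1 (x i)); lra|].
intros x y c H. assert (Hc := sup_nonneg x y c H). eapply Rle_trans; [apply H2|].
apply Rle_trans with (k * c); [apply Rmult_le_compat_l; auto|]. apply Rmult_le_compat_r; lra.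
Qed.

Lemma blip_scalar (g : R -> R) f B k (lo : R) : 0 <= B -> 0 <= k -> blip f -> (forall x, lo <= f x) ->
  (forall u, lo <= u -> Rabs (g u) <= B) -> (forall u v, lo <= u -> lo <= v -> Rabs (g u - g v) <= k * Rabs (u - v)) ->
  blip (fun x => g (f x)).
Proof.
intros HB Hk [M [HM [F1 F2]]] Hlo H1 H2. assert (0 <= k * M) by (apply Rmult_le_pos; auto). exists (B + k * M). split; [lra|]. split.
- intros x. specialize (H1 (f x) (Hlo x)). lra.
- intros x y c H0. assert (Hc := sup_nonneg x y c H0). eapply Rle_trans; [apply H2; auto|].
  apply Rle_trans with (k * (M * c)); [apply Rmult_le_compat_l; auto|]. rewrite <- Rmult_assoc. apply Rmult_le_compat_r; lra.
Qed.

Lemma blip_inv f lo : 0 < lo -> blip f -> (forall x, lo <= f x) -> blip (fun x => / f x).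
Proof.
intros Hlo Hf Hl. assert (Pi : 0 < / lo) by (apply Rinv_0_lt_compat; auto).
apply (blip_scalar Rinv f (/ lo) (/ lo * / lo) lo); auto; try (left; auto; fail); [apply Rmult_le_pos; lra| |].
- intros u Hu. rewrite Rabs_pos_eq by (left; apply Rinv_0_lt_compat; lra). apply Rinv_le_contravar; auto.
- intros u v Hu Hv. replace (/ u - / v) with (- (u - v) * (/ u * / v)) by (field; lra).
  rewrite Rabs_mult, Rabs_Ropp, Rmult_comm. apply Rmult_le_compat_r; [apply Rabs_pos|].
  assert (0 < / u) by (apply Rinv_0_lt_compat; lra). assert (0 < / v) by (apply Rinv_0_lt_compat; lra).
  rewrite Rabs_pos_eq by (apply Rmult_le_pos; lra). apply Rmult_le_compat; try lra; apply Rinv_le_contravar; auto.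
Qed.

Lemma blip_sqrt f lo : 0 < lo -> blip f -> (forall x, lo <= f x) -> blip (fun x => sqrt (f x)).
Proof.
intros Hlo Hf Hl. assert (Hf' := Hf). destruct Hf' as [M [HM [F1 F2]]].
assert (Hs : 0 < sqrt lo) by (apply sqrt_lt_R0; auto).
exists (M + 1 + M * / sqrt lo). assert (Pi : 0 < / sqrt lo) by (apply Rinv_0_lt_compat; auto).
assert (0 <= M * / sqrt lo) by (apply Rmult_le_pos; lra).
split; [lra|]. split.
- intros x. rewrite Rabs_pos_eq by apply sqrt_pos. specialize (F1 x). specialize (Hl x). rewrite Rabs_pos_eq in F1 by lra.
  assert (sqrt (f x) <= f x + 1); [|lra]. assert (E : sqrt (f x) * sqrt (f x) = f x) by (apply sqrt_sqrt; lra). nra.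
- intros x y c H0. assert (Hc := sup_nonneg x y c H0). assert (Hx := Hl x). assert (Hy := Hl y).
  assert (Sx : sqrt lo <= sqrt (f x)) by (apply sqrt_le_1; lra). assert (Sy : sqrt lo <= sqrt (f y)) by (apply sqrt_le_1; lra).
  assert (E : sqrt (f x) - sqrt (f y) = (f x - f y) * / (sqrt (f x) + sqrt (f y))).
  { rewrite <- (sqrt_sqrt (f x)) at 2 by lra. rewrite <- (sqrt_sqrt (f y)) at 2 by lra. field. lra. }
  rewrite E, Rabs_mult, (Rabs_pos_eq (/ _)) by (left; apply Rinv_0_lt_compat; lra).
  apply Rle_trans with (M * c * / sqrt lo).
  + apply Rmult_le_compat; auto; [apply Rabs_pos|left; apply Rinv_0_lt_compat; lra|apply Rinv_le_contravar; lra].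
  + assert (0 <= M * c) by (apply Rmult_le_pos; auto).
    replace ((M + 1 + M * / sqrt lo) * c) with (M * c + c + M * c * / sqrt lo) by ring. lra.
Qed.

Lemma blip_clamp lo hi i : lo <= hi -> blip (fun x => clamp lo hi (x i)).
Proof.
intros H. apply (blip_comp_coord (clamp lo hi) i (Rabs lo + Rabs hi) 1); try lra.
- pose proof (Rabs_pos lo). pose proof (Rabs_pos hi). lra.
- intros u. pose proof (clamp_bounds lo hi u H). pose proof (Rabs_pos lo). pose proof (Rabs_pos hi).
  pose proof (Rle_abs hi). pose proof (Rabs_maj2 lo). apply Rabs_le. lra.
- intros u v. rewrite Rmult_1_l. apply clamp_lip; auto.
Qed.

Lemma blip_max f c : blip f -> blip (fun x => Rmax (f x) c).
Proof.
intros [M [HM [F1 F2]]]. exists (M + Rabs c). pose proof (Rabs_pos c). split; [lra|]. split.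
- intros x. specialize (F1 x). unfold Rmax. destruct Rle_dec; lra.
- intros x y e H0. assert (Hc := sup_nonneg x y e H0). specialize (F2 x y e H0). apply Rle_trans with (M * e).
  + eapply Rle_trans; [|apply F2]. unfold Rmax. repeat destruct Rle_dec; unfold Rabs; repeat destruct Rcase_abs; lra.
  + apply Rmult_le_compat_r; lra.
Qed.

Section Truncated.
Variables (d Rm d1 mu : R).

(** The cut-off at half of d^2 leaves a margin below r = d^2, so that the field is exact in a
    neighbourhood of points on that circle. *)
Definition tr_r (x : coord -> R) : R := clamp (d ^ 2 / 2) Rm (x Cr).
Definition tr_L (x : coord -> R) : R := clamp (-1) 1 (x CL).
Definition tr_D (x : coord -> R) : R := Rmax (Dq (tr_r x) (x Cth)) (d1 ^ 2).

(* The polar vector field, cut off near the Sun, near Jupiter and at infinity so as to be globally Lipschitz. *)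
Definition trunc_field (x : coord -> R) (i : coord) : R :=
  match i with
  | Cr => x Cw
  | Cth => tr_L x * / tr_r x ^ 2 - 1
  | Cw => tr_L x ^ 2 * / tr_r x ^ 3 - (1 - mu) * / tr_r x ^ 2 + mu * ((cos (x Cth) - tr_r x) * / sqrt (tr_D x) ^ 3 - cos (x Cth))
  | CL => mu * (tr_r x * sin (x Cth) - tr_r x * sin (x Cth) * / sqrt (tr_D x) ^ 3)
  end.

Lemma trunc_lip : 0 < d -> d ^ 2 <= Rm -> 0 < d1 -> exists k, 1 <= k /\ lip_field trunc_field k.
Proof.
intros Hd HR Hd1. assert (Hd2 : 0 < d ^ 2) by (apply pow_lt; auto).
assert (Br : blip tr_r) by (apply blip_clamp; lra).
assert (BL : blip tr_L) by (apply blip_clamp; lra).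
assert (Bc : blip (fun x => cos (x Cth))).
{ apply (blip_comp_coord cos Cth 1 1); try lra; [intros; apply Rabs_le, COS_bound|intros; rewrite Rmult_1_l; apply cos_lip]. }
assert (Bs : blip (fun x => sin (x Cth))).
{ apply (blip_comp_coord sin Cth 1 1); try lra; [intros; apply Rabs_le, SIN_bound|intros; rewrite Rmult_1_l; apply sin_lip]. }
assert (lr : forall x, d ^ 2 / 2 <= tr_r x) by (intros; apply clamp_bounds; lra).

assert (Bi2 : forall n, blip (fun x => / tr_r x ^ n)).
{ intros n. apply (blip_inv _ ((d ^ 2 / 2) ^ n)); [apply pow_lt; lra|apply blip_pow; auto|].
  intros x. apply pow_incr. split; [lra|auto]. }
assert (BD : blip tr_D).
{ apply blip_max. unfold Dq. apply blip_plus; [|apply blip_pow; auto]. apply blip_minus; [apply blip_const|].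
  apply blip_mult; auto. apply blip_mult; auto. apply blip_const. }
assert (P1 : 0 < d1 ^ 2) by (apply pow_lt; auto).
assert (lD : forall x, d1 ^ 2 <= tr_D x) by (intros; apply Rmax_r).
assert (Bq : blip (fun x => / sqrt (tr_D x) ^ 3)).
{ apply (blip_inv _ (sqrt (d1 ^ 2) ^ 3)).
  - apply pow_lt, sqrt_lt_R0; auto.
  - apply blip_pow. apply (blip_sqrt _ (d1 ^ 2)); auto.
  - intros x. apply pow_incr. split; [apply sqrt_pos|apply sqrt_le_1; auto; [lra|]]. specialize (lD x). lra. }
assert (F2 : blip (fun x => trunc_field x Cth)).
{ apply blip_minus; [apply blip_mult; auto|apply blip_const]. }
assert (F3 : blip (fun x => trunc_field x Cw)).
{ apply blip_plus; [apply blip_minus; apply blip_mult; auto; try (apply blip_pow; auto); apply blip_const|].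
  apply blip_mult; [apply blip_const|]. apply blip_minus; auto. apply blip_mult; auto. apply blip_minus; auto. }
assert (F4 : blip (fun x => trunc_field x CL)).
{ apply blip_mult; [apply blip_const|]. apply blip_minus; [apply blip_mult; auto|]. apply blip_mult; auto. apply blip_mult; auto. }
destruct F2 as [M2 [H2 [_ G2]]]. destruct F3 as [M3 [H3 [_ G3]]]. destruct F4 as [M4 [H4 [_ G4]]].
exists (1 + M2 + M3 + M4). split; [lra|]. intros x y c H. assert (Hc := sup_nonneg x y c H).
specialize (G2 x y c H). specialize (G3 x y c H). specialize (G4 x y c H). specialize (H Cw).
assert (0 <= M2 * c) by (apply Rmult_le_pos; auto). assert (0 <= M3 * c) by (apply Rmult_le_pos; auto).
assert (0 <= M4 * c) by (apply Rmult_le_pos; auto).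
replace ((1 + M2 + M3 + M4) * c) with (c + M2 * c + M3 * c + M4 * c) by ring.
intros i. destruct i; [simpl; lra|lra|lra|lra].
Qed.

Definition vec (r th w L : R) (i : coord) : R := match i with Cr => r | Cth => th | Cw => w | CL => L end.

Lemma trunc_exact r th w L : d ^ 2 / 2 <= r <= Rm -> -1 <= L <= 1 -> d1 ^ 2 <= Dq r th -> 0 < r ->
  trunc_field (vec r th w L) Cr = w /\ trunc_field (vec r th w L) Cth = L / r ^ 2 - 1 /\
  trunc_field (vec r th w L) Cw = L ^ 2 / r ^ 3 - (1 - mu) / r ^ 2 + Ur mu r th /\
  trunc_field (vec r th w L) CL = Uth mu r th.
Proof.
intros Hr HL HD Hr0. unfold trunc_field, tr_D, tr_r, tr_L, vec. rewrite !clamp_id by lra. rewrite Rmax_left by auto.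
split; [auto|]. split; [auto|]. split; [unfold Ur, Rdiv; ring|unfold Uth; ring].
Qed.

Lemma trunc_bounds r th w L : 0 < d -> 0 < d1 -> 0 <= mu -> d ^ 2 / 2 <= r <= Rm -> -1 <= L <= 1 ->
  let X := Rmax (Dq r th) (d1 ^ 2) in
  trunc_field (vec r th w L) Cth = L / r ^ 2 - 1 /\
  Rabs (trunc_field (vec r th w L) Cw - (L ^ 2 / r ^ 3 - / r ^ 2)) <= mu * (/ r ^ 2 + / X + 1) /\
  Rabs (trunc_field (vec r th w L) CL) <= mu * (/ X + r).
Proof.
intros Hd Hd1 Hmu Hr HL X. assert (Hd2 : 0 < d ^ 2) by (apply pow_lt; auto).
assert (HX : 0 < X) by (eapply Rlt_le_trans; [apply (pow_lt d1 2 Hd1)|apply Rmax_r]).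
destruct (jupiter_force r th X (Rmax_l _ _) HX) as [A B]. pose proof (COS_bound th). pose proof (SIN_bound th).
unfold trunc_field, tr_D, tr_r, tr_L, vec. rewrite !clamp_id by lra. fold X.
split; [auto|]. split.
- replace (_ - _) with (mu * (/ r ^ 2 + ((cos th - r) * / sqrt X ^ 3 + - cos th))) by (assert (0 < sqrt X) by (apply sqrt_lt_R0; auto); field; lra).
  rewrite Rabs_mult, (Rabs_pos_eq mu) by auto. apply Rmult_le_compat_l; auto.
  assert (P : 0 < / r ^ 2) by (apply Rinv_0_lt_compat, pow_lt; lra).
  eapply Rle_trans; [apply Rabs_triang|]. rewrite (Rabs_pos_eq (/ r ^ 2)) by lra.
  assert (Rabs ((cos th - r) * / sqrt X ^ 3 + - cos th) <= / X + 1); [|lra].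
  eapply Rle_trans; [apply Rabs_triang|]. rewrite Rabs_Ropp. assert (Rabs (cos th) <= 1) by (apply Rabs_le; lra). lra.
- rewrite Rabs_mult, (Rabs_pos_eq mu) by auto. apply Rmult_le_compat_l; auto.
  unfold Rminus. eapply Rle_trans; [apply Rabs_triang|]. rewrite Rabs_Ropp.
  assert (Rabs (r * sin th) <= r) by (apply Rabs_le; split; nra). lra.
Qed.
End Truncated.

(** * The excursion of an elliptic orbit *)

Lemma far_energy al r w L E : 100 <= al -> 2 <= r -> 0 < al ^ 4 -> Rabs L <= 1 / 400 ->
  E = w ^ 2 / 2 + L ^ 2 / (2 * r ^ 2) - / r -> Rabs (E + / (2 * al ^ 4)) <= / (8 * al ^ 4) ->
  r <= 3 * al ^ 4 /\ w ^ 2 <= 1.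
Proof.
intros Hal Hr Ha HL HE HE2. apply Rabs_le_between in HE2.

replace (/ (2 * al ^ 4)) with (/ al ^ 4 / 2) in HE2 by (field; lra).
replace (/ (8 * al ^ 4)) with (/ al ^ 4 / 8) in HE2 by (field; lra).
assert (Hr2 : 0 < r ^ 2) by (apply pow_lt; lra).
assert (HL2 : 0 <= L ^ 2 / (2 * r ^ 2)) by (apply Rdiv_le_0_compat; [apply pow2_ge_0|lra]).
assert (Hw2 : 0 <= w ^ 2) by apply pow2_ge_0.
assert (Hir : / r <= 1 / 2) by (replace (1 / 2) with (/ 2) by field; apply Rinv_le_contravar; lra).
split; [|lra].

assert (H2 : r * (/ al ^ 4 * (3 / 8)) <= r * / r) by (apply Rmult_le_compat_l; lra).
rewrite Rinv_r in H2 by lra.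
assert (H3 : al ^ 4 * (r * (/ al ^ 4 * (3 / 8))) <= al ^ 4 * 1) by (apply Rmult_le_compat_l; lra).
replace (al ^ 4 * (r * (/ al ^ 4 * (3 / 8)))) with (3 / 8 * r) in H3 by (field; lra). lra.
Qed.

Lemma far_decel r L eps b R0 : 2 <= r <= R0 -> Rabs L <= 1 / 400 -> Rabs (b - (L ^ 2 / r ^ 3 - / r ^ 2)) <= eps ->
  100 * eps * R0 ^ 2 <= 1 -> b <= - / (2 * r ^ 2).
Proof.
intros Hr HL Hb He. apply Rabs_le_between in Hb.
assert (Hr2 : 0 < r ^ 2) by (apply pow_lt; lra).
assert (HR : r ^ 2 <= R0 ^ 2) by (apply pow_incr; lra).

assert (A : eps <= / r ^ 2 / 100).
{ assert (eps * r ^ 2 <= eps * R0 ^ 2) by (apply Rmult_le_compat_l; lra).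
  apply Rmult_le_reg_r with (r ^ 2); auto. replace (/ r ^ 2 / 100 * r ^ 2) with (1 / 100) by (field; lra). lra. }
assert (B : L ^ 2 / r ^ 3 <= / r ^ 2 / 100).
{ assert (L ^ 2 <= (1 / 400) ^ 2) by (rewrite <- pow2_abs; apply pow_incr; split; [apply Rabs_pos|auto]).
  replace (L ^ 2 / r ^ 3) with (/ r ^ 2 * (L ^ 2 / r)) by (field; lra).
  assert (L ^ 2 / r <= / 100) by (apply Rle_div_l; lra).
  assert (/ r ^ 2 * (L ^ 2 / r) <= / r ^ 2 * / 100) by (apply Rmult_le_compat_l; lra). lra. }
replace (/ (2 * r ^ 2)) with (/ r ^ 2 / 2) by (field; lra). lra.
Qed.

(** To second order c0 cos be + be sin be equals c0 + be^2 (1 - c0 / 2), and c0 <= 1. The gain of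
    be^2 / 2 dominates the errors, which are small fractions of be^2. *)
Lemma phase_lower c0 be A B eta : 0 < be <= 1 / 10 -> 0 <= c0 <= 1 -> Rabs (A - c0) <= eta -> Rabs (B - be) <= eta -> eta <= be ^ 2 / 10 ->
  c0 < A * cos be + B * sin be.
Proof.
intros Hb Hc HA HB He. apply Rabs_le_between in HA. apply Rabs_le_between in HB.
pose proof (cos_ge be). pose proof (sin_ge be ltac:(lra)). pose proof (sin_le_id be ltac:(lra)). pose proof (COS_bound be).
assert (Hb2 : be ^ 2 <= / 100) by nra. assert (H0b : 0 < be ^ 2) by (apply pow_lt; lra).

assert (Hs : 0 <= sin be). { assert (be ^ 3 <= be) by nra. lra. }
assert (E1 : c0 - be ^ 2 / 2 - eta <= A * cos be).
{ assert (c0 * (1 - be ^ 2 / 2) <= c0 * cos be) by (apply Rmult_le_compat_l; lra).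
  assert ((c0 - eta) * cos be <= A * cos be) by (apply Rmult_le_compat_r; lra).
  assert (eta * cos be <= eta * 1) by (apply Rmult_le_compat_l; lra).
  assert (c0 * be ^ 2 <= 1 * be ^ 2) by (apply Rmult_le_compat_r; lra). lra. }
assert (E2 : be ^ 2 - be ^ 4 / 6 - eta <= B * sin be).
{ assert ((be - eta) * sin be <= B * sin be) by (apply Rmult_le_compat_r; lra).
  assert (be * (be - be ^ 3 / 6) <= be * sin be) by (apply Rmult_le_compat_l; lra).
  assert (eta * sin be <= eta * 1) by (apply Rmult_le_compat_l; lra).
  replace (be ^ 2 - be ^ 4 / 6) with (be * (be - be ^ 3 / 6)) by field. lra. }
assert (be ^ 4 <= be ^ 2 * / 100) by (replace (be ^ 4) with (be ^ 2 * be ^ 2) by ring; apply Rmult_le_compat_l; lra). lra.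
Qed.

Lemma phase_upper v y : 0 <= v <= PI / 2 -> 1 - 5 * y <= cos v -> 0 < y -> v ^ 2 <= 16 * y.
Proof.
intros Hv Hc Hy. pose proof (cos_le v). pose proof PI_4. assert (v ^ 2 <= 4) by nra.
replace (v ^ 4) with (v ^ 2 * v ^ 2) in H by ring.  nra.
Qed.

Section FarTrip.
Variables (al eps t2 : R) (r th w L a b Q : R -> R).
Hypotheses (Hal : 100 <= al) (Heps0 : 0 <= eps) (Heps : 100000 * eps * al ^ 26 <= 1).
Hypothesis Hder : forall t, t2 <= t -> is_derive r t (w t) /\ is_derive th t (a t) /\ is_derive w t (b t) /\ is_derive L t (Q t).
Hypothesis Hfld : forall t, t2 <= t -> 2 <= r t <= 4 * al ^ 4 -> Rabs (L t) <= 1 ->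
  a t = L t / (r t) ^ 2 - 1 /\ Rabs (b t - ((L t) ^ 2 / (r t) ^ 3 - / (r t) ^ 2)) <= eps /\ Rabs (Q t) <= eps.
Hypotheses (Hr2 : r t2 = 2) (Hw2 : 0 < w t2) (HL2 : Rabs (L t2) <= 1 / 1000)
  (HE2 : En (r t2) (w t2) (L t2) = - / (2 * al ^ 4)).

(** The semi-major axis is written al^4 so that its square root al^2 and the period 2 pi al^6 are
    integral powers. The excursion lasts at most 80 al^8, which makes [e1] a bound for the total
    effect of a perturbation of size eps. *)
Let E t := En (r t) (w t) (L t).
Let e1 := eps * (80 * al ^ 8).

Lemma al_pow n : (0 < n)%nat -> 100 <= al ^ n.
Proof.
intros Hn. destruct n; [lia|]. simpl. assert (1 <= al ^ n) by (apply pow_R1_Rle; lra). nra.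
Qed.

Lemma eps_pow n : (n <= 26)%nat -> 100000 * eps * al ^ n <= 1.
Proof.
intros Hn. eapply Rle_trans; [|apply Heps]. apply Rmult_le_compat_l; [lra|]. apply Rle_pow; [lra|auto].
Qed.

Lemma e1_small : 0 <= e1 /\ 1000 * e1 * al ^ 16 <= 1.
Proof.
split; [unfold e1; apply Rmult_le_pos; auto; pose proof (al_pow 8 ltac:(lia)); lra|].
unfold e1. pose proof (eps_pow 24 ltac:(lia)).
replace (1000 * (eps * (80 * al ^ 8)) * al ^ 16) with (80000 * (eps * al ^ 24)) by ring.
 lra.
Qed.

Lemma e1_pow n : (n <= 16)%nat -> 1000 * e1 * al ^ n <= 1.
Proof.
intros Hn. destruct e1_small as [A B]. eapply Rle_trans; [|apply B]. apply Rmult_le_compat_l; [lra|]. apply Rle_pow; [lra|auto].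
Qed.

Let good t := Rabs (L t) < 1 / 400 /\ Rabs (E t + / (2 * al ^ 4)) < / (8 * al ^ 4).

Lemma good_facts t : t2 <= t -> 2 <= r t -> good t ->
  r t <= 3 * al ^ 4 /\ (w t) ^ 2 <= 1 /\ a t = L t / (r t) ^ 2 - 1 /\
  Rabs (b t - ((L t) ^ 2 / (r t) ^ 3 - / (r t) ^ 2)) <= eps /\ Rabs (Q t) <= eps /\ b t <= - / (2 * (r t) ^ 2).
Proof.
intros Ht Hr [G1 G2]. pose proof (al_pow 4 ltac:(lia)) as A4.
destruct (far_energy al (r t) (w t) (L t) (E t) Hal Hr ltac:(lra) ltac:(lra) eq_refl ltac:(lra)) as [F1 F2].
destruct (Hfld t Ht ltac:(lra) ltac:(lra)) as [F3 [F4 F5]].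
split; [auto|]. split; [auto|]. split; [auto|]. split; [auto|]. split; [auto|].
apply (far_decel (r t) (L t) eps (b t) (4 * al ^ 4)); auto; try lra.
pose proof (eps_pow 8 ltac:(lia)). replace (100 * eps * (4 * al ^ 4) ^ 2) with (1600 * (eps * al ^ 8)) by ring.
 lra.
Qed.

(** On r <= 3 al^4 the deceleration is at least 1 / (18 al^8) while |w| <= 1. This limits the
    duration, and through it the change of L and of the energy. *)
Lemma far_step t : t2 <= t -> (forall s, t2 <= s <= t -> 2 <= r s) -> (forall s, t2 <= s < t -> good s) ->
  t - t2 <= 80 * al ^ 8 /\ Rabs (L t - L t2) <= e1 /\ Rabs (E t - E t2) <= 2 * e1.
Proof.
intros Ht Hr IH.  pose proof (al_pow 8 ltac:(lia)) as A8.
assert (Time : forall s, t2 <= s < t -> s - t2 <= 79 * al ^ 8).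
{ intros s Hs.
  assert (G : w s - w t2 <= (fun u => - (u / (32 * al ^ 8))) s - (fun u => - (u / (32 * al ^ 8))) t2).
  { apply (open_derive_le w (fun u => - (u / (32 * al ^ 8))) b (fun _ => - / (32 * al ^ 8))); try lra.
    - intros u Hu. apply Hder; lra.
    - intros u Hu. auto_derive; [auto|]. field. lra.
    - intros u Hu. destruct (good_facts u ltac:(lra) (Hr u ltac:(lra)) (IH u ltac:(lra))) as [F1 [_ [_ [_ [_ F6]]]]].
      specialize (Hr u ltac:(lra)). eapply Rle_trans; [apply F6|]. apply Ropp_le_contravar, Rinv_le_contravar.
      + assert (0 < r u ^ 2) by (apply pow_lt; lra). lra.
      + assert (r u ^ 2 <= (3 * al ^ 4) ^ 2) by (apply pow_incr; lra). replace ((3 * al ^ 4) ^ 2) with (9 * al ^ 8) in H by ring. lra. }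
  cbv beta in G.
  destruct (good_facts s ltac:(lra) (Hr s ltac:(lra)) (IH s ltac:(lra))) as [_ [F2 _]].
  destruct (good_facts t2 ltac:(lra) (Hr t2 ltac:(lra)) (IH t2 ltac:(lra))) as [_ [F2' _]].
  assert (- 1 <= w s) by nra. assert (w t2 <= 1) by nra.
  assert (H1 : (s - t2) / (32 * al ^ 8) <= 2) by (unfold Rdiv in *; lra).
  apply Rle_div_l in H1; [|lra]. lra. }
(* [Time] covers only s < t, hence the evaluation at t - 1; the lost unit is absorbed by passing
   from 79 to 80. *)
assert (Tt : t - t2 <= 80 * al ^ 8).
{ destruct (Rle_lt_dec t (t2 + 1)); [lra|]. specialize (Time (t - 1) ltac:(lra)). lra. }
split; [auto|]. split.
- apply Rle_trans with (eps * (t - t2)).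
  + apply (open_derive_bound L Q); [lra| |].
    * intros u Hu. apply Hder; lra.
    * intros u Hu. apply (good_facts u); [lra|apply Hr; lra|apply IH; lra].
  + unfold e1. apply Rmult_le_compat_l; auto.
- apply Rle_trans with (2 * eps * (t - t2)).
  + apply (open_derive_bound E (fun s => w s * (b s - ((L s) ^ 2 / (r s) ^ 3 - / (r s) ^ 2)) + L s * Q s / (r s) ^ 2)); [lra| |].
    * intros u Hu. destruct (Hder u ltac:(lra)) as [D1 [_ [D3 D4]]]. specialize (Hr u Hu). apply En_derive; auto; lra.
    * intros u Hu. destruct (good_facts u ltac:(lra) (Hr u ltac:(lra)) (IH u ltac:(lra))) as [F1 [F2 [_ [F4 [F5 _]]]]].
      destruct (IH u ltac:(lra)) as [G1 _]. specialize (Hr u ltac:(lra)).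
      assert (Rabs (w u) <= 1) by (apply abs_le_of_sq; lra).
      eapply Rle_trans; [apply Rabs_triang|].
      assert (Rabs (w u * (b u - (L u ^ 2 / r u ^ 3 - / r u ^ 2))) <= 1 * eps).
      { rewrite Rabs_mult. apply Rmult_le_compat; auto; apply Rabs_pos. }
      assert (Rabs (L u * Q u / r u ^ 2) <= 1 * eps); [|lra].
      replace (L u * Q u / r u ^ 2) with ((L u / r u ^ 2) * Q u) by (field; lra). rewrite Rabs_mult.
      apply Rmult_le_compat; auto; try apply Rabs_pos.
      apply Rle_trans with (1 / 400 / 2 ^ 2); [|lra].
      apply Rabs_div_le; [lra|apply pow_incr; lra|lra].
  + unfold e1. replace (2 * (eps * (80 * al ^ 8))) with (2 * eps * (80 * al ^ 8)) by ring. apply Rmult_le_compat_l; lra.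
Qed.

Lemma far_good X : (forall t, t2 <= t <= X -> 2 <= r t) -> forall t, t2 <= t <= X -> good t.
Proof.
intros Hr. pose proof (al_pow 4 ltac:(lia)) as A4.
assert (Hi : / (2 * al ^ 4) = / al ^ 4 / 2 /\ / (8 * al ^ 4) = / al ^ 4 / 8) by (split; field; lra).

assert (Hee : 16 * e1 < / al ^ 4).
{ pose proof (e1_pow 4 ltac:(lia)). destruct e1_small as [P _]. apply Rmult_lt_reg_r with (al ^ 4); [lra|]. rewrite Rinv_l by lra.
   lra. }
apply bootstrap.
- intros t Ht [G1 G2]. destruct (Hder t ltac:(lra)) as [D1 [D2 [D3 D4]]]. specialize (Hr t Ht).
  apply filter_and.
  + apply (locally_lt (fun s => Rabs (L s))); auto. apply (continuous_comp L Rabs); [exact (is_derive_continuous _ _ _ D4)|apply continuous_Rabs].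
  + apply (locally_lt (fun s => Rabs (E s + / (2 * al ^ 4)))); auto.
    apply (continuous_comp (fun s => E s + / (2 * al ^ 4)) Rabs); [|apply continuous_Rabs].
    apply (continuous_plus (V := R_NormedModule)); [|apply continuous_const].
    eapply is_derive_continuous. apply En_derive; [lra|exact D1|exact D3|exact D4].
- intros t Ht IH. destruct (far_step t ltac:(lra) (fun s Hs => Hr s ltac:(lra)) IH) as [_ [B1 B2]].
  destruct e1_small as [P P2]. pose proof (e1_pow 0 ltac:(lia)) as P3. simpl in P3.
  split.
  + replace (L t) with ((L t - L t2) + L t2) by ring. eapply Rle_lt_trans; [apply Rabs_triang|]. lra.
  + replace (E t + / (2 * al ^ 4)) with (E t - E t2) by (unfold E at 2; rewrite HE2; ring). lra.
Qed.

Lemma far_return : exists t3, t2 < t3 /\ (forall t, t2 <= t <= t3 -> 2 <= r t) /\ r t3 = 2 /\ w t3 < 0.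
Proof.
 pose proof (al_pow 8 ltac:(lia)) as A8.
assert (Hex : exists t4, t2 <= t4 <= t2 + 81 * al ^ 8 /\ r t4 < 2).
{ apply NNPP. intros Hn.
  assert (Hr : forall t, t2 <= t <= t2 + 81 * al ^ 8 -> 2 <= r t).
  { intros t Ht. apply Rnot_lt_le. intros Hlt. apply Hn. exists t. auto. }
  destruct (far_step (t2 + 81 * al ^ 8) ltac:(lra) Hr) as [H _]; [|lra].
  intros s Hs. apply (far_good (t2 + 81 * al ^ 8)); auto; lra. }
destruct Hex as [t4 [Ht4 Hr4]].
assert (Dw2 : continuous w t2) by (destruct (Hder t2 ltac:(lra)) as [_ [_ [D _]]]; exact (is_derive_continuous _ _ _ D)).
destruct (locally_gt w t2 0 Dw2 Hw2) as [e He].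
assert (Hep := cond_pos e).
(* The excursion starts on r = 2 itself. The return is therefore the first hit sought after t2 + e /
   2, when the orbit is already outside. *)
assert (Hup : forall s, t2 < s < t2 + e -> 2 < r s).
{ intros s Hs. rewrite <- Hr2. destruct (MVT_cor2 r w t2 s) as [x [Ex Hx]]; [lra|intros; apply is_derive_Reals; apply Hder; lra|].
  assert (0 < w x). { apply He. change (Rabs (x - t2) < e). rewrite Rabs_pos_eq; lra. }
  assert (0 < w x * (s - t2)) by (apply Rmult_lt_0_compat; lra). lra. }
assert (He4 : t2 + e <= t4).
{ apply Rnot_lt_le. intros Hlt. destruct (Req_dec t4 t2) as [Z|Z]; [subst; lra|].
  specialize (Hup t4 ltac:(lra)). lra. }
assert (Hupe := Hup (t2 + e / 2) ltac:(lra)).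
assert (Cr' : forall x, t2 + e / 2 <= x <= t4 -> continuous (fun u => - r u) x).
{ intros x Hx. apply (continuous_opp (V := R_NormedModule)). destruct (Hder x ltac:(lra)) as [D _]. exact (is_derive_continuous _ _ _ D). }
destruct (first_hit (fun u => - r u) (t2 + e / 2) t4 (-2) ltac:(lra) Cr' ltac:(lra)) as [t3 [Ht3 [E3 Hlt3]]].
assert (Hr3 : forall t, t2 <= t <= t3 -> 2 <= r t).
{ intros t Ht. destruct (Req_dec t t2) as [->|]; [lra|]. destruct (Rlt_le_dec t (t2 + e)) as [HH|HH]; [left; apply Hup; lra|].
  destruct (Req_dec t t3) as [->|]; [lra|]. specialize (Hlt3 t ltac:(lra)). lra. }
exists t3. split; [lra|]. split; [auto|]. split; [lra|].
apply Rnot_le_lt. intros Hw3.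
assert (G : forall s, t2 <= s < t3 -> 0 < w s).
{ intros s Hs. destruct (MVT_cor2 w b s t3) as [x [Ex Hx]]; [lra|intros; apply is_derive_Reals; apply Hder; lra|].
  assert (Hrx : 2 <= r x) by (apply Hr3; lra).
  destruct (good_facts x ltac:(lra) Hrx) as [_ [_ [_ [_ [_ F6]]]]]; [apply (far_good t3); auto; lra|].
  assert (0 < / (2 * r x ^ 2)) by (apply Rinv_0_lt_compat; assert (0 < r x ^ 2) by (apply pow_lt; lra); lra).
  assert (0 < - b x * (t3 - s)) by (apply Rmult_lt_0_compat; lra). lra. }
destruct (MVT_cor2 r w t2 t3) as [x [Ex Hx]]; [lra|intros; apply is_derive_Reals; apply Hder; lra|].
specialize (G x ltac:(lra)). assert (0 < w x * (t3 - t2)) by (apply Rmult_lt_0_compat; lra). lra.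
Qed.

(** Kepler motion with eccentric anomaly u, du/dt = 1 / (al^2 r), measured from the start of the
    excursion. The pair (1 - r/a, r w / sqrt a) with a = al^4 is the eccentricity times (cos, sin)
    of the anomaly counted from pericentre, so it rotates with u. Coming back to r = 2 with w < 0
    forces u to be within O(1/al) of 2 pi, and Kepler's equation converts this into the duration 2
    pi al^6 with an error of order al^5. *)
Lemma far_phase t3 : t2 < t3 -> (forall t, t2 <= t <= t3 -> 2 <= r t) -> r t3 = 2 -> w t3 < 0 ->
  Rabs (t3 - t2 - 2 * PI * al ^ 6) <= 5 * al ^ 5 /\ Rabs (L t3 - L t2) <= e1 /\ Rabs (E t3 - E t2) <= 2 * e1 /\
  Rabs (th t3 - th t2 + (t3 - t2)) <= 1.
Proof.
intros H23 Hr Hr3 Hw3. pose proof (al_pow 2 ltac:(lia)) as A2. pose proof (al_pow 4 ltac:(lia)) as A4.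
assert (G := far_good t3 Hr).
assert (F := fun t Ht => good_facts t (proj1 Ht) (Hr t Ht) (G t Ht)).
assert (Step := fun t (Ht : t2 <= t <= t3) => far_step t (proj1 Ht) (fun s Hs => Hr s ltac:(lra)) (fun s Hs => G s ltac:(lra))).
destruct (Step t3 ltac:(lra)) as [T3 [L3 E3]]. destruct e1_small as [P1 P2].
assert (Wabs : forall t, t2 <= t <= t3 -> -1 <= w t <= 1) by (intros t Ht; destruct (F t Ht) as [_ [F2 _]]; split; nra).
assert (Ww2 : 9 / 10 <= w t2).
{ assert (Q1 : (w t2) ^ 2 / 2 = 1 / 2 - / (2 * al ^ 4) - (L t2) ^ 2 / 8) by (rewrite <- (Ropp_involutive (/ (2 * al ^ 4))), <- HE2; unfold En; rewrite Hr2; field).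
  assert (/ (2 * al ^ 4) <= / 100) by (apply Rinv_le_contravar; lra).
  assert ((L t2) ^ 2 <= (1 / 1000) ^ 2) by (rewrite <- pow2_abs; apply pow_incr; split; [apply Rabs_pos|auto]). nra. }
split; [|split; [exact L3|split; [exact E3|]]].
(* The angle gained from L is the integral of L / r^2, and 1 / r^2 is at most twice the
   deceleration. The integral is thus paid for by the decrease of w, which is at most 2. *)
2:{ replace (th t3 - th t2 + (t3 - t2)) with ((fun t => th t + t) t3 - (fun t => th t + t) t2) by ring.
  apply Rle_trans with ((fun t => - (1 / 100 * w t)) t3 - (fun t => - (1 / 100 * w t)) t2).
  - apply (open_derive_abs (fun t => th t + t) (fun t => - (1 / 100 * w t)) (fun t => a t + 1) (fun t => - (1 / 100 * b t))); [lra| | |].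
    + intros t Ht. destruct (Hder t ltac:(lra)) as [_ [D _]].
      apply (is_derive_plus (V := R_NormedModule)); [exact D|auto_derive; auto].
    + intros t Ht. destruct (Hder t ltac:(lra)) as [_ [_ [D _]]]. apply (is_derive_opp (V := R_NormedModule)), (is_derive_scal w t), D.
    + intros t Ht. destruct (F t ltac:(lra)) as [_ [_ [F3 [_ [_ F6]]]]]. destruct (G t ltac:(lra)) as [G1 _]. rewrite F3.
      specialize (Hr t ltac:(lra)). assert (0 < r t ^ 2) by (apply pow_lt; lra).
      replace (L t / r t ^ 2 - 1 + 1) with (L t * / r t ^ 2) by (field; lra).
      assert (0 < / r t ^ 2) by (apply Rinv_0_lt_compat; auto).
      rewrite Rabs_mult, (Rabs_pos_eq (/ r t ^ 2)) by lra. replace (/ (2 * r t ^ 2)) with (/ r t ^ 2 / 2) in F6 by (field; lra).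
      assert (Rabs (L t) * / r t ^ 2 <= 1 / 400 * / r t ^ 2) by (apply Rmult_le_compat_r; lra). lra.
  - cbv beta. pose proof (Wabs t2 ltac:(lra)). pose proof (Wabs t3 ltac:(lra)). lra. }
(* The rate of the eccentric anomaly. The two maxima only make it continuous on the whole line; they
   are inactive on the excursion. *)
pose (h := fun s => / (al ^ 2 * Rmax 1 (r (Rmax t2 s)))).
pose (u := fun t => RInt h t2 t).
assert (Ch : forall t : R, continuous h t).
{ intros t. assert (Cm : forall c (x : R), continuous (Rmax c) x).
  { intros c x. apply (continuous_of_lip _ 1). intros p q. unfold Rmax. repeat destruct Rle_dec; unfold Rabs; repeat destruct Rcase_abs; lra. }
  apply (continuous_comp (fun s => Rmax 1 (r (Rmax t2 s))) (fun x => / (al ^ 2 * x))).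
  - apply (continuous_comp (fun s => r (Rmax t2 s)) (Rmax 1)); auto.
    apply (continuous_comp (Rmax t2) r); auto. destruct (Hder (Rmax t2 t) (Rmax_l _ _)) as [D _]. exact (is_derive_continuous _ _ _ D).
  - apply (ex_derive_continuous (fun x => / (al ^ 2 * x))). pose proof (Rmax_l 1 (r (Rmax t2 t))).
    auto_derive. apply Rgt_not_eq. apply Rmult_lt_0_compat; lra. }
assert (Du : forall t, t2 <= t <= t3 -> is_derive u t (/ (al ^ 2 * r t))).
{ intros t Ht. replace (/ (al ^ 2 * r t)) with (h t).
  - apply (is_derive_RInt (V := R_CompleteNormedModule) h _ t2 t); auto.
    exists (mkposreal 1 Rlt_0_1). intros y _. apply (RInt_correct (V := R_CompleteNormedModule)), ex_RInt_cont; auto.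
  - unfold h. specialize (Hr t Ht). rewrite (Rmax_right t2 t) by lra. rewrite Rmax_right by lra. auto. }
assert (u0 : u t2 = 0) by (unfold u; rewrite RInt_point; reflexivity).
pose (c := fun t => 1 - r t / al ^ 4). pose (s := fun t => r t * w t / al ^ 2).
(* The defect by which (c, s) fails to rotate: it collects the drift of the energy and the
   perturbing radial force. *)
pose (er := fun t => (2 * (E t - E t2) + r t * (b t - ((L t) ^ 2 / (r t) ^ 3 - / (r t) ^ 2))) / al ^ 2).
assert (erb : forall t, t2 <= t <= t3 -> Rabs (er t) <= 5 * e1).
{ intros t Ht. destruct (F t Ht) as [F1 [_ [_ [F4 _]]]]. destruct (Step t Ht) as [_ [_ S3]]. specialize (Hr t Ht).
  unfold er. apply Rle_trans with ((5 * e1) / 1); [|lra]. apply Rabs_div_le; try lra.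
  eapply Rle_trans; [apply Rabs_triang|]. rewrite !Rabs_mult, (Rabs_pos_eq 2), (Rabs_pos_eq (r t)) by lra.
  assert (r t * Rabs (b t - (L t ^ 2 / r t ^ 3 - / r t ^ 2)) <= 3 * al ^ 4 * eps) by (apply Rmult_le_compat; try lra; apply Rabs_pos).
  assert (3 * al ^ 4 * eps <= e1). { unfold e1. assert (al ^ 4 <= al ^ 8) by (apply Rle_pow; [lra|lia]). assert (al ^ 4 * eps <= al ^ 8 * eps) by (apply Rmult_le_compat_r; auto).
    assert (0 <= al ^ 8 * eps) by (apply Rmult_le_pos; lra). lra. } lra. }
assert (Edef : forall t, t2 <= t <= t3 -> (w t) ^ 2 + r t * b t = 2 * E t + / r t + r t * (b t - ((L t) ^ 2 / (r t) ^ 3 - / (r t) ^ 2))).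
{ intros t Ht. specialize (Hr t Ht). unfold E, En. field. lra. }
assert (Et2 : E t2 = - / (2 * al ^ 4)) by exact HE2.
assert (Dc : forall t, t2 <= t <= t3 -> is_derive c t (- s t * / (al ^ 2 * r t))).
{ intros t Ht. destruct (Hder t ltac:(lra)) as [D _]. assert (E0 : Derive (fun x => r x) t = _) by (apply is_derive_unique; exact D).
  specialize (Hr t Ht). unfold c, s. auto_derive; [eexists; eauto|]. rewrite E0. field. lra. }
assert (Ds : forall t, t2 <= t <= t3 -> is_derive s t (c t * / (al ^ 2 * r t) + er t)).
{ intros t Ht. destruct (Hder t ltac:(lra)) as [D [_ [D' _]]]. assert (E0 : Derive (fun x => r x) t = _) by (apply is_derive_unique; exact D).
  assert (E0' : Derive (fun x => w x) t = _) by (apply is_derive_unique; exact D').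
  specialize (Edef t Ht). specialize (Hr t Ht). unfold c, er, s. auto_derive; [split; [eexists; eauto|split; [eexists; eauto|auto]]|]. rewrite E0, E0'.
  transitivity (((w t) ^ 2 + r t * b t) / al ^ 2); [field; lra|].
  rewrite Edef, Et2. field. lra. }
(* The vector (c, s) rotated back by u: constant for pure Kepler motion, and nearly constant here.
   Its initial value is (c0, be). *)
pose (A := fun t => c t * cos (u t) + s t * sin (u t)). pose (B := fun t => s t * cos (u t) - c t * sin (u t)).
assert (DA : forall t, t2 <= t <= t3 -> is_derive A t (er t * sin (u t)) /\ is_derive B t (er t * cos (u t))).
{ intros t Ht. assert (X1 : Derive (fun x => c x) t = _) by (apply is_derive_unique; exact (Dc t Ht)).
  assert (X2 : Derive (fun x => s x) t = _) by (apply is_derive_unique; exact (Ds t Ht)).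
  assert (X3 : Derive (fun x => u x) t = _) by (apply is_derive_unique; exact (Du t Ht)).
  assert (Y1 : ex_derive c t) by (eexists; exact (Dc t Ht)). assert (Y2 : ex_derive s t) by (eexists; exact (Ds t Ht)).
  assert (Y3 : ex_derive u t) by (eexists; exact (Du t Ht)).
  split; [unfold A|unfold B]; (auto_derive; [repeat split; auto|]); rewrite X1, X2, X3; ring. }
set (et := 400 * e1 * al ^ 8).
assert (AB : forall t, t2 <= t <= t3 -> Rabs (A t - A t2) <= et /\ Rabs (B t - B t2) <= et).
{ intros t Ht. destruct (Step t Ht) as [Tt _].
  assert (K : 5 * e1 * (t - t2) <= et) by (unfold et; assert (5 * e1 * (t - t2) <= 5 * e1 * (80 * al ^ 8)) by (apply Rmult_le_compat_l; lra); lra).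
  split; (eapply Rle_trans; [|exact K]).
  - apply (open_derive_bound A (fun t => er t * sin (u t))); [lra| |].
    + intros x Hx. apply DA; lra.
    + intros x Hx. rewrite Rabs_mult. specialize (erb x ltac:(lra)). assert (Rabs (sin (u x)) <= 1) by (apply Rabs_le, SIN_bound).
      assert (Rabs (er x) * Rabs (sin (u x)) <= 5 * e1 * 1) by (apply Rmult_le_compat; auto; apply Rabs_pos). lra.
  - apply (open_derive_bound B (fun t => er t * cos (u t))); [lra| |].
    + intros x Hx. apply DA; lra.
    + intros x Hx. rewrite Rabs_mult. specialize (erb x ltac:(lra)). assert (Rabs (cos (u x)) <= 1) by (apply Rabs_le, COS_bound).
      assert (Rabs (er x) * Rabs (cos (u x)) <= 5 * e1 * 1) by (apply Rmult_le_compat; auto; apply Rabs_pos). lra. }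
set (be := 2 * w t2 / al ^ 2). set (c0 := 1 - 2 / al ^ 4).
assert (A0 : A t2 = c0) by (unfold A, c; rewrite u0, cos_0, sin_0, Hr2; unfold c0; ring).
assert (B0 : B t2 = be) by (unfold B, s; rewrite u0, cos_0, sin_0, Hr2; unfold be; field; lra).
assert (Hi2 : 0 < / al ^ 2 <= / 100) by (split; [apply Rinv_0_lt_compat; lra|apply Rinv_le_contravar; lra]).
assert (Hi4 : / al ^ 4 = / al ^ 2 * / al ^ 2) by (rewrite <- Rinv_mult; f_equal; ring).
assert (Hbe : 18 / 10 * / al ^ 2 <= be <= 2 * / al ^ 2).
{ pose proof (Wabs t2 ltac:(lra)). unfold be, Rdiv. split; apply Rmult_le_compat_r; lra. }
assert (Het : 0 <= et /\ et <= / al ^ 4 / 4).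
{ unfold et. split; [repeat apply Rmult_le_pos; lra|]. pose proof (e1_pow 12 ltac:(lia)) as Q12.
  apply Rmult_le_reg_r with (al ^ 4); [lra|]. replace (/ al ^ 4 / 4 * al ^ 4) with (1 / 4) by (field; lra).
  assert (0 <= e1 * al ^ 12) by (apply Rmult_le_pos; [lra|apply pow_le; lra]).
  replace (400 * e1 * al ^ 8 * al ^ 4) with (400 * (e1 * al ^ 12)) by ring.
  replace (1000 * e1 * al ^ 12) with (1000 * (e1 * al ^ 12)) in Q12 by ring.
  assert (100 * (1000 * (e1 * al ^ 12)) <= 1); [|lra].
  pose proof (e1_pow 13 ltac:(lia)) as Q13. replace (al ^ 13) with (al * al ^ 12) in Q13 by ring.
  assert (100 * (e1 * al ^ 12) <= al * (e1 * al ^ 12)) by (apply Rmult_le_compat_r; lra). lra. }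
assert (Hetb : et <= be ^ 2 / 10).
{ assert ((18 / 10 * / al ^ 2) ^ 2 <= be ^ 2) by (apply pow_incr; lra).
  replace ((18 / 10 * / al ^ 2) ^ 2) with (324 / 100 * / al ^ 4) in H by (rewrite Hi4; field; lra). lra. }
assert (Hc0 : 0 <= c0 <= 1) by (unfold c0, Rdiv; rewrite Hi4; assert (0 <= / al ^ 2 * / al ^ 2 <= / 100 * / 100) by (split; [apply Rmult_le_pos; lra|apply Rmult_le_compat; lra]); lra).
assert (Ucont : forall t, t2 <= t <= t3 -> continuous u t) by (intros t Ht; exact (is_derive_continuous _ _ _ (Du t Ht))).
assert (cs : forall t, c t = A t * cos (u t) - B t * sin (u t) /\ s t = A t * sin (u t) + B t * cos (u t)).
{ intros t. unfold A, B. pose proof (sc1 (u t)) as SC. set (cc := cos (u t)) in *. set (ss := sin (u t)) in *. split.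
  - transitivity (c t * (ss * ss + cc * cc)); [rewrite SC; ring|ring].
  - transitivity (s t * (ss * ss + cc * cc)); [rewrite SC; ring|ring]. }
 pose proof PI2_1 as PI21.
(* At the phase 2 pi - be the value of c would exceed c0, that is, r would be below 2, contrary to r
   >= 2 on the excursion. *)
assert (U3 : u t3 < 2 * PI - be).
{ apply Rnot_le_lt. intros Hle.
  destruct (ivt_between u t2 t3 (2 * PI - be)) as [t [Ht Eu]]; [lra|exact Ucont|rewrite u0; left; lra|].
  destruct (AB t Ht) as [X1 X2]. rewrite A0 in X1. rewrite B0 in X2.
  assert (K := phase_lower c0 be (A t) (B t) et ltac:(lra) Hc0 X1 X2 Hetb).
  destruct (cs t) as [C1 _]. rewrite Eu in C1.
  replace (cos (2 * PI - be)) with (cos be) in C1 by (rewrite <- cos_neg, <- (cos_period (- be) 1); f_equal; simpl; ring).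
  replace (sin (2 * PI - be)) with (- sin be) in C1 by (rewrite <- sin_neg, <- (sin_period (- be) 1); f_equal; simpl; ring).
  assert (c t <= c0). { unfold c, c0, Rdiv. specialize (Hr t Ht). assert (2 * / al ^ 4 <= r t * / al ^ 4) by (apply Rmult_le_compat_r; [left; apply Rinv_0_lt_compat|]; lra). lra. }
  lra. }
destruct (AB t3 ltac:(lra)) as [X1 X2]. rewrite A0 in X1. rewrite B0 in X2.
assert (Hi4' : 0 < / al ^ 4 <= / 100 * / al ^ 2) by (rewrite Hi4; split; [apply Rmult_lt_0_compat; lra|apply Rmult_le_compat_r; lra]).
assert (A3 : 1 / 2 <= A t3 <= 1) by (apply Rabs_le_between in X1; unfold c0, Rdiv in *; lra).
assert (B3 : 0 < B t3 <= 21 / 10 * / al ^ 2) by (apply Rabs_le_between in X2; lra).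
destruct (cs t3) as [C3 S3].
assert (s3 : s t3 < 0). { unfold s. rewrite Hr3. unfold Rdiv. assert (0 < 2 * - w t3 * / al ^ 2) by (apply Rmult_lt_0_compat; lra). lra. }
assert (u3p : 0 <= u t3).
{ assert (0 - 0 <= u t3 - u t2); [|lra]. apply (open_derive_le (fun _ => 0) u (fun _ => 0) (fun t => / (al ^ 2 * r t))); [lra|intros; apply @is_derive_const|exact Du|].
  intros t Ht. left. specialize (Hr t ltac:(lra)). apply Rinv_0_lt_compat, Rmult_lt_0_compat; lra. }
assert (U3' : PI / 2 < u t3).
{ apply Rnot_le_lt. intros Hle. pose proof (sin_ge_0 (u t3) u3p ltac:(lra)). pose proof (cos_ge_0 (u t3) ltac:(lra) Hle).
  assert (0 <= A t3 * sin (u t3)) by (apply Rmult_le_pos; lra). assert (0 <= B t3 * cos (u t3)) by (apply Rmult_le_pos; lra). lra. }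
set (v := 2 * PI - u t3).
assert (cv : cos (u t3) = cos v) by (unfold v; rewrite <- (cos_neg (u t3)), <- (cos_period (- u t3) 1); f_equal; simpl; ring).
assert (sv : sin (u t3) = - sin v) by (unfold v; rewrite <- (Ropp_involutive (sin (u t3))), <- (sin_neg (u t3)), <- (sin_period (- u t3) 1); do 2 f_equal; simpl; ring).
assert (c3 : c t3 = c0) by (unfold c; rewrite Hr3; reflexivity).
rewrite c3, cv, sv in C3.
assert (Hcv : 1 - 5 * / al ^ 2 <= cos v).
{ pose proof (SIN_bound v). assert (B t3 * sin v <= B t3 * 1) by (apply Rmult_le_compat_l; lra).
  assert (Qv : 1 - 5 * / al ^ 2 <= A t3 * cos v) by (unfold c0, Rdiv in C3; lra).
  assert (0 <= cos v). { apply Rnot_lt_le. intros Hn. assert (0 < A t3 * - cos v) by (apply Rmult_lt_0_compat; lra). lra. }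
  assert (A t3 * cos v <= 1 * cos v) by (apply Rmult_le_compat_r; lra). lra. }
assert (Hv : 0 <= v <= PI / 2).
{ split; [unfold v; lra|]. apply Rnot_lt_le. intros Hn. assert (cos v <= 0) by (apply cos_le_0; unfold v in *; lra). lra. }
assert (Hv2 := phase_upper v (/ al ^ 2) Hv Hcv ltac:(lra)).
assert (Hva : v <= 4 / al).
{ apply Rabs_le_between. apply abs_le_of_sq; [apply Rdiv_le_0_compat; lra|]. replace ((4 / al) ^ 2) with (16 * / al ^ 2) by (field; lra). auto. }
(* Kepler's equation: Z is constant on unperturbed orbits and relates elapsed time to the anomaly
   u. *)
pose (Z := fun t => r t * w t + t / al ^ 4 - al ^ 2 * u t).
assert (HZ : Rabs (Z t3 - Z t2) <= 1).
{ apply Rle_trans with (5 * e1 * al ^ 2 * (t3 - t2)).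
  - apply (open_derive_bound Z (fun t => er t * al ^ 2)); [lra| |].
    + intros t Ht. destruct (Hder t ltac:(lra)) as [D [_ [D' _]]]. assert (E0 : Derive (fun x => r x) t = _) by (apply is_derive_unique; exact D).
      assert (E0' : Derive (fun x => w x) t = _) by (apply is_derive_unique; exact D').
      assert (E0'' : Derive (fun x => u x) t = _) by (apply is_derive_unique; exact (Du t Ht)).

      specialize (Edef t Ht). specialize (Hr t Ht). unfold Z. auto_derive; [repeat split; auto; eexists; eauto|]. rewrite E0, E0', E0''.
      transitivity (((w t) ^ 2 + r t * b t) + / al ^ 4 - / r t); [field; lra|]. rewrite Edef. unfold er. rewrite Et2. field. lra.
    + intros t Ht. rewrite Rabs_mult, (Rabs_pos_eq (al ^ 2)) by lra. apply Rmult_le_compat_r; [lra|apply erb; lra].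
  - pose proof (e1_pow 10 ltac:(lia)) as Q10. assert (0 <= e1 * al ^ 2) by (apply Rmult_le_pos; lra).
    assert (5 * (e1 * al ^ 2) * (t3 - t2) <= 5 * (e1 * al ^ 2) * (80 * al ^ 8)) by (apply Rmult_le_compat_l; lra).
    replace (5 * (e1 * al ^ 2) * (80 * al ^ 8)) with (400 * (e1 * al ^ 10)) in H0 by ring.
     lra. }
assert (Tm : t3 - t2 - 2 * PI * al ^ 6 = al ^ 4 * ((Z t3 - Z t2) - 2 * w t3 + 2 * w t2) - al ^ 6 * v).
{ unfold Z, v. rewrite Hr3, Hr2, u0. field. lra. }
rewrite Tm. unfold Rminus at 1. eapply Rle_trans; [apply Rabs_triang|]. rewrite Rabs_Ropp, !Rabs_mult, (Rabs_pos_eq (al ^ 4)), (Rabs_pos_eq (al ^ 6)), (Rabs_pos_eq v); try lra; [|apply pow_le; lra].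
assert (Rabs (Z t3 - Z t2 - 2 * w t3 + 2 * w t2) <= 5).
{ pose proof (Wabs t2 ltac:(lra)). pose proof (Wabs t3 ltac:(lra)). apply Rabs_le_between in HZ. apply Rabs_le; lra. }
assert (al ^ 4 * Rabs (Z t3 - Z t2 - 2 * w t3 + 2 * w t2) <= al ^ 4 * 5) by (apply Rmult_le_compat_l; lra).
assert (al ^ 6 * v <= al ^ 6 * (4 / al)) by (apply Rmult_le_compat_l; [apply pow_le; lra|lra]).
replace (al ^ 6 * (4 / al)) with (4 * al ^ 5) in H1 by (field; lra).
replace (al ^ 5) with (al * al ^ 4) in H1 |- * by ring.
assert (5 * al ^ 4 <= al * al ^ 4) by (apply Rmult_le_compat_r; lra). lra.
Qed.
Lemma far_range t3 t : (forall t, t2 <= t <= t3 -> 2 <= r t) -> t2 <= t <= t3 -> r t <= 3 * al ^ 4 /\ Rabs (L t) <= 1 / 2.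
Proof.
intros Hr Ht. assert (G := far_good t3 Hr t Ht). split; [apply (good_facts t (proj1 Ht) (Hr t Ht) G)|].
destruct G as [G _]. lra.
Qed.
End FarTrip.

(** * The return past Jupiter *)

Lemma atan_gap x y : Rabs (atan x - atan y) <= 4.
Proof. pose proof (atan_bound x). pose proof (atan_bound y). pose proof PI_4. apply Rabs_le. lra. Qed.

Section Inbound.
Variables (d M eps mu d1 t3 : R) (r th w L a b Q : R -> R).
Hypotheses (Hd : 0 < d <= 1 / 1000) (HM : 0 < M <= d ^ 4 / 1000) (Heps : 0 <= eps) (Hmu : 0 < mu) (Hd1 : 0 < d1).
Hypothesis Hkick : 6 * eps + 50 * (mu / d1) <= M / 2.
Hypothesis Hder : forall t, t3 <= t -> is_derive r t (w t) /\ is_derive th t (a t) /\ is_derive w t (b t) /\ is_derive L t (Q t).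
Let bnd t := eps + 4 * mu / ((r t - 1) ^ 2 + d1 ^ 2).
Hypothesis Hfld : forall t, t3 <= t -> d ^ 2 <= r t <= 2 -> Rabs (L t) <= 1 ->
  a t = L t / (r t) ^ 2 - 1 /\ Rabs (b t - ((L t) ^ 2 / (r t) ^ 3 - / (r t) ^ 2)) <= bnd t /\ Rabs (Q t) <= bnd t.
Hypotheses (Hr3 : r t3 = 2) (Hw3 : w t3 < 0) (HL3 : Rabs (L t3) <= M / 2) (HE3 : Rabs (En (r t3) (w t3) (L t3)) <= M / 2).

Let E t := En (r t) (w t) (L t).
(** A primitive of the perturbation bound divided by the radial velocity. Since |w| stays above 1/2,
    the arctangent bounds the total kick by a multiple of mu / d1, although the force itself is only
    bounded by mu / d1^2. *)
Let g t := eps * r t + 4 * (mu / d1) * atan ((r t - 1) / d1).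
Let good t := 0 < r t /\ w t < - (1 / 2) /\ Rabs (L t) < 2 * M /\ Rabs (E t) < 2 * M.

Lemma bnd_pos t : 0 <= bnd t.
Proof.
unfold bnd. assert (0 < (r t - 1) ^ 2 + d1 ^ 2) by (pose proof (pow2_ge_0 (r t - 1)); assert (0 < d1 ^ 2) by (apply pow_lt; auto); lra).
assert (0 <= 4 * mu / ((r t - 1) ^ 2 + d1 ^ 2)) by (apply Rdiv_le_0_compat; lra). lra.
Qed.

Lemma g_derive t : t3 <= t -> is_derive g t (w t * bnd t).
Proof.
intros Ht. destruct (Hder t Ht) as [D _]. assert (E0 : Derive (fun x => r x) t = _) by (apply is_derive_unique; exact D).

unfold g, bnd. auto_derive; [repeat split; auto; eexists; eauto|]. rewrite E0. field. repeat split; try lra.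
all: apply Rgt_not_eq; assert (0 < d1 ^ 2) by (apply pow_lt; auto); pose proof (pow2_ge_0 (r t - 1)); lra.
Qed.

Lemma g_gap s t : 0 <= r s <= 2 -> 0 <= r t <= 2 -> Rabs (g s - g t) <= 2 * eps + 16 * (mu / d1).
Proof.
intros Hs Ht. unfold g. assert (0 < mu / d1) by (apply Rdiv_lt_0_compat; auto).
replace (eps * r s + 4 * (mu / d1) * atan ((r s - 1) / d1) - (eps * r t + 4 * (mu / d1) * atan ((r t - 1) / d1))) with
 (eps * (r s - r t) + 4 * (mu / d1) * (atan ((r s - 1) / d1) - atan ((r t - 1) / d1))) by ring.
eapply Rle_trans; [apply Rabs_triang|]. rewrite (Rabs_mult eps), (Rabs_pos_eq eps), (Rabs_mult (4 * _)), (Rabs_pos_eq (4 * (mu / d1))) by lra.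
assert (Rabs (r s - r t) <= 2) by (apply Rabs_le; lra).
pose proof (atan_gap ((r s - 1) / d1) ((r t - 1) / d1)).
assert (eps * Rabs (r s - r t) <= eps * 2) by (apply Rmult_le_compat_l; lra).
assert (4 * (mu / d1) * Rabs (atan ((r s - 1) / d1) - atan ((r t - 1) / d1)) <= 4 * (mu / d1) * (4)) by (apply Rmult_le_compat_l; lra).
lra.
Qed.

Lemma inbound_step t : t3 <= t -> (forall s, t3 <= s <= t -> d ^ 2 <= r s) -> (forall s, t3 <= s < t -> good s) ->
  r t <= 2 /\ t - t3 <= 4 /\ w t < - (1 / 2) /\ Rabs (L t - L t3) <= 4 * eps + 32 * (mu / d1) /\ Rabs (E t - E t3) <= 6 * eps + 48 * (mu / d1).
Proof.
intros Ht Hr IH. assert (Hd2 : 0 < d ^ 2) by (apply pow_lt; lra).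
assert (Hk : 0 < mu / d1) by (apply Rdiv_lt_0_compat; auto).
assert (HM1 : M <= / 1000) by (assert (d ^ 4 <= 1) by (replace 1 with (1 ^ 4) by ring; apply pow_incr; lra); lra).
assert (Hr2 : forall s, t3 <= s <= t -> r s <= 2 /\ (s - t3) / 2 <= r t3 - r s).
{ intros s Hs. assert (G : r s - r t3 <= (fun u => - (u / 2)) s - (fun u => - (u / 2)) t3).
  { apply (open_derive_le r (fun u => - (u / 2)) w (fun _ => - (1 / 2))); [lra| | |].
    - intros u Hu. apply Hder; lra.
    - intros u Hu. apply (is_derive_eq (fun v : R => - (v / 2)) u (- (1 * / 2)) (- (1 / 2))); [field|auto_derive; auto].
    - intros u Hu. destruct (IH u ltac:(lra)) as [_ [G _]]. lra. }
  cbv beta in G. rewrite Hr3 in *. lra. }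
assert (F : forall s, t3 < s < t -> a s = L s / (r s) ^ 2 - 1 /\ Rabs (b s - ((L s) ^ 2 / (r s) ^ 3 - / (r s) ^ 2)) <= bnd s /\ Rabs (Q s) <= bnd s).
{ intros s Hs. destruct (IH s ltac:(lra)) as [_ [_ [G _]]]. apply Hfld; [lra|split; [apply Hr; lra|apply Hr2; lra]|lra]. }
destruct (Hr2 t ltac:(lra)) as [Rt Tt]. rewrite Hr3 in Tt. specialize (Hr t ltac:(lra)) as Hrt.
assert (Gap := g_gap t3 t ltac:(lra) ltac:(lra)). apply Rabs_le_between in Gap.
assert (GL : Rabs (L t - L t3) <= 4 * eps + 32 * (mu / d1)).
{ apply Rle_trans with ((fun s => - (2 * g s)) t - (fun s => - (2 * g s)) t3); [|cbv beta; lra].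
  apply (open_derive_abs L (fun s => - (2 * g s)) Q (fun s => - (2 * (w s * bnd s)))); [lra| | |].
  - intros u Hu. apply Hder; lra.
  - intros u Hu. apply (is_derive_opp (V := R_NormedModule)), (is_derive_scal g u), g_derive; lra.
  - intros u Hu. destruct (IH u ltac:(lra)) as [_ [G _]]. destruct (F u Hu) as [_ [_ F3]]. pose proof (bnd_pos u). nra. }
assert (GE : Rabs (E t - E t3) <= 6 * eps + 48 * (mu / d1)).
{ apply Rle_trans with ((fun s => - (3 * g s)) t - (fun s => - (3 * g s)) t3); [|cbv beta; lra].
  apply (open_derive_abs E (fun s => - (3 * g s)) (fun s => w s * (b s - ((L s) ^ 2 / (r s) ^ 3 - / (r s) ^ 2)) + L s * Q s / (r s) ^ 2) (fun s => - (3 * (w s * bnd s)))); [lra| | |].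
  - intros u Hu. destruct (Hder u ltac:(lra)) as [D1 [_ [D3 D4]]]. specialize (Hr u ltac:(lra)). apply En_derive; auto; lra.
  - intros u Hu. apply (is_derive_opp (V := R_NormedModule)), (is_derive_scal g u), g_derive; lra.
  - intros u Hu. destruct (IH u ltac:(lra)) as [_ [G [G3 _]]]. destruct (F u Hu) as [_ [F2 F3]]. pose proof (bnd_pos u).
    specialize (Hr u ltac:(lra)).
    eapply Rle_trans; [apply Rabs_triang|].
    assert (A1 : Rabs (w u * (b u - (L u ^ 2 / r u ^ 3 - / r u ^ 2))) <= - w u * bnd u).
    { rewrite Rabs_mult, (Rabs_left (w u)) by lra. apply Rmult_le_compat_l; lra. }
    assert (A2 : Rabs (L u * Q u / r u ^ 2) <= 1 * bnd u).
    { replace (L u * Q u / r u ^ 2) with ((L u / r u ^ 2) * Q u) by (field; lra). rewrite Rabs_mult.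
      apply Rmult_le_compat; auto; try apply Rabs_pos.
      apply Rle_trans with (2 * M / (d ^ 2) ^ 2).
      - apply Rabs_div_le; [apply pow_lt; lra|apply pow_incr; lra|lra].
      - apply Rle_div_l; [apply pow_lt; lra|]. replace ((d ^ 2) ^ 2) with (d ^ 4) by ring. lra. }
    assert (bnd u <= -2 * w u * bnd u) by nra. lra. }
split; [auto|]. split; [lra|]. split; [|split; auto].
assert (Lt : Rabs (L t) <= 2 * M).
{ replace (L t) with ((L t - L t3) + L t3) by ring. eapply Rle_trans; [apply Rabs_triang|]. lra. }
assert (Et : Rabs (En (r t) (w t) (L t)) <= 2 * M).
{ change (Rabs (E t) <= 2 * M). replace (E t) with ((E t - E t3) + E t3) by ring. eapply Rle_trans; [apply Rabs_triang|]. change (E t3) with (En (r t3) (w t3) (L t3)) at 2. lra. }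
destruct (energy_speed d M (r t) (w t) (L t) Hd HM ltac:(lra) Lt Et) as [_ [Hw2 _]].
assert (w t < 0); [|nra]. destruct (Req_dec t t3) as [->|Hn]; [auto|].
assert (1 / 2 <= - w t); [|lra]. apply (left_limit_ge (fun s => - w s) t3 t); [lra| |].
- apply (continuous_opp (V := R_NormedModule)). destruct (Hder t ltac:(lra)) as [_ [_ [D _]]]. exact (is_derive_continuous _ _ _ D).
- intros s Hs. destruct (IH s Hs) as [_ [G _]]. lra.
Qed.

Lemma inbound_good X : (forall t, t3 <= t <= X -> d ^ 2 <= r t) -> forall t, t3 <= t <= X -> good t.
Proof.
intros Hr. assert (Hd2 : 0 < d ^ 2) by (apply pow_lt; lra). assert (Hk : 0 < mu / d1) by (apply Rdiv_lt_0_compat; auto).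
apply bootstrap.
- intros t Ht [G1 [G2 [G3 G4]]]. destruct (Hder t ltac:(lra)) as [D1 [D2 [D3 D4]]].
  repeat apply filter_and.
  + apply locally_gt; auto. exact (is_derive_continuous _ _ _ D1).
  + apply locally_lt; auto. exact (is_derive_continuous _ _ _ D3).
  + apply (locally_lt (fun s => Rabs (L s))); auto. apply (continuous_comp L Rabs); [exact (is_derive_continuous _ _ _ D4)|apply continuous_Rabs].
  + apply (locally_lt (fun s => Rabs (E s))); auto. apply (continuous_comp E Rabs); [|apply continuous_Rabs].
    eapply is_derive_continuous. apply En_derive; [lra|exact D1|exact D3|exact D4].
- intros t Ht IH. destruct (inbound_step t ltac:(lra) (fun s Hs => Hr s ltac:(lra)) IH) as [_ [_ [S1 [S2 S3]]]].
  specialize (Hr t Ht). split; [lra|]. split; [auto|]. split.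
  + replace (L t) with ((L t - L t3) + L t3) by ring. eapply Rle_lt_trans; [apply Rabs_triang|]. lra.
  + replace (E t) with ((E t - E t3) + E t3) by ring. eapply Rle_lt_trans; [apply Rabs_triang|]. change (E t3) with (En (r t3) (w t3) (L t3)) at 2. lra.
Qed.

Lemma inbound_est X t : (forall s, t3 <= s <= X -> d ^ 2 <= r s) -> t3 <= t <= X ->
  r t <= 2 /\ t - t3 <= 4 /\ w t < - (1 / 2) /\ Rabs (L t - L t3) <= 4 * eps + 32 * (mu / d1) /\
  Rabs (L t) <= 2 * M /\ Rabs (E t) <= 2 * M /\ a t = L t / (r t) ^ 2 - 1 /\ Rabs (Q t) <= bnd t.
Proof.
intros Hr Ht. assert (G := inbound_good X Hr).
destruct (inbound_step t ltac:(lra) (fun s Hs => Hr s ltac:(lra)) (fun s Hs => G s ltac:(lra))) as [S1 [S2 [S3 [S4 S5]]]].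
destruct (G t Ht) as [_ [_ [G3 G4]]].
assert (HM1 : 2 * M <= 1) by (assert (d ^ 4 <= 1) by (replace 1 with (1 ^ 4) by ring; apply pow_incr; lra); lra).
destruct (Hfld t ltac:(lra)) as [F1 [_ F3]]; [split; [apply Hr; lra|auto]|lra|].
repeat split; auto; lra.
Qed.

Lemma inbound_arrival : exists tD, t3 < tD /\ r tD = d ^ 2 /\ forall t, t3 <= t <= tD -> d ^ 2 <= r t.
Proof.
assert (Hd2 : d ^ 2 <= 1) by (replace 1 with (1 ^ 2) by ring; apply pow_incr; lra).
assert (Hex : exists t4, t3 <= t4 <= t3 + 5 /\ r t4 < d ^ 2).
{ apply NNPP. intros Hn.
  assert (Hr : forall t, t3 <= t <= t3 + 5 -> d ^ 2 <= r t).
  { intros t Ht. apply Rnot_lt_le. intros Hlt. apply Hn. exists t. auto. }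
  destruct (inbound_est (t3 + 5) (t3 + 5) Hr ltac:(lra)) as [_ [H _]]. lra. }
destruct Hex as [t4 [Ht4 Hr4]].
assert (Cr' : forall x, t3 <= x <= t4 -> continuous (fun u => - r u) x).
{ intros x Hx. apply (continuous_opp (V := R_NormedModule)). destruct (Hder x ltac:(lra)) as [D _]. exact (is_derive_continuous _ _ _ D). }
destruct (first_hit (fun u => - r u) t3 t4 (- d ^ 2) ltac:(lra) Cr' ltac:(lra)) as [tD [HtD [ED HltD]]].
exists tD. split; [|split; [lra|]].
- destruct (Req_dec tD t3) as [Z|]; [rewrite Z, Hr3 in ED; lra|lra].
- intros t Ht. destruct (Req_dec t tD) as [->|]; [lra|]. specialize (HltD t ltac:(lra)). lra.
Qed.

(** The speed w grows like the inverse root of r near the Sun, but r w stays bounded; hence the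
    Lipschitz estimate is stated for r^2. *)
Lemma inbound_radius X s t : (forall u, t3 <= u <= X -> d ^ 2 <= r u) -> t3 <= s -> s <= t -> t <= X ->
  (t - s) / 2 <= r s - r t /\ Rabs ((r t) ^ 2 - (r s) ^ 2) <= 41 / 10 * (t - s).
Proof.
intros Hr Hs Hst Ht. split.
- assert (G : r t - r s <= (fun u => - (u / 2)) t - (fun u => - (u / 2)) s); [|cbv beta in G; lra].
  apply (open_derive_le r (fun u => - (u / 2)) w (fun _ => - (1 / 2))); [lra| | |].
  + intros u Hu. apply Hder; lra.
  + intros u Hu. apply (is_derive_eq (fun v : R => - (v / 2)) u (- (1 * / 2)) (- (1 / 2))); [field|auto_derive; auto].
  + intros u Hu. destruct (inbound_est X u Hr ltac:(lra)) as [_ [_ [G _]]]. lra.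
- apply (open_derive_bound (fun u => (r u) ^ 2) (fun u => 2 * r u * w u)); [lra| |].
  + intros u Hu. destruct (Hder u ltac:(lra)) as [D _]. assert (E0 : Derive (fun x => r x) u = _) by (apply is_derive_unique; exact D).
    auto_derive; [eexists; eauto|]. rewrite E0. ring.
  + intros u Hu. destruct (inbound_est X u Hr ltac:(lra)) as [R2 [_ [_ [_ [Lu [Eu _]]]]]]. specialize (Hr u ltac:(lra)).
    destruct (energy_speed d M (r u) (w u) (L u) Hd HM ltac:(lra) Lu Eu) as [_ [_ Hk]].
    apply abs_le_of_sq; [lra|]. replace ((2 * r u * w u) ^ 2) with (4 * r u * (w u ^ 2 * r u)) by ring.
    assert (Hd2 : 0 < d ^ 2) by (apply pow_lt; lra).
    apply Rle_trans with (4 * 2 * (21 / 10)); [|lra]. apply Rmult_le_compat; try lra.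
    apply Rmult_le_pos; [apply pow2_ge_0|lra].
Qed.
End Inbound.

(** * Jupiter's kick on the way in *)

Lemma Rabs_mult_le a b A B : Rabs a <= A -> Rabs b <= B -> Rabs (a * b) <= A * B.
Proof. intros HA HB. rewrite Rabs_mult. apply Rmult_le_compat; auto; apply Rabs_pos. Qed.

Lemma Rabs_plus_le a b A B : Rabs a <= A -> Rabs b <= B -> Rabs (a + b) <= A + B.
Proof. intros HA HB. eapply Rle_trans; [apply Rabs_triang|lra]. Qed.

(** S is the squared distance to Jupiter on the straight passage, at time tau after crossing r = 1.
    It is comparable to (b + |tau|)^2, the scale against which all errors are measured. *)
Lemma kick_quadratic b tau : 0 < b ->
  let S := 3 * tau ^ 2 + 2 * b * tau + b ^ 2 in
  (b + Rabs tau) ^ 2 / 3 <= S /\ (2 * b ^ 2 / 3 <= S) /\ S = 2 * tau ^ 2 + (b + tau) ^ 2.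
Proof.
intros Hb S. split; [|split; [|unfold S; ring]].
- unfold S, Rabs. destruct (Rcase_abs tau) as [H|H].
  + pose proof (pow2_ge_0 (2 * tau + b)). nra.
  +    nra.
- unfold S. pose proof (pow2_ge_0 (tau + b / 3)). nra.
Qed.

Lemma kick_distance ka b tau x Y : 0 < ka <= / 1000000 -> 0 < b <= ka / 10 -> Rabs tau <= ka ->
  Rabs (x + sqrt 2 * tau) <= 5 * ka * Rabs tau -> Rabs (Y - (b + tau)) <= ka * Rabs tau ->
  let rho := b + Rabs tau in
  Rabs (x ^ 2 + 2 * (1 + x) * (1 - cos Y) - (2 * tau ^ 2 + (b + tau) ^ 2)) <= 21 * ka * rho ^ 2 /\
  Rabs ((1 + x) * sin Y - (b + tau)) <= 4 * ka * rho.
Proof.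
intros Hk Hb Ht Hx HY rho. set (t := Rabs tau) in *. assert (H0t : 0 <= t) by apply Rabs_pos.
assert (Hrho : 0 < rho <= 11 / 10 * ka) by (unfold rho; lra). assert (Htr : t <= rho) by (unfold rho; lra).
pose proof sqrt2_bounds as S2. assert (Q2 : sqrt 2 * sqrt 2 = 2) by (apply sqrt_sqrt; lra).
assert (Kt : 0 <= ka * t <= t / 1000000). { split; [apply Rmult_le_pos; lra|]. assert (ka * t <= / 1000000 * t) by (apply Rmult_le_compat_r; lra). lra. }
assert (St : Rabs (sqrt 2 * tau) <= 142 / 100 * t) by (apply Rabs_mult_le; [rewrite Rabs_pos_eq; lra|apply Rle_refl]).
assert (X1 : Rabs x <= 143 / 100 * rho).
{ replace x with ((x + sqrt 2 * tau) + - (sqrt 2 * tau)) by ring. eapply Rle_trans; [apply Rabs_plus_le; [apply Hx|rewrite Rabs_Ropp; apply St]|]. lra. }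
assert (X2 : Rabs (x - sqrt 2 * tau) <= 3 * t).
{ replace (x - sqrt 2 * tau) with ((x + sqrt 2 * tau) + - (2 * (sqrt 2 * tau))) by ring.
  assert (Rabs (- (2 * (sqrt 2 * tau))) <= 2 * (142 / 100 * t)) by (rewrite Rabs_Ropp; apply Rabs_mult_le; [rewrite Rabs_pos_eq; lra|auto]).
  eapply Rle_trans; [apply Rabs_plus_le; [apply Hx|apply H]|]. lra. }
assert (B1 : Rabs (b + tau) <= rho) by (unfold rho; eapply Rle_trans; [apply Rabs_triang|rewrite (Rabs_pos_eq b) by lra; apply Rle_refl]).
assert (Y1 : Rabs Y <= 1001 / 1000 * rho).
{ replace Y with ((Y - (b + tau)) + (b + tau)) by ring. eapply Rle_trans; [apply Rabs_plus_le; [apply HY|apply B1]|]. lra. }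
assert (Y2 : Y ^ 2 <= 1003 / 1000 * rho ^ 2).
{ rewrite <- pow2_abs. apply Rle_trans with ((1001 / 1000 * rho) ^ 2); [apply pow_incr; split; [apply Rabs_pos|auto]|].
  replace ((1001 / 1000 * rho) ^ 2) with ((1001 / 1000) ^ 2 * rho ^ 2) by ring. apply Rmult_le_compat_r; [apply pow2_ge_0|lra]. }
assert (H0Y : 0 <= Y ^ 2) by apply pow2_ge_0. assert (H0r : 0 < rho ^ 2) by (apply pow_lt; lra).
assert (R3 : rho ^ 2 * rho <= rho ^ 2 * (11 / 10 * ka)) by (apply Rmult_le_compat_l; lra).
assert (tt : t * t <= rho ^ 2) by (replace (rho ^ 2) with (rho * rho) by ring; apply Rmult_le_compat; lra).
assert (tr : t * rho <= rho ^ 2) by (replace (rho ^ 2) with (rho * rho) by ring; apply Rmult_le_compat; lra).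
assert (C1 := cos_ge Y). assert (C2 := cos_le Y).
assert (A1 : Rabs (x ^ 2 - 2 * tau ^ 2) <= 15 * ka * rho ^ 2).
{ replace (x ^ 2 - 2 * tau ^ 2) with ((x + sqrt 2 * tau) * (x - sqrt 2 * tau)) by
   (replace ((x + sqrt 2 * tau) * (x - sqrt 2 * tau)) with (x ^ 2 - (sqrt 2 * sqrt 2) * tau ^ 2) by ring; rewrite Q2; ring).
  eapply Rle_trans; [apply Rabs_mult_le; [apply Hx|apply X2]|]. replace (5 * ka * t * (3 * t)) with (15 * ka * (t * t)) by ring.
  apply Rmult_le_compat_l; lra. }
assert (K0 : 0 < ka * rho ^ 2) by (apply Rmult_lt_0_compat; lra).
assert (Y3 : Y ^ 2 <= ka / 500).
{ assert (rho ^ 2 <= ka / 1000); [|lra]. replace (rho ^ 2) with (rho * rho) by ring.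
  apply Rle_trans with ((11 / 10 * ka) * / 1100); [|lra]. apply Rmult_le_compat; lra. }
assert (A2 : Rabs (2 * (1 - cos Y) - Y ^ 2) <= ka * rho ^ 2).
{ assert (Y ^ 4 <= 12 * (ka * rho ^ 2)); [|apply Rabs_le; lra].
  replace (Y ^ 4) with (Y ^ 2 * Y ^ 2) by ring. apply Rle_trans with ((1003 / 1000 * rho ^ 2) * (ka / 500)); [apply Rmult_le_compat; auto|].
  lra. }
assert (A3 : Rabs (Y ^ 2 - (b + tau) ^ 2) <= 3 * ka * rho ^ 2).
{ replace (Y ^ 2 - (b + tau) ^ 2) with ((Y - (b + tau)) * (Y + (b + tau))) by ring.
  eapply Rle_trans; [apply Rabs_mult_le; [apply HY|apply (Rabs_plus_le _ _ _ _ Y1 B1)]|].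
  replace (ka * t * (1001 / 1000 * rho + rho)) with (ka * (t * rho * (2001 / 1000))) by field.
  replace (3 * ka * rho ^ 2) with (ka * (3 * rho ^ 2)) by ring. apply Rmult_le_compat_l; lra. }
assert (A4 : Rabs (x * (2 * (1 - cos Y))) <= 2 * ka * rho ^ 2).
{ assert (B : Rabs (2 * (1 - cos Y)) <= 1003 / 1000 * rho ^ 2) by (apply Rabs_le; pose proof (COS_bound Y); lra).
  eapply Rle_trans; [apply (Rabs_mult_le _ _ _ _ X1 B)|].
  replace (143 / 100 * rho * (1003 / 1000 * rho ^ 2)) with (143 / 100 * (1003 / 1000) * (rho ^ 2 * rho)) by ring. lra. }
split.
- replace (x ^ 2 + 2 * (1 + x) * (1 - cos Y) - (2 * tau ^ 2 + (b + tau) ^ 2)) with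
   ((x ^ 2 - 2 * tau ^ 2) + ((2 * (1 - cos Y) - Y ^ 2) + ((Y ^ 2 - (b + tau) ^ 2) + x * (2 * (1 - cos Y))))) by ring.
  eapply Rle_trans; [apply (Rabs_plus_le _ _ _ _ A1 (Rabs_plus_le _ _ _ _ A2 (Rabs_plus_le _ _ _ _ A3 A4)))|]. lra.
- assert (D1 : Rabs (sin Y - Y) <= 12 / 10 * ka * rho).
  { assert (G := sin_rem 0 Y). rewrite sin_0, cos_0 in G. replace (sin Y - 0 - 1 * (Y - 0)) with (sin Y - Y) in G by ring.
    rewrite Rminus_0_r in G. replace (rho ^ 2) with (rho * rho) in Y2 by ring.
    assert (rho * rho <= rho * (11 / 10 * ka)) by (apply Rmult_le_compat_l; lra). lra. }
  assert (D2 : Rabs (x * sin Y) <= 17 / 10 * ka * rho).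
  { assert (B : Rabs (sin Y) <= 1001 / 1000 * rho).
    { assert (G := sin_lip 0 Y). rewrite sin_0, !Rminus_0_r in G. lra. }
    eapply Rle_trans; [apply (Rabs_mult_le _ _ _ _ X1 B)|].
    assert (rho * rho <= rho * (11 / 10 * ka)) by (apply Rmult_le_compat_l; lra). lra. }
  assert (D3 : Rabs (Y - (b + tau)) <= ka * rho) by (eapply Rle_trans; [apply HY|apply Rmult_le_compat_l; lra]).
  replace ((1 + x) * sin Y - (b + tau)) with (x * sin Y + ((sin Y - Y) + (Y - (b + tau)))) by ring.
  eapply Rle_trans; [apply (Rabs_plus_le _ _ _ _ D2 (Rabs_plus_le _ _ _ _ D1 D3))|].
  assert (0 < ka * rho) by (apply Rmult_lt_0_compat; lra). lra.
Qed.

Lemma cube_ratio k D D0 N N0 rho : 0 < D0 -> 0 < D -> 0 <= k <= / 1000000 -> Rabs (D ^ 2 - D0 ^ 2) <= 63 * k * D0 ^ 2 ->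
  0 < rho -> 57 / 100 * rho <= D0 -> Rabs N0 <= rho -> Rabs (N - N0) <= 4 * k * rho ->
  Rabs (N / D ^ 3 - N0 / D0 ^ 3) <= 1600 * k / rho ^ 2.
Proof.
intros H0 HD Hk H1 Hr HD0 HN0 HN.
assert (V : Rabs (D - D0) <= 63 * k * D0).
{ apply Rmult_le_reg_r with D0; auto. apply Rle_trans with (Rabs (D - D0) * (D + D0)).
  - apply Rmult_le_compat_l; [apply Rabs_pos|lra].
  - replace (Rabs (D - D0) * (D + D0)) with (Rabs (D ^ 2 - D0 ^ 2)); [lra|].
    replace (D ^ 2 - D0 ^ 2) with ((D - D0) * (D + D0)) by ring. rewrite Rabs_mult, (Rabs_pos_eq (D + D0)) by lra. auto. }
assert (KD : 0 <= k * D0 <= D0 / 1000000). { split; [apply Rmult_le_pos; lra|]. assert (k * D0 <= / 1000000 * D0) by (apply Rmult_le_compat_r; lra). lra. }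
assert (V' := V). apply Rabs_le_between in V'.

assert (D03 : 0 < D0 ^ 3) by (apply pow_lt; auto). assert (D3 : 0 < D ^ 3) by (apply pow_lt; auto).
assert (L3 : 99 / 100 * D0 ^ 3 <= D ^ 3).
{ apply Rle_trans with ((999 / 1000 * D0) ^ 3); [|apply pow_incr; lra].
  replace ((999 / 1000 * D0) ^ 3) with ((999 / 1000) ^ 3 * D0 ^ 3) by ring. apply Rmult_le_compat_r; lra. }
assert (C3 : Rabs (D0 ^ 3 - D ^ 3) <= 192 * k * D0 ^ 3).
{ replace (D0 ^ 3 - D ^ 3) with (- (D - D0) * (D0 ^ 2 + D0 * D + D ^ 2)) by ring.
  assert (B : Rabs (D0 ^ 2 + D0 * D + D ^ 2) <= 3004 / 1000 * D0 ^ 2).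
  { assert (D0 * D <= D0 * (1001 / 1000 * D0)) by (apply Rmult_le_compat_l; lra).
    assert (D ^ 2 <= (1001 / 1000 * D0) ^ 2) by (apply pow_incr; lra).
    assert (0 < D0 * D) by (apply Rmult_lt_0_compat; auto). assert (0 < D ^ 2) by (apply pow_lt; auto).
    rewrite Rabs_pos_eq by lra. lra. }
  eapply Rle_trans; [apply (Rabs_mult_le (- (D - D0)) (D0 ^ 2 + D0 * D + D ^ 2) (63 * k * D0) (3004 / 1000 * D0 ^ 2)); [rewrite Rabs_Ropp; exact V|exact B]|].
  assert (0 <= k * D0 ^ 3) by (apply Rmult_le_pos; lra). replace (63 * k * D0 * (3004 / 1000 * D0 ^ 2)) with (63 * 3004 / 1000 * (k * D0 ^ 3)) by field. lra. }
assert (I3 : / D ^ 3 <= 102 / 100 * / D0 ^ 3).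
{ apply Rle_trans with (/ (99 / 100 * D0 ^ 3)); [apply Rinv_le_contravar; lra|].
  rewrite Rinv_mult. apply Rmult_le_compat_r; [left; apply Rinv_0_lt_compat; auto|lra]. }
 assert (Pd3 : 0 < / D ^ 3) by (apply Rinv_0_lt_compat; auto).
assert (J : Rabs (/ D ^ 3 - / D0 ^ 3) <= 196 * k * / D0 ^ 3).
{ replace (/ D ^ 3 - / D0 ^ 3) with ((D0 ^ 3 - D ^ 3) * (/ D ^ 3 * / D0 ^ 3)) by (field; lra).
  assert (B : Rabs (/ D ^ 3 * / D0 ^ 3) <= 102 / 100 * / D0 ^ 3 * / D0 ^ 3).
  { rewrite Rabs_pos_eq by (apply Rmult_le_pos; lra). apply Rmult_le_compat_r; lra. }
  eapply Rle_trans; [apply (Rabs_mult_le _ _ _ _ C3 B)|].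
  replace (192 * k * D0 ^ 3 * (102 / 100 * / D0 ^ 3 * / D0 ^ 3)) with (192 * 102 / 100 * (k * / D0 ^ 3)) by (field; lra).
  assert (0 <= k * / D0 ^ 3) by (apply Rmult_le_pos; lra). lra. }
replace (N / D ^ 3 - N0 / D0 ^ 3) with ((N - N0) * / D ^ 3 + N0 * (/ D ^ 3 - / D0 ^ 3)) by (field; lra).
assert (T1 : Rabs ((N - N0) * / D ^ 3) <= 4 * k * rho * (102 / 100 * / D0 ^ 3)).
{ apply Rabs_mult_le; auto. rewrite Rabs_pos_eq by lra. auto. }
assert (T2 : Rabs (N0 * (/ D ^ 3 - / D0 ^ 3)) <= rho * (196 * k * / D0 ^ 3)) by (apply Rabs_mult_le; auto).
eapply Rle_trans; [apply (Rabs_plus_le _ _ _ _ T1 T2)|].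
assert (R3 : 0 < rho ^ 3) by (apply pow_lt; auto).
assert (I0 : / D0 ^ 3 <= 6 * / rho ^ 3).
{ apply Rle_trans with (/ (18 / 100 * rho ^ 3)).
  - apply Rinv_le_contravar; [lra|]. apply Rle_trans with ((57 / 100 * rho) ^ 3); [|apply pow_incr; lra].
    replace ((57 / 100 * rho) ^ 3) with ((57 / 100) ^ 3 * rho ^ 3) by ring. apply Rmult_le_compat_r; lra.
  - rewrite Rinv_mult. apply Rmult_le_compat_r; [left; apply Rinv_0_lt_compat; auto|lra]. }
assert (KR : 0 <= k * rho) by (apply Rmult_le_pos; lra).
replace (4 * k * rho * (102 / 100 * / D0 ^ 3) + rho * (196 * k * / D0 ^ 3)) with ((4 * 102 / 100 + 196) * (k * rho) * / D0 ^ 3) by (field; lra).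
apply Rle_trans with ((4 * 102 / 100 + 196) * (k * rho) * (6 * / rho ^ 3)); [apply Rmult_le_compat_l; lra|].
replace ((4 * 102 / 100 + 196) * (k * rho) * (6 * / rho ^ 3)) with ((4 * 102 / 100 + 196) * 6 * (k / rho ^ 2)) by (field; lra).
assert (0 <= k / rho ^ 2) by (apply Rdiv_le_0_compat; [lra|apply pow_lt; auto]). replace (1600 * k / rho ^ 2) with (1600 * (k / rho ^ 2)) by (field; lra). lra.
Qed.

(* Jupiter's pull along a straight passage with radial speed sqrt 2, angular speed 1 and offset b, compared with the actual one;
   (x, Y) are the radial and angular displacements from Jupiter. *)
Lemma kick_ineq ka b tau x Y : 0 < ka <= / 1000000 -> 0 < b <= ka / 10 -> Rabs tau <= ka ->
  Rabs (x + sqrt 2 * tau) <= 5 * ka * Rabs tau -> Rabs (Y - (b + tau)) <= ka * Rabs tau ->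
  0 < x ^ 2 + 2 * (1 + x) * (1 - cos Y) ->
  Rabs ((1 + x) * sin Y / sqrt (x ^ 2 + 2 * (1 + x) * (1 - cos Y)) ^ 3 - (b + tau) / sqrt (3 * tau ^ 2 + 2 * b * tau + b ^ 2) ^ 3)
    <= 1600 * ka / (b + Rabs tau) ^ 2.
Proof.
intros Hk Hb Ht Hx HY HD. destruct (kick_distance ka b tau x Y Hk Hb Ht Hx HY) as [K1 K2].
destruct (kick_quadratic b tau ltac:(lra)) as [S1 [S2 S3]].
set (S := 3 * tau ^ 2 + 2 * b * tau + b ^ 2) in *. rewrite <- S3 in K1.
set (D2 := x ^ 2 + 2 * (1 + x) * (1 - cos Y)) in *. pose proof (Rabs_pos tau).
assert (Hr2 : 0 < (b + Rabs tau) ^ 2) by (apply pow_lt; lra).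

assert (E1 : sqrt D2 ^ 2 = D2) by (apply pow2_sqrt; lra). assert (E2 : sqrt S ^ 2 = S) by (apply pow2_sqrt; lra).
apply cube_ratio; auto; try (apply sqrt_lt_R0; auto); try lra.
- rewrite E1, E2. eapply Rle_trans; [exact K1|]. replace (63 * ka * S) with (21 * ka * (3 * S)) by ring. apply Rmult_le_compat_l; lra.
(* The constant 57 / 100 is below 1 / sqrt 3, the square root of the factor in S >= (b + |tau|)^2 /
   3. *)
- rewrite <- (sqrt_pow2 (57 / 100 * (b + Rabs tau))) by lra. apply sqrt_le_1; try apply pow2_ge_0; lra.
- eapply Rle_trans; [apply Rabs_triang|]. rewrite (Rabs_pos_eq b) by lra. lra.
Qed.

Section Scatter.
Variables (d M mu d1 Kp t3 tR tD : R) (r th w L a Q : R -> R).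
Hypotheses (Hd : 0 < d <= 1 / 1000) (HM : 0 < M <= d ^ 4 / 1000) (Hmu : 0 < mu) (Hd1 : 0 < d1).
(** The angle th is not reduced modulo 2 pi. [Kp] stands for a lift of Jupiter's angle, and only
    this periodicity is needed of it. *)
Hypothesis HK : forall x, cos (x - Kp) = cos x /\ sin (x - Kp) = sin x.
Hypotheses (HtR : t3 <= tR <= tD) (HtD : tD - t3 <= 4).
Hypothesis Hder : forall t, t3 <= t <= tD -> is_derive r t (w t) /\ is_derive th t (a t) /\ is_derive L t (Q t).
Hypothesis Hst : forall t, t3 <= t <= tD -> d ^ 2 <= r t <= 2 /\ w t < - (1 / 2) /\ Rabs (L t) <= 2 * M /\ Rabs (En (r t) (w t) (L t)) <= 2 * M /\
  a t = L t / (r t) ^ 2 - 1 /\ Q t = mu * (r t * sin (th t) - r t * sin (th t) * / sqrt (Rmax (Dq (r t) (th t)) (d1 ^ 2)) ^ 3).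
Hypothesis Hrad : forall s t, t3 <= s -> s <= t -> t <= tD -> (t - s) / 2 <= r s - r t /\ Rabs ((r t) ^ 2 - (r s) ^ 2) <= 41 / 10 * (t - s).
Hypotheses (Hr3 : r t3 = 2) (HrR : r tR = 1) (HrD : r tD = d ^ 2).

Lemma scatter_small : M <= / 1000000 /\ d ^ 2 <= / 1000.
Proof.
assert (d ^ 2 <= (1 / 1000) ^ 2) by (apply pow_incr; lra). assert (d ^ 4 <= (1 / 1000) ^ 4) by (apply pow_incr; lra). lra.
Qed.

Lemma scatter_radius t : t3 <= t <= tD -> Rabs (t - tR) / 2 <= Rabs (r t - 1) /\ Rabs ((r t) ^ 2 - 1) <= 41 / 10 * Rabs (t - tR).
Proof.
intros Ht. destruct (Rle_dec t tR) as [H|H].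
- destruct (Hrad t tR ltac:(lra) H ltac:(lra)) as [A B]. rewrite HrR in A, B. rewrite (Rabs_left1 (t - tR)) by lra. split.
  + pose proof (Rle_abs (r t - 1)). lra.
  + rewrite Rabs_minus_sym. replace (1 ^ 2) with 1 in B by ring. lra.
- destruct (Hrad tR t ltac:(lra) ltac:(lra) ltac:(lra)) as [A B]. rewrite HrR in A, B. rewrite (Rabs_pos_eq (t - tR)) by lra. split.
  + pose proof (Rabs_maj2 (r t - 1)). lra.
  + replace (1 ^ 2) with 1 in B by ring. lra.
Qed.

Lemma bound_between (f f' : R -> R) c x : (forall t, t3 <= t <= tD -> is_derive f t (f' t)) -> t3 <= x <= tD ->
  (forall t, t3 <= t <= tD -> Rabs (t - tR) <= Rabs (x - tR) -> Rabs (f' t) <= c) -> Rabs (f x - f tR) <= c * Rabs (x - tR).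
Proof.
intros D Hx B. destruct (Rle_dec x tR) as [H|H].
- rewrite (Rabs_left1 (x - tR)) by lra. rewrite Rabs_minus_sym. replace (- (x - tR)) with (tR - x) by ring.
  apply (open_derive_bound f f'); [lra|intros; apply D; lra|]. intros u Hu. apply B; [lra|]. rewrite !Rabs_left1 by lra. lra.
- rewrite (Rabs_pos_eq (x - tR)) by lra.
  apply (open_derive_bound f f'); [lra|intros; apply D; lra|]. intros u Hu. apply B; [lra|]. rewrite !Rabs_pos_eq by lra. lra.
Qed.

Lemma scatter_angle t : t3 <= t <= tD -> Rabs (t - tR) <= 1 / 8 ->
  2 / 3 <= r t /\ Rabs (th t - th tR + (t - tR)) <= 5 * M * Rabs (t - tR).
Proof.
intros Ht Hs.
assert (R1 : forall u, t3 <= u <= tD -> Rabs (u - tR) <= 1 / 8 -> 4 / 9 <= (r u) ^ 2 /\ 2 / 3 <= r u).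
{ intros u Hu Hu8. destruct (scatter_radius u Hu) as [_ B]. apply Rabs_le_between in B. split; [lra|].
  destruct (Hst u Hu) as [[G _] _]. assert (0 < d ^ 2) by (apply pow_lt; lra). apply Rnot_lt_le. intros Hc.
  assert ((r u) ^ 2 <= (2 / 3) ^ 2) by (apply pow_incr; lra). lra. }
split; [apply R1; auto|].
replace (th t - th tR + (t - tR)) with ((fun u => th u + u) t - (fun u => th u + u) tR) by ring.
apply (bound_between (fun u => th u + u) (fun u => a u + 1)); auto.
- intros u Hu. destruct (Hder u Hu) as [_ [D _]]. apply (is_derive_plus th (fun u => u)); auto. apply (is_derive_id u).
- intros u Hu Hu2. destruct (R1 u Hu ltac:(lra)) as [A _]. destruct (Hst u Hu) as [_ [_ [B [_ [C _]]]]]. rewrite C.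
  replace (L u / r u ^ 2 - 1 + 1) with (L u / r u ^ 2) by ring.
  eapply Rle_trans; [apply (Rabs_div_le _ _ (2 * M) (4 / 9)); lra|]. lra.
Qed.

(** At r = 1 the body is behind Jupiter by the angle b'. For |t - tR| <= b' / 2 the angle has moved
    by little more than that and still separates the two; later or earlier the radial distance does,
    because the radial speed is at least 1/2. *)
Lemma scatter_distance b' t : 0 < b' <= 1 / 4 -> th tR = Kp - b' -> t3 <= t <= tD -> (b' / 8) ^ 2 <= Dq (r t) (th t).
Proof.
intros Hb Hth Ht. destruct (Dq_split (r t) (th t)) as [E1 E2]. destruct scatter_small as [SM _].
destruct (Rle_dec (Rabs (t - tR)) (b' / 2)) as [H|H].
- destruct (scatter_angle t Ht ltac:(lra)) as [_ A]. rewrite E1. destruct (HK (th t)) as [_ Hs].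
  pose proof (pow2_ge_0 (r t - cos (th t))). assert (A' := A). apply Rabs_le_between in A'. rewrite Hth in A'.
  assert (B : 5 * M * Rabs (t - tR) <= 5 * / 1000000 * Rabs (t - tR)) by (apply Rmult_le_compat_r; [apply Rabs_pos|lra]).
  pose proof (Rle_abs (t - tR)). pose proof (Rabs_maj2 (t - tR)).
  assert (C : b' / 4 <= Rabs (th t - Kp) <= 1) by (rewrite Rabs_left by lra; lra).
  pose proof (sin_lower (th t - Kp) ltac:(lra)) as S. rewrite Hs in S.
  assert ((b' / 8) ^ 2 <= Rabs (sin (th t)) ^ 2) by (apply pow_incr; lra). rewrite pow2_abs in H3. lra.
- destruct (scatter_radius t Ht) as [A _]. rewrite E2.
  assert (0 <= 2 * r t * (1 - cos (th t))).
  { pose proof (COS_bound (th t)). destruct (Hst t Ht) as [[G _] _]. assert (0 < d ^ 2) by (apply pow_lt; lra). apply Rmult_le_pos; lra. }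
  assert ((b' / 8) ^ 2 <= Rabs (r t - 1) ^ 2) by (apply pow_incr; lra). rewrite pow2_abs in H1. replace ((1 - r t) ^ 2) with ((r t - 1) ^ 2) by ring. lra.
Qed.

Lemma scatter_torque t X : t3 <= t <= tD -> 0 < X -> X <= Rmax (Dq (r t) (th t)) (d1 ^ 2) -> Rabs (Q t) <= mu * (2 + / X).
Proof.
intros Ht HX H. destruct (Hst t Ht) as [[G1 G2] [_ [_ [_ [_ E]]]]]. rewrite E. set (Y := Rmax (Dq (r t) (th t)) (d1 ^ 2)) in *.
assert (HY : 0 < Y) by lra. destruct (jupiter_force (r t) (th t) Y (Rmax_l _ _) HY) as [_ B].
rewrite Rabs_mult, (Rabs_pos_eq mu) by lra. apply Rmult_le_compat_l; [lra|].
unfold Rminus. apply Rabs_plus_le.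
- replace 2 with (2 * 1) by ring. assert (0 < d ^ 2) by (apply pow_lt; lra). apply Rabs_mult_le; [rewrite Rabs_pos_eq; lra|apply Rabs_le, SIN_bound].
- rewrite Rabs_Ropp. eapply Rle_trans; [|apply Rinv_le_contravar; [exact HX|exact H]]. unfold Rdiv in B. exact B.
Qed.

Lemma scatter_far : d1 <= 1 / 32 -> th tR = Kp - 1 / 4 -> Rabs (L tD - L t3) <= 5000 * mu.
Proof.
intros Hd132 Hth. apply Rle_trans with (mu * (2 + / (1 / 4 / 8) ^ 2) * (tD - t3)).
- apply (open_derive_bound L Q); [lra|intros; apply Hder; lra|]. intros t Ht. apply scatter_torque; [lra|lra|].
  eapply Rle_trans; [|apply Rmax_l]. apply scatter_distance; lra.
- apply Rle_trans with (mu * (2 + / (1 / 4 / 8) ^ 2) * 4); [|lra]. apply Rmult_le_compat_l; [apply Rmult_le_pos; lra|lra].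
Qed.

Lemma scatter_velocity ka t : 10 * M <= ka <= / 1000000 -> t3 <= t <= tD -> Rabs (t - tR) <= ka -> Rabs (w t + sqrt 2) <= 5 * ka.
Proof.
intros Hka Ht Htau. destruct scatter_small as [SM _]. destruct (scatter_radius t Ht) as [_ A].
destruct (Hst t Ht) as [[G1 G2] [W [HL [HE _]]]].
destruct (energy_speed d M (r t) (w t) (L t) Hd HM ltac:(lra) HL HE) as [K1 [K2 K3]].
assert (Hd2 : 0 < d ^ 2) by (apply pow_lt; lra).
assert (B : Rabs (r t - 1) <= 41 / 10 * ka) by (eapply Rle_trans; [apply abs_sub_one; lra|lra]).
assert (B' := B). apply Rabs_le_between in B'.
assert (W2 : w t ^ 2 <= 22 / 10).
{ apply Rmult_le_reg_r with (r t); [lra|]. apply Rle_trans with (22 / 10 * (99 / 100)); [lra|]. apply Rmult_le_compat_l; lra. }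
assert (C : Rabs (w t ^ 2 - 2) <= 10 * ka).
{ replace (w t ^ 2 - 2) with (w t ^ 2 * - (r t - 1) + 2 * (w t ^ 2 * r t / 2 - 1)) by field.
  eapply Rle_trans; [apply (Rabs_plus_le _ _ (22 / 10 * (41 / 10 * ka)) (2 * (41 / 10 * M)))|lra].
  - apply Rabs_mult_le; [rewrite Rabs_pos_eq; lra|rewrite Rabs_Ropp; auto].
  - apply Rabs_mult_le; [rewrite Rabs_pos_eq; lra|auto]. }
pose proof sqrt2_bounds as S2. assert (Q2 : sqrt 2 * sqrt 2 = 2) by (apply sqrt_sqrt; lra).
replace (w t ^ 2 - 2) with ((w t + sqrt 2) * (w t - sqrt 2)) in C by
  (replace ((w t + sqrt 2) * (w t - sqrt 2)) with (w t ^ 2 - sqrt 2 * sqrt 2) by ring; rewrite Q2; ring).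
assert (W9 : w t <= - (9 / 10)). { apply Rnot_lt_le. intros Hc. assert ((- w t) ^ 2 <= (9 / 10) ^ 2) by (apply pow_incr; lra). lra. }
rewrite Rabs_mult, (Rabs_left (w t - sqrt 2)) in C by lra.
assert (Rabs (w t + sqrt 2) * 2 <= Rabs (w t + sqrt 2) * - (w t - sqrt 2)) by (apply Rmult_le_compat_l; [apply Rabs_pos|lra]). lra.
Qed.

Lemma scatter_kick ka b t : 10 * M <= ka <= / 1000000 -> 0 < b <= ka / 10 -> b = 8 * d1 -> th tR = Kp - b ->
  t3 <= t <= tD -> Rabs (t - tR) <= ka ->
  mu * ((b + (t - tR)) / sqrt (3 * (t - tR) ^ 2 + 2 * b * (t - tR) + b ^ 2) ^ 3 - 1600 * ka / (b ^ 2 + (t - tR) ^ 2) - 2) <= Q t.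
Proof.
intros Hka Hb Hbd Hth Ht Htau. destruct scatter_small as [SM _].
set (tau := t - tR) in *. set (x := r t - 1). set (Y := Kp - th t).
destruct (Hst t Ht) as [[G1 G2] [W [HL [HE [_ EQ]]]]].
assert (HD := scatter_distance b t ltac:(lra) Hth Ht). assert (H0d : 0 < d1 ^ 2) by (apply pow_lt; auto).
assert (ED : Dq (r t) (th t) = x ^ 2 + 2 * (1 + x) * (1 - cos Y)).
{ destruct (Dq_split (r t) (th t)) as [_ E]. rewrite E. unfold Y, x. rewrite <- (cos_neg (Kp - th t)).
  replace (- (Kp - th t)) with (th t - Kp) by ring. destruct (HK (th t)) as [-> _]. ring. }
assert (Es : sin (th t) = - sin Y).
{ unfold Y. rewrite <- sin_neg. replace (- (Kp - th t)) with (th t - Kp) by ring. destruct (HK (th t)) as [_ ->]. auto. }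
replace (b / 8) with d1 in HD by lra. rewrite Rmax_left in EQ by auto. rewrite ED in EQ, HD. rewrite Es in EQ.
assert (Hx : Rabs (x + sqrt 2 * tau) <= 5 * ka * Rabs tau).
{ unfold x, tau. replace (r t - 1 + sqrt 2 * (t - tR)) with ((fun u => r u + sqrt 2 * u) t - (fun u => r u + sqrt 2 * u) tR) by (cbv beta; rewrite HrR; ring).
  apply (bound_between (fun u => r u + sqrt 2 * u) (fun u => w u + sqrt 2)); auto.
  - intros u Hu. destruct (Hder u Hu) as [D _]. apply (is_derive_plus r (fun u => sqrt 2 * u)); auto.
    apply (is_derive_eq (fun u => sqrt 2 * u) u (sqrt 2 * 1)); [ring|]. apply (is_derive_scal (fun u => u)). apply (is_derive_id u).
  - intros u Hu Hu2. apply scatter_velocity; auto. unfold tau in Htau. lra. }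
assert (HY : Rabs (Y - (b + tau)) <= ka * Rabs tau).
{ destruct (scatter_angle t Ht ltac:(unfold tau in Htau; lra)) as [_ A]. fold tau in A.
  replace (Y - (b + tau)) with (- (th t - th tR + tau)) by (unfold Y; rewrite Hth; ring). rewrite Rabs_Ropp.
  eapply Rle_trans; [exact A|]. apply Rmult_le_compat_r; [apply Rabs_pos|lra]. }
assert (K := kick_ineq ka b tau x Y ltac:(lra) Hb Htau Hx HY ltac:(lra)).
rewrite EQ. apply Rmult_le_compat_l; [lra|].
set (P := sqrt (x ^ 2 + 2 * (1 + x) * (1 - cos Y))) in *. assert (HP : 0 < P) by (apply sqrt_lt_R0; lra).
replace (r t) with (1 + x) by (unfold x; ring).
replace ((1 + x) * - sin Y - (1 + x) * - sin Y * / P ^ 3) with ((1 + x) * sin Y / P ^ 3 + - ((1 + x) * sin Y)) by (field; lra).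
apply Rabs_le_between in K.
assert (T : Rabs ((1 + x) * sin Y) <= 2 * 1).
{ assert (Hd2 : 0 < d ^ 2) by (apply pow_lt; lra). apply Rabs_mult_le; [unfold x; rewrite Rabs_pos_eq; lra|apply Rabs_le, SIN_bound]. }
apply Rabs_le_between in T.
assert (C : 1600 * ka / (b + Rabs tau) ^ 2 <= 1600 * ka / (b ^ 2 + tau ^ 2)); [|lra].
assert (0 < b ^ 2) by (apply pow_lt; lra). pose proof (pow2_ge_0 tau). pose proof (Rabs_pos tau). apply Rmult_le_compat_l; [lra|].
apply Rinv_le_contravar; [lra|]. rewrite <- (pow2_abs tau).
assert (0 <= b * Rabs tau) by (apply Rmult_le_pos; lra). lra.
Qed.

(* The main term comes from d/dt (t / (b sqrt (3 t^2 + 2 b t + b^2))) = (b + t) / (3 t^2 + 2 b t + b^2)^(3/2). *)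
Lemma kick_primitive ka b t : 0 < b -> let tau := t - tR in
  is_derive (fun t => mu * ((t - tR) / (b * sqrt (3 * (t - tR) ^ 2 + 2 * b * (t - tR) + b ^ 2)) - 1600 * ka / b * atan ((t - tR) / b) - 2 * (t - tR))) t
   (mu * ((b + tau) / sqrt (3 * tau ^ 2 + 2 * b * tau + b ^ 2) ^ 3 - 1600 * ka / (b ^ 2 + tau ^ 2) - 2)).
Proof.
intros Hb tau. destruct (kick_quadratic b tau Hb) as [_ [K _]]. unfold tau in *.
assert (0 < b ^ 2) by (apply pow_lt; auto). pose proof (pow2_ge_0 (t - tR)).
set (S := 3 * (t - tR) ^ 2 + 2 * b * (t - tR) + b ^ 2) in *. assert (HS : 0 < S) by lra.
assert (Hq : 0 < sqrt S) by (apply sqrt_lt_R0; auto). assert (E : sqrt S * sqrt S = S) by (apply sqrt_sqrt; lra).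
eapply is_derive_eq; cycle 1.
- apply (is_derive_scal (fun t => (t - tR) / (b * sqrt (3 * (t - tR) ^ 2 + 2 * b * (t - tR) + b ^ 2)) - 1600 * ka / b * atan ((t - tR) / b) - 2 * (t - tR))).
  apply (is_derive_minus (fun t => (t - tR) / (b * sqrt (3 * (t - tR) ^ 2 + 2 * b * (t - tR) + b ^ 2)) - 1600 * ka / b * atan ((t - tR) / b)) (fun t => 2 * (t - tR))).
  + apply (is_derive_minus (fun t => (t - tR) / (b * sqrt (3 * (t - tR) ^ 2 + 2 * b * (t - tR) + b ^ 2))) (fun t => 1600 * ka / b * atan ((t - tR) / b))).
    * instantiate (1 := (b + (t - tR)) / sqrt S ^ 3).
      eapply is_derive_eq; cycle 1; [auto_derive; [|reflexivity]|].
      { change (3 * ((t + - tR) * ((t + - tR) * 1)) + 2 * b * (t + - tR) + b * (b * 1)) with S. repeat split; auto. apply Rgt_not_eq, Rmult_lt_0_compat; auto. }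
      change (3 * ((t + - tR) * ((t + - tR) * 1)) + 2 * b * (t + - tR) + b * (b * 1)) with S. set (q := sqrt S) in *.
      transitivity ((q * q - (t - tR) * (3 * (t - tR) + b)) / (b * q ^ 3)); [field; lra|].
      rewrite E. unfold S. field. lra.
    * instantiate (1 := 1600 * ka / (b ^ 2 + (t - tR) ^ 2)).
      eapply is_derive_eq; cycle 1; [auto_derive; [auto|reflexivity]|].
       field. repeat split; try lra.
  + instantiate (1 := 2). eapply is_derive_eq; cycle 1; [auto_derive; [auto|reflexivity]|]. simpl. ring.
- unfold minus, plus, opp. simpl. ring.
Qed.

(** The interval |t - tR| <= ka contains the passage. At its two ends the straight-line distance is
    at most 2 ka, so the primitive contributes at least 1 / (2 b) twice, and the error terms cost a
    small fraction of 1 / b. Outside the interval the torque is at most mu (2 + 4 / ka^2) for a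
    total time of at most 4. *)
Lemma scatter_near ka b : 10 * M <= ka <= / 1000000 -> 0 < b <= ka / 10 -> b = 8 * d1 -> th tR = Kp - b ->
  mu * (9 / (10 * b) - 9 - 16 / ka ^ 2) <= L tD - L t3.
Proof.
intros Hka Hb Hbd Hth. destruct scatter_small as [_ D2].
destruct (scatter_radius t3 ltac:(lra)) as [_ R3]. destruct (scatter_radius tD ltac:(lra)) as [_ RD].
rewrite Hr3 in R3. rewrite HrD in RD. rewrite (Rabs_left1 (t3 - tR)) in R3 by lra. rewrite (Rabs_pos_eq (tD - tR)) in RD by lra.
assert (d ^ 2 <= 1) by lra. assert (0 < d ^ 2) by (apply pow_lt; lra).
assert ((d ^ 2) ^ 2 <= 1 / 1000) by nra.
rewrite Rabs_pos_eq in R3 by lra. rewrite Rabs_left1 in RD by lra.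


set (c := mu * (2 + / ((ka / 2) ^ 2))).
assert (Tail : forall t, t3 <= t <= tD -> ka <= Rabs (t - tR) -> Rabs (Q t) <= c).
{ intros t Ht Htau. apply scatter_torque; auto; [apply pow_lt; lra|]. eapply Rle_trans; [|apply Rmax_l].
  destruct (scatter_radius t Ht) as [A _]. destruct (Dq_split (r t) (th t)) as [_ E]. rewrite E.
  destruct (Hst t Ht) as [[G _] _]. pose proof (COS_bound (th t)). assert (0 <= 2 * r t * (1 - cos (th t))) by (apply Rmult_le_pos; lra).
  assert ((ka / 2) ^ 2 <= Rabs (r t - 1) ^ 2) by (apply pow_incr; lra). rewrite pow2_abs in H4. replace ((1 - r t) ^ 2) with ((r t - 1) ^ 2) by ring. lra. }
assert (T1 : Rabs (L (tR - ka) - L t3) <= c * (tR - ka - t3)).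
{ apply (open_derive_bound L Q); [lra|intros; apply Hder; lra|]. intros t Ht. apply Tail; [lra|]. rewrite Rabs_left1; lra. }
assert (T2 : Rabs (L tD - L (tR + ka)) <= c * (tD - (tR + ka))).
{ apply (open_derive_bound L Q); [lra|intros; apply Hder; lra|]. intros t Ht. apply Tail; [lra|]. rewrite Rabs_pos_eq; lra. }
assert (T3 := open_derive_le _ L _ Q (tR - ka) (tR + ka) ltac:(lra) (fun t _ => kick_primitive ka b t ltac:(lra)) (fun t Ht => proj2 (proj2 (Hder t ltac:(lra))))
  (fun t Ht => scatter_kick ka b t Hka Hb Hbd Hth ltac:(lra) (Rabs_le (t - tR) ka ltac:(lra)))).
cbv beta in T3. replace (tR + ka - tR) with ka in T3 by ring. replace (tR - ka - tR) with (- ka) in T3 by ring.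
assert (ES : forall x, Rabs x = ka -> / (2 * ka) <= / sqrt (3 * x ^ 2 + 2 * b * x + b ^ 2)).
{ intros x Hx. destruct (kick_quadratic b x ltac:(lra)) as [_ [K1 _]]. assert (0 < b ^ 2) by (apply pow_lt; lra).
  apply Rinv_le_contravar; [apply sqrt_lt_R0; lra|]. rewrite <- (sqrt_pow2 (2 * ka)) by lra. apply sqrt_le_1; [lra|apply pow2_ge_0|].
  assert (x ^ 2 = ka ^ 2) by (rewrite <- pow2_abs, Hx; auto). pose proof (Rle_abs x).
  assert (b * x <= ka / 10 * ka) by (apply Rle_trans with (b * ka); [apply Rmult_le_compat_l; lra|apply Rmult_le_compat_r; lra]).
  assert (b ^ 2 <= (ka / 10) ^ 2) by (apply pow_incr; lra). rewrite H3. replace (2 * b * x) with (2 * (b * x)) by ring. lra. }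
set (q1 := sqrt (3 * ka ^ 2 + 2 * b * ka + b ^ 2)) in *. set (q2 := sqrt (3 * (- ka) ^ 2 + 2 * b * - ka + b ^ 2)) in *.
assert (Q1 : / (2 * ka) <= / q1) by (apply ES, Rabs_pos_eq; lra).
assert (Q2 : / (2 * ka) <= / q2) by (apply ES; rewrite Rabs_Ropp; apply Rabs_pos_eq; lra).
assert (P0 : 0 < / (2 * ka)) by (apply Rinv_0_lt_compat; lra).
assert (Z : forall q, / (2 * ka) <= / q -> / (2 * b) <= ka / (b * q)).
{ intros q Hq. assert (q <> 0). { intros ->. rewrite Rinv_0 in Hq. lra. }
  replace (ka / (b * q)) with (ka / b * / q) by (field; lra). replace (/ (2 * b)) with (ka / b * / (2 * ka)) by (field; lra).
  apply Rmult_le_compat_l; auto. apply Rdiv_le_0_compat; lra. }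
apply Z in Q1. apply Z in Q2.
assert (At := atan_gap (ka / b) (- ka / b)). apply Rabs_le_between in At.
replace (- ka / (b * q2)) with (- (ka / (b * q2))) in T3 by (unfold Rdiv; ring).
assert (Ib : 0 < / b) by (apply Rinv_0_lt_compat; lra).
replace (/ (2 * b)) with (/ b / 2) in * by (field; lra).
assert (A2 : 1600 * ka / b * (atan (ka / b) - atan (- ka / b)) <= / b / 100).
{ apply Rle_trans with (1600 * ka / b * 4); [apply Rmult_le_compat_l; [apply Rdiv_le_0_compat; lra|lra]|].
  unfold Rdiv. replace (1600 * ka * / b * 4) with (6400 * ka * / b) by ring. rewrite (Rmult_comm (/ b)). apply Rmult_le_compat_r; lra. }
assert (T4 : mu * (99 / 100 * / b - 1) <= L (tR + ka) - L (tR - ka)).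
{ eapply Rle_trans; [|exact T3].
  match goal with |- _ <= mu * ?u - mu * ?v => replace (mu * u - mu * v) with (mu * (u - v)) by ring end.
  apply Rmult_le_compat_l; lra. }
apply Rabs_le_between in T1. apply Rabs_le_between in T2.
assert (0 <= c) by (apply Rmult_le_pos; [lra|]; assert (0 < / (ka / 2) ^ 2) by (apply Rinv_0_lt_compat, pow_lt; lra); lra).
assert (c * (tR - ka - t3) + c * (tD - (tR + ka)) <= c * 4) by (rewrite <- Rmult_plus_distr_l; apply Rmult_le_compat_l; lra).
replace (mu * (9 / (10 * b) - 9 - 16 / ka ^ 2)) with (mu * (9 / 10 * / b - 1) - c * 4) by (unfold c; field; lra).
assert (mu * (9 / 10 * / b - 1) <= mu * (99 / 100 * / b - 1)) by (apply Rmult_le_compat_l; lra). lra.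
Qed.
End Scatter.

(** * Connecting to a Sun collision *)

Lemma fourth_root x : 0 < x -> exists y, 0 < y /\ y ^ 4 = x.
Proof.
intros Hx. exists (sqrt (sqrt x)). assert (0 < sqrt x) by (apply sqrt_lt_R0; auto). split; [apply sqrt_lt_R0; auto|].
replace (sqrt (sqrt x) ^ 4) with ((sqrt (sqrt x) * sqrt (sqrt x)) * (sqrt (sqrt x) * sqrt (sqrt x))) by ring.
rewrite !sqrt_sqrt; auto; lra.
Qed.

Lemma mult_le_left a b : 0 <= a -> b <= 1 -> a * b <= a.
Proof. intros Ha Hb. rewrite <- (Rmult_1_r a) at 2. apply Rmult_le_compat_l; auto. Qed.

Lemma small_scales d N : 0 < d -> 3 <= N -> 10000000 * (N * d) <= 1 ->
  0 < d ^ 5 /\ d <= 1 / 1000 /\ N * d ^ 5 <= d ^ 4 / 10000000 /\ d ^ 4 <= / 10000000 /\ 2 * (N * d ^ 5) * (100 * N) ^ 4 <= 1.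
Proof.
intros Hd HN H. assert (Nd : 3 * d <= N * d) by (apply Rmult_le_compat_r; lra).
assert (H5 : 0 < d ^ 5) by (apply pow_lt; auto). assert (H4 : 0 < d ^ 4) by (apply pow_lt; auto).

split; [auto|]. split; [lra|]. split; [|split].
- replace (N * d ^ 5) with (d ^ 4 * (N * d)) by ring. replace (d ^ 4 / 10000000) with (d ^ 4 * / 10000000) by field.
  apply Rmult_le_compat_l; lra.
- assert (d ^ 4 <= (1 / 10000000) ^ 4) by (apply pow_incr; lra). lra.
- replace (2 * (N * d ^ 5) * (100 * N) ^ 4) with (2 * 100 ^ 4 * (N * d) ^ 5) by ring.
  assert ((N * d) ^ 5 <= (1 / 10000000) ^ 5) by (apply pow_incr; lra). lra.
Qed.

(** * The whole trip from the section back to the section *)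

Section Trip.
Variables (d N mu : R) (y : coord -> R -> R).
(** The unit of energy and angular momentum is q, and u bounds |L| at the start. The truncation
    radius satisfies mu / d1 = 20 u, so the strongest kick allowed by the cut-off is still of order
    u, and M = 2200 u bounds L and the energy after it. The outer cut-off 8 / q lies beyond the
    excursion, whose semi-major axis is at most 2 / q. *)
Let q := d ^ 5. Let u := N * q. Let eps := 300 * mu / d ^ 8. Let d1 := mu / (20 * u). Let Rm := 8 / q. Let M := 2200 * u.
Hypotheses (Hd : 0 < d) (HN : 3 <= N) (HNd : 10000000 * (N * d) <= 1) (Hmu : 0 < mu) (Heps : eps <= q ^ 7 / 1000000000).
Hypothesis Hflow : flow_of (trunc_field d Rm d1 mu) y.
Let r := y Cr. Let th := y Cth. Let w := y Cw. Let L := y CL.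
Let F i t := trunc_field d Rm d1 mu (fun j => y j t) i.
Let E t := En (r t) (w t) (L t).
Hypotheses (Hr0 : r 0 = d ^ 2) (Hw0 : 0 < w 0) (Hth0 : Rabs (th 0 - sqrt 2 / 3 * (1 - d ^ 3)) <= d ^ 4)
  (HL0 : - (N - 1) * q <= L 0 <= - (3 / 10) * q) (HE0 : Rabs (E 0 - L 0) <= q / 100)
  (Hmiss : d ^ 4 / 2 <= Rabs (th 0 - sqrt 2 / 3 * (1 - d ^ 3) + sqrt 2 * L 0 / d)).

Lemma trip_scales : 0 < q <= / 10000000 /\ d <= 1 / 1000 /\ 3 * q <= u /\ u <= d ^ 4 / 10000000 /\ u <= / 10000000 /\
  0 < eps <= q / 1000000000 /\ 300 * mu <= eps /\ 0 < d1 <= d ^ 4 / 10 /\ 0 < d ^ 4 <= / 10000000.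
Proof.
destruct (small_scales d N Hd HN HNd) as [S1 [S2 [S3 [S4 S5]]]]. fold q in S1, S3. fold u in S3.

assert (Q : 3 * q <= u) by (apply Rmult_le_compat_r; lra).

assert (H8 : 0 < d ^ 8 <= 1) by (split; [apply pow_lt; auto|replace 1 with (1 ^ 8) by ring; apply pow_incr; lra]).
assert (I8 : 1 <= / d ^ 8) by (rewrite <- Rinv_1; apply Rinv_le_contravar; lra).
assert (E1 : 300 * mu <= eps) by (unfold eps, Rdiv; rewrite <- (Rmult_1_r (300 * mu)) at 1; apply Rmult_le_compat_l; lra).
assert (Q6 : q ^ 6 <= 1) by (replace 1 with (1 ^ 6) by ring; apply pow_incr; lra).
assert (Q5 : q ^ 5 <= 1) by (replace 1 with (1 ^ 5) by ring; apply pow_incr; lra).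
assert (Q7 : q ^ 7 <= q) by (replace (q ^ 7) with (q * q ^ 6) by ring; rewrite <- (Rmult_1_r q) at 3; apply Rmult_le_compat_l; lra).
assert (Q72 : q ^ 7 <= q * q) by (replace (q ^ 7) with (q * (q * q ^ 5)) by ring; apply Rmult_le_compat_l; [lra|]; apply mult_le_left; lra).
assert (D1 : 0 < d1 <= d ^ 4 / 10).
{ unfold d1. split; [apply Rdiv_lt_0_compat; lra|]. apply Rle_div_l; [lra|].
  apply Rle_trans with (q * q / 1000000); [lra|].
  assert (q * q <= (d ^ 4 / 10000000) * u) by (apply Rmult_le_compat; lra). lra. }
repeat split; lra.
Qed.

Lemma trip_flow t : 0 <= t -> is_derive r t (w t) /\ is_derive th t (F Cth t) /\ is_derive w t (F Cw t) /\ is_derive L t (F CL t).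
Proof. intros Ht. exact (conj (Hflow Cr t Ht) (conj (Hflow Cth t Ht) (conj (Hflow Cw t Ht) (Hflow CL t Ht)))). Qed.

Lemma trip_field t X : d ^ 2 <= r t <= Rm -> Rabs (L t) <= 1 -> 0 < X -> X <= Rmax (Dq (r t) (th t)) (d1 ^ 2) ->
  F Cth t = L t / (r t) ^ 2 - 1 /\ Rabs (F Cw t - ((L t) ^ 2 / (r t) ^ 3 - / (r t) ^ 2)) <= mu * (/ (r t) ^ 2 + / X + 1) /\
  Rabs (F CL t) <= mu * (/ X + r t).
Proof.
intros Hr HL HX HD. destruct trip_scales as [_ [_ [_ [_ [_ [_ [_ [[Hd1 _] _]]]]]]]].
assert (Hd2 : 0 < d ^ 2) by (apply pow_lt; auto). apply Rabs_le_between in HL.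
destruct (trunc_bounds d Rm d1 mu (r t) (th t) (w t) (L t) Hd Hd1 ltac:(lra) ltac:(lra) ltac:(lra)) as [A [B C]].
assert (I : / Rmax (Dq (r t) (th t)) (d1 ^ 2) <= / X) by (apply Rinv_le_contravar; auto).
split; [exact A|]. split.
- eapply Rle_trans; [exact B|]. apply Rmult_le_compat_l; lra.
- eapply Rle_trans; [exact C|]. apply Rmult_le_compat_l; lra.
Qed.

Lemma Rm_large : 8 <= Rm.
Proof. destruct trip_scales as [S _]. unfold Rm. apply (proj1 (Rle_div_r 8 8 q ltac:(lra))). lra. Qed.

Lemma inv_radius_sq t : d ^ 2 <= r t -> / r t ^ 2 <= / d ^ 8.
Proof.
intros H. destruct trip_scales as [_ [S _]]. assert (Hd2 : 0 < d ^ 2 <= 1) by (split; [apply pow_lt; auto|replace 1 with (1 ^ 2) by ring; apply pow_incr; lra]).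
apply Rinv_le_contravar; [apply pow_lt; lra|]. replace (d ^ 8) with ((d ^ 4) ^ 2) by ring. apply pow_incr. split; [apply pow_le; lra|].
apply Rle_trans with (d ^ 2); [|auto]. replace (d ^ 4) with (d ^ 2 * d ^ 2) by ring. apply mult_le_left; lra.
Qed.

Lemma inv_d8 : 1 <= / d ^ 8 /\ mu * (300 * / d ^ 8) = eps.
Proof.
destruct trip_scales as [_ [S _]]. assert (H8 : 0 < d ^ 8 <= 1) by (split; [apply pow_lt; auto|replace 1 with (1 ^ 8) by ring; apply pow_incr; lra]).
split; [rewrite <- Rinv_1; apply Rinv_le_contravar; lra|unfold eps, Rdiv; ring].
Qed.

Lemma trip_out : exists t2, 0 < t2 <= 4 /\ r t2 = 2 /\ 0 < w t2 /\ Rabs (L t2 - L 0) <= 4 * eps /\ Rabs (E t2 - E 0) <= 6 * eps /\ Rabs (th t2) <= 3 /\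
  forall t, 0 <= t <= t2 -> d ^ 2 <= r t <= 2 /\ Rabs (L t) <= 1 / 2 /\ d1 ^ 2 <= Dq (r t) (th t).
Proof.
destruct trip_scales as [S1 [S2 [S3 [S4 [S5 [S6 [S7 [S8 S9]]]]]]]]. destruct inv_d8 as [I1 I2]. pose proof Rm_large as HRm.

assert (HLm : Rabs (L 0) <= u) by (apply Rabs_le; unfold u in *; lra).
assert (HEm : Rabs (En (r 0) (w 0) (L 0)) <= u).
{ apply Rabs_le_between in HE0. unfold E in HE0. apply Rabs_le. unfold u in *. lra. }
assert (D100 : 0 < (d ^ 4 / 10) ^ 2) by (apply pow_lt; lra).
assert (I3 : / (d ^ 4 / 10) ^ 2 = 100 * / d ^ 8) by (field; lra).
assert (Leg : forall b, 0 <= b -> (forall t, 0 <= t <= b -> r t <= 2) -> forall t, 0 <= t <= b -> d ^ 2 <= r t /\ 1 / 2 < w t /\ (d ^ 4 / 10) ^ 2 < Dq (r t) (th t) /\ t <= 4 /\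
  Rabs (L t - L 0) <= 4 * eps /\ Rabs (E t - E 0) <= 6 * eps /\ Rabs (th t) <= 3).
{ intros b Hb Hr2. apply (outgoing_leg d u eps b r th w L (F Cth) (F Cw) (F CL)); auto; try lra.
  - split; [lra|]. apply Rle_trans with (q ^ 7 / 1000000000); [auto|].
    assert (q ^ 5 <= 1) by (replace 1 with (1 ^ 5) by ring; apply pow_incr; lra).
    assert (q * q <= u * (d ^ 4 / 10000000)) by (apply Rmult_le_compat; lra).
    assert (q ^ 7 <= q * q * 1) by (replace (q ^ 7) with (q * q * q ^ 5) by ring; apply Rmult_le_compat_l; [apply Rmult_le_pos; lra|auto]). lra.
  - intros t Ht. apply trip_flow; lra.
  - intros t Ht Hrt HLt HDt. destruct (trip_field t ((d ^ 4 / 10) ^ 2) ltac:(lra) HLt D100) as [A [B C]].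
    { eapply Rle_trans; [exact HDt|apply Rmax_l]. }
    rewrite I3 in B, C. pose proof (inv_radius_sq t ltac:(lra)). split; [exact A|]. rewrite <- I2. split.
    + eapply Rle_trans; [exact B|]. apply Rmult_le_compat_l; lra.
    + eapply Rle_trans; [exact C|]. apply Rmult_le_compat_l; lra. }
assert (Hex : exists t, 0 <= t <= 5 /\ 2 < r t).
{ apply NNPP. intros Hn. assert (Hle : forall t, 0 <= t <= 5 -> r t <= 2) by (intros t Ht; apply Rnot_lt_le; intros Hlt; apply Hn; exists t; auto).
  destruct (Leg 5 ltac:(lra) Hle 5 ltac:(lra)) as [_ [_ [_ [H _]]]]. lra. }
destruct Hex as [t1 [Ht1 Hrt1]].
assert (Cr' : forall x, 0 <= x <= t1 -> continuous r x).
{ intros x Hx. destruct (trip_flow x ltac:(lra)) as [D _]. exact (is_derive_continuous _ _ _ D). }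
assert (d ^ 2 <= 1) by (replace 1 with (1 ^ 2) by ring; apply pow_incr; lra).
destruct (first_hit r 0 t1 2 ltac:(lra) Cr' ltac:(lra)) as [t2 [Ht2 [E2 Hlt2]]].
assert (Hle2 : forall t, 0 <= t <= t2 -> r t <= 2).
{ intros t Ht. destruct (Req_dec t t2) as [->|]; [lra|]. left. apply Hlt2. lra. }
assert (G := Leg t2 ltac:(lra) Hle2). destruct (G t2 ltac:(lra)) as [G1 [G2 [G3 [G4 [G5 [G6 G7]]]]]].
exists t2. assert (t2 <> 0) by (intros Z; rewrite Z in E2; lra).
split; [lra|]. split; [auto|]. split; [lra|]. split; [auto|]. split; [auto|]. split; [auto|].
intros t Ht. destruct (G t Ht) as [K1 [K2 [K3 [K4 [K5 _]]]]]. split; [split; auto|]. split.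
- replace (L t) with ((L t - L 0) + L 0) by ring. eapply Rle_trans; [apply Rabs_plus_le; [exact K5|exact HLm]|]. lra.
- left. eapply Rle_lt_trans; [|exact K3]. apply pow_incr. lra.
Qed.

Lemma trip_far : exists t3 al, 5 < t3 /\ 100 * N <= al /\ Rabs (- / (2 * al ^ 4) - L 0) <= q / 50 /\
  r t3 = 2 /\ w t3 < 0 /\ Rabs (L t3 - L 0) <= q / 100 /\ Rabs (E t3 - L 0) <= q / 10 /\
  Rabs (t3 - 2 * PI * al ^ 6) <= 5 * al ^ 5 + 4 /\ Rabs (th t3 + t3) <= 8 /\
  (forall t, 5 <= t <= t3 -> 2 <= r t) /\
  (forall t, 0 <= t <= t3 -> d ^ 2 <= r t <= Rm /\ Rabs (L t) <= 1 / 2 /\ d1 ^ 2 <= Dq (r t) (th t)).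
Proof.
destruct trip_scales as [S1 [S2 [S3 [S4 [S5 [S6 [S7 [S8 S9]]]]]]]]. destruct inv_d8 as [I1 I2]. pose proof Rm_large as HRm.
destruct trip_out as [t2 [Ht2 [Hr2 [Hw2 [HL2 [HE2 [Hth2 Hin]]]]]]].
assert (HEL : Rabs (E t2 - L 0) <= q / 50).
{ replace (E t2 - L 0) with ((E t2 - E 0) + (E 0 - L 0)) by ring. eapply Rle_trans; [apply Rabs_plus_le; [exact HE2|exact HE0]|]. lra. }
assert (HEL' := HEL). apply Rabs_le_between in HEL'.
 assert (Neg2 : - E t2 < u) by (unfold u in *; lra).
(* The semi-major axis is read off the energy at the exit through r = 2, where the Kepler excursion
   begins, and not from the initial data. *)
destruct (fourth_root (/ (2 * - E t2))) as [al [Hal0 Hal4]]; [apply Rinv_0_lt_compat; lra|].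
assert (EE : - / (2 * al ^ 4) = E t2) by (rewrite Hal4; field; lra).
assert (Hal : 100 * N <= al).
{ apply Rnot_lt_le. intros Hc. assert (A : al ^ 4 <= (100 * N) ^ 4) by (apply pow_incr; lra).
  destruct (small_scales d N Hd HN HNd) as [_ [_ [_ [_ B]]]]. fold q in B. fold u in B.
  assert (C : / (2 * u) < / (2 * - E t2)) by (apply Rinv_lt_contravar; [apply Rmult_lt_0_compat; lra|lra]).
  assert (G : 2 * u * / (2 * u) < 2 * u * (100 * N) ^ 4) by (apply Rmult_lt_compat_l; lra).
  rewrite Rinv_r in G by lra. lra. }
assert (Hal42 : al ^ 4 <= 2 / q).
{ rewrite Hal4. replace (2 / q) with (/ (q / 2)) by (field; lra). apply Rinv_le_contravar; lra. }
assert (HRa : 4 * al ^ 4 <= Rm) by (unfold Rm; replace (8 / q) with (4 * (2 / q)) by (field; lra); lra).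
assert (Hp1 : forall n, 1 <= al ^ n) by (intros n; apply pow_R1_Rle; lra).
(* The excursion requires eps al^26 to be small. As al^4 is at most 2 / q, this follows from eps <=
   q^7 / 10^9: the origin of the power 7. *)
assert (H28 : al ^ 28 <= 128 / q ^ 7).
{ replace (al ^ 28) with ((al ^ 4) ^ 7) by ring. replace (128 / q ^ 7) with ((2 / q) ^ 7) by (field; lra).
  apply pow_incr. split; [pose proof (Hp1 4%nat); lra|auto]. }

assert (H26 : 100000 * eps * al ^ 26 <= 1).
{ apply Rle_trans with (100000 * (q ^ 7 / 1000000000) * (128 / q ^ 7)).
  - apply Rmult_le_compat; [lra|pose proof (Hp1 26%nat); lra|lra|]. eapply Rle_trans; [|exact H28]. apply Rle_pow; [lra|lia].
  - replace (100000 * (q ^ 7 / 1000000000) * (128 / q ^ 7)) with (100000 * 128 / 1000000000) by (field; lra). lra. }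
assert (He1 : eps * (80 * al ^ 8) <= q / 1000).
{ assert (B8 : al ^ 8 <= 4 / q ^ 2).
  { replace (al ^ 8) with ((al ^ 4) ^ 2) by ring. replace (4 / q ^ 2) with ((2 / q) ^ 2) by (field; lra).
    apply pow_incr. split; [pose proof (Hp1 4%nat); lra|auto]. }
  apply Rle_trans with ((q ^ 7 / 1000000000) * (80 * (4 / q ^ 2))).
  - apply Rmult_le_compat; [lra|pose proof (Hp1 8%nat); lra|lra|lra].
  - replace ((q ^ 7 / 1000000000) * (80 * (4 / q ^ 2))) with (q * (q ^ 4 * (320 / 1000000000))) by (field; lra).
    assert (q ^ 4 <= 1) by (replace 1 with (1 ^ 4) by ring; apply pow_incr; lra).
    replace (q / 1000) with (q * / 1000) by field. apply Rmult_le_compat_l; lra. }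
assert (Hfld : forall t, t2 <= t -> 2 <= r t <= 4 * al ^ 4 -> Rabs (L t) <= 1 ->
  F Cth t = L t / (r t) ^ 2 - 1 /\ Rabs (F Cw t - ((L t) ^ 2 / (r t) ^ 3 - / (r t) ^ 2)) <= eps /\ Rabs (F CL t) <= eps).
{ intros t Ht Hr HL. assert (Hd2 : d ^ 2 <= 1) by (replace 1 with (1 ^ 2) by ring; apply pow_incr; lra).
  destruct (trip_field t 1 ltac:(lra) HL ltac:(lra)) as [A [B C]].
  { eapply Rle_trans; [|apply Rmax_l]. pose proof (Dq_lower (r t) (th t) ltac:(lra)) as HD0.
    assert (1 ^ 2 <= (r t - 1) ^ 2) by (apply pow_incr; lra). replace ((1 - r t) ^ 2) with ((r t - 1) ^ 2) in HD0 by ring. lra. }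
  rewrite Rinv_1 in B, C. pose proof (inv_radius_sq t ltac:(lra)). split; [exact A|]. rewrite <- I2. split.
  - eapply Rle_trans; [exact B|]. apply Rmult_le_compat_l; lra.
  - eapply Rle_trans; [exact C|]. apply Rmult_le_compat_l; [lra|].
    assert (Rm <= 8 * / d ^ 8); [|lra]. unfold Rm, Rdiv. apply Rmult_le_compat_l; [lra|].
    apply Rinv_le_contravar; [apply pow_lt; auto|]. unfold q. replace (d ^ 8) with (d ^ 5 * d ^ 3) by ring.
    apply mult_le_left; [apply pow_le; lra|]. replace 1 with (1 ^ 3) by ring. apply pow_incr. lra. }
assert (Hder : forall t, t2 <= t -> is_derive r t (w t) /\ is_derive th t (F Cth t) /\ is_derive w t (F Cw t) /\ is_derive L t (F CL t)) by (intros t Ht; apply trip_flow; lra).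
assert (HL2s : Rabs (L t2) <= 1 / 1000).
{ replace (L t2) with ((L t2 - L 0) + L 0) by ring. assert (Rabs (L 0) <= u) by (apply Rabs_le; unfold u in *; lra).
  eapply Rle_trans; [apply Rabs_plus_le; [exact HL2|exact H]|]. lra. }
destruct (far_return al eps t2 r th w L (F Cth) (F Cw) (F CL) ltac:(lra) ltac:(lra) H26 Hder Hfld Hr2 Hw2 HL2s (eq_sym EE)) as [t3 [T1 [T2 [T3 T4]]]].
destruct (far_phase al eps t2 r th w L (F Cth) (F Cw) (F CL) ltac:(lra) ltac:(lra) H26 Hder Hfld Hr2 Hw2 HL2s (eq_sym EE) t3 T1 T2 T3 T4) as [P1 [P2 [P3 P4]]].
assert (Rg := fun t Ht => far_range al eps t2 r th w L (F Cth) (F Cw) (F CL) ltac:(lra) ltac:(lra) H26 Hder Hfld HL2s (eq_sym EE) t3 t T2 Ht).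
apply Rabs_le_between in P1. apply Rabs_le_between in P4. apply Rabs_le_between in Hth2.
assert (Long : 5 < t3).
{ pose proof PI2_1. pose proof (Hp1 5%nat). assert (300 * al ^ 5 <= al ^ 6) by (replace (al ^ 6) with (al * al ^ 5) by ring; apply Rmult_le_compat_r; lra).
  assert (2 * PI * al ^ 6 >= 4 * al ^ 6) by (apply Rle_ge, Rmult_le_compat_r; [pose proof (Hp1 6%nat); lra|lra]). lra. }
exists t3, al. split; [auto|]. split; [auto|]. split; [rewrite EE; auto|]. split; [auto|]. split; [auto|].
split; [|split; [|split; [|split; [|split]]]].
- replace (L t3 - L 0) with ((L t3 - L t2) + (L t2 - L 0)) by ring. eapply Rle_trans; [apply Rabs_plus_le; [exact P2|exact HL2]|]. lra.
- change (Rabs (E t3 - E t2) <= 2 * (eps * (80 * al ^ 8))) in P3.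
  replace (E t3 - L 0) with ((E t3 - E t2) + (E t2 - L 0)) by ring. eapply Rle_trans; [apply Rabs_plus_le; [exact P3|exact HEL]|]. lra.
- apply Rabs_le. lra.
- apply Rabs_le. lra.
- intros t Ht. apply T2. lra.
- intros t Ht. destruct (Rle_dec t t2) as [H|H].
  + destruct (Hin t ltac:(lra)) as [A [B C]]. split; [lra|]. split; auto.
  + destruct (Rg t ltac:(lra)) as [A B]. specialize (T2 t ltac:(lra)).
    assert (Hd2 : d ^ 2 <= 1) by (replace 1 with (1 ^ 2) by ring; apply pow_incr; lra).
     split; [lra|]. split; [auto|].
    assert (d1 ^ 2 <= 1) by (replace 1 with (1 ^ 2) by ring; apply pow_incr; lra).
    pose proof (Dq_lower (r t) (th t) ltac:(lra)).
    assert (1 ^ 2 <= (r t - 1) ^ 2) by (apply pow_incr; lra). replace ((1 - r t) ^ 2) with ((r t - 1) ^ 2) in H2 by ring. lra.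
Qed.

Lemma trip : exists t3 tR tD al, 5 < t3 /\ t3 < tR /\ tR < tD /\ tD - t3 <= 4 /\ 100 * N <= al /\
  Rabs (- / (2 * al ^ 4) - L 0) <= q / 50 /\ Rabs (L t3 - L 0) <= q / 100 /\
  Rabs (th tR + 2 * PI * al ^ 6) <= 5 * al ^ 5 + 30 /\
  r t3 = 2 /\ r tR = 1 /\ r tD = d ^ 2 /\
  (forall t, 5 <= t < tR -> 1 < r t) /\ (forall t, 5 <= t < tD -> d ^ 2 < r t) /\
  (forall t, 0 <= t <= t3 -> d ^ 2 <= r t <= Rm /\ Rabs (L t) <= 1 / 2 /\ d1 ^ 2 <= Dq (r t) (th t)) /\
  (forall t, t3 <= t <= tD -> d ^ 2 <= r t <= 2 /\ w t < - (1 / 2) /\ Rabs (L t) <= 2 * M /\ Rabs (E t) <= 2 * M /\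
    F Cth t = L t / (r t) ^ 2 - 1 /\ F CL t = mu * (r t * sin (th t) - r t * sin (th t) * / sqrt (Rmax (Dq (r t) (th t)) (d1 ^ 2)) ^ 3)) /\
  (forall s t, t3 <= s -> s <= t -> t <= tD -> (t - s) / 2 <= r s - r t /\ Rabs ((r t) ^ 2 - (r s) ^ 2) <= 41 / 10 * (t - s)).
Proof.
destruct trip_scales as [S1 [S2 [S3 [S4 [S5 [S6 [S7 [S8 S9]]]]]]]]. destruct inv_d8 as [I1 I2]. pose proof Rm_large as HRm.
destruct trip_far as [t3 [al [T1 [T2 [T3 [T4 [T5 [T6 [T7 [T8 [T9 [T10 T11]]]]]]]]]]]].
assert (Ek : mu / d1 = 20 * u) by (unfold d1; field; lra).
assert (HL0u : Rabs (L 0) <= u) by (apply Rabs_le; unfold u in *; lra).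
assert (Hd2 : 0 < d ^ 2 <= 1) by (split; [apply pow_lt; auto|replace 1 with (1 ^ 2) by ring; apply pow_incr; lra]).
assert (Hkick : 6 * eps + 50 * (mu / d1) <= M / 2) by (rewrite Ek; unfold M; lra).
assert (HM : 0 < M <= d ^ 4 / 1000) by (unfold M; lra).
assert (HL3 : Rabs (L t3) <= M / 2).
{ replace (L t3) with ((L t3 - L 0) + L 0) by ring. eapply Rle_trans; [apply Rabs_plus_le; [exact T6|exact HL0u]|]. unfold M; lra. }
assert (HE3 : Rabs (En (r t3) (w t3) (L t3)) <= M / 2).
{ change (Rabs (E t3) <= M / 2). replace (E t3) with ((E t3 - L 0) + L 0) by ring. eapply Rle_trans; [apply Rabs_plus_le; [exact T7|exact HL0u]|]. unfold M; lra. }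
assert (Hder : forall t, t3 <= t -> is_derive r t (w t) /\ is_derive th t (F Cth t) /\ is_derive w t (F Cw t) /\ is_derive L t (F CL t)) by (intros t Ht; apply trip_flow; lra).
assert (Hd12 : 0 < d1 ^ 2) by (apply pow_lt; lra).
assert (Hfld : forall t, t3 <= t -> d ^ 2 <= r t <= 2 -> Rabs (L t) <= 1 ->
  F Cth t = L t / (r t) ^ 2 - 1 /\ Rabs (F Cw t - ((L t) ^ 2 / (r t) ^ 3 - / (r t) ^ 2)) <= eps + 4 * mu / ((r t - 1) ^ 2 + d1 ^ 2) /\
  Rabs (F CL t) <= eps + 4 * mu / ((r t - 1) ^ 2 + d1 ^ 2)).
{ intros t Ht Hr HL. set (Z := (r t - 1) ^ 2 + d1 ^ 2). assert (HZ : 0 < Z) by (unfold Z; pose proof (pow2_ge_0 (r t - 1)); lra).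
  destruct (trip_field t (Z / 2) ltac:(lra) HL ltac:(lra)) as [A [B C]].
  { unfold Z. pose proof (Dq_lower (r t) (th t) ltac:(lra)). replace ((1 - r t) ^ 2) with ((r t - 1) ^ 2) in H by ring.
    pose proof (Rmax_l (Dq (r t) (th t)) (d1 ^ 2)). pose proof (Rmax_r (Dq (r t) (th t)) (d1 ^ 2)). lra. }
  pose proof (inv_radius_sq t ltac:(lra)). assert (HiZ : 0 < / Z) by (apply Rinv_0_lt_compat; auto).
  replace (/ (Z / 2)) with (2 * / Z) in B, C by (field; lra). replace (4 * mu / Z) with (mu * (4 * / Z)) by (field; lra).
  split; [exact A|]. rewrite <- I2, <- Rmult_plus_distr_l. split.
  - eapply Rle_trans; [exact B|]. apply Rmult_le_compat_l; lra.
  - eapply Rle_trans; [exact C|]. apply Rmult_le_compat_l; lra. }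
destruct (inbound_arrival d M eps mu d1 t3 r th w L (F Cth) (F Cw) (F CL) ltac:(lra) HM ltac:(lra) Hmu ltac:(lra) Hkick Hder Hfld T4 T5 HL3 HE3) as [tD [D1 [D2 D3]]].
assert (Est := fun t Ht => inbound_est d M eps mu d1 t3 r th w L (F Cth) (F Cw) (F CL) ltac:(lra) HM ltac:(lra) Hmu ltac:(lra) Hkick Hder Hfld T4 T5 HL3 HE3 tD t D3 Ht).
assert (Rad := fun s t => inbound_radius d M eps mu d1 t3 r th w L (F Cth) (F Cw) (F CL) ltac:(lra) HM ltac:(lra) Hmu ltac:(lra) Hkick Hder Hfld T4 T5 HL3 HE3 tD s t D3).
assert (Crr : forall x, t3 <= x <= tD -> continuous r x).
{ intros x Hx. destruct (Hder x ltac:(lra)) as [D _]. exact (is_derive_continuous _ _ _ D). }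
destruct (ivt_between r t3 tD 1 ltac:(lra) Crr ltac:(right; lra)) as [tR [R1 R2]].
assert (R3 : t3 < tR < tD).
{ assert (d ^ 2 < 1) by (assert (d ^ 2 <= (1 / 1000) ^ 2) by (apply pow_incr; lra); lra).
  split; apply Rnot_le_lt; intros Hc; [replace tR with t3 in R2 by lra|replace tR with tD in R2 by lra]; lra. }
exists t3, tR, tD, al. split; [auto|]. split; [lra|]. split; [lra|]. split; [apply Est; lra|]. split; [auto|]. split; [auto|]. split; [auto|].
split; [|split; [auto|split; [auto|split; [auto|split; [|split; [|split; [auto|split]]]]]]].
- assert (A : Rabs (th tR - th t3) <= 2 * (tR - t3)).
  { apply (open_derive_bound th (F Cth)); [lra|intros; apply Hder; lra|]. intros t Ht.
    destruct (Est t ltac:(lra)) as [_ [_ [_ [_ [B1 [_ [B2 _]]]]]]]. rewrite B2.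
    destruct (Rad t tR ltac:(lra) ltac:(lra) ltac:(lra)) as [B3 _]. rewrite R2 in B3.
    replace 2 with (1 + 1) by ring. apply Rabs_plus_le; [|rewrite Rabs_Ropp, Rabs_R1; lra].
    replace 1 with (1 / 1) by field. apply Rabs_div_le; [lra| |lra]. replace 1 with (1 ^ 2) by ring. apply pow_incr. lra. }
  destruct (Est tR ltac:(lra)) as [_ [B _]].
  replace (th tR + 2 * PI * al ^ 6) with ((th tR - th t3) + ((th t3 + t3) + - (t3 - 2 * PI * al ^ 6))) by ring.
  eapply Rle_trans; [apply (Rabs_plus_le _ _ 8 (8 + (5 * al ^ 5 + 4)))|lra]; [lra|].
  apply Rabs_plus_le; [auto|rewrite Rabs_Ropp; auto].
- intros t Ht. destruct (Rle_dec t t3) as [H|H]; [specialize (T10 t ltac:(lra)); lra|].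
  destruct (Rad t tR ltac:(lra) ltac:(lra) ltac:(lra)) as [B _]. lra.
- intros t Ht. destruct (Rle_dec t t3) as [H|H]; [specialize (T10 t ltac:(lra)); lra|].
  destruct (Rad t tD ltac:(lra) ltac:(lra) ltac:(lra)) as [B _]. lra.
- intros t Ht. destruct (Est t Ht) as [B1 [B2 [B3 [B4 [B5 [B6 [B7 _]]]]]]]. specialize (D3 t Ht).
  repeat split; auto. unfold F, trunc_field, tr_D, tr_r. change (y Cr t) with (r t). rewrite clamp_id by lra. reflexivity.
- intros s t H1 H2 H3. apply Rad; lra.
Qed.
End Trip.

(** * Continuous dependence and the connecting orbit *)

Lemma choice_fun (A B : Type) (P : A -> B -> Prop) : (forall x, exists y, P x y) -> exists f, forall x, P x (f x).
Proof.
intros H. exists (fun x => proj1_sig (constructive_indefinite_description _ (H x))).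
intros x. exact (proj2_sig (constructive_indefinite_description _ (H x))).
Qed.

Lemma decrease_right (f : R -> R) x v e : is_derive f x v -> v < 0 -> 0 < e -> exists t, x < t < x + e /\ f t < f x.
Proof.
intros D Hv He. apply is_derive_Reals in D. destruct (D (- v / 2) ltac:(lra)) as [del Hdel].
pose proof (cond_pos del). set (h := Rmin del e / 2).
assert (Hm : 0 < Rmin del e) by (apply Rmin_pos; auto). pose proof (Rmin_l del e). pose proof (Rmin_r del e).
assert (Hh : 0 < h) by (unfold h; lra).
specialize (Hdel h ltac:(lra)). rewrite Rabs_pos_eq in Hdel by lra. specialize (Hdel ltac:(unfold h; lra)).
apply Rabs_def2 in Hdel. exists (x + h). split; [unfold h; lra|].
assert ((f (x + h) - f x) / h * h < v / 2 * h) by (apply Rmult_lt_compat_r; lra).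
replace ((f (x + h) - f x) / h * h) with (f (x + h) - f x) in H2 by (field; lra). nra.
Qed.

Section Family.
Variable Y : R -> coord -> R -> R.
Hypothesis Hunif : forall s T e, 0 < e -> exists del, 0 < del /\ forall s', Rabs (s' - s) < del -> forall i t, 0 <= t <= T -> Rabs (Y s' i t - Y s i t) < e.
Hypothesis Hcont : forall s i t, 0 <= t -> continuous (Y s i) t.

(** A strictly inward crossing persists under perturbation, and before it the radius stays away from
    y on compact intervals. The lower time [lo] discards the start and the outward leg, on which the
    same radius occurs as well. *)
Lemma hitting_time_continuous (y lo : R) (tau : R -> R) : 0 <= lo -> (forall s, lo < tau s) ->
  (forall s t, lo <= t < tau s -> y < Y s Cr t) -> (forall s, Y s Cr (tau s) = y) ->
  (forall s, exists v, v < 0 /\ is_derive (Y s Cr) (tau s) v) -> forall s, continuous tau s.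
Proof.
intros Hlo Htau Hgt Heq Hdec s. apply continuous_eps. intros e He.
set (e' := Rmin (e / 2) ((tau s - lo) / 2)). specialize (Htau s) as Hts.
assert (He' : 0 < e' /\ e' < e /\ e' < tau s - lo).
{ unfold e'. split; [apply Rmin_pos; lra|]. pose proof (Rmin_l (e / 2) ((tau s - lo) / 2)). pose proof (Rmin_r (e / 2) ((tau s - lo) / 2)). lra. }
destruct (Hdec s) as [v [Hv Dv]]. destruct (decrease_right _ _ _ e' Dv Hv ltac:(lra)) as [tp [Htp Hlow]]. rewrite Heq in Hlow.
destruct (continuity_ab_min (Y s Cr) lo (tau s - e') ltac:(lra)) as [tm [Hmin Htm]].
{ intros c Hc. apply continuity_pt_filterlim. apply Hcont. lra. }
assert (Hm := Hgt s tm ltac:(lra)).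
set (e0 := Rmin (y - Y s Cr tp) (Y s Cr tm - y)).
assert (He0 : 0 < e0) by (apply Rmin_pos; lra).
pose proof (Rmin_l (y - Y s Cr tp) (Y s Cr tm - y)). pose proof (Rmin_r (y - Y s Cr tp) (Y s Cr tm - y)). fold e0 in H, H0.
destruct (Hunif s (tau s + e') e0 He0) as [del [Hdel Hu]]. exists del. split; auto. intros s' Hs'.
specialize (Hu s' Hs' Cr).
assert (A : tau s' <= tp).
{ apply Rnot_lt_le. intros Hc. specialize (Hgt s' tp ltac:(lra)). specialize (Hu tp ltac:(lra)). apply Rabs_def2 in Hu. lra. }
assert (B : tau s - e' <= tau s').
{ apply Rnot_lt_le. intros Hc. specialize (Htau s'). specialize (Hu (tau s') ltac:(lra)). apply Rabs_def2 in Hu. rewrite Heq in Hu.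
  specialize (Hmin (tau s') ltac:(lra)). lra. }
apply Rabs_def1; lra.
Qed.

Lemma value_at_time_continuous i (tau : R -> R) : (forall s, 0 <= tau s) -> (forall s, continuous tau s) -> forall s, continuous (fun s : R => Y s i (tau s)) s.
Proof.
intros Hp Hc s. apply continuous_eps. intros e He.
destruct (proj1 (continuous_eps _ _) (Hcont s i (tau s) (Hp s)) (e / 2) ltac:(lra)) as [d1 [Hd1 H1]].
destruct (proj1 (continuous_eps _ _) (Hc s) (Rmin d1 1)) as [d2 [Hd2 H2]]; [apply Rmin_pos; lra|].
destruct (Hunif s (tau s + 1) (e / 2) ltac:(lra)) as [d3 [Hd3 H3]].
exists (Rmin d2 d3). split; [apply Rmin_pos; auto|]. intros s' Hs'.
pose proof (Rmin_l d2 d3). pose proof (Rmin_r d2 d3). pose proof (Rmin_l d1 1). pose proof (Rmin_r d1 1).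
specialize (H2 s' ltac:(lra)). specialize (H1 (tau s') ltac:(lra)). apply Rabs_def2 in H2.
assert (Hr : 0 <= tau s' <= tau s + 1) by (split; [apply Hp|lra]). specialize (H3 s' ltac:(lra) i (tau s') Hr).
replace (Y s' i (tau s') - Y s i (tau s)) with ((Y s' i (tau s') - Y s i (tau s')) + (Y s i (tau s') - Y s i (tau s))) by ring.
eapply Rle_lt_trans; [apply Rabs_triang|]. lra.
Qed.
End Family.

Lemma flow_family_uniform F k (Y : R -> coord -> R -> R) (y0 : R -> coord -> R) : 1 <= k -> lip_field F k ->
  (forall s, flow_of F (Y s)) -> (forall s i, Y s i 0 = y0 s i) -> (forall i s, continuous (fun s : R => y0 s i) s) ->
  forall s T e, 0 < e -> exists del, 0 < del /\ forall s', Rabs (s' - s) < del -> forall i t, 0 <= t <= T -> Rabs (Y s' i t - Y s i t) < e.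
Proof.
intros Hk HF Hfl H0 Hc s T e He.
set (B := exp (8 * k * T)). assert (HB : 0 < B) by apply exp_pos.
assert (HsB : 0 < sqrt B) by (apply sqrt_lt_R0; auto).
set (c := e / (3 * sqrt B)). assert (Hcp : 0 < c) by (apply Rdiv_lt_0_compat; lra).
assert (Hi : forall i, exists del, 0 < del /\ forall s', Rabs (s' - s) < del -> Rabs (y0 s' i - y0 s i) < c).
{ intros i. apply (proj1 (continuous_eps _ _) (Hc i s)). auto. }
destruct (Hi Cr) as [a1 [A1 B1]]. destruct (Hi Cth) as [a2 [A2 B2]]. destruct (Hi Cw) as [a3 [A3 B3]]. destruct (Hi CL) as [a4 [A4 B4]].
exists (Rmin (Rmin a1 a2) (Rmin a3 a4)). split; [repeat apply Rmin_pos; auto|]. intros s' Hs' i t Ht.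
pose proof (Rmin_l (Rmin a1 a2) (Rmin a3 a4)). pose proof (Rmin_r (Rmin a1 a2) (Rmin a3 a4)).
pose proof (Rmin_l a1 a2). pose proof (Rmin_r a1 a2). pose proof (Rmin_l a3 a4). pose proof (Rmin_r a3 a4).
specialize (B1 s' ltac:(lra)). specialize (B2 s' ltac:(lra)). specialize (B3 s' ltac:(lra)). specialize (B4 s' ltac:(lra)).
assert (G := flow_gronwall F k (Y s') (Y s) 0 t ltac:(lra) HF ltac:(lra) (fun i t Ht => Hfl s' i t (proj1 Ht)) (fun i t Ht => Hfl s i t (proj1 Ht))).
assert (D0 : dist2 (fun i => Y s' i 0) (fun i => Y s i 0) <= 4 * c ^ 2).
{ unfold dist2. rewrite !H0.
  assert (Sq : forall x, Rabs x < c -> x ^ 2 <= c ^ 2) by (intros x Hx; rewrite <- pow2_abs; apply pow_incr; split; [apply Rabs_pos|lra]).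
  apply Sq in B1. apply Sq in B2. apply Sq in B3. apply Sq in B4. lra. }
assert (Ex : exp (8 * k * (t - 0)) <= B).
{ unfold B. destruct (Rle_lt_or_eq_dec (8 * k * (t - 0)) (8 * k * T)) as [X|X]; [apply Rmult_le_compat_l; lra|left; apply exp_increasing; auto|rewrite X; lra]. }
assert (G2 := dist2_ge (fun i => Y s' i t) (fun i => Y s i t) i). cbv beta in G2.
assert (D1 : (Y s' i t - Y s i t) ^ 2 <= 4 * c ^ 2 * B).
{ eapply Rle_trans; [exact G2|]. eapply Rle_trans; [exact G|]. apply Rmult_le_compat; auto; [|left; apply exp_pos].
  unfold dist2. pose proof (pow2_ge_0 (Y s' Cr 0 - Y s Cr 0)). pose proof (pow2_ge_0 (Y s' Cth 0 - Y s Cth 0)).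
  pose proof (pow2_ge_0 (Y s' Cw 0 - Y s Cw 0)). pose proof (pow2_ge_0 (Y s' CL 0 - Y s CL 0)). lra. }
apply Rle_lt_trans with (2 * c * sqrt B).
- apply abs_le_of_sq; [apply Rmult_le_pos; lra|]. replace ((2 * c * sqrt B) ^ 2) with (4 * c ^ 2 * (sqrt B * sqrt B)) by ring. rewrite sqrt_sqrt by lra. auto.
- unfold c. replace (2 * (e / (3 * sqrt B)) * sqrt B) with (2 * e / 3) by (field; lra). lra.
Qed.

Lemma period_Z (k : Z) x : cos (x - 2 * PI * IZR k) = cos x /\ sin (x - 2 * PI * IZR k) = sin x.
Proof.
assert (P : forall n y, cos (y + 2 * INR n * PI) = cos y /\ sin (y + 2 * INR n * PI) = sin y) by (intros; split; [apply cos_period|apply sin_period]).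
destruct (Z.le_gt_cases 0 k) as [H|H].
- destruct (P (Z.to_nat k) (x - 2 * PI * IZR k)) as [A B]. rewrite INR_IZR_INZ, Z2Nat.id in A, B by lia.
  replace (x - 2 * PI * IZR k + 2 * IZR k * PI) with x in A, B by ring. auto.
- destruct (P (Z.to_nat (- k)) x) as [A B]. rewrite INR_IZR_INZ, Z2Nat.id in A, B by lia. rewrite opp_IZR in A, B.
  replace (x + 2 * - IZR k * PI) with (x - 2 * PI * IZR k) in A, B by ring. auto.
Qed.

(* The orbit passes r = 2, r = 1 and r = d^2 inwards at the times t3, tR and tD; al^4 is the semi-major axis of the excursion. *)
Definition trip_spec (d N mu : R) (y : coord -> R -> R) (t3 tR tD al : R) : Prop :=
  let q := d ^ 5 in let u := N * q in let d1 := mu / (20 * u) in let Rm := 8 / q in let M := 2200 * u in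
  let r := y Cr in let th := y Cth in let w := y Cw in let L := y CL in
  let F i t := trunc_field d Rm d1 mu (fun j => y j t) i in
  5 < t3 /\ t3 < tR /\ tR < tD /\ tD - t3 <= 4 /\ 100 * N <= al /\
  Rabs (- / (2 * al ^ 4) - L 0) <= q / 50 /\ Rabs (L t3 - L 0) <= q / 100 /\
  Rabs (th tR + 2 * PI * al ^ 6) <= 5 * al ^ 5 + 30 /\
  r t3 = 2 /\ r tR = 1 /\ r tD = d ^ 2 /\
  (forall t, 5 <= t < tR -> 1 < r t) /\ (forall t, 5 <= t < tD -> d ^ 2 < r t) /\
  (forall t, 0 <= t <= t3 -> d ^ 2 <= r t <= Rm /\ Rabs (L t) <= 1 / 2 /\ d1 ^ 2 <= Dq (r t) (th t)) /\
  (forall t, t3 <= t <= tD -> d ^ 2 <= r t <= 2 /\ w t < - (1 / 2) /\ Rabs (L t) <= 2 * M /\ Rabs (En (r t) (w t) (L t)) <= 2 * M /\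
    F Cth t = L t / (r t) ^ 2 - 1 /\ F CL t = mu * (r t * sin (th t) - r t * sin (th t) * / sqrt (Rmax (Dq (r t) (th t)) (d1 ^ 2)) ^ 3)) /\
  (forall s t, t3 <= s -> s <= t -> t <= tD -> (t - s) / 2 <= r s - r t /\ Rabs ((r t) ^ 2 - (r s) ^ 2) <= 41 / 10 * (t - s)).

(** An energy gap q / 5 at energies of size at most N q changes the semi-major axis by a relative
    amount of at least 1 / (5 N), hence also al^6. As al >= 100 N, the change of al^6 is at least 20
    al^5, which beats the phase errors 5 al^5 + 30 of both orbits and leaves 9, more than a full
    turn. *)
Lemma phase_gap N q a1 a2 : 3 <= N -> 0 < q -> 100 * N <= a1 -> 100 * N <= a2 -> / (2 * a2 ^ 4) <= N * q -> / (2 * a1 ^ 4) + q / 5 <= / (2 * a2 ^ 4) ->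
  2 * PI * a2 ^ 6 + (5 * a1 ^ 5 + 30) + (5 * a2 ^ 5 + 30) + 9 <= 2 * PI * a1 ^ 6.
Proof.
intros HN Hq H1 H2 HX HD.
assert (P1 : 0 < a1 ^ 4) by (apply pow_lt; lra). assert (P2 : 0 < a2 ^ 4) by (apply pow_lt; lra).
assert (Hr : 5 * N * (a1 ^ 4 - a2 ^ 4) >= a1 ^ 4).
{ apply (Rmult_le_compat_r (2 * a1 ^ 4 * a2 ^ 4)) in HD; [|apply Rmult_le_pos; lra].
  replace ((/ (2 * a1 ^ 4) + q / 5) * (2 * a1 ^ 4 * a2 ^ 4)) with (a2 ^ 4 + q / 5 * (2 * a1 ^ 4 * a2 ^ 4)) in HD by (field; lra).
  replace (/ (2 * a2 ^ 4) * (2 * a1 ^ 4 * a2 ^ 4)) with (a1 ^ 4) in HD by (field; lra).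
  apply (Rmult_le_compat_r (2 * a2 ^ 4)) in HX; [|lra]. rewrite Rinv_l in HX by lra.
  assert (a1 ^ 4 * 1 <= a1 ^ 4 * (N * q * (2 * a2 ^ 4))) by (apply Rmult_le_compat_l; lra).
  assert (N * (q / 5 * (2 * a1 ^ 4 * a2 ^ 4)) <= N * (a1 ^ 4 - a2 ^ 4)) by (apply Rmult_le_compat_l; lra). lra. }
assert (Lt : a2 <= a1).
{ apply Rnot_lt_le. intros Hc. assert (a1 ^ 4 <= a2 ^ 4) by (apply pow_incr; lra).
  assert (5 * N * (a1 ^ 4 - a2 ^ 4) <= 5 * N * 0) by (apply Rmult_le_compat_l; lra). lra. }
assert (A2 : 0 < a1 ^ 2) by (apply pow_lt; lra).
assert (G : 5 * N * (a1 ^ 6 - a2 ^ 6) >= a1 ^ 6).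
{ assert (a2 ^ 6 <= a1 ^ 2 * a2 ^ 4).
  { replace (a2 ^ 6) with (a2 ^ 2 * a2 ^ 4) by ring. apply Rmult_le_compat_r; [lra|]. apply pow_incr; lra. }
  assert (a1 ^ 2 * a1 ^ 4 <= a1 ^ 2 * (5 * N * (a1 ^ 4 - a2 ^ 4))) by (apply Rmult_le_compat_l; lra).
  assert (5 * N * (a1 ^ 6 - a1 ^ 2 * a2 ^ 4) <= 5 * N * (a1 ^ 6 - a2 ^ 6)) by (apply Rmult_le_compat_l; lra).
  replace (a1 ^ 6) with (a1 ^ 2 * a1 ^ 4) at 2 by ring.
  replace (a1 ^ 2 * (5 * N * (a1 ^ 4 - a2 ^ 4))) with (5 * N * (a1 ^ 6 - a1 ^ 2 * a2 ^ 4)) in H0 by ring. lra. }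
assert (G5 : 20 * a1 ^ 5 <= a1 ^ 6 - a2 ^ 6).
{ apply Rmult_le_reg_l with (5 * N); [lra|]. apply Rle_trans with (a1 ^ 6); [|lra].
  replace (a1 ^ 6) with (a1 * a1 ^ 5) by ring. replace (5 * N * (20 * a1 ^ 5)) with (100 * N * a1 ^ 5) by ring.
  apply Rmult_le_compat_r; [apply pow_le; lra|auto]. }
assert (a2 ^ 5 <= a1 ^ 5) by (apply pow_incr; lra).
assert (100 ^ 5 <= a1 ^ 5) by (apply pow_incr; lra). pose proof PI2_1.
assert (2 * 2 * (a1 ^ 6 - a2 ^ 6) <= 2 * PI * (a1 ^ 6 - a2 ^ 6)) by (apply Rmult_le_compat_r; lra). lra.
Qed.

Section Connection.
Variables (d N mu s1 s2 : R) (S0 W0 L0 G : R -> R).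
Let q := d ^ 5. Let u := N * q. Let eps := 300 * mu / d ^ 8. Let d1 := mu / (20 * u). Let Rm := 8 / q. Let M := 2200 * u.
Hypotheses (Hd : 0 < d) (HN : 3 <= N) (HNd : 10000000 * (N * d) <= 1) (Hmu : 0 < mu) (Heps : eps <= q ^ 7 / 1000000000).
Hypotheses (CS : forall s, continuous S0 s) (CW : forall s, continuous W0 s) (CLc : forall s, continuous L0 s) (CG : forall s, continuous G s).
Hypothesis Hdata : forall s, 0 < W0 s /\ Rabs (S0 s - sqrt 2 / 3 * (1 - d ^ 3)) <= d ^ 4 /\ - (N - 1) * q <= L0 s <= - (3 / 10) * q /\
  Rabs (En (d ^ 2) (W0 s) (L0 s) - L0 s) <= q / 100 /\ d ^ 4 / 2 <= Rabs (S0 s - sqrt 2 / 3 * (1 - d ^ 3) + sqrt 2 * L0 s / d).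
Hypotheses (Hs12 : s1 <= s2) (Hgap : L0 s2 <= L0 s1 - q / 4) (HG : forall x, Rabs (G x) <= q / 100).

Lemma collision_connection : exists s y tD, 0 < tD /\ flow_of (trunc_field d Rm d1 mu) y /\
  y Cr 0 = d ^ 2 /\ y Cth 0 = S0 s /\ y Cw 0 = W0 s /\ y CL 0 = L0 s /\
  (forall t, 0 <= t <= tD -> d ^ 2 <= y Cr t <= Rm /\ Rabs (y CL t) <= 1 / 2 /\ d1 ^ 2 <= Dq (y Cr t) (y Cth t)) /\
  y Cr tD = d ^ 2 /\ y Cw tD < 0 /\ y CL tD = G (y Cth tD).
Proof.
destruct (small_scales d N Hd HN HNd) as [Q0 [Hd3 [Hu4 [Hd4 _]]]]. fold q in Q0, Hu4. fold u in Hu4.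

assert (Hqu : 3 * q <= u) by (apply Rmult_le_compat_r; lra).

assert (Hmu1 : 300 * mu <= eps).
{ assert (H8 : 0 < d ^ 8 <= 1) by (split; [apply pow_lt; auto|replace 1 with (1 ^ 8) by ring; apply pow_incr; lra]).
  assert (1 <= / d ^ 8) by (rewrite <- Rinv_1; apply Rinv_le_contravar; lra).
  unfold eps, Rdiv. rewrite <- (Rmult_1_r (300 * mu)) at 1. apply Rmult_le_compat_l; lra. }
assert (Hmu2 : mu <= q ^ 3 / 1000000000).
{ assert (0 <= q ^ 3) by (apply pow_le; lra). assert (q ^ 4 <= 1) by (replace 1 with (1 ^ 4) by ring; apply pow_incr; lra).
  assert (q ^ 7 <= q ^ 3) by (replace (q ^ 7) with (q ^ 3 * q ^ 4) by ring; apply mult_le_left; auto). lra. }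
assert (Q2 : q ^ 2 <= / 1000000) by (assert (q ^ 2 <= (/ 10000000) ^ 2) by (apply pow_incr; lra); lra).
assert (Hmu3 : mu <= q / 1000000000) by (replace (q ^ 3) with (q * q ^ 2) in Hmu2 by ring; assert (q * q ^ 2 <= q) by (apply mult_le_left; lra); lra).
assert (Hd1 : 0 < d1 <= u / 100).
{ unfold d1. split; [apply Rdiv_lt_0_compat; lra|]. apply Rle_div_l; [lra|].
  assert (q * q <= u * u) by (apply Rmult_le_compat; lra). replace (q ^ 3) with (q * q * q) in Hmu2 by ring.
  assert (q * q * q <= q * q) by (apply mult_le_left; [apply Rmult_le_pos; lra|lra]). lra. }
assert (Hd2 : 0 < d ^ 2 <= 1) by (split; [apply pow_lt; auto|replace 1 with (1 ^ 2) by ring; apply pow_incr; lra]).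
assert (HRm : d ^ 2 <= Rm) by (apply Rle_trans with 8; [lra|]; unfold Rm; apply (proj1 (Rle_div_r 8 8 q ltac:(lra))); lra).
destruct (trunc_lip d Rm d1 mu Hd HRm ltac:(lra)) as [k [Hk Hlip]].
destruct (choice_fun _ _ (fun s y => (forall i, y i 0 = vec (d ^ 2) (S0 s) (W0 s) (L0 s) i) /\ flow_of (trunc_field d Rm d1 mu) y))
  as [Y HY]; [intros s; apply (flow_exists _ k); auto|].
destruct (choice_fun _ _ (fun s (p : (R * R) * (R * R)) => trip_spec d N mu (Y s) (fst (fst p)) (snd (fst p)) (fst (snd p)) (snd (snd p)))) as [p Hp].
{ intros s. destruct (HY s) as [Y0 Yf]. destruct (Hdata s) as [D1 [D2 [D3 [D4 D5]]]].
  assert (E1 := Y0 Cr). assert (E2 := Y0 Cth). assert (E3 := Y0 Cw). assert (E4 := Y0 CL). simpl in E1, E2, E3, E4.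
  destruct (trip d N mu (Y s) Hd HN HNd Hmu Heps Yf) as [t3 [tR [tD [al H]]]]; rewrite ?E1, ?E2, ?E3, ?E4; auto.
  exists ((t3, tR), (tD, al)). exact H. }
set (t3 := fun s => fst (fst (p s))). set (tR := fun s => snd (fst (p s))). set (tD := fun s => fst (snd (p s))). set (al := fun s => snd (snd (p s))).
assert (Hp' : forall s, trip_spec d N mu (Y s) (t3 s) (tR s) (tD s) (al s)) by exact Hp. clearbody t3 tR tD al. clear Hp p.
assert (Hunif : forall s T e, 0 < e -> exists del, 0 < del /\ forall s', Rabs (s' - s) < del -> forall i t, 0 <= t <= T -> Rabs (Y s' i t - Y s i t) < e).
{ apply (flow_family_uniform (trunc_field d Rm d1 mu) k Y (fun s => vec (d ^ 2) (S0 s) (W0 s) (L0 s))); auto.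
  - intros s. apply HY.
  - intros s. apply HY.
  - intros i s. destruct i; simpl; auto. apply continuous_const. }
assert (Hder : forall s i t, 0 <= t -> is_derive (Y s i) t (trunc_field d Rm d1 mu (fun j => Y s j t) i)) by (intros s i t Ht; apply HY; auto).
assert (Hcont : forall s i t, 0 <= t -> continuous (Y s i) t) by (intros s i t Ht; exact (is_derive_continuous _ _ _ (Hder s i t Ht))).
assert (CtR : forall s, continuous tR s).
{ apply (hitting_time_continuous Y Hunif Hcont 1 5); try lra.
  - intros s. destruct (Hp' s) as [? [? _]]. lra.
  - intros s. destruct (Hp' s) as [_ [_ [_ [_ [_ [_ [_ [_ [_ [_ [_ [A _]]]]]]]]]]]]. exact A.
  - intros s. destruct (Hp' s) as [_ [_ [_ [_ [_ [_ [_ [_ [_ [A _]]]]]]]]]]. exact A.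
  - intros s. destruct (Hp' s) as [T1 [T2 [T3 [_ [_ [_ [_ [_ [_ [_ [_ [_ [_ [_ [A _]]]]]]]]]]]]]]].
    destruct (A (tR s) ltac:(lra)) as [_ [B _]]. exists (Y s Cw (tR s)). split; [lra|]. exact (Hder s Cr (tR s) ltac:(lra)). }
assert (CtD : forall s, continuous tD s).
{ apply (hitting_time_continuous Y Hunif Hcont (d ^ 2) 5); try lra.
  - intros s. destruct (Hp' s) as [? [? [? _]]]. lra.
  - intros s. destruct (Hp' s) as [_ [_ [_ [_ [_ [_ [_ [_ [_ [_ [_ [_ [A _]]]]]]]]]]]]]. exact A.
  - intros s. destruct (Hp' s) as [_ [_ [_ [_ [_ [_ [_ [_ [_ [_ [A _]]]]]]]]]]]. exact A.
  - intros s. destruct (Hp' s) as [T1 [T2 [T3 [_ [_ [_ [_ [_ [_ [_ [_ [_ [_ [_ [A _]]]]]]]]]]]]]]].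
    destruct (A (tD s) ltac:(lra)) as [_ [B _]]. exists (Y s Cw (tD s)). split; [lra|]. exact (Hder s Cr (tD s) ltac:(lra)). }
assert (Pt : forall s, 0 <= tR s /\ 0 <= tD s) by (intros s; destruct (Hp' s) as [? [? [? _]]]; lra).
set (thR := fun s : R => Y s Cth (tR s)).
assert (CthR : forall s, continuous thR s) by (apply (value_at_time_continuous Y Hunif Hcont Cth tR); auto; intros; apply Pt).
set (H := fun s : R => Y s CL (tD s) - G (Y s Cth (tD s))).
assert (CH : forall s, continuous H s).
{ intros s. apply (continuous_minus (V := R_NormedModule)).
  - apply (value_at_time_continuous Y Hunif Hcont CL tD); auto; intros; apply Pt.
  - apply (continuous_comp (fun s : R => Y s Cth (tD s)) G); auto. apply (value_at_time_continuous Y Hunif Hcont Cth tD); auto; intros; apply Pt. }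
assert (EL : forall s, Y s CL 0 = L0 s) by (intros s; destruct (HY s) as [Y0 _]; exact (Y0 CL)).
assert (Sweep : thR s1 + 9 <= thR s2).
{ destruct (Hp' s1) as [_ [_ [_ [_ [A1 [A2 [_ [A3 _]]]]]]]]. destruct (Hp' s2) as [_ [_ [_ [_ [B1 [B2 [_ [B3 _]]]]]]]].
  fold q in A2, B2. rewrite EL in A2, B2. fold (thR s1) in A3. fold (thR s2) in B3.
  apply Rabs_le_between in A2. apply Rabs_le_between in A3. apply Rabs_le_between in B2. apply Rabs_le_between in B3.
  destruct (Hdata s2) as [_ [_ [D _]]].
  pose proof (phase_gap N q (al s1) (al s2) HN Q0 A1 B1 ltac:(lra) ltac:(lra)). lra. }
(* A lift of Jupiter's angle at most 2 pi <= 8 beyond the phase at s1 plus 1/4. The sweep of 9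
   therefore covers the entire window below it. *)
set (kk := up ((thR s1 + 1 / 4) / (2 * PI))). set (Kp := 2 * PI * IZR kk).
assert (HKp : thR s1 + 1 / 4 < Kp <= thR s1 + 1 / 4 + 8).
{ pose proof PI2_1. pose proof PI_4. destruct (archimed ((thR s1 + 1 / 4) / (2 * PI))) as [A B]. fold kk in A, B.

  assert (A' : (thR s1 + 1 / 4) / (2 * PI) * (2 * PI) < IZR kk * (2 * PI)) by (apply Rmult_lt_compat_r; lra).
  assert (B' : (IZR kk - (thR s1 + 1 / 4) / (2 * PI)) * (2 * PI) <= 1 * (2 * PI)) by (apply Rmult_le_compat_r; lra).
  replace ((thR s1 + 1 / 4) / (2 * PI) * (2 * PI)) with (thR s1 + 1 / 4) in A' by (field; lra).
  replace ((IZR kk - (thR s1 + 1 / 4) / (2 * PI)) * (2 * PI)) with (IZR kk * (2 * PI) - (thR s1 + 1 / 4)) in B' by (field; lra).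
  unfold Kp. lra. }
assert (HK : forall x, cos (x - Kp) = cos x /\ sin (x - Kp) = sin x) by (intros x; apply period_Z).
set (b := 8 * d1). set (ka := 22000 * u).
assert (Hb : 0 < b <= 1 / 4) by (unfold b; lra).
destruct (ivt_window thR s1 s2 (Kp - 1 / 4) (Kp - b) Hs12 (fun x _ => CthR x) ltac:(lra) ltac:(lra) ltac:(lra)) as [su [sv [W1 [W2 [W3 [W4 [W5 W6]]]]]]].
assert (HM : 0 < M <= d ^ 4 / 1000) by (unfold M; lra).
assert (Sder : forall s t, t3 s <= t <= tD s -> is_derive (Y s Cr) t (Y s Cw t) /\
   is_derive (Y s Cth) t (trunc_field d Rm d1 mu (fun j => Y s j t) Cth) /\ is_derive (Y s CL) t (trunc_field d Rm d1 mu (fun j => Y s j t) CL)).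
{ intros s t Ht. destruct (Hp' s) as [T1 _]. exact (conj (Hder s Cr t ltac:(lra)) (conj (Hder s Cth t ltac:(lra)) (Hder s CL t ltac:(lra)))). }
(* A passage at angle 1/4 changes L by at most 5000 mu, negligible against the initial value, which
   is below -3 q / 10. *)
assert (Hneg : H su <= 0).
{ destruct (Hp' su) as [T1 [T2 [T3 [T4 [T5 [T6 [T7 [T8 [T9 [T10 [T11 [T12 [T13 [T14 [T15 T16]]]]]]]]]]]]]]].
  assert (A := scatter_far d M mu d1 Kp (t3 su) (tR su) (tD su) (Y su Cr) (Y su Cth) (Y su Cw) (Y su CL) _ _ ltac:(lra) HM Hmu HK ltac:(lra) T4
    (Sder su) T15 T16 T10 ltac:(lra) W4).
  fold q in T7. rewrite EL in T7. destruct (Hdata su) as [_ [_ [D _]]]. specialize (HG (Y su Cth (tD su))).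
  apply Rabs_le_between in A. apply Rabs_le_between in T7. apply Rabs_le_between in HG. unfold H. lra. }
assert (Hpos : 0 <= H sv).
{ destruct (Hp' sv) as [T1 [T2 [T3 [T4 [T5 [T6 [T7 [T8 [T9 [T10 [T11 [T12 [T13 [T14 [T15 T16]]]]]]]]]]]]]]].
  assert (A := scatter_near d M mu d1 Kp (t3 sv) (tR sv) (tD sv) (Y sv Cr) (Y sv Cth) (Y sv Cw) (Y sv CL) _ _ ltac:(lra) HM Hmu ltac:(lra) HK ltac:(lra) T4
    (Sder sv) T15 T16 T9 T10 T11 ka b ltac:(unfold ka, M; lra) ltac:(unfold ka, b; lra) eq_refl W5).
  fold q in T7. rewrite EL in T7. destruct (Hdata sv) as [_ [_ [D _]]]. specialize (HG (Y sv Cth (tD sv))).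
  apply Rabs_le_between in T7. apply Rabs_le_between in HG.
  assert (B1 : mu * (9 / (10 * b)) = 9 / 4 * u) by (unfold b, d1; field; lra).
  assert (B2 : mu * (16 / ka ^ 2) <= q).
  { apply Rle_trans with (mu * (1 / u ^ 2)).
    - apply Rmult_le_compat_l; [lra|]. assert (0 < u ^ 2) by (apply pow_lt; lra). unfold ka.
      replace (16 / (22000 * u) ^ 2) with (16 / 22000 ^ 2 * (1 / u ^ 2)) by (field; lra).
      assert (0 <= 1 / u ^ 2) by (apply Rdiv_le_0_compat; lra). lra.
    - replace (mu * (1 / u ^ 2)) with (mu / u ^ 2) by (field; lra). apply Rle_div_l; [apply pow_lt; lra|].
      replace (q ^ 3) with (q * q ^ 2) in Hmu2 by ring. assert (q ^ 2 <= u ^ 2) by (apply pow_incr; lra).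
      assert (q * q ^ 2 <= q * u ^ 2) by (apply Rmult_le_compat_l; lra).
       lra. }
  replace (mu * (9 / (10 * b) - 9 - 16 / ka ^ 2)) with (mu * (9 / (10 * b)) - 9 * mu - mu * (16 / ka ^ 2)) in A by ring.
  rewrite B1 in A. unfold H. unfold u in *. lra. }
destruct (ivt_between H su sv 0 W2 (fun x _ => CH x) ltac:(left; lra)) as [s [Hs EHs]].
specialize (W6 s Hs). destruct (HY s) as [Y0 Yf].
destruct (Hp' s) as [T1 [T2 [T3 [T4 [T5 [T6 [T7 [T8 [T9 [T10 [T11 [T12 [T13 [T14 [T15 T16]]]]]]]]]]]]]]].
exists s, (Y s), (tD s). split; [lra|]. split; [exact Yf|]. split; [exact (Y0 Cr)|]. split; [exact (Y0 Cth)|]. split; [exact (Y0 Cw)|]. split; [exact (Y0 CL)|].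
split; [|split; [exact T11|split]].
- intros t Ht. destruct (Rle_dec t (t3 s)) as [Hle|Hle]; [apply T14; lra|].
  destruct (T15 t ltac:(lra)) as [B1 [_ [B2 _]]]. change (Rabs (Y s CL t) <= 2 * M) in B2.
  assert (HR8 : 8 <= Rm) by (unfold Rm; apply (proj1 (Rle_div_r 8 8 q ltac:(lra))); lra).
  split; [lra|]. split; [unfold M in B2; lra|].
  (* Here the offset is Kp minus the phase of the orbit found, which the window keeps between 8 d1
     and 1/4. *)
  assert (A := scatter_distance d M mu d1 Kp (t3 s) (tR s) (tD s) (Y s Cr) (Y s Cth) (Y s Cw) (Y s CL) _ _ ltac:(lra) HM HK ltac:(lra)
    (Sder s) T15 T16 T10 (Kp - thR s) t ltac:(lra) ltac:(unfold thR; ring) ltac:(lra)).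
  eapply Rle_trans; [|exact A]. apply pow_incr. unfold b in W6. lra.
- destruct (T15 (tD s) ltac:(lra)) as [_ [B _]]. lra.
- unfold H in EHs. lra.
Qed.
End Connection.

(** * Uniqueness of orbits and exclusion of a Jupiter collision *)

Lemma polar_in_trunc d Rm d1 mu r th w L t : polar_at mu r th w L t -> d ^ 2 / 2 <= r t <= Rm -> -1 <= L t <= 1 -> d1 ^ 2 <= Dq (r t) (th t) ->
  forall i, is_derive (fun s : R => vec (r s) (th s) (w s) (L s) i) t (trunc_field d Rm d1 mu (fun j => vec (r t) (th t) (w t) (L t) j) i).
Proof.
intros [P1 [P2 [P3 [P4 [P5 P6]]]]] Hr HL HD i.
destruct (trunc_exact d Rm d1 mu (r t) (th t) (w t) (L t) Hr HL HD P1) as [T1 [T2 [T3 T4]]].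
change (fun j => vec (r t) (th t) (w t) (L t) j) with (vec (r t) (th t) (w t) (L t)).
destruct i; [rewrite T1|rewrite T2|rewrite T3|rewrite T4]; auto.
Qed.

Lemma trunc_flow_polar d Rm d1 mu y t : flow_of (trunc_field d Rm d1 mu) y -> 0 < d -> 0 < d1 -> 0 <= t ->
  d ^ 2 <= y Cr t <= Rm -> Rabs (y CL t) <= 1 -> d1 ^ 2 <= Dq (y Cr t) (y Cth t) -> polar_at mu (y Cr) (y Cth) (y Cw) (y CL) t.
Proof.
intros Hf Hd Hd1 Ht Hr HL HD. assert (Hd2 : 0 < d ^ 2) by (apply pow_lt; auto). assert (0 < d1 ^ 2) by (apply pow_lt; auto).
apply Rabs_le_between in HL.
destruct (trunc_exact d Rm d1 mu (y Cr t) (y Cth t) (y Cw t) (y CL t) ltac:(lra) ltac:(lra) HD ltac:(lra)) as [T1 [T2 [T3 T4]]].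
split; [lra|]. split; [lra|]. rewrite <- T2, <- T3, <- T4.
exact (conj (Hf Cr t Ht) (conj (Hf Cth t Ht) (conj (Hf Cw t Ht) (Hf CL t Ht)))).
Qed.

Definition agree (r th w L r' th' w' L' : R -> R) (t : R) : Prop := r t = r' t /\ th t = th' t /\ w t = w' t /\ L t = L' t.

Lemma polar_continuous mu r th w L t : polar_at mu r th w L t ->
  continuous r t /\ continuous th t /\ continuous w t /\ continuous L t /\ continuous (fun s : R => Dq (r s) (th s)) t.
Proof.
intros [_ [_ [D1 [D2 [D3 D4]]]]].
assert (C1 := is_derive_continuous _ _ _ D1). assert (C2 := is_derive_continuous _ _ _ D2).
split; [exact C1|]. split; [exact C2|]. split; [exact (is_derive_continuous _ _ _ D3)|]. split; [exact (is_derive_continuous _ _ _ D4)|].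

apply (ex_derive_continuous (fun s : R => Dq (r s) (th s))). unfold Dq. auto_derive. repeat split; eexists; eauto.
Qed.

Lemma eq_at_left_limit (f g : R -> R) a t : a < t -> continuous f t -> continuous g t -> (forall s, a <= s < t -> f s = g s) -> f t = g t.
Proof.
intros Hat Cf Cg H.
assert (Z : forall f g : R -> R, continuous f t -> continuous g t -> (forall s, a <= s < t -> f s = g s) -> 0 <= f t - g t).
{ intros f0 g0 C1 C2 E. apply (left_limit_ge (fun s => f0 s - g0 s) a t 0 Hat); [apply (continuous_minus (V := R_NormedModule)); auto|].
  intros s Hs. rewrite (E s Hs). lra. }
pose proof (Z f g Cf Cg H). pose proof (Z g f Cg Cf (fun s Hs => eq_sym (H s Hs))). lra.
Qed.

(** The polar field is not globally Lipschitz. Near each time, however, both orbits solve a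
    truncated field whose cut-offs are adapted to the current point: half of the current r, twice
    it, and half of the current distance to Jupiter. Gronwall's lemma gives local uniqueness, and
    continuous induction does the rest. *)
Lemma polar_unique mu r th w L r' th' w' L' b :
  (forall t, 0 <= t < b -> polar_at mu r th w L t) -> (forall t, 0 <= t < b -> polar_at mu r' th' w' L' t) ->
  (forall t, 0 <= t < b -> Rabs (L t) < 1) -> agree r th w L r' th' w' L' 0 ->
  forall t, 0 <= t < b -> agree r th w L r' th' w' L' t.
Proof.
intros H H' HL H0. apply real_induction.
- intros t Ht IH. destruct (Req_dec t 0) as [->|Hn]; [auto|].
  destruct (polar_continuous _ _ _ _ _ _ (H t Ht)) as [C1 [C2 [C3 [C4 _]]]].
  destruct (polar_continuous _ _ _ _ _ _ (H' t Ht)) as [C1' [C2' [C3' [C4' _]]]].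
  split; [|split; [|split]]; apply (eq_at_left_limit _ _ 0 t); auto; try lra; intros s Hs; apply IH; auto.
- intros t Ht IH. destruct (IH t ltac:(lra)) as [E1 [E2 [E3 E4]]].
  destruct (polar_continuous _ _ _ _ _ _ (H t Ht)) as [C1 [C2 [C3 [C4 C5]]]].
  destruct (polar_continuous _ _ _ _ _ _ (H' t Ht)) as [C1' [C2' [C3' [C4' C5']]]].
  destruct (H t Ht) as [P1 [P2 _]]. specialize (HL t Ht).
  set (d := sqrt (r t)). set (d1 := sqrt (Dq (r t) (th t)) / 2).
  assert (Hd : 0 < d) by (apply sqrt_lt_R0; auto). assert (Hd1 : 0 < d1) by (apply Rdiv_lt_0_compat; [apply sqrt_lt_R0; auto|lra]).
  assert (Ed : d ^ 2 = r t) by (apply pow2_sqrt; lra).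
  assert (Ed1 : d1 ^ 2 = Dq (r t) (th t) / 4) by (unfold d1; replace ((sqrt (Dq (r t) (th t)) / 2) ^ 2) with (sqrt (Dq (r t) (th t)) ^ 2 / 4) by field; rewrite pow2_sqrt by lra; auto).
  destruct (trunc_lip d (2 * r t) d1 mu Hd ltac:(lra) Hd1) as [k [Hk Hlip]].
  assert (Loc : forall r th L, continuous r t -> continuous L t -> continuous (fun s : R => Dq (r s) (th s)) t ->
     0 < r t -> 0 < Dq (r t) (th t) -> Rabs (L t) < 1 ->
     locally t (fun s => (r t / 2 < r s /\ r s < 2 * r t) /\ (Rabs (L s) < 1 /\ Dq (r t) (th t) / 4 < Dq (r s) (th s)))).
  { intros ra tha La K1 K2 K3 K4 K5 K6. apply filter_and; apply filter_and.
    - apply locally_gt; auto; lra.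
    - apply locally_lt; auto; lra.
    - apply (locally_lt (fun s => Rabs (La s))); auto. apply (continuous_comp La Rabs); auto. apply continuous_Rabs.
    - apply (locally_gt (fun s => Dq (ra s) (tha s))); auto; lra. }
  destruct (Loc r th L C1 C4 C5 P1 P2 HL) as [e1 He1].
  destruct (Loc r' th' L' C1' C4' C5' ltac:(lra) ltac:(rewrite <- E1, <- E2; lra) ltac:(rewrite <- E4; lra)) as [e2 He2].
  rewrite <- E1, <- E2 in He2.
  exists (Rmin e1 e2). split; [apply Rmin_pos; apply cond_pos|]. intros s Hs Hsb.
  pose proof (Rmin_l e1 e2). pose proof (Rmin_r e1 e2).
  assert (G := flow_gronwall (trunc_field d (2 * r t) d1 mu) k (fun i s => vec (r s) (th s) (w s) (L s) i) (fun i s => vec (r' s) (th' s) (w' s) (L' s) i)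
    t s ltac:(lra) Hlip ltac:(lra)).
  assert (Z : dist2 (fun i => vec (r s) (th s) (w s) (L s) i) (fun i => vec (r' s) (th' s) (w' s) (L' s) i) <= 0).
  { eapply Rle_trans; [apply G|].
    - intros i x Hx. assert (Hb : ball t e1 x) by (change (Rabs (x - t) < e1); rewrite Rabs_pos_eq; lra).
      destruct (He1 x Hb) as [[A1 A2] [A3 A4]]. apply Rabs_def2 in A3. apply polar_in_trunc; [apply H; lra|lra|lra|lra].
    - intros i x Hx. assert (Hb : ball t e2 x) by (change (Rabs (x - t) < e2); rewrite Rabs_pos_eq; lra).
      destruct (He2 x Hb) as [[A1 A2] [A3 A4]]. apply Rabs_def2 in A3. apply polar_in_trunc; [apply H'; lra|lra|lra|lra].
    - unfold dist2. simpl. rewrite E1, E2, E3, E4. lra. }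
  assert (V : forall i, vec (r s) (th s) (w s) (L s) i = vec (r' s) (th' s) (w' s) (L' s) i).
  { intros i. pose proof (dist2_ge (fun i => vec (r s) (th s) (w s) (L s) i) (fun i => vec (r' s) (th' s) (w' s) (L' s) i) i) as G2. cbv beta in G2.
    pose proof (pow2_ge_0 (vec (r s) (th s) (w s) (L s) i - vec (r' s) (th' s) (w' s) (L' s) i)).
    assert (Z2 : (vec (r s) (th s) (w s) (L s) i - vec (r' s) (th' s) (w' s) (L' s) i) ^ 2 = 0) by lra.
    replace ((vec (r s) (th s) (w s) (L s) i - vec (r' s) (th' s) (w' s) (L' s) i) ^ 2) with (Rsqr (vec (r s) (th s) (w s) (L s) i - vec (r' s) (th' s) (w' s) (L' s) i)) in Z2 by (unfold Rsqr; ring).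
    apply Rsqr_0_uniq in Z2. lra. }
  exact (conj (V Cr) (conj (V Cth) (conj (V Cw) (V CL)))).
Qed.

(** Supplies, from the Jacobi integral alone, the bound |L| < 1 under which the truncated field is
    exact along collision orbits. *)
Lemma angular_momentum_small mu r th w L eta : 0 < mu <= 1 / 100 -> -1 / 8 <= eta <= 1 / 8 -> 0 < r <= 1 / 100 -> Jac mu r th w L = eta -> Rabs L < 1.
Proof.
intros Hmu Heta Hr HJ. pose proof (Upot_small mu r th ltac:(lra) ltac:(lra)) as HU. apply Rabs_le_between in HU.
unfold Jac in HJ. assert (Hw : 0 <= w ^ 2) by apply pow2_ge_0.  assert (Hr2 : 0 < r ^ 2 <= / 10000) by (split; [apply pow_lt; lra|nra]).
assert (A : L ^ 2 <= 2 * r ^ 2 * (1 / 8 + 3 / 100) + 2 * r ^ 2 * L + 2 * r).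
{ assert (B : L ^ 2 / (2 * r ^ 2) <= 1 / 8 + 3 / 100 + L + (1 - mu) / r) by lra.
  apply (Rmult_le_compat_r (2 * r ^ 2)) in B; [|lra].
  replace (L ^ 2 / (2 * r ^ 2) * (2 * r ^ 2)) with (L ^ 2) in B by (field; lra).
  replace ((1 / 8 + 3 / 100 + L + (1 - mu) / r) * (2 * r ^ 2)) with (2 * r ^ 2 * (1 / 8 + 3 / 100) + 2 * r ^ 2 * L + 2 * ((1 - mu) * r)) in B by (field; lra).
  assert ((1 - mu) * r <= 1 * r) by (apply Rmult_le_compat_r; lra). lra. }
apply Rnot_le_lt. intros Hc.
assert (L2 : 1 <= L ^ 2 /\ Rabs L <= L ^ 2).
{ rewrite <- (pow2_abs L). replace (Rabs L ^ 2) with (Rabs L * Rabs L) by ring.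
  assert (Rabs L * 1 <= Rabs L * Rabs L) by (apply Rmult_le_compat_l; lra). lra. }
pose proof (Rle_abs L). assert (2 * r ^ 2 * L <= 2 * r ^ 2 * L ^ 2) by (apply Rmult_le_compat_l; lra).
assert (2 * r ^ 2 * L ^ 2 <= 2 * / 10000 * L ^ 2) by (apply Rmult_le_compat_r; lra). lra.
Qed.

Lemma jupiter_approach mu r ph T t0 c : t0 < T -> 0 < c ->
  filterlim (fun t => cQ1 mu (r t) (ph t)) (at_left T) (locally (1 - mu)) ->
  filterlim (fun t => cQ2 (r t) (ph t)) (at_left T) (locally 0) -> exists t, t0 < t < T /\ Dq (r t) (ph t) < c.
Proof.
intros Ht Hc L1 L2. set (e := sqrt c / 2). assert (Hs : 0 < sqrt c) by (apply sqrt_lt_R0; auto). assert (He : 0 < e) by (unfold e; lra).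
destruct (at_left_point _ T t0 Ht (near_jupiter mu r ph T e He L1 L2)) as [t [Htt [N1 N2]]]. exists t. split; auto.
pose proof (small_Dq mu (r t) (ph t) e He N1 N2) as S.
assert (e ^ 2 = c / 4) by (unfold e; replace ((sqrt c / 2) ^ 2) with (sqrt c ^ 2 / 4) by field; rewrite pow2_sqrt by lra; auto). lra.
Qed.

Lemma polar_shift mu r th w L s t : polar_at mu r th w L (t + s) ->
  polar_at mu (fun t => r (t + s)) (fun t => th (t + s)) (fun t => w (t + s)) (fun t => L (t + s)) t.
Proof.
intros [P1 [P2 [D1 [D2 [D3 D4]]]]].
assert (C : forall (f : R -> R) (l : R), is_derive f (t + s) l -> is_derive (fun t : R => f (t + s)) t l).
{ intros f l D. apply (is_derive_eq _ _ (scal 1 l)); [unfold scal; simpl; unfold mult; simpl; ring|].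
  apply (is_derive_comp f (fun t => t + s)); auto. apply (is_derive_eq _ _ (1 + 0)); [ring|]. apply (is_derive_plus (fun t : R => t) (fun _ => s)); [apply (is_derive_id t)|apply (is_derive_const s t)]. }
split; [exact P1|]. split; [exact P2|]. split; [apply C; exact D1|]. split; [apply (C th); exact D2|]. split; [apply (C w); exact D3|apply (C L); exact D4].
Qed.

(** A Jupiter collision before tD contradicts the distance d1 kept by the truncated orbit. After tD,
    uniqueness identifies the orbit with the Sun collision orbit issued from the same point: a
    Jupiter collision during the fall is impossible since r < d^2 there, and a later one would
    require an orbit continuing through the instant when r tends to 0. *)
Lemma sun_jupiter_exclusive mu eta d Rm d1 y tD thc lac T r ph w L :
  0 < mu <= 1 / 100 -> -1 / 8 <= eta <= 1 / 8 -> 0 < d <= 1 / 1000 -> 0 < d1 ->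
  (exists M, tame M (Avel (mu, eta)) /\ tame M (Bvel (mu, eta))) ->
  0 < tD -> flow_of (trunc_field d Rm d1 mu) y ->
  (forall t, 0 <= t <= tD -> d ^ 2 <= y Cr t <= Rm /\ Rabs (y CL t) <= 1 / 2 /\ d1 ^ 2 <= Dq (y Cr t) (y Cth t)) ->
  y Cr tD = d ^ 2 -> y Cw tD < 0 -> y CL tD = d ^ 2 * lac d -> bvp_sol (Avel (mu, eta)) (Bvel (mu, eta)) d (y Cth tD) thc lac ->
  Jac mu (y Cr 0) (y Cth 0) (y Cw 0) (y CL 0) = eta ->
  0 < T -> (forall t, 0 <= t < T -> polar_at mu r ph w L t) -> agree (y Cr) (y Cth) (y Cw) (y CL) r ph w L 0 ->
  filterlim (fun t => cQ1 mu (r t) (ph t)) (at_left T) (locally (1 - mu)) ->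
  filterlim (fun t => cQ2 (r t) (ph t)) (at_left T) (locally 0) -> False.
Proof.
intros Hmu Heta Hd Hd1 HM HtD Hf Hin HrD HwD HLD Hsol HJ HT Hp Hag L1 L2.
assert (Hd2 : 0 < d ^ 2 <= 1 / 100) by (split; [apply pow_lt; lra|]; assert (d ^ 2 <= (1 / 1000) ^ 2) by (apply pow_incr; lra); lra).
assert (Hy : forall t, 0 <= t <= tD -> polar_at mu (y Cr) (y Cth) (y Cw) (y CL) t).
{ intros t Ht. destruct (Hin t Ht) as [A [B C]]. apply (trunc_flow_polar d Rm d1); auto; lra. }
destruct (Rle_dec T tD) as [HTD|HTD].
- assert (U := polar_unique mu _ _ _ _ r ph w L T (fun t Ht => Hy t ltac:(lra)) Hp (fun t Ht => Rle_lt_trans _ _ 1 (proj1 (proj2 (Hin t ltac:(lra)))) ltac:(lra)) Hag).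
  assert (0 < d1 ^ 2) by (apply pow_lt; auto).
  destruct (jupiter_approach mu r ph T 0 (d1 ^ 2) HT H L1 L2) as [t [Ht HD]].
  destruct (U t ltac:(lra)) as [E1 [E2 _]]. destruct (Hin t ltac:(lra)) as [_ [_ B]]. rewrite E1, E2 in B. lra.
- assert (U := polar_unique mu _ _ _ _ r ph w L tD (fun t Ht => Hy t ltac:(lra)) (fun t Ht => Hp t ltac:(lra)) (fun t Ht => Rle_lt_trans _ _ 1 (proj1 (proj2 (Hin t ltac:(lra)))) ltac:(lra)) Hag).
  assert (UD : agree (y Cr) (y Cth) (y Cw) (y CL) r ph w L tD).
  { destruct (polar_continuous _ _ _ _ _ _ (Hy tD ltac:(lra))) as [C1 [C2 [C3 [C4 _]]]].
    destruct (polar_continuous _ _ _ _ _ _ (Hp tD ltac:(lra))) as [C1' [C2' [C3' [C4' _]]]].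
    split; [|split; [|split]]; apply (eq_at_left_limit _ _ 0 tD); auto; intros s Hs; apply U; auto. }
  destruct (collision_orbit mu eta d (y Cth tD) thc lac ltac:(lra) Heta ltac:(lra) HM Hsol) as [T' [r' [ph' [w' [L' [HT' [Hp' [R0 [P0 [A0 [W0 [J0 [Hlow [Lim _]]]]]]]]]]]]]].
  assert (JD := Jac_const mu (y Cr) (y Cth) (y Cw) (y CL) 0 tD ltac:(lra) Hy). rewrite HJ in JD.
  (* Position and angular momentum agree by construction. The Jacobi integral then fixes the square
     of the radial velocity, and both velocities point inwards. *)
  assert (EW : w' 0 = y Cw tD).
  { rewrite <- JD in J0. rewrite R0, P0, A0, HrD, HLD in J0. unfold Jac in J0.
    assert (E : Rsqr (w' 0) = Rsqr (y Cw tD)) by (unfold Rsqr; lra). apply Rsqr_eq in E. destruct E; lra. }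
  set (b := Rmin T' (T - tD)).
  pose proof (Rmin_l T' (T - tD)) as B1. pose proof (Rmin_r T' (T - tD)) as B2. fold b in B1, B2.
  destruct UD as [U1 [U2 [U3 U4]]].
  assert (Jc : forall t, 0 <= t < T' -> Rabs (L' t) < 1).
  { intros t Ht. apply (angular_momentum_small mu (r' t) (ph' t) (w' t) (L' t) eta); auto.
    - destruct (Hp' t Ht) as [P _]. split; auto. destruct (Req_dec t 0) as [->|Hn]; [lra|]. specialize (Hlow t ltac:(lra)). lra.
    - rewrite <- J0. apply Jac_const; [lra|]. intros s Hs. apply Hp'. lra. }
  assert (V := polar_unique mu r' ph' w' L' (fun t => r (t + tD)) (fun t => ph (t + tD)) (fun t => w (t + tD)) (fun t => L (t + tD)) b
    (fun t Ht => Hp' t ltac:(lra)) (fun t Ht => polar_shift mu r ph w L tD t (Hp (t + tD) ltac:(lra))) (fun t Ht => Jc t ltac:(lra))).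
  assert (V0 : agree r' ph' w' L' (fun t => r (t + tD)) (fun t => ph (t + tD)) (fun t => w (t + tD)) (fun t => L (t + tD)) 0).
  { unfold agree. rewrite Rplus_0_l. rewrite R0, P0, A0, EW, <- U1, <- U2, <- U3, <- U4. auto. }
  specialize (V V0).
  destruct (Rle_dec (T - tD) T') as [HC|HC].
  + destruct (jupiter_approach mu r ph T tD (1 / 2) ltac:(lra) ltac:(lra) L1 L2) as [t [Ht HD]].
    assert (Eb : b = T - tD) by (unfold b; apply Rmin_right; auto).
    destruct (V (t - tD) ltac:(lra)) as [E1 [E2 _]]. replace (t - tD + tD) with t in E1, E2 by ring.
    specialize (Hlow (t - tD) ltac:(lra)). destruct (Hp t ltac:(lra)) as [Pr _].
    pose proof (Dq_lower (r t) (ph t) ltac:(lra)). rewrite E1 in Hlow.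
    assert ((99 / 100) ^ 2 <= (1 - r t) ^ 2) by (apply pow_incr; lra). lra.
  (* The orbit is still defined at the moment of the Sun collision, so r is positive and continuous
     there, against its limit 0. *)
  + assert (Eb : b = T') by (unfold b; apply Rmin_left; lra).
    destruct (Hp (T' + tD) ltac:(lra)) as [Pr _].
    destruct (polar_continuous _ _ _ _ _ _ (Hp (T' + tD) ltac:(lra))) as [C1 _].
    assert (Hg := locally_gt r (T' + tD) (r (T' + tD) / 2) C1 ltac:(lra)). destruct Hg as [e He].
    assert (Hl := proj1 (filterlim_locally _ 0) Lim (mkposreal (r (T' + tD) / 2) ltac:(lra))).
    destruct (at_left_point _ T' (Rmax 0 (T' - e)) ltac:(apply Rmax_lub_lt; [lra|pose proof (cond_pos e); lra]) Hl) as [t [Ht HB]].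
    pose proof (Rmax_l 0 (T' - e)). pose proof (Rmax_r 0 (T' - e)).
    destruct (V t ltac:(lra)) as [E1 _]. change (Rabs (r' t - 0) < r (T' + tD) / 2) in HB.
    assert (Hb2 : ball (T' + tD) e (t + tD)) by (change (Rabs (t + tD - (T' + tD)) < e); apply Rabs_def1; lra).
    specialize (He _ Hb2). apply Rabs_def2 in HB. lra.
Qed.

(** * The crossing point *)

Section Crossing.
Variables (K d mu h eta Mc : R) (ThJ : R -> R) (TH LA : R -> R -> R).
Let N := K + 3. Let q := d ^ 5. Let u := N * q. Let th0 := - (sqrt 2 / 3) * (1 - d ^ 3).
Hypotheses (HK : 0 <= K) (Hd : 0 < d) (HNd : 10000000 * (N * d) <= 1) (HMc : 1 <= Mc) (HMd : 16 * Mc * d <= 1).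
Hypothesis Htame : forall p, valid p -> tame Mc (Avel p) /\ tame Mc (Bred p) /\ tame Mc (Bvel p).
Hypotheses (Hmu : 0 < mu <= 1 / 100) (Heta : Rabs eta <= q / 1000000) (Hmu1 : mu / d ^ 2 <= q / 1000000) (Hmu2 : mu * (Mc + 10) <= q / 1000000)
  (Heps : 300 * mu / d ^ 8 <= q ^ 7 / 1000000000) (Eeta : eta = h + mu ^ 2 / 2).
Hypothesis HThJ : forall th, th0 - d ^ 4 < th < th0 + d ^ 4 ->
  (exists RR, RR < 0 /\ Hbar mu (d ^ 2) th RR (ThJ th) = h /\ jup_ejection_bwd mu (d ^ 2) th RR (ThJ th)) /\
  Rabs (ThJ th - d / sqrt 2 * (th - th0)) <= K * d ^ 5 /\ ex_derive ThJ th /\ Rabs (Derive ThJ th - d / sqrt 2) <= K * d ^ 2.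
Hypothesis Hfam : collision_family Mc mu eta d TH LA.

Let g th := d ^ 2 * LA th d - mu * d ^ 2 * cos th.
(** The least slope of [ThJ] allowed by the hypotheses. Since N d is tiny it is d / sqrt 2 up to a
    relative error of order K d. *)
Let c := d / sqrt 2 - K * d ^ 2.

Lemma crossing_scales : 0 < q <= / 10000000 /\ d <= 1 / 1000 /\ 3 * q <= u /\ u <= d ^ 4 / 10000000 /\ 0 < d ^ 4 <= / 10000000 /\ 0 < d ^ 2 <= / 1000000 /\
  - (1 / 8) <= eta <= 1 / 8 /\ q = d * d ^ 4 /\ 10000000 * (K * d) <= 1 /\ mu <= q / 10000000.
Proof.
assert (HN : 3 <= N) by (unfold N; lra).
destruct (small_scales d N Hd HN HNd) as [Q0 [Hd3 [Hu4 [Hd4 _]]]]. fold q in Q0, Hu4. fold u in Hu4.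
 assert (Hqu : 3 * q <= u) by (apply Rmult_le_compat_r; lra).
assert (d ^ 2 <= (1 / 1000) ^ 2) by (apply pow_incr; lra). assert (0 < d ^ 2) by (apply pow_lt; auto).
assert (K * d <= N * d) by (apply Rmult_le_compat_r; unfold N; lra).
assert (mu * 10 <= mu * (Mc + 10)) by (apply Rmult_le_compat_l; lra).
apply Rabs_le_between in Heta. repeat split; lra.
Qed.

Lemma slope_constants : 69 / 100 * d <= c /\ c <= 71 / 100 * d /\ sqrt 2 * c / d = 1 - sqrt 2 * (K * d) /\ c <= d / sqrt 2.
Proof.
destruct crossing_scales as [_ [_ [_ [_ [_ [_ [_ [_ [Kd _]]]]]]]]]. pose proof sqrt2_bounds as S2. assert (Q2 : sqrt 2 * sqrt 2 = 2) by (apply sqrt_sqrt; lra).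
assert (I : / sqrt 2 = sqrt 2 / 2) by (apply Rmult_eq_reg_r with (sqrt 2); [rewrite Rinv_l by lra; lra|lra]).
assert (E : d / sqrt 2 = d * (sqrt 2 / 2)) by (unfold Rdiv at 1; rewrite I; auto).
assert (KD : 0 <= K * d ^ 2 <= d / 10000000). { replace (K * d ^ 2) with (d * (K * d)) by ring. split; [apply Rmult_le_pos; [lra|apply Rmult_le_pos; lra]|]. replace (d / 10000000) with (d * / 10000000) by field. apply Rmult_le_compat_l; lra. }
unfold c. rewrite E. assert (d * (70 / 100) <= d * (sqrt 2 / 2)) by (apply Rmult_le_compat_l; lra). assert (d * (sqrt 2 / 2) <= d * (71 / 100)) by (apply Rmult_le_compat_l; lra).
split; [lra|]. split; [lra|]. split; [|lra].
replace (sqrt 2 * (d * (sqrt 2 / 2) - K * d ^ 2) / d) with (sqrt 2 * sqrt 2 / 2 - sqrt 2 * (K * d)) by (field; lra). rewrite Q2. field.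
Qed.

Lemma ThJ_slope x y : th0 - d ^ 4 < x -> x <= y -> y < th0 + d ^ 4 -> c * (y - x) <= ThJ y - ThJ x.
Proof.
intros Hx Hxy Hy. replace (c * (y - x)) with ((fun t => c * t) y - (fun t => c * t) x) by ring.
apply (open_derive_le (fun t => c * t) ThJ (fun _ => c) (Derive ThJ)); auto.
- intros t Ht. auto_derive; auto. ring.
- intros t Ht. apply Derive_correct. apply (HThJ t). lra.
- intros t Ht. destruct (HThJ t ltac:(lra)) as [_ [_ [_ B]]]. apply Rabs_le_between in B. unfold c. lra.
Qed.

Lemma ThJ_continuous x : th0 - d ^ 4 < x < th0 + d ^ 4 -> continuous ThJ x.
Proof. intros Hx. destruct (HThJ x Hx) as [_ [_ [D _]]]. apply (ex_derive_continuous ThJ x D). Qed.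

Lemma collision_graph_small th : Rabs (g th) <= q / 1000000 /\ Rabs (d ^ 2 * LA th d) <= q / 1000000 /\ Rabs (mu * d ^ 2 * cos th) <= q / 1000000.
Proof.
destruct crossing_scales as [_ [_ [_ [_ [_ [D2 _]]]]]]. destruct Hfam as [_ [B _]].
assert (A1 : Rabs (d ^ 2 * LA th d) <= 1 * (mu * Mc)) by (apply Rabs_mult_le; [rewrite Rabs_pos_eq; lra|apply B]).
assert (A2 : Rabs (mu * d ^ 2 * cos th) <= mu * 1).
{ rewrite Rmult_assoc. apply Rabs_mult_le; [rewrite Rabs_pos_eq; lra|]. replace 1 with (1 * 1) by ring. apply Rabs_mult_le; [rewrite Rabs_pos_eq; lra|apply Rabs_le, COS_bound]. }
assert (0 <= mu * Mc) by (apply Rmult_le_pos; lra).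
split; [|lra]. unfold g, Rminus. eapply Rle_trans; [apply Rabs_plus_le; [exact A1|rewrite Rabs_Ropp; exact A2]|]. lra.
Qed.

Lemma collision_graph_derive th : ex_derive g th /\ Rabs (Derive g th) <= q.
Proof.
destruct crossing_scales as [Q0 [_ [_ [_ [_ [D2 _]]]]]]. destruct Hfam as [_ [_ [E B]]].
assert (D : is_derive g th (d ^ 2 * Derive (fun x => LA x d) th - mu * d ^ 2 * - sin th)).
{ unfold g. apply (is_derive_minus (fun x => d ^ 2 * LA x d) (fun x => mu * d ^ 2 * cos x)).
  - apply is_derive_scal. apply Derive_correct. apply E.
  - apply is_derive_scal. apply is_derive_cos. }
split; [eexists; exact D|]. rewrite (is_derive_unique _ _ _ D).
assert (A1 : Rabs (d ^ 2 * Derive (fun x => LA x d) th) <= 1 * (4 * mu * Mc)) by (apply Rabs_mult_le; [rewrite Rabs_pos_eq; lra|apply B]).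
assert (A2 : Rabs (mu * d ^ 2 * - sin th) <= mu * 1).
{ rewrite Rmult_assoc. apply Rabs_mult_le; [rewrite Rabs_pos_eq; lra|]. replace 1 with (1 * 1) by ring. apply Rabs_mult_le; [rewrite Rabs_pos_eq; lra|rewrite Rabs_Ropp; apply Rabs_le, SIN_bound]. }

unfold Rminus. eapply Rle_trans; [apply Rabs_plus_le; [exact A1|rewrite Rabs_Ropp; exact A2]|]. lra.
Qed.

(** The square of the radial velocity on the level [eta] of the Jacobi integral at r = d^2. *)
Let speed2 s L := 2 * (eta + (1 - mu) / d ^ 2 + L + Upot mu (d ^ 2) s - L ^ 2 / (2 * (d ^ 2) ^ 2)).

Lemma speed_facts s L : Rabs L <= u -> 1 <= speed2 s L /\ (forall w, Jac mu (d ^ 2) s w L = eta <-> w ^ 2 = speed2 s L) /\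
  (forall w, Jac mu (d ^ 2) s w L = eta -> Rabs (En (d ^ 2) w L - L) <= q / 100000).
Proof.
intros HL. destruct crossing_scales as [Q0 [D1 [Qu [U4 [D4 [D2 [He [_ [_ Mq]]]]]]]]].
pose proof (Upot_small mu (d ^ 2) s ltac:(lra) ltac:(lra)) as HU. apply Rabs_le_between in HU.
split; [|split].
- unfold speed2.
  assert (A : L ^ 2 / (2 * (d ^ 2) ^ 2) <= 1).
  {  apply Rle_div_l; [lra|].
    assert (L ^ 2 <= (d ^ 2) ^ 2); [|lra]. rewrite <- (pow2_abs L). apply pow_incr. split; [apply Rabs_pos|].
    assert (d ^ 4 <= d ^ 2) by (replace (d ^ 4) with (d ^ 2 * d ^ 2) by ring; apply mult_le_left; lra). lra. }
  assert (B : 10 <= (1 - mu) / d ^ 2) by (apply (proj1 (Rle_div_r 10 (1 - mu) (d ^ 2) ltac:(lra))); lra).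
  apply Rabs_le_between in HL. lra.
- intros w. unfold Jac, speed2. split; intros E; lra.
- intros w E. rewrite (En_of_Jac mu (d ^ 2) s) by lra. rewrite E.
  assert (0 < mu / d ^ 2) by (apply Rdiv_lt_0_compat; lra). apply Rabs_le_between in Heta. apply Rabs_le. lra.
Qed.

Lemma reversed_ejection th : th0 - d ^ 4 < th < th0 + d ^ 4 -> Rabs (ThJ th + mu * d ^ 2 * cos th) <= u ->
  exists T r ph w L, 0 < T /\ (forall t, 0 <= t < T -> polar_at mu r ph w L t) /\
   r 0 = d ^ 2 /\ ph 0 = - th /\ L 0 = ThJ th + mu * d ^ 2 * cos th /\ 0 < w 0 /\ Jac mu (d ^ 2) (- th) (w 0) (L 0) = eta /\
   filterlim (fun t => cQ1 mu (r t) (ph t)) (at_left T) (locally (1 - mu)) /\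
   filterlim (fun t => cQ2 (r t) (ph t)) (at_left T) (locally 0).
Proof.
intros Hth HL. destruct (HThJ th Hth) as [[RR [HR [HH HJ]]] _]. destruct crossing_scales as [_ [_ [_ [_ [_ [D2 _]]]]]].
destruct (jup_reverse mu (d ^ 2) th RR (ThJ th) ltac:(lra) HJ) as [T [r [ph [w [L [H1 [H2 [H3 [H4 [H5 [H6 [H7 H8]]]]]]]]]]]].
assert (EJ : Jac mu (d ^ 2) (- th) (w 0) (L 0) = eta).
{ rewrite Hbar_Jac in HH by lra. rewrite H5, H6. replace eta with (h + mu ^ 2 / 2) by lra. rewrite <- HH.
  unfold Jac, Upot, Dq. rewrite cos_neg. unfold Rdiv. ring. }
exists T, r, ph, w, L. split; [auto|]. split; [auto|]. split; [auto|]. split; [auto|]. split; [auto|]. split; [|auto].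
rewrite <- H6 in HL. destruct (speed_facts (- th) (L 0) HL) as [S1 [S2 _]]. apply S2 in EJ.
rewrite H5 in *. pose proof (SIN_bound th).
assert (B : Rabs (mu * sin th) <= 1 / 100 * 1) by (apply Rabs_mult_le; [rewrite Rabs_pos_eq; lra|apply Rabs_le; auto]). apply Rabs_le_between in B.
(* The sign of [RR] only gives w > -mu sin th. A value w <= 0 would therefore be tiny, whereas the
   energy level forces w^2 >= 1. *)
apply Rnot_le_lt. intros Hc. assert (Hs : (- (- RR - mu * sin th)) ^ 2 <= (1 / 2) ^ 2) by (apply pow_incr; lra).
replace ((- (- RR - mu * sin th)) ^ 2) with ((- RR - mu * sin th) ^ 2) in Hs by ring. lra.
Qed.
(** At th0 - 9/10 d^4, just inside the open window, [ThJ] is above the tiny values of g, and its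
    slope lifts it to at least 0.6 d^5 at th0. Through the energy level this is also the energy of
    the reversed orbit. As its starting angle is exactly the parabolic one, the offset from Jupiter
    is sqrt 2 L / d, above d^4 / 2. *)
Lemma not_above : (forall th, th0 - d ^ 4 < th < th0 + d ^ 4 -> g th < ThJ th) -> False.
Proof.
intros Hab. destruct crossing_scales as [Q0 [D1 [Qu [U4 [D4 [D2 [He [Eq [Kd Mq]]]]]]]]]. destruct slope_constants as [C1 _].
assert (Hx := Hab (th0 - 9 / 10 * d ^ 4) ltac:(lra)). destruct (collision_graph_small (th0 - 9 / 10 * d ^ 4)) as [G1 _]. apply Rabs_le_between in G1.
assert (Sl := ThJ_slope (th0 - 9 / 10 * d ^ 4) th0 ltac:(lra) ltac:(lra) ltac:(lra)).
assert (c * (th0 - (th0 - 9 / 10 * d ^ 4)) >= 62 / 100 * q).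
{ replace (th0 - (th0 - 9 / 10 * d ^ 4)) with (9 / 10 * d ^ 4) by ring. assert (69 / 100 * d * (9 / 10 * d ^ 4) <= c * (9 / 10 * d ^ 4)) by (apply Rmult_le_compat_r; lra). lra. }
destruct (HThJ th0 ltac:(lra)) as [_ [B _]]. fold q in B. rewrite Rminus_diag, Rmult_0_r, Rminus_0_r in B. apply Rabs_le_between in B.
destruct (collision_graph_small th0) as [_ [_ G3]]. apply Rabs_le_between in G3.
assert (HLu : Rabs (ThJ th0 + mu * d ^ 2 * cos th0) <= u) by (apply Rabs_le; unfold u, N; lra).
destruct (reversed_ejection th0 ltac:(lra) HLu) as [T [r [ph [w [L [H1 [H2 [H3 [H4 [H5 [H6 [H7 [H8 H9]]]]]]]]]]]]].
rewrite <- H5 in HLu. destruct (speed_facts (- th0) (L 0) HLu) as [_ [_ S3]]. specialize (S3 _ H7).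
assert (ET : ph 0 - sqrt 2 / 3 * (1 - d ^ 3) = 0) by (rewrite H4; unfold th0; ring).
set (eps := 300 * mu / d ^ 8).
assert (H8p : 0 < d ^ 8) by (apply pow_lt; auto).
assert (Ep : 0 <= eps) by (apply Rdiv_le_0_compat; lra).
assert (Q5 : q ^ 5 <= 1) by (replace 1 with (1 ^ 5) by ring; apply pow_incr; lra).
assert (Q7 : q ^ 7 <= q * q) by (replace (q ^ 7) with (q * q * q ^ 5) by ring; apply mult_le_left; [apply Rmult_le_pos; lra|auto]).

assert (QQ : q * q <= u * d ^ 4) by (apply Rmult_le_compat; lra).
assert (QQ1 : q * q <= q) by (apply mult_le_left; lra).
assert (Nu : N * u <= / 1000000).
{ replace (N * u) with ((N * d) * (N * d) * d ^ 3) by (unfold u, q; ring). assert (0 < N * d) by (apply Rmult_lt_0_compat; [unfold N; lra|auto]).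
  assert (d ^ 3 <= 1) by (replace 1 with (1 ^ 3) by ring; apply pow_incr; lra).
  assert ((N * d) * (N * d) <= / 10000000 * / 10000000) by (apply Rmult_le_compat; lra).
  eapply Rle_trans; [apply mult_le_left; [apply Rmult_le_pos; lra|auto]|lra]. }
assert (UU : u ^ 2 <= q / 1000000).
{ replace (u ^ 2) with (q * (N * u)) by (unfold u; ring). replace (q / 1000000) with (q * / 1000000) by field. apply Rmult_le_compat_l; lra. }
apply Rabs_le_between in S3. apply Rabs_le_between in HLu.
apply (no_hyperbolic_ejection mu d u eps (q / 4) T r ph w L); auto; try lra.
- unfold eps in *. lra.
- unfold eps. right. field. lra.
- unfold eps in *. lra.
- rewrite ET, Rabs_R0. lra.
- apply Rabs_le. lra.
- rewrite H3. apply Rabs_le. unfold u, N in *. lra.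
- rewrite ET, Rplus_0_l. pose proof sqrt2_bounds.
  assert (Hq : sqrt 2 * (6 / 10 * q) <= sqrt 2 * L 0) by (apply Rmult_le_compat_l; lra).
  assert (Hq2 : sqrt 2 * (6 / 10 * q) / d <= sqrt 2 * L 0 / d) by (apply Rmult_le_compat_r; [left; apply Rinv_0_lt_compat; auto|auto]).
  replace (sqrt 2 * (6 / 10 * q) / d) with (sqrt 2 * (6 / 10) * d ^ 4) in Hq2 by (rewrite Eq; field; lra).
  assert (1 / 2 * d ^ 4 <= sqrt 2 * (6 / 10) * d ^ 4) by (apply Rmult_le_compat_r; lra).
  eapply Rle_trans; [|apply Rle_abs]. lra.
- rewrite H3. lra.
Qed.

(** The slope now carries the smallness of [ThJ] at th0 + 9/10 d^4 back to values below -0.6 d^5 on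
    the arc, while the K-bound keeps them above -(K + 2) d^5. Over the half-window the values change
    by more than d^5 / 4, the energy gap needed to sweep a full turn of phases. *)
Lemma not_below : (forall th, th0 - d ^ 4 < th < th0 + d ^ 4 -> ThJ th < g th) -> False.
Proof.
intros Hbe. destruct crossing_scales as [Q0 [D1 [Qu [U4 [D4 [D2 [He [Eq [Kd Mq]]]]]]]]]. destruct slope_constants as [C1 [C2 [C3 C4]]].
pose proof sqrt2_bounds as S2.
(* Reversal reflects the angle, so the arc [th0 - d^4 / 2, th0] is run through by s = -th. Clamping
   provides data for every real parameter. *)
set (s1 := - th0). set (s2 := - th0 + d ^ 4 / 2). set (S0 := clamp s1 s2).
set (L0 := fun s : R => ThJ (- S0 s) + mu * d ^ 2 * cos (S0 s)). set (W0 := fun s => sqrt (speed2 (S0 s) (L0 s))).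
assert (BS : forall s, s1 <= S0 s <= s2) by (intros; apply clamp_bounds; unfold s1, s2; lra).
assert (Win : forall s, th0 - d ^ 4 < - S0 s < th0 + d ^ 4) by (intros s; specialize (BS s); unfold s1, s2 in BS; lra).
assert (Up : forall s, ThJ (- S0 s) <= q / 1000000 - c * (S0 s + th0 + 9 / 10 * d ^ 4)).
{ intros s. specialize (BS s). unfold s1, s2 in BS. assert (Hx := Hbe (th0 + 9 / 10 * d ^ 4) ltac:(lra)).
  destruct (collision_graph_small (th0 + 9 / 10 * d ^ 4)) as [G1 _]. apply Rabs_le_between in G1.
  assert (Sl := ThJ_slope (- S0 s) (th0 + 9 / 10 * d ^ 4) ltac:(lra) ltac:(lra) ltac:(lra)).
  replace (th0 + 9 / 10 * d ^ 4 - - S0 s) with (S0 s + th0 + 9 / 10 * d ^ 4) in Sl by ring. lra. }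
assert (Small : forall s, Rabs (L0 s - ThJ (- S0 s)) <= q / 1000000).
{ intros s. unfold L0. replace (ThJ (- S0 s) + mu * d ^ 2 * cos (S0 s) - ThJ (- S0 s)) with (mu * d ^ 2 * cos (S0 s)) by ring. apply collision_graph_small. }
assert (Rng : forall s, - (N - 1) * q <= L0 s <= - (3 / 10) * q).
{ intros s. specialize (Up s). specialize (Small s). apply Rabs_le_between in Small. specialize (Win s). specialize (BS s). unfold s1, s2 in BS.
  destruct (HThJ (- S0 s) Win) as [_ [B _]]. fold q in B. apply Rabs_le_between in B. split.
  - assert (d / sqrt 2 <= 72 / 100 * d).
    { assert (K * d ^ 2 <= d / 1000). { replace (K * d ^ 2) with (d * (K * d)) by ring. replace (d / 1000) with (d * / 1000) by field. apply Rmult_le_compat_l; lra. }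
      unfold c in C2. lra. }
    assert (d / sqrt 2 * (S0 s + th0) <= 72 / 100 * d * (d ^ 4 / 2)).
    { apply Rmult_le_compat; lra. }
    replace (d / sqrt 2 * (- S0 s - th0)) with (- (d / sqrt 2 * (S0 s + th0))) in B by ring. unfold N. lra.
  - assert (69 / 100 * d * (9 / 10 * d ^ 4) <= c * (S0 s + th0 + 9 / 10 * d ^ 4)) by (apply Rmult_le_compat; lra). lra. }
assert (Lu : forall s, Rabs (L0 s) <= u) by (intros s; specialize (Rng s); apply Rabs_le; unfold u, N in *; lra).
assert (EW : forall s, (W0 s) ^ 2 = speed2 (S0 s) (L0 s)).
{ intros s. destruct (speed_facts (S0 s) (L0 s) (Lu s)) as [A _]. unfold W0. apply pow2_sqrt. lra. }
assert (CS : forall s, continuous S0 s) by (intros s; apply (continuous_of_lip S0 1); intros x y; rewrite Rmult_1_l; apply clamp_lip; unfold s1, s2; lra).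
assert (Ccos : forall s, continuous (fun s : R => mu * d ^ 2 * cos (S0 s)) s).
{ intros s. apply (continuous_comp S0 (fun x : R => mu * d ^ 2 * cos x)); auto. apply (ex_derive_continuous (fun x : R => mu * d ^ 2 * cos x)). auto_derive. auto. }
assert (CL0 : forall s, continuous L0 s).
{ intros s. apply (continuous_plus (V := R_NormedModule)); auto.
  apply (continuous_comp (fun x : R => - S0 x) ThJ); [apply (continuous_opp (V := R_NormedModule)); auto|apply ThJ_continuous, Win]. }
assert (CW : forall s, continuous W0 s).
{ intros s. apply (continuous_comp (fun s => speed2 (S0 s) (L0 s)) sqrt); [|apply continuous_sqrt]. unfold speed2.
  apply (continuous_scal_r (V := R_NormedModule) 2). apply (continuous_minus (V := R_NormedModule)); [apply (continuous_plus (V := R_NormedModule)); [apply (continuous_plus (V := R_NormedModule)); [apply continuous_const|auto]|]|].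
  - apply (continuous_comp S0 (fun x : R => Upot mu (d ^ 2) x)); auto. apply (ex_derive_continuous (fun x : R => Upot mu (d ^ 2) x)).
    pose proof (Dq_lower (d ^ 2) (S0 s) ltac:(lra)). assert (0 < (1 - d ^ 2) ^ 2) by (apply pow_lt; lra). unfold Upot, Dq in *. auto_derive.
    match goal with |- 0 < ?x /\ _ => assert (HX : 0 < x) by (eapply Rlt_le_trans; [apply H0|]; eapply Rle_trans; [exact H|]; right; ring) end.
    split; [exact HX|]. split; [apply Rgt_not_eq, sqrt_lt_R0, HX|auto].
  - apply (continuous_comp L0 (fun x : R => x ^ 2 / (2 * (d ^ 2) ^ 2))); auto. apply (ex_derive_continuous (fun x : R => x ^ 2 / (2 * (d ^ 2) ^ 2))). auto_derive. auto. }
assert (CG : forall x, continuous (fun x : R => d ^ 2 * LA x d) x).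
{ intros x. destruct Hfam as [_ [_ [D _]]]. apply (ex_derive_continuous (fun x : R => d ^ 2 * LA x d)). apply ex_derive_scal. apply D. }
destruct (collision_connection d N mu s1 s2 S0 W0 L0 (fun x => d ^ 2 * LA x d)) as [s [y [tD [T1 [T2 [T3 [T4 [T5 [T6 [T7 [T8 [T9 T10]]]]]]]]]]]]; auto.
- unfold N; lra.
- lra.
- intros s. specialize (BS s). specialize (Up s). specialize (Rng s). specialize (Small s). specialize (Lu s). specialize (EW s). unfold s1, s2 in BS.
  destruct (speed_facts (S0 s) (L0 s) Lu) as [A1 [A2 A3]].
  assert (ES : S0 s - sqrt 2 / 3 * (1 - d ^ 3) = S0 s + th0) by (unfold th0; ring). rewrite ES.
  split; [apply sqrt_lt_R0; lra|]. split; [apply Rabs_le; lra|]. split; [auto|]. split.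
  + apply A2 in EW. specialize (A3 _ EW). fold q. lra.
  + apply Rabs_le_between in Small.

    (* The angular momentum at the upper end of the slope estimate turns the offset S0 + th0 into
       the same quantity with opposite sign, because sqrt 2 c / d is nearly 1. What remains is an
       offset from Jupiter of about -9/10 d^4 or beyond on the whole arc. *)
    assert (HL2 : sqrt 2 * L0 s / d <= sqrt 2 * (q / 500000 - c * (S0 s + th0 + 9 / 10 * d ^ 4)) / d).
    { apply Rmult_le_compat_r; [left; apply Rinv_0_lt_compat; auto|]. apply Rmult_le_compat_l; lra. }
    replace (sqrt 2 * (q / 500000 - c * (S0 s + th0 + 9 / 10 * d ^ 4)) / d) with (sqrt 2 / 500000 * d ^ 4 - sqrt 2 * c / d * (S0 s + th0 + 9 / 10 * d ^ 4)) in HL2 by (rewrite Eq; field; lra).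
    rewrite C3 in HL2.
    assert (KS : sqrt 2 * (K * d) * (S0 s + th0 + 9 / 10 * d ^ 4) <= 2 * / 10000000 * (2 * d ^ 4)).
    { assert (0 <= K * d) by (apply Rmult_le_pos; lra). apply Rmult_le_compat; try lra; [apply Rmult_le_pos; lra|apply Rmult_le_compat; lra]. }
    assert (sqrt 2 / 500000 * d ^ 4 <= 2 / 500000 * d ^ 4) by (apply Rmult_le_compat_r; lra).
    rewrite Rabs_left1; lra.
- unfold s1, s2; lra.
- assert (Z1 : S0 s1 = - th0) by (unfold S0; apply clamp_id; unfold s1, s2; lra).
  assert (Z2 : S0 s2 = - th0 + d ^ 4 / 2) by (unfold S0; apply clamp_id; unfold s1, s2; lra).
  pose proof (Small s1) as B1. pose proof (Small s2) as B2. rewrite Z1 in B1. rewrite Z2 in B2. rewrite Ropp_involutive in B1. apply Rabs_le_between in B1. apply Rabs_le_between in B2.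
  assert (Sl := ThJ_slope (- (- th0 + d ^ 4 / 2)) th0 ltac:(lra) ltac:(lra) ltac:(lra)).
  assert (69 / 100 * d * (d ^ 4 / 2) <= c * (th0 - - (- th0 + d ^ 4 / 2))) by (apply Rmult_le_compat; lra). fold q. lra.
- intros x. destruct (collision_graph_small x) as [_ [B _]]. fold q. lra.
- assert (HLu : Rabs (ThJ (- S0 s) + mu * d ^ 2 * cos (- S0 s)) <= u) by (rewrite cos_neg; apply Lu).
  destruct (reversed_ejection (- S0 s) (Win s) HLu) as [T [r [ph [w [L [H1 [H2 [H3 [H4 [H5 [H6 [H7 [H8 H9]]]]]]]]]]]]].
  rewrite Ropp_involutive in H4, H7. rewrite cos_neg in H5. change (L 0 = L0 s) in H5. rewrite H5 in H7.
  destruct (speed_facts (S0 s) (L0 s) (Lu s)) as [A1 [A2 _]].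
  assert (EJ := proj2 (A2 (W0 s)) (EW s)).
  assert (Ew : W0 s = w 0).
  { apply A2 in H7. specialize (EW s). assert (E : Rsqr (W0 s) = Rsqr (w 0)) by (unfold Rsqr; lra).
    assert (0 <= W0 s) by apply sqrt_pos. apply Rsqr_eq in E. destruct E; lra. }
  apply (sun_jupiter_exclusive mu eta d (8 / q) (mu / (20 * u)) y tD (TH (y Cth tD)) (LA (y Cth tD)) T r ph w L); auto; try lra.
  + apply Rdiv_lt_0_compat; lra.
  + exists Mc. destruct (Htame (mu, eta)) as [B1 [_ B2]]; [unfold valid; simpl; lra|]. auto.
  + apply Hfam.
  + rewrite T3, T4, T5, T6. auto.
  + unfold agree. rewrite T3, T4, T5, T6. auto.
Qed.
Lemma crossing_exists : exists x, th0 - d ^ 4 < x < th0 + d ^ 4 /\ ThJ x = g x.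
Proof.
destruct crossing_scales as [_ [_ [_ [_ [D4 _]]]]].
apply NNPP. intros Hn.
assert (Sign : forall x y, th0 - d ^ 4 < x < th0 + d ^ 4 -> th0 - d ^ 4 < y < th0 + d ^ 4 -> g x < ThJ x -> ThJ y <= g y -> False).
{ intros x y Hx Hy H1 H2.
  assert (Hc : forall t, Rmin x y <= t <= Rmax x y -> continuous (fun t : R => ThJ t - g t) t).
  { intros t Ht. apply (continuous_minus (V := R_NormedModule)).
    - apply ThJ_continuous. unfold Rmin, Rmax in Ht. destruct Rle_dec; lra.
    - apply (ex_derive_continuous g). apply collision_graph_derive. }
  destruct (ivt_between (fun t : R => ThJ t - g t) (Rmin x y) (Rmax x y) 0 (Rle_trans _ _ _ (Rmin_l x y) (Rmax_l x y)) Hc) as [t [Ht Et]].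
  - unfold Rmin, Rmax. destruct Rle_dec; [right|left]; lra.
  - apply Hn. exists t. split; [unfold Rmin, Rmax in Ht; destruct Rle_dec; lra|lra]. }
destruct (Rlt_le_dec (g th0) (ThJ th0)) as [H|H].
- apply not_above. intros x Hx. apply Rnot_le_lt. intros Hc. apply (Sign th0 x); auto; lra.
- apply not_below. intros x Hx. destruct (Rtotal_order (ThJ x) (g x)) as [A|[A|A]]; auto.
  + exfalso. apply Hn. exists x. auto.
  + exfalso. apply (Sign x th0); auto; lra.
Qed.

Lemma DeltaS_crossing th Th : DeltaS_minus mu d h th Th <-> Th = g th.
Proof.
destruct crossing_scales as [_ [D1 [_ [_ [_ [_ [He _]]]]]]].
apply (DeltaS_graph Mc mu eta d TH LA); auto; lra.
Qed.

Lemma crossing_transversal x : th0 - d ^ 4 < x < th0 + d ^ 4 -> ThJ x = g x ->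
  transversal_at (DeltaS_minus mu d h) ThJ x /\ transversal_at (DeltaU_plus mu d h) (fun th => ThJ (- th)) (- x).
Proof.
intros Hx Ex. destruct crossing_scales as [Q0 [D1 [_ [_ [D4 [_ [_ [Eq _]]]]]]]]. destruct slope_constants as [C1 _].
destruct (HThJ x Hx) as [_ [_ [D B]]]. destruct (collision_graph_derive x) as [_ G2].
assert (Hne : Derive g x <> Derive ThJ x).
{ apply Rabs_le_between in B. apply Rabs_le_between in G2. fold c in C1. assert (c <= Derive ThJ x) by (unfold c; lra).
  assert (q <= d * / 10000000) by (rewrite Eq; apply Rmult_le_compat_l; lra). lra. }
assert (Opp : forall f : R -> R, ex_derive f x -> is_derive (fun th : R => f (- th)) (- x) (- Derive f x)).
{ intros f Df. apply (is_derive_eq _ _ (scal (-1) (Derive f x))); [unfold scal; simpl; unfold mult; simpl; ring|].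
  apply (is_derive_comp f (fun th : R => - th)).
  - rewrite Ropp_involutive. apply Derive_correct, Df.
  - auto_derive; auto. }
split.
- split; [auto|]. exists 1, g. split; [lra|]. split; [auto|]. split; [intros; apply collision_graph_derive|]. split; [|auto].
  intros th Th _ _. apply DeltaS_crossing.
- split; [eexists; apply Opp; auto|]. exists 1, (fun th : R => g (- th)). split; [lra|]. rewrite Ropp_involutive. split; [auto|].
  split; [|split].
  + intros th _. apply (ex_derive_comp g (fun th : R => - th)); [apply collision_graph_derive|auto_derive; auto].
  + intros th Th _ _. rewrite DeltaU_DeltaS by auto. apply DeltaS_crossing.
  + rewrite (is_derive_unique _ _ _ (Opp ThJ D)), (is_derive_unique _ _ _ (Opp g (proj1 (collision_graph_derive x)))). lra.
Qed.
End Crossing.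

Theorem mainTheorem10 :
  forall a b : R, a < b ->
  forall K : R, 0 <= K ->
  exists delta0 C : R, 0 < delta0 /\ 0 <= C /\
  forall delta : R, 0 < delta < delta0 ->
  exists mu0 : R, 0 < mu0 /\
  forall mu h0 : R, 0 < mu < mu0 -> a <= h0 <= b ->
  let h := mu * h0 in
  let th0 := - (sqrt 2 / 3) * (1 - delta ^ 3) in
  forall ThJ : R -> R,
    (* hypotheses of the proposition describing overline Delta^-_J(mu):
       it is the graph of ThJ over (th0 - delta^4, th0 + delta^4), its points
       lie in overline Sigma^< on orbits ejected from Jupiter, and
       ThJ = delta/sqrt2 (th - th0) + O(delta^5),
       d ThJ = delta/sqrt2 (1 + O(delta)) *)
    (forall th, th0 - delta ^ 4 < th < th0 + delta ^ 4 ->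
       (exists RR, RR < 0 /\ Hbar mu (delta ^ 2) th RR (ThJ th) = h /\
                   jup_ejection_bwd mu (delta ^ 2) th RR (ThJ th)) /\
       Rabs (ThJ th - delta / sqrt 2 * (th - th0)) <= K * delta ^ 5 /\
       ex_derive ThJ th /\
       Rabs (Derive ThJ th - delta / sqrt 2) <= K * delta ^ 2) ->
    exists thm : R,
      th0 - delta ^ 4 < thm < th0 + delta ^ 4 /\
      Rabs (thm - th0) <= C * delta ^ 4 /\
      (* p_- = (thm, ThJ thm) lies on Delta^s_{S^-} and Delta^-_J, transversally *)
      DeltaS_minus mu delta h thm (ThJ thm) /\
      transversal_at (DeltaS_minus mu delta h) ThJ thm /\
      (* p_+ = (-thm, ThJ thm) lies on Delta^u_{S^+} and Delta^+_J
         (the graph of th |-> ThJ (-th)), transversally *)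
      DeltaU_plus mu delta h (- thm) (ThJ thm) /\
      transversal_at (DeltaU_plus mu delta h) (fun th => ThJ (- th)) (- thm) /\
      (* both points lie in the energy level {Hbar(delta^2, ., ., .) = h} *)
      (exists RR, RR < 0 /\ Hbar mu (delta ^ 2) thm RR (ThJ thm) = h) /\
      (exists RR, 0 < RR /\ Hbar mu (delta ^ 2) (- thm) RR (ThJ thm) = h).
Proof.
intros a b Hab K HK. destruct uniform_tame as [Mc [HMc Htame]].
set (N := K + 3). set (B := Rabs a + Rabs b).
assert (HN : 3 <= N) by (unfold N; lra). assert (HB : 0 <= B) by (unfold B; pose proof (Rabs_pos a); pose proof (Rabs_pos b); lra).
assert (HNM : N <= N * Mc /\ Mc <= N * Mc).
{ split; [assert (N * 1 <= N * Mc) by (apply Rmult_le_compat_l; lra); lra|assert (1 * Mc <= N * Mc) by (apply Rmult_le_compat_r; lra); lra]. }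
(* delta0 makes both N delta and Mc delta small, the latter for the contraction of the two-point
   problem. The constant C = 1 merely records that the crossing lies in the window. *)
exists (/ (10000000 * (N * Mc))), 1. split; [apply Rinv_0_lt_compat; lra|]. split; [lra|].
intros d [Hd Hd0].
assert (Hp : 10000000 * (N * Mc) * d <= 1).
{ apply Rmult_le_reg_l with (/ (10000000 * (N * Mc))); [apply Rinv_0_lt_compat; lra|].
  replace (/ (10000000 * (N * Mc)) * (10000000 * (N * Mc) * d)) with d by (field; lra). lra. }
assert (HNd : 10000000 * (N * d) <= 1) by (assert (N * d <= N * Mc * d) by (apply Rmult_le_compat_r; lra); lra).
assert (HMd : 16 * Mc * d <= 1) by (assert (Mc * d <= N * Mc * d) by (apply Rmult_le_compat_r; lra); assert (0 < Mc * d) by (apply Rmult_lt_0_compat; lra); lra).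
destruct (small_scales d N Hd HN HNd) as [Q0 [Hd3 [_ [Hd4 _]]]]. set (q := d ^ 5) in *.
assert (H8 : 0 < d ^ 8) by (apply pow_lt; auto).
assert (I8 : 1 <= / d ^ 8) by (rewrite <- Rinv_1; apply Rinv_le_contravar; [auto|replace 1 with (1 ^ 8) by ring; apply pow_incr; lra]).
(* One summand of Z per requirement on mu: B for the energy h = mu h0, Mc for the size of the Sun
   collision curve, and 300 / d^8 for Jupiter's force at distance d^4 / 10 together with the
   remaining perturbations. *)
set (Z := B + Mc + 20 + 300 * / d ^ 8). assert (HZ : 300 <= Z) by (unfold Z; lra).
assert (Q7 : 0 < q ^ 7) by (apply pow_lt; auto).
exists (q ^ 7 / (1000000000 * Z)). split; [apply Rdiv_lt_0_compat; lra|].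
intros mu h0 [Hmu Hmu0] Hh0 h th0 ThJ HThJ.
assert (HX : mu * Z <= q ^ 7 / 1000000000).
{ replace (q ^ 7 / 1000000000) with (q ^ 7 / (1000000000 * Z) * Z) by (field; lra). apply Rmult_le_compat_r; lra. }
assert (Hq1 : q <= 1) by (unfold q; replace 1 with (1 ^ 5) by ring; apply pow_incr; lra).
assert (Hqq : q ^ 7 <= q).
{ replace (q ^ 7) with (q * q ^ 6) by ring. apply mult_le_left; [lra|]. replace 1 with (1 ^ 6) by ring. apply pow_incr; lra. }
unfold Z in HX. rewrite !Rmult_plus_distr_l in HX.
assert (P1 : 0 <= mu * B) by (apply Rmult_le_pos; lra). assert (P2 : 0 <= mu * Mc) by (apply Rmult_le_pos; lra).
assert (P3 : 0 <= mu * (300 * / d ^ 8)) by (apply Rmult_le_pos; lra).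
assert (Hm100 : 0 < mu <= 1 / 100) by lra.
assert (Heta : Rabs (h + mu ^ 2 / 2) <= q / 1000000).
{ assert (E1 : Rabs h <= mu * B).
  { unfold h. apply Rabs_mult_le; [rewrite Rabs_pos_eq; lra|]. unfold B. pose proof (Rle_abs b). pose proof (Rabs_maj2 a). pose proof (Rabs_pos a). pose proof (Rabs_pos b). apply Rabs_le. lra. }
  assert (E2 : Rabs (mu ^ 2 / 2) <= mu).
  { assert (mu ^ 2 <= mu) by (replace (mu ^ 2) with (mu * mu) by ring; apply mult_le_left; lra). pose proof (pow2_ge_0 mu). rewrite Rabs_pos_eq; lra. }
  eapply Rle_trans; [apply (Rabs_plus_le _ _ _ _ E1 E2)|]. lra. }
assert (Hmu1 : mu / d ^ 2 <= q / 1000000).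
{ assert (/ d ^ 2 <= / d ^ 8).
  { apply Rinv_le_contravar; auto. replace (d ^ 8) with (d ^ 2 * d ^ 6) by ring. apply mult_le_left; [apply pow_le; lra|]. replace 1 with (1 ^ 6) by ring. apply pow_incr; lra. }
  assert (mu * / d ^ 2 <= mu * / d ^ 8) by (apply Rmult_le_compat_l; lra). unfold Rdiv at 1. lra. }
assert (Hmu2 : mu * (Mc + 10) <= q / 1000000) by (rewrite Rmult_plus_distr_l; lra).
assert (Heps : 300 * mu / d ^ 8 <= q ^ 7 / 1000000000) by (unfold Rdiv at 1; lra).
assert (He8 : -1 / 8 <= h + mu ^ 2 / 2 <= 1 / 8) by (apply Rabs_le_between in Heta; lra).
destruct (collision_family_exists Mc mu (h + mu ^ 2 / 2) d Htame HMc ltac:(lra) He8 ltac:(lra) HMd) as [TH [LA Hfam]].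
destruct (crossing_exists K d mu h (h + mu ^ 2 / 2) Mc ThJ TH LA) as [thm [Hthm Eth]]; auto.
assert (DS : DeltaS_minus mu d h thm (ThJ thm)) by (apply (DeltaS_crossing K d mu h (h + mu ^ 2 / 2) Mc TH LA); auto).
destruct (crossing_transversal K d mu h (h + mu ^ 2 / 2) Mc ThJ TH LA) with (x := thm) as [T1 T2]; auto.
assert (DU : DeltaU_plus mu d h (- thm) (ThJ thm)) by (apply DeltaU_DeltaS; [auto|rewrite Ropp_involutive; auto]).
exists thm. split; [auto|]. split; [rewrite Rmult_1_l; unfold th0; apply Rabs_le; lra|]. split; [auto|]. split; [auto|]. split; [auto|]. split; [auto|].
split; [destruct DS as [RR [A1 [A2 _]]]|destruct DU as [RR [A1 [A2 _]]]]; exists RR; auto.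
Qed.
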